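(* The tangent cone $C_pZ'$ to $Z'=E^4/(G,i)$ at the image $p$ of $0$ is isomorphic to the cone over the Igusa quartic $\mathcal{I}_4$ in $\mathbb{P}^4$. It is defined by the two equations $$y_1+\ldots+y_6=0,\qquad (y_1^2+\ldots+y_6^2)^2-4(y_1^4+\ldots+y_6^4)=0$$ in $\mathbb{C}^6$. The images of the tangent cones at $0$ of the ten $(G,i)$-invariant divisors with first Chern class $H$ and passing through $0$ are the ten hyperplane sections defined by $$y_a+y_b+y_c=y_d+y_e+y_f=0\qquad(\{a,b,c,d,e,f\}=\{1,2,\ldots,6\}).$$ The group $U(H)$ acts on $C_pZ'$ through its quotient $U(H)/(G,i)\cong\Sigma_6$ as the standard representation, i.e. simply by permuting the six variables $y_1,\ldots,y_6$.
   Context: Let $E=\mathbb{C}/\mathbb{Z}[i]$. Matrices $M\in GL(4,\mathbb{Z}[i])$ act on $E^4=\mathbb{C}^4/\mathbb{Z}[i]^4$ by $x\mapsto xM$ on row vectors. Let $$T_0=\begin{pmatrix}1&0&0&0\\0&-1&0&0\\0&-1+i&1&0\\1-i&0&0&-1\end{pmatrix},\quad N_5=\begin{pmatrix}1&-1&0&-i\\-i&0&i&i\\-i&-1&1+i&0\\1&-1+i&0&-1-i\end{pmatrix},$$ $T_j=N_5^jT_0N_5^{-j}$, and $G=\langle T_0,\dots,T_4\rangle\cong Q_8\times_{\mathbb{Z}_2}D_8$ (order $32$). $(G,i)$ is the group of order $64$ generated by $G$ and diagonal multiplication by $i$. Let $$H=\begin{pmatrix}2&0&1&1+i\\0&2&1+i&-i\\1&1-i&2&0\\1-i&i&0&2\end{pmatrix},$$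 giving the $G$-invariant principal polarization $H(x,y)=xH\overline{y}^{\,t}$ on $E^4$, with first Chern class $\mathrm{Im}\,H$. $U(H)=\{M\in GL(4,\mathbb{Z}[i]):MH\overline{M}^t=H\}$ has order $46080$, contains $(G,i)$ as a normal subgroup, and $U(H)/(G,i)\cong\Sigma_6$ (the symmetric group on six letters). There are $16$ effective $(G,i)$-invariant divisors with first Chern class $\mathrm{Im}\,H$; exactly ten of them pass through $0\in E^4$, and each of these ten has a node at $0$, so its tangent cone at $0$ is a quadric cone in $T_0E^4=\mathbb{C}^4$. The tangent cone $C_pZ'$ is the image of $T_0E^4$ under the induced quotient by $(G,i)$, i.e. the spectrum of the ring of $(G,i)$-invariant polynomials on $T_0E^4$. The Igusa quartic is the quartic threefold in $\mathbb{P}^4=\{\sum y_i=0\}\subset\mathbb{P}^5$ given by $(\sum y_i^2)^2-4\sum y_i^4=0$. *)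

(* Defs.v *)
(* C is R[i] for an arbitrary realType R. *)
From HB Require Import structures.
From mathcomp Require Import all_boot all_order all_algebra all_fingroup.
From mathcomp Require Import complex.
From mathcomp Require mpoly.
(* The notations of mpoly clash with those of all_analysis. *)
Import -(notations) mpoly.
From mathcomp Require Import all_classical all_reals all_analysis.

Set Implicit Arguments.
Unset Strict Implicit.
Unset Printing Implicit Defensive.

Import Order.TTheory GRing.Theory Num.Theory.
Import numFieldNormedType.Exports.

Local Open Scope classical_set_scope.
Local Open Scope ring_scope.
Local Open Scope complex_scope.

Section Matrices.
Variable R : realType.
Local Notation C := R[i].

Definition gaussInt : pred C :=
  [pred z | (complex.Re z \is a Num.int) && (complex.Im z \is a Num.int)].

Definition GL4_Zi : set 'M[C]_4 :=
  [set M | [/\ M \is a mxOver gaussInt, M \in unitmx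
             & invmx M \is a mxOver gaussInt]].

Definition mx4 (s : seq (seq C)) : 'M[C]_4 :=
  \matrix_(j < 4, k < 4) nth 0 (nth [::] s j) k.

Definition T0 : 'M[C]_4 := mx4
  [:: [::       1;        0;  0;   0];
      [::       0;       -1;  0;   0];
      [::       0;  -1 + 'i;  1;   0];
      [::  1 - 'i;        0;  0;  -1]].

Definition N5 : 'M[C]_4 := mx4
  [:: [::    1;       -1;       0;     - 'i];
      [:: - 'i;        0;       'i;   'i];
      [:: - 'i;       -1;   1 + 'i;    0];
      [::    1;  -1 + 'i;        0; - 1 - 'i]].

Definition Tmx (j : nat) : 'M[C]_4 := N5 ^+ j * T0 * N5 ^- j.

Definition Hmx : 'M[C]_4 := mx4
  [:: [::      2;       0;       1;  1 + 'i];
      [::      0;       2;  1 + 'i;    - 'i];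
      [::      1;  1 - 'i;       2;       0];
      [:: 1 - 'i;      'i;       0;       2]].

Inductive generated (S : set 'M[C]_4) : 'M[C]_4 -> Prop :=
  | generated_in M of S M : generated S M
  | generated_1 : generated S 1
  | generated_M M N of generated S M & generated S N : generated S (M * N)
  | generated_V M of generated S M : generated S M^-1.

Definition G : set 'M[C]_4 :=
  generated [set M | exists j : 'I_5, M = Tmx j].

Definition Gi : set 'M[C]_4 := generated (G `|` [set 'i%:M]).

Definition UH : set 'M[C]_4 :=
  [set M | GL4_Zi M /\ M *m Hmx *m (map_mx conjc M)^T = Hmx].

Definition Hform (x y : 'rV[C]_4) : C :=
  (x *m Hmx *m (map_mx conjc y)^T) ord0 ord0.

Definition ImH (x y : 'rV[C]_4) : R := complex.Im (Hform x y).

End Matrices.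

Section Divisors.
Variable R : realType.
Local Notation C := R[i].
Local Notation V := 'rV[R[i]]_4.

Definition lattice : set V := [set l | l \is a mxOver (@gaussInt R)].

Definition holomorphic (f : V -> C^o) : Prop := forall x, differentiable f x.

Definition cexp (z : C) : C :=
  (expR (complex.Re z))%:C * (cos (complex.Im z) +i* sin (complex.Im z)).

Definition twopii : C := 0 +i* (2 * pi).

(* Every divisor on C^4 is principal (Cousin), so an effective divisor on
   E^4 = C^4 / lattice is represented by an entire function F <> 0 whose divisor
   is lattice-invariant; F is unique up to a nowhere vanishing entire factor. *)
Definition same_divisor (F F' : V -> C) : Prop :=
  exists u : V -> C, [/\ holomorphic u, forall x, u x != 0
                       & forall x, F' x = u x * F x].

Definition effective_divisor (F : V -> C) : Prop :=
  [/\ holomorphic F, exists x, F x != 0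
    & forall l, lattice l -> same_divisor F (fun x => F (x + l))].

(* The connecting map of the exponential sequence on group cohomology:
   exp(2 pi i f_l(x)) is the factor of automorphy of O(D), and the alternating
   form below is its first Chern class. The sign is the usual one, for which the
   factor exp(pi H(x,l) + pi/2 H(l,l)) has class Im H. *)
Definition has_chern_class (F : V -> C) (E : V -> V -> R) : Prop :=
  exists f : V -> V -> C,
    [/\ forall l, lattice l -> holomorphic (f l),
        forall l x, lattice l -> F (x + l) = cexp (twopii * f l x) * F x
      & forall l m x, lattice l -> lattice m ->
          f m (x + l) + f l x - f l (x + m) - f m x = (E l m)%:C].

Definition invariant_divisor (K : set 'M[C]_4) (F : V -> C) : Prop :=
  forall M, K M -> same_divisor F (fun x => F (x *m M)).

(* The lowest order homogeneous part of F at 0. *)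
Definition initial_form (F : V -> C^o) (q : mpoly 4 C) : Prop :=
  exists d : nat,
    [/\ q \is ishomog1 d (@mdeg 4), q != 0
      & (fun x : V => F x - meval (x ord0) q : C^o) =o_ (0 : (V : normedModType C))
          (fun x : V => `|x| ^+ d : C^o)].

Definition tangent_cone (F : V -> C) : set V :=
  [set x | exists2 q, initial_form F q & meval (x ord0) q = 0].

Definition invariant_divisor_through0 (F : V -> C) : Prop :=
  [/\ effective_divisor F, has_chern_class F (@ImH R),
      invariant_divisor (@Gi R) F & F 0 = 0].

End Divisors.

Section Quotient.
Variable R : realType.
Local Notation C := R[i].

(* The polynomial function x |-> p (x M). *)
Definition lin_subst (M : 'M[C]_4) (p : mpoly 4 C) : mpoly 4 C :=
  comp_mpoly [tuple \sum_(i < 4) M i j *: mpolyX C (mnm1 i) | j < 4] p.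

Definition invariant_poly (K : set 'M[C]_4) (p : mpoly 4 C) : Prop :=
  forall M, K M -> lin_subst M p = p.

Definition in_ideal n k (e : k.-tuple (mpoly n C)) (q : mpoly n C) : Prop :=
  exists a : 'I_k -> mpoly n C, q = \sum_(j < k) a j * tnth e j.

(* The algebra map y_j |-> Y_j induces an isomorphism from C[y_1..y_n]/(e) onto
   the ring of K-invariants C[x_1..x_4]^K; equivalently, (Y_1,...,Y_n) is an
   isomorphism from C^4 / K = Spec C[x_1..x_4]^K onto the subscheme of C^n
   defined by e. *)
Definition quotient_iso (K : set 'M[C]_4) n (Y : n.-tuple (mpoly 4 C))
    k (e : k.-tuple (mpoly n C)) : Prop :=
  [/\ forall j, invariant_poly K (tnth Y j),
      forall p, invariant_poly K p -> exists q, p = comp_mpoly Y q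
    & forall q, comp_mpoly Y q = 0 <-> in_ideal e q].

Definition quotient_map n (Y : n.-tuple (mpoly 4 C)) (x : 'rV[C]_4) : 'rV[C]_n :=
  \row_j meval (x ord0) (tnth Y j).

Definition power_sum (k : nat) : mpoly 6 C :=
  \sum_(j < 6) mpolyX C (mnm1 j) ^+ k.

Definition igusa_cone_eqs : 2.-tuple (mpoly 6 C) :=
  [tuple power_sum 1; power_sum 2 ^+ 2 - 4 *: power_sum 4].

Definition igusa_cone : set 'rV[C]_6 :=
  [set y | forall k : 'I_2, meval (y ord0) (tnth igusa_cone_eqs k) = 0].

Definition hyperplane_section (S : {set 'I_6}) : set 'rV[C]_6 :=
  [set y | [/\ igusa_cone y, \sum_(j in S) y ord0 j = 0
             & \sum_(j in ~: S) y ord0 j = 0]].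

End Quotient.

(* Main.v *)
(** In the coordinates given by [Bmx] the group (G,i) is a Pauli group: sign
    changes, double transpositions and multiplication by i. Its invariants are
    generated by the squares A_k of four diagonal quadrics and the product T of
    the coordinates, subject to one quartic relation, which becomes the Igusa
    quartic in six linear combinations y_j of A_0, ..., A_3 and T. Every element
    of U(H) is a word in the root reflections, which permute the y_j by
    transpositions.

    The second order form at 0 of an invariant divisor through 0 is
    semi-invariant under the Pauli group. It does not vanish: otherwise the theta
    function F would vanish to order three at 0, hence have more zeros on the
    translates of the lines spanned by root vectors than its quasi-periodicity
    allows, and propagating from lines to planes to spaces gives F = 0. So the
    form is one of ten quadrics, whose squares are multiples of
    y_a + y_b + y_c. One such divisor is written down as a combination of products
    of Jacobi theta functions; U(H) moves it to the other nine. *)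
Require Import Defs.
From HB Require Import structures.
From mathcomp Require Import all_boot all_order all_algebra all_fingroup.
From mathcomp Require Import complex.
From mathcomp Require mpoly.
Import -(notations) mpoly.
From mathcomp Require Import all_classical all_reals all_analysis.
From mathcomp Require Import ring lra zify ssrZ.
Import Order.TTheory GRing.Theory Num.Theory.
Import numFieldNormedType.Exports.
Set Implicit Arguments.
Unset Strict Implicit.
Unset Printing Implicit Defensive.
Local Open Scope classical_set_scope.
Local Open Scope ring_scope.
Local Open Scope complex_scope.

(** A Chern class supplies only holomorphic exponents [f l] with a cocycle condition, and no theta
    expansion of an unknown invariant divisor. Everything about such a divisor is therefore read off
    from its restrictions to complex lines: in a root direction [l] the cocycle gives the constant
    [H(l,l) = 2], and the argument principle allows two zeros per unit square unless the restriction
    vanishes identically. This is why one-variable function theory, from Goursat to Liouville, is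
    built over [R[i]], and why the quadratic term at [0] is defined line by line.

    On the algebraic side [H] is a Gaussian structure on the [E_8] lattice and [U(H)] is the complex
    reflection group [G_31]. Its elements are enumerated through the 240 vectors with [H(u,u) = 2]
    and the stabilizer of one of them; each becomes a word in reflections, so identities checked on
    five generators hold on the whole group. The invariant ring comes from filtering monomials by
    parity twice, in the coordinates and then in the four diagonal quadrics. *)

Section Modulus.
Variable R : realType.
Local Notation C := R[i].

(** The norm of [R[i]] has values in [R[i]]; its real part lies in the ordered field [R], where
    estimates can be left to [lra]. *)
Definition cmod (z : C) : R := complex.Re `|z|.

Lemma cmodE (z : C) : `|z| = (cmod z)%:C.
Proof. by rewrite /cmod RRe_real // normr_real. Qed.

Lemma cmod_ge0 (z : C) : 0 <= cmod z.
Proof. by rewrite -lecR -cmodE normr_ge0. Qed.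

Lemma cmodM (z w : C) : cmod (z * w) = cmod z * cmod w.
Proof. by apply: (@complexI R); rewrite rmorphM /= -!cmodE normrM. Qed.

Lemma cmodD (z w : C) : cmod (z + w) <= cmod z + cmod w.
Proof. by rewrite -lecR rmorphD /= -!cmodE ler_normD. Qed.

Lemma cmodN (z : C) : cmod (- z) = cmod z.
Proof. by rewrite /cmod normrN. Qed.

Lemma cmodB (z w : C) : cmod (z - w) <= cmod z + cmod w.
Proof. by rewrite -(cmodN w) cmodD. Qed.

Lemma cmodBC (z w : C) : cmod (z - w) = cmod (w - z).
Proof. by rewrite -cmodN opprB. Qed.

Lemma cmod_dist (z w y : C) : cmod (z - w) <= cmod (z - y) + cmod (y - w).
Proof. by apply: le_trans (cmodD _ _); rewrite addrA subrK. Qed.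

Lemma cmod_tri (z w : C) : cmod z <= cmod w + cmod (z - w).
Proof. by apply: le_trans (cmodD _ _); rewrite addrC subrK. Qed.

Lemma cmod0 : cmod 0 = 0.
Proof. by rewrite /cmod normr0. Qed.

Lemma cmod1 : cmod 1 = 1.
Proof. by rewrite /cmod normr1. Qed.

Lemma cmod_eq0 (z : C) : (cmod z == 0) = (z == 0).
Proof. by rewrite -(inj_eq (@complexI R)) -cmodE normr_eq0. Qed.

Lemma cmod_gt0 (z : C) : (0 < cmod z) = (z != 0).
Proof. by rewrite lt_def cmod_eq0 cmod_ge0 andbT. Qed.

Lemma cmodV (z : C) : cmod z^-1 = (cmod z)^-1.
Proof.
have [->|z0] := eqVneq z 0; first by rewrite invr0 cmod0 invr0.
apply: (mulfI (_ : cmod z != 0)); first by rewrite cmod_eq0.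
by rewrite -cmodM !divff ?cmod1 ?cmod_eq0.
Qed.

Lemma cmodX (z : C) n : cmod (z ^+ n) = cmod z ^+ n.
Proof. by elim: n => [|n IH]; rewrite ?expr0 ?cmod1 // !exprS cmodM IH. Qed.

Lemma cmodR (r : R) : cmod r%:C = `|r|.
Proof. by apply: (@complexI R); rewrite -cmodE normc_def /= expr0n addr0 sqrtr_sqr. Qed.

Lemma cmod_i : cmod 'i = 1.
Proof. by apply: (@complexI R); rewrite -cmodE normc_def /= expr0n add0r expr1n sqrtr1. Qed.

Lemma cmod_nat n : cmod n%:R = n%:R.
Proof. by apply: (@complexI R); rewrite -cmodE normr_nat rmorph_nat. Qed.

Lemma cmod_sq (z : C) : cmod z ^+ 2 = complex.Re z ^+ 2 + complex.Im z ^+ 2.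
Proof.
by apply: (@complexI R); rewrite rmorphXn /= -cmodE normc_def /= -rmorphXn /=
  sqr_sqrtr // addr_ge0 // sqr_ge0.
Qed.

Lemma Re_le_cmod (z : C) : `|complex.Re z| <= cmod z.
Proof.
rewrite -(@ler_pXn2r _ 2) ?nnegrE ?cmod_ge0 ?normr_ge0 // cmod_sq.
by rewrite real_normK ?num_real // lerDl sqr_ge0.
Qed.

Lemma Im_le_cmod (z : C) : `|complex.Im z| <= cmod z.
Proof.
rewrite -(@ler_pXn2r _ 2) ?nnegrE ?cmod_ge0 ?normr_ge0 // cmod_sq.
by rewrite real_normK ?num_real // lerDr sqr_ge0.
Qed.

Lemma cmod_le_ReIm (z : C) : cmod z <= `|complex.Re z| + `|complex.Im z|.
Proof.
rewrite -(@ler_pXn2r _ 2) ?nnegrE ?cmod_ge0 ?addr_ge0 ?normr_ge0 // cmod_sq.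
rewrite sqrrD !real_normK ?num_real // -addrA lerD2l lerDr.
by rewrite mulrn_wge0 // mulr_ge0.
Qed.

Lemma cmod_small (z : C) : (forall e : R, 0 < e -> cmod z <= e) -> z = 0.
Proof.
move=> h; apply/eqP; rewrite -cmod_eq0 eq_le cmod_ge0 andbT.
by apply/ler_addgt0Pl => e e0; rewrite addr0 h.
Qed.

End Modulus.

(** * Complex differentiability in one variable *)

Section Calculus.
Variable R : realType.
Local Notation C := R[i].
Implicit Types (f g : C -> C) (z w l : C).

Definition ccont f z := forall e : R, 0 < e ->
  exists2 d : R, 0 < d & forall w, cmod (w - z) < d -> cmod (f w - f z) <= e.

(** The quotient-free form: the point [w = z] is no exception, and the product and chain rules need
    no division. *)
Definition cder f z l := forall e : R, 0 < e ->
  exists2 d : R, 0 < d & forall w, cmod (w - z) < d ->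
    cmod (f w - f z - l * (w - z)) <= e * cmod (w - z).

Definition entire f := forall z, exists l, cder f z l.

Lemma cder_cont f z l : cder f z l -> ccont f z.
Proof.
move=> h e e0; have [d d0 hd] := h 1 ltr01.
have k0 : 0 < 1 + cmod l by rewrite ltr_wpDr // cmod_ge0.
exists (Num.min d (e / (1 + cmod l))); first by rewrite lt_min d0 divr_gt0.
move=> w; rewrite lt_min => /andP[/hd h1 h2].
apply: le_trans (cmod_tri _ (l * (w - z))) _; rewrite cmodM.
apply: le_trans (lerD (lexx _) h1) _; rewrite mul1r -[X in _ + X]mul1r -mulrDl addrC.
by rewrite mulrC -ler_pdivlMr // ltW.
Qed.

Lemma cder_ext f g z l : f =1 g -> cder f z l -> cder g z l.
Proof. by move=> /funext ->. Qed.

Lemma cder_near f g z l (r : R) : 0 < r -> (forall w, cmod (w - z) < r -> f w = g w) ->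
  cder f z l -> cder g z l.
Proof.
move=> r0 fg h e e0; have [d d0 hd] := h e e0.
exists (Num.min d r); first by rewrite lt_min d0.
move=> w; rewrite lt_min => /andP[h1 h2].
by rewrite -!fg ?subrr ?cmod0 // hd.
Qed.

Lemma cder_cst c z : cder (fun=> c) z 0.
Proof. by move=> e e0; exists 1 => // w _; rewrite subrr mul0r subr0 cmod0 mulr_ge0 ?cmod_ge0 ?ltW. Qed.

Lemma cder_id z : cder id z 1.
Proof. by move=> e e0; exists 1 => // w _; rewrite mul1r subrr cmod0 mulr_ge0 ?cmod_ge0 ?ltW. Qed.

Lemma cderD f g z l m : cder f z l -> cder g z m -> cder (fun w => f w + g w) z (l + m).
Proof.
move=> hf hg e e0; have e2 : 0 < e / 2 by rewrite divr_gt0.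
have [d d0 hd] := hf _ e2; have [d' d0' hd'] := hg _ e2.
exists (Num.min d d'); first by rewrite lt_min d0.
move=> w; rewrite lt_min => /andP[/hd h1 /hd' h2].
have -> : f w + g w - (f z + g z) - (l + m) * (w - z) =
  (f w - f z - l * (w - z)) + (g w - g z - m * (w - z)) by ring.
apply: le_trans (cmodD _ _) _; apply: le_trans (lerD h1 h2) _.
by rewrite -mulrDl -splitr.
Qed.

Lemma cderZ f z l c : cder f z l -> cder (fun w => c * f w) z (c * l).
Proof.
move=> hf e e0; have k0 : 0 < 1 + cmod c by rewrite ltr_wpDr // cmod_ge0.
have e2 : 0 < e / (1 + cmod c) by rewrite divr_gt0.
have [d d0 hd] := hf _ e2; exists d => // w /hd h1.
have -> : c * f w - c * f z - c * l * (w - z) = c * (f w - f z - l * (w - z)) by ring.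
rewrite cmodM; apply: le_trans (ler_wpM2l (cmod_ge0 _) h1) _.
rewrite mulrA ler_wpM2r ?cmod_ge0 // mulrCA ler_piMr ?ltW //.
by rewrite ltr_pdivrMr // mul1r ltrDr.
Qed.

Lemma ccont_bd f z : ccont f z -> exists2 d : R, 0 < d &
  forall w, cmod (w - z) < d -> cmod (f w) <= cmod (f z) + 1.
Proof.
move=> h; have [d d0 hd] := h 1 ltr01; exists d => // w /hd h1.
by apply: le_trans (cmod_tri _ (f z)) _; rewrite lerD2l.
Qed.

Lemma cderM f g z l m : cder f z l -> cder g z m ->
  cder (fun w => f w * g w) z (l * g z + f z * m).
Proof.
move=> hf hg e e0.
have [d1 d10 hd1] := ccont_bd (cder_cont hg).
pose K := 1 + cmod (g z) + cmod (f z) + cmod l.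
have K0 : 0 < K by rewrite /K -!addrA ltr_pwDl // !addr_ge0 ?cmod_ge0.
have e3 : 0 < e / 3 / K by rewrite !divr_gt0.
have [d2 d20 hd2] := hf _ e3; have [d3 d30 hd3] := hg _ e3.
have [d4 d40 hd4] := cder_cont hg e3.
exists (Num.min (Num.min d1 d2) (Num.min d3 d4)); first by rewrite !lt_min d10 d20 d30.
move=> w; rewrite !lt_min => /andP[/andP[/hd1 h1 /hd2 h2] /andP[/hd3 h3 /hd4 h4]].
(* Three error terms, each at most [e / 3 * t], since [K] bounds all the coefficients that occur. *)
have -> : f w * g w - f z * g z - (l * g z + f z * m) * (w - z) =
  (f w - f z - l * (w - z)) * g w + f z * (g w - g z - m * (w - z))
   + l * (w - z) * (g w - g z) by ring.
set t := cmod (w - z) in h2 h3 *; have t0 : 0 <= t by apply: cmod_ge0.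
apply: le_trans (cmodD _ _) _; apply: le_trans (lerD (cmodD _ _) (lexx _)) _.
rewrite !cmodM -/t.
have hK : e / 3 / K * K = e / 3 by rewrite divfK // gt_eqF.
have h5 : cmod (f w - f z - l * (w - z)) * cmod (g w) <= e / 3 / K * t * K.
  by apply: ler_pM; rewrite ?cmod_ge0 //; apply: le_trans h1 _; rewrite /K;
     move: (cmod_ge0 (f z)) (cmod_ge0 l); lra.
have h6 : cmod (f z) * cmod (g w - g z - m * (w - z)) <= K * (e / 3 / K * t).
  by apply: ler_pM; rewrite ?cmod_ge0 // /K; move: (cmod_ge0 (g z)) (cmod_ge0 l); lra.
have h7 : cmod l * t * cmod (g w - g z) <= K * t * (e / 3 / K).
  apply: ler_pM; rewrite ?cmod_ge0 ?mulr_ge0 ?cmod_ge0 // ler_wpM2r //.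
  by rewrite /K; move: (cmod_ge0 (g z)) (cmod_ge0 (f z)); lra.
have hh : e / 3 / K * t * K = e / 3 * t by rewrite mulrAC hK.
move: h5 h6 h7; rewrite mulrC [K * (_ * t)]mulrC hh.
have -> : K * t * (e / 3 / K) = e / 3 * t by rewrite -hh; ring.
lra.
Qed.

Lemma cder_comp f g z l m : cder f z l -> cder g (f z) m ->
  cder (fun w => g (f w)) z (m * l).
Proof.
move=> hf hg e e0.
pose K := 1 + cmod l + cmod m.
have K0 : 0 < K by rewrite /K -!addrA ltr_pwDl // !addr_ge0 ?cmod_ge0.
have eK : 0 < e / 2 / K by rewrite !divr_gt0.
have [d1 d10 hd1] := hg _ eK.
have [d2 d20 hd2] := hf _ eK.
have [d3 d30 hd3] := hf 1 ltr01.
have [d4 d40 hd4] := cder_cont hf (divr_gt0 d10 (ltr0n _ 2)).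
exists (Num.min d2 (Num.min d3 d4)); first by rewrite !lt_min d20 d30.
move=> w; rewrite !lt_min => /andP[/hd2 h2 /andP[/hd3 h3 /hd4 h4]].
have h5 : cmod (f w - f z) < d1 by apply: le_lt_trans h4 _; rewrite ltr_pdivrMr // mulr_natr mulr2n ltrDl.
have {}h5 := hd1 _ h5.
have h6 : cmod (f w - f z) <= K * cmod (w - z).
  apply: le_trans (cmod_tri _ (l * (w - z))) _; rewrite cmodM.
  have := mulr_ge0 (cmod_ge0 m) (cmod_ge0 (w - z)); rewrite /K; lra.
have -> : g (f w) - g (f z) - m * l * (w - z) =
  (g (f w) - g (f z) - m * (f w - f z)) + m * (f w - f z - l * (w - z)) by ring.
apply: le_trans (cmodD _ _) _; rewrite cmodM.
apply: le_trans (lerD (le_trans h5 (ler_wpM2l (ltW eK) h6)) (ler_wpM2l (cmod_ge0 m) h2)) _.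
have hK : e / 2 / K * K = e / 2 by rewrite divfK // gt_eqF.
have h7 : cmod m * (e / 2 / K * cmod (w - z)) <= K * (e / 2 / K * cmod (w - z)).
  apply: ler_wpM2r; first by rewrite mulr_ge0 ?cmod_ge0 // ltW.
  by rewrite /K; have := cmod_ge0 l; lra.
apply: le_trans (lerD (lexx _) h7) _.
by rewrite [X in _ + X]mulrCA [X in X + X]mulrA hK -mulrDl -splitr.
Qed.

Lemma cderV z : z != 0 -> cder (fun w => w^-1) z (- (z^-1 ^+ 2)).
Proof.
move=> z0 e e0; have a0 : 0 < cmod z by rewrite cmod_gt0.
(* The first radius keeps [w] away from [0], with [|w| >= |z| / 2]; the second bounds the exact
   remainder [(w - z)^2 / (w z^2)]. *)
exists (Num.min (cmod z / 2) (e * cmod z ^+ 3 / 2)).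
  by rewrite lt_min !divr_gt0 ?mulr_gt0 ?exprn_gt0.
move=> w; rewrite lt_min => /andP[h1 h2].
have hw : cmod z / 2 <= cmod w.
  by have := cmod_tri z w; rewrite cmodBC; lra.
have w0 : w != 0 by rewrite -cmod_gt0; apply: lt_le_trans hw; rewrite divr_gt0.
have -> : w^-1 - z^-1 - - (z^-1 ^+ 2) * (w - z) = (w - z) ^+ 2 * (w^-1 * z^-1 ^+ 2).
  by field; rewrite z0 w0.
rewrite !(cmodM, cmodV, expr2); set t := cmod (w - z) in h1 h2 *.
have t0 : 0 <= t by apply: cmod_ge0.
rewrite -mulrA [X in _ <= X]mulrC; apply: ler_wpM2l => //.
have hw' : (cmod w)^-1 <= 2 / cmod z.
  by rewrite -[2 / _]invrK invf_div lef_pV2 ?posrE // ?divr_gt0 // cmod_gt0.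
have -> : e = e * cmod z ^+ 3 / 2 * (2 / cmod z * ((cmod z)^-1 * (cmod z)^-1)).
  by field; rewrite gt_eqF.
apply: ler_pM; rewrite ?mulr_ge0 ?invr_ge0 ?cmod_ge0 //; first exact: ltW.
by apply: ler_wpM2r; rewrite ?mulr_ge0 ?invr_ge0 ?cmod_ge0.
Qed.

Lemma cder_uniq f z l m : cder f z l -> cder f z m -> l = m.
Proof.
move=> hf hg; apply/eqP; rewrite -subr_eq0; apply/eqP; apply: cmod_small => e e0.
have e2 : 0 < e / 2 by rewrite divr_gt0.
have [d d0 hd] := hf _ e2; have [d' d0' hd'] := hg _ e2.
pose t := Num.min d d' / 2.
have t0 : 0 < t by rewrite divr_gt0 // lt_min d0.
have tz : cmod (z + t%:C - z) = t by rewrite addrAC subrr add0r cmodR gtr0_norm.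
have td : t < Num.min d d' by rewrite ltr_pdivrMr // mulr_natr mulr2n ltrDl lt_min d0.
move: td; rewrite lt_min => /andP[].
move=> td td'; have := hd (z + t%:C); have := hd' (z + t%:C).
rewrite tz (_ : z + t%:C - z = t%:C); last by ring.
move=> /(_ td') h2 /(_ td) h1.
rewrite -(ler_pM2r t0) -{1}[t]gtr0_norm // -cmodR -cmodM.
set u := f (z + t%:C) - f z in h1 h2.
have -> : (l - m) * t%:C = (u - m * t%:C) - (u - l * t%:C) by ring.
by apply: le_trans (cmodB _ _) _; apply: le_trans (lerD h2 h1) _; rewrite -mulrDl -splitr.
Qed.

Lemma ccontM f g z : ccont f z -> ccont g z -> ccont (fun w => f w * g w) z.
Proof.
move=> hf hg e e0.
pose K := 1 + cmod (f z) + cmod (g z).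
have K0 : 0 < K by rewrite /K -!addrA ltr_pwDl // !addr_ge0 ?cmod_ge0.
have e2 : 0 < e / 2 / K by rewrite !divr_gt0.
have [d d0 hd] := hf _ e2; have [d' d0' hd'] := hg _ e2.
have [d1 d10 hd1] := ccont_bd hg.
exists (Num.min d (Num.min d' d1)); first by rewrite !lt_min d0 d0'.
move=> w; rewrite !lt_min => /andP[/hd h1 /andP[/hd' h2 /hd1 h3]].
have -> : f w * g w - f z * g z = (f w - f z) * g w + f z * (g w - g z) by ring.
apply: le_trans (cmodD _ _) _; rewrite !cmodM.
have -> : e = e / 2 / K * K + K * (e / 2 / K) by field; rewrite gt_eqF.
by apply: lerD; apply: ler_pM; rewrite ?cmod_ge0 // /K; move: (cmod_ge0 (f z)) (cmod_ge0 (g z)) h3; lra.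
Qed.

Lemma ccontD f g z : ccont f z -> ccont g z -> ccont (fun w => f w + g w) z.
Proof.
move=> hf hg e e0; have e2 : 0 < e / 2 by rewrite !divr_gt0.
have [d d0 hd] := hf _ e2; have [d' d0' hd'] := hg _ e2.
exists (Num.min d d'); first by rewrite !lt_min d0 d0'.
move=> w; rewrite !lt_min => /andP[/hd h1 /hd' h2].
rewrite opprD addrACA; apply: le_trans (cmodD _ _) _.
by apply: le_trans (lerD h1 h2) _; rewrite -splitr.
Qed.

Lemma ccont_comp f g z : ccont f z -> ccont g (f z) -> ccont (fun w => g (f w)) z.
Proof.
move=> hf hg e e0; have [d d0 hd] := hg _ e0.
have [d' d0' hd'] := hf _ (divr_gt0 d0 (ltr0n _ 2)); exists d' => // w /hd' h.
by apply: hd; apply: le_lt_trans h _; rewrite ltr_pdivrMr // mulr_natr mulr2n ltrDl.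
Qed.

Lemma ccont_near f g z (r : R) : 0 < r -> (forall w, cmod (w - z) < r -> f w = g w) ->
  ccont f z -> ccont g z.
Proof.
move=> r0 fg h e e0; have [d d0 hd] := h e e0.
exists (Num.min d r); first by rewrite lt_min d0.
move=> w; rewrite lt_min => /andP[h1 h2].
by rewrite -!fg ?subrr ?cmod0 // hd.
Qed.

Lemma ccont_cst c z : ccont (fun=> c) z.
Proof. exact: cder_cont (cder_cst c z). Qed.

Lemma cder_quot f z0 z l : z != z0 -> cder f z l ->
  exists m, cder (fun w => (f w - f z0) / (w - z0)) z m.
Proof.
move=> zz h; eexists.
apply: (@cderM (fun w => f w - f z0) (fun w => (w - z0)^-1)).
  by apply: cderD h (cder_cst _ _).
apply: (@cder_comp (fun w => w - z0) (fun w => w^-1)).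
  by apply: cderD (cder_id _) (cder_cst _ _).
by apply: cderV; rewrite subr_eq0.
Qed.

Lemma entireD f g : entire f -> entire g -> entire (fun w => f w + g w).
Proof. by move=> hf hg z; have [l ?] := hf z; have [m ?] := hg z; exists (l + m); apply: cderD. Qed.

Lemma entireM f g : entire f -> entire g -> entire (fun w => f w * g w).
Proof. by move=> hf hg z; have [l ?] := hf z; have [m ?] := hg z; eexists; apply: cderM; eassumption. Qed.

Lemma entire_cst c : entire (fun=> c).
Proof. by move=> z; exists 0; apply: cder_cst. Qed.

Lemma entire_id : entire id.
Proof. by move=> z; exists 1; apply: cder_id. Qed.

Lemma entire_comp f g : entire f -> entire g -> entire (fun w => g (f w)).
Proof. by move=> hf hg z; have [l ?] := hf z; have [m ?] := hg (f z); exists (m * l); apply: cder_comp. Qed.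

Lemma entire_cont f z : entire f -> ccont f z.
Proof. by move=> h; have [l /cder_cont] := h z. Qed.

End Calculus.

(** * Integrals of complex functions of a real variable *)

Section Integral.
Variable R : realType.
Local Notation C := R[i].
Local Notation mu := (@lebesgue_measure R).
Implicit Types (f : R -> R) (p q : R -> C) (a b c t : R).

Definition pcont p t := forall e : R, 0 < e ->
  exists2 d : R, 0 < d & forall s, `|s - t| < d -> cmod (p s - p t) <= e.

Definition pder p t (l : C) := forall e : R, 0 < e ->
  exists2 d : R, 0 < d & forall s, `|s - t| < d ->
    cmod (p s - p t - l * (s - t)%:C) <= e * `|s - t|.

Definition cint p a b : C :=
  (\int[mu]_(x in `[a, b]) complex.Re (p x)) +i* (\int[mu]_(x in `[a, b]) complex.Im (p x)).

Lemma continuous_ed f t : (forall e : R, 0 < e ->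
  exists2 d : R, 0 < d & forall s, `|s - t| < d -> `|f s - f t| <= e) ->
  {for t, continuous (f : R -> R^o)}.
Proof.
move=> h; apply/cvgrPdist_le => e e0; have [d d0 hd] := h e e0.
near=> s; rewrite distrC; apply: hd; rewrite distrC; near: s.
by apply: (@cvgr_dist_lt _ _ _ (nbhs t) _ id t) => //; apply: cvg_id.
Unshelve. all: by end_near. Qed.

Lemma pcont_integrable p a b : (forall t, a <= t <= b -> pcont p t) ->
  mu.-integrable `[a, b] (EFin \o (fun t => complex.Re (p t))) /\
  mu.-integrable `[a, b] (EFin \o (fun t => complex.Im (p t))).
Proof.
move=> h; split; apply: continuous_compact_integrable; try exact: segment_compact;
  apply: continuous_in_subspaceT => t; rewrite inE /= in_itv /= => /h ht;
  apply: continuous_ed => e e0; have [d d0 hd] := ht e e0;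
  exists d => // s /hd; apply: le_trans; rewrite /= -raddfB.
- exact: Re_le_cmod.
- exact: Im_le_cmod.
Qed.

Lemma cintD p q a b : (forall t, a <= t <= b -> pcont p t) ->
  (forall t, a <= t <= b -> pcont q t) ->
  cint (fun t => p t + q t) a b = cint p a b + cint q a b.
Proof.
move=> /pcont_integrable[h1 h2] /pcont_integrable[h3 h4].
rewrite /cint; apply/eqP; rewrite eq_complex /=; apply/andP; split; apply/eqP.
- by rewrite -RintegralD //; apply: eq_Rintegral => x _; rewrite raddfD.
- by rewrite -RintegralD //; apply: eq_Rintegral => x _; rewrite raddfD.
Qed.

Lemma cintB p q a b : (forall t, a <= t <= b -> pcont p t) ->
  (forall t, a <= t <= b -> pcont q t) ->
  cint (fun t => p t - q t) a b = cint p a b - cint q a b.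
Proof.
move=> /pcont_integrable[h1 h2] /pcont_integrable[h3 h4].
rewrite /cint; apply/eqP; rewrite eq_complex /=; apply/andP; split; apply/eqP.
- by rewrite -RintegralB //; apply: eq_Rintegral => x _; rewrite raddfB.
- by rewrite -RintegralB //; apply: eq_Rintegral => x _; rewrite raddfB.
Qed.

Lemma eq_cint p q a b : (forall t, a <= t <= b -> p t = q t) -> cint p a b = cint q a b.
Proof.
move=> h; rewrite /cint; congr (_ +i* _); apply: eq_Rintegral => x;
  by rewrite inE /= in_itv /= => /h ->.
Qed.

Lemma Rint_cst (r : R) a b : a <= b -> \int[mu]_(x in `[a, b]) r = r * (b - a).
Proof.
move=> ab; rewrite Rintegral_cst //= lebesgue_measure_itv /= lte_fin.
case: ifPn => // hab; suff -> : b - a = 0 by [].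
by apply/eqP; rewrite subr_eq0 eq_le ab andbT leNgt.
Qed.

Lemma cint_cst (k : C) a b : a <= b -> cint (fun=> k) a b = k * (b - a)%:C.
Proof.
by move=> ab; rewrite /cint !Rint_cst //; case: k => x y;
  apply/eqP; rewrite eq_complex /= !(mulr0, mul0r, subr0, addr0, add0r) !eqxx.
Qed.

Lemma Rint_cat f a b c : a <= c <= b -> mu.-integrable `[a, b] (EFin \o f) ->
  \int[mu]_(x in `[a, b]) f x = \int[mu]_(x in `[a, c]) f x + \int[mu]_(x in `[c, b]) f x.
Proof.
move=> /andP[ac cb] hf; apply/eqP; rewrite addrC -subr_eq; apply/eqP.
rewrite Rintegral_itvB ?bnd_simp //.
rewrite Rintegral_itv_obnd_cbnd //; apply: integrableS hf => //=.
by apply: subset_itvr; rewrite bnd_simp.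
Qed.

Lemma cint_cat p a b c : a <= c <= b -> (forall t, a <= t <= b -> pcont p t) ->
  cint p a b = cint p a c + cint p c b.
Proof.
by move=> ac /pcont_integrable[h1 h2]; rewrite /cint (Rint_cat ac h1) (Rint_cat ac h2).
Qed.

Lemma Rint_le f a b (M : R) : a <= b -> mu.-integrable `[a, b] (EFin \o f) ->
  (forall t, a <= t <= b -> `|f t| <= M) ->
  `|\int[mu]_(x in `[a, b]) f x| <= M * (b - a).
Proof.
move=> ab hf h; apply: le_trans (le_normr_Rintegral _ _) _ => //.
rewrite -Rint_cst //; apply: le_Rintegral => //.
- exact: (integrable_norm hf).
- apply: continuous_compact_integrable; first exact: segment_compact.
  by apply: continuous_subspaceT => x; apply: cvg_cst.
Qed.

(** The real and imaginary parts are estimated separately, which costs the factor 2. It survives in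
    [mean_bound] and is removed in [max_principle]. *)
Lemma cint_le p a b (M : R) : a <= b -> (forall t, a <= t <= b -> pcont p t) ->
  (forall t, a <= t <= b -> cmod (p t) <= M) -> cmod (cint p a b) <= 2 * M * (b - a).
Proof.
move=> ab /pcont_integrable[h1 h2] h.
apply: le_trans (cmod_le_ReIm _) _; rewrite -mulrA mulr_natl mulr2n; apply: lerD.
- by apply: Rint_le => // t /h; apply: le_trans; apply: Re_le_cmod.
- by apply: Rint_le => // t /h; apply: le_trans; apply: Im_le_cmod.
Qed.

(** The bridge from elementary estimates to [is_derive], for the sake of the fundamental theorem of
    calculus; [derive_ed] is the way back. *)
Lemma is_derive_ed f t l : (forall e : R, 0 < e ->
  exists2 d : R, 0 < d & forall s, `|s - t| < d -> `|f s - f t - l * (s - t)| <= e * `|s - t|) ->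
  is_derive t (1 : R^o) (f : R^o -> R^o) l.
Proof.
move=> h.
have hc : (fun h : R => h^-1 *: (f (h + t) - f t)) @ 0^' --> l.
  apply/cvgrPdist_le => e e0; have [d d0 hd] := h e e0.
  near=> s.
  have s0 : s != 0 by near: s; apply: nbhs_dnbhs_neq.
  have := hd (s + t); rewrite addrK => /(_ _) hh.
  rewrite distrC -(ler_pM2r (_ : 0 < `|s|)) ?normr_gt0 // -normrM.
  rewrite mulrBl -[_ *: _]/(s^-1 * _) mulrAC mulVf // mul1r; apply: hh.
  near: s; apply: dnbhs0_lt; exact: d0.
have dv : derivable (f : R^o -> R^o) t 1.
  apply/cvg_ex; exists l; rewrite /=.
  by under eq_fun do rewrite -[_ *: 1]/(_ * 1) mulr1.
apply: DeriveDef => //; apply/cvg_lim => //.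
by under eq_fun do rewrite -[_ *: 1]/(_ * 1) mulr1.
Unshelve. all: by end_near. Qed.

Lemma Rint_ftc f (g : R -> R) a b : a < b ->
  (forall t, a <= t <= b -> {for t, continuous (g : R -> R^o)}) ->
  (forall t, a <= t <= b -> is_derive t (1 : R^o) (f : R^o -> R^o) (g t)) ->
  \int[mu]_(x in `[a, b]) g x = f b - f a.
Proof.
move=> ab cg df.
have cf t : a <= t <= b -> {for t, continuous (f : R^o -> R^o)}.
  move=> /df[dt _]; apply: differentiable_continuous.
  by apply/derivable1_diffP.
rewrite /Rintegral (@continuous_FTC2 _ g f) //.
- by apply: continuous_in_subspaceT => t; rewrite inE /= in_itv /= => /cg.
- split.
  + by move=> t; rewrite in_itv /= => /andP[at' tb]; have [] := df t _; rewrite ?ltW.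
  + by apply: cvg_at_right_filter; apply: cf; rewrite lexx ltW.
  + by apply: cvg_at_left_filter; apply: cf; rewrite lexx ltW.
- move=> t; rewrite in_itv /= => /andP[at' tb]; rewrite derive1E.
  by apply: derive_val; apply: df; rewrite !ltW.
Qed.

Lemma ReM_real (z : C) t : complex.Re (z * t%:C) = complex.Re z * t.
Proof. by case: z => x y /=; rewrite mulr0 subr0. Qed.

Lemma ImM_real (z : C) t : complex.Im (z * t%:C) = complex.Im z * t.
Proof. by case: z => x y /=; rewrite mulr0 add0r. Qed.

Lemma cint_ftc (p q : R -> C) a b : a < b ->
  (forall t, a <= t <= b -> pcont q t) ->
  (forall t, a <= t <= b -> pder p t (q t)) ->
  cint q a b = p b - p a.
Proof.
move=> ab cq dp; rewrite /cint.
have -> : p b - p a = (complex.Re (p b) - complex.Re (p a)) +i* (complex.Im (p b) - complex.Im (p a)).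
  by apply/eqP; rewrite eq_complex /= !raddfB !eqxx.
congr (_ +i* _).
- apply: (@Rint_ftc (fun t => complex.Re (p t))) => // t /[dup] tt.
  + move=> /cq ht; apply: continuous_ed => e e0; have [d d0 hd] := ht e e0.
    by exists d => // s /hd; apply: le_trans; rewrite -raddfB Re_le_cmod.
  + move=> /dp ht; apply: is_derive_ed => e e0; have [d d0 hd] := ht e e0.
    exists d => // s /hd; apply: le_trans; apply: le_trans (Re_le_cmod _).
    by rewrite -ReM_real -!raddfB.
- apply: (@Rint_ftc (fun t => complex.Im (p t))) => // t /[dup] tt.
  + move=> /cq ht; apply: continuous_ed => e e0; have [d d0 hd] := ht e e0.
    by exists d => // s /hd; apply: le_trans; rewrite -raddfB Im_le_cmod.
  + move=> /dp ht; apply: is_derive_ed => e e0; have [d d0 hd] := ht e e0.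
    exists d => // s /hd; apply: le_trans; apply: le_trans (Im_le_cmod _).
    by rewrite -ImM_real -!raddfB.
Qed.

End Integral.

(** * Integrals along the boundary of a rectangle and Goursat's theorem *)

Section Goursat.
Variable R : realType.
Local Notation C := R[i].
Implicit Types (f g : C -> C) (a b c d : R).

(** The contour integral along the boundary of [[a,b] x [c,d]], counterclockwise; [dz] is [dx] on
    the horizontal sides and [i dy] on the vertical ones. *)
Definition rect f a b c d : C :=
  cint (fun x => f (x +i* c)) a b - cint (fun x => f (x +i* d)) a b
  + 'i * (cint (fun y => f (b +i* y)) c d - cint (fun y => f (a +i* y)) c d).

Definition inrect a b c d (z : C) :=
  (a <= complex.Re z <= b) && (c <= complex.Im z <= d).

Lemma vdiff (x s y : R) : x +i* s - x +i* y = 'i * (s - y)%:C :> C.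
Proof.
rewrite -[LHS]/((x - x) +i* (s - y)) subrr.
by simpc.
Qed.

Lemma hdiff (x s y : R) : s +i* y - x +i* y = (s - x)%:C :> C.
Proof. by rewrite -[LHS]/((s - x) +i* (y - y)) subrr. Qed.

Lemma pcont_hline f (x y : R) : ccont f (x +i* y) -> pcont (fun t => f (t +i* y)) x.
Proof.
move=> h e e0; have [d d0 hd] := h e e0; exists d => // s hs; apply: hd.
by rewrite hdiff cmodR.
Qed.

Lemma pcont_vline f (x y : R) : ccont f (x +i* y) -> pcont (fun t => f (x +i* t)) y.
Proof.
move=> h e e0; have [d d0 hd] := h e e0; exists d => // s hs; apply: hd.
by rewrite vdiff cmodM cmod_i mul1r cmodR.
Qed.

Lemma pcont_cst (k : C) t : pcont (fun=> k) t.
Proof. by move=> e e0; exists 1 => // s _; rewrite subrr cmod0 ltW. Qed.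

Lemma rect_split f a b c d m n : a <= m <= b -> c <= n <= d ->
  (forall z, inrect a b c d z -> ccont f z) ->
  rect f a b c d = rect f a m c n + rect f m b c n + (rect f a m n d + rect f m b n d).
Proof.
move=> /andP[am mb] /andP[cn nd] hf.
have hh x y : a <= x <= b -> c <= y <= d -> pcont (fun t => f (t +i* y)) x.
  by move=> xx yy; apply/pcont_hline/hf/andP.
have hv x y : a <= x <= b -> c <= y <= d -> pcont (fun t => f (x +i* t)) y.
  by move=> xx yy; apply/pcont_vline/hf/andP.
have ab := le_trans am mb; have cd := le_trans cn nd.
rewrite /rect (@cint_cat _ (fun x => f (x +i* c)) a b m) ?am //; last first.
  by move=> t tt; apply: hh; rewrite ?lexx.
rewrite (@cint_cat _ (fun x => f (x +i* d)) a b m) ?am //; last first.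
  by move=> t tt; apply: hh; rewrite ?lexx ?cd.
rewrite (@cint_cat _ (fun y => f (b +i* y)) c d n) ?cn //; last first.
  by move=> t tt; apply: hv; rewrite ?lexx ?ab.
rewrite (@cint_cat _ (fun y => f (a +i* y)) c d n) ?cn //; last first.
  by move=> t tt; apply: hv; rewrite ?lexx ?ab.
ring.
Qed.

(** The affine part [f z + l (w - z)] contributes [l i (c - d) (b - a)] along the horizontal sides
    and [i l (b - a) (d - c)] along the vertical ones. These cancel, so only the remainder, at most
    [e D] with [D = b - a + (d - c)], is integrated. *)
Lemma rect_small f a b c d (z l : C) (e : R) : a <= b -> c <= d -> 0 <= e ->
  (forall w, inrect a b c d w -> ccont f w) -> inrect a b c d z ->
  (forall w, inrect a b c d w -> cmod (f w - f z - l * (w - z)) <= e * cmod (w - z)) ->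
  cmod (rect f a b c d) <= 4 * e * (b - a + (d - c)) ^+ 2.
Proof.
move=> ab cd e0 hc hz h.
pose D := b - a + (d - c).
have hD w : inrect a b c d w -> cmod (f w - f z - l * (w - z)) <= e * D.
  move=> hw; apply: le_trans (h w hw) _; apply: ler_wpM2l => //.
  apply: le_trans (cmod_le_ReIm _) _; rewrite !raddfB /=.
  move: hw hz => /andP[/andP[p1 p2] /andP[p3 p4]] /andP[/andP[q1 q2] /andP[q3 q4]].
  apply: lerD; rewrite ler_norml; apply/andP; split; lra.
have hh x y : a <= x <= b -> c <= y <= d -> pcont (fun t => f (t +i* y)) x.
  by move=> xx yy; apply/pcont_hline/hc/andP.
have hv x y : a <= x <= b -> c <= y <= d -> pcont (fun t => f (x +i* t)) y.
  by move=> xx yy; apply/pcont_vline/hc/andP.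
have H1 : cmod (cint (fun x => f (x +i* c)) a b - cint (fun x => f (x +i* d)) a b
   - l * ('i * (c - d)%:C) * (b - a)%:C) <= 2 * (2 * (e * D)) * (b - a).
  have k0 t : a <= t <= b -> pcont (fun x => f (x +i* c) - f (x +i* d)) t.
    move=> tt e1 e10; have e2 : 0 < e1 / 2 by rewrite divr_gt0.
    have [d1 d10 k1] := hh t c tt (introT andP (conj (lexx c) cd)) _ e2.
    have [d2 d20 k2] := hh t d tt (introT andP (conj cd (lexx d))) _ e2.
    exists (Num.min d1 d2); rewrite ?lt_min ?d10 // => s.
    rewrite lt_min => /andP[/k1 {}k1 /k2 {}k2].
    rewrite (_ : _ - _ = (f (s +i* c) - f (t +i* c)) - (f (s +i* d) - f (t +i* d))); last by ring.
    by apply: le_trans (cmodB _ _) _; rewrite [e1]splitr; exact: lerD.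
  rewrite -cintB; [|by move=> t tt; apply: hh; rewrite ?lexx ?cd..].
  rewrite -cint_cst // -cintB //; last by move=> t _; apply: pcont_cst.
  apply: cint_le => //.
    move=> t tt e1 e10; have [d1 d10 k1] := k0 t tt e1 e10; exists d1 => // s /k1.
    by rewrite (_ : forall x y k : C, x - k - (y - k) = x - y) // => x y k; ring.
  move=> t tt.
  have i1 : inrect a b c d (t +i* c) by rewrite /inrect /= tt lexx cd.
  have i2 : inrect a b c d (t +i* d) by rewrite /inrect /= tt lexx cd.
  have -> : f (t +i* c) - f (t +i* d) - l * ('i * (c - d)%:C) =
    (f (t +i* c) - f z - l * (t +i* c - z)) - (f (t +i* d) - f z - l * (t +i* d - z)).
    by rewrite -(vdiff t); ring.
  by apply: le_trans (cmodB _ _) _; rewrite mulr_natl mulr2n; apply: lerD; apply: hD.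
have H2 : cmod (cint (fun y => f (b +i* y)) c d - cint (fun y => f (a +i* y)) c d
   - l * (b - a)%:C * (d - c)%:C) <= 2 * (2 * (e * D)) * (d - c).
  have k0 t : c <= t <= d -> pcont (fun y => f (b +i* y) - f (a +i* y)) t.
    move=> tt e1 e10; have e2 : 0 < e1 / 2 by rewrite divr_gt0.
    have [d1 d10 k1] := hv b t (introT andP (conj ab (lexx b))) tt _ e2.
    have [d2 d20 k2] := hv a t (introT andP (conj (lexx a) ab)) tt _ e2.
    exists (Num.min d1 d2); rewrite ?lt_min ?d10 // => s.
    rewrite lt_min => /andP[/k1 {}k1 /k2 {}k2].
    rewrite (_ : _ - _ = (f (b +i* s) - f (b +i* t)) - (f (a +i* s) - f (a +i* t))); last by ring.
    by apply: le_trans (cmodB _ _) _; rewrite [e1]splitr; exact: lerD.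
  rewrite -cintB; [|by move=> t tt; apply: hv; rewrite ?lexx ?ab..].
  rewrite -cint_cst // -cintB //; last by move=> t _; apply: pcont_cst.
  apply: cint_le => //.
    move=> t tt e1 e10; have [d1 d10 k1] := k0 t tt e1 e10; exists d1 => // s /k1.
    by rewrite (_ : forall x y k : C, x - k - (y - k) = x - y) // => x y k; ring.
  move=> t tt.
  have i1 : inrect a b c d (b +i* t) by rewrite /inrect /= tt lexx ab.
  have i2 : inrect a b c d (a +i* t) by rewrite /inrect /= tt lexx ab.
  have -> : f (b +i* t) - f (a +i* t) - l * (b - a)%:C =
    (f (b +i* t) - f z - l * (b +i* t - z)) - (f (a +i* t) - f z - l * (a +i* t - z)).
    by rewrite -(hdiff _ _ t); ring.
  by apply: le_trans (cmodB _ _) _; rewrite mulr_natl mulr2n; apply: lerD; apply: hD.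
rewrite /rect.
set X := cint _ a b - _ in H1 *; set Y := cint _ c d - _ in H2 *.
have -> : X + 'i * Y = (X - l * ('i * (c - d)%:C) * (b - a)%:C)
   + 'i * (Y - l * (b - a)%:C * (d - c)%:C).
  by rewrite !(rmorphB (real_complex R)) /=; ring.
apply: le_trans (cmodD _ _) _; rewrite cmodM cmod_i mul1r.
apply: le_trans (lerD H1 H2) _; rewrite le_eqVlt; apply/orP; left; apply/eqP; rewrite /D; ring.
Qed.

End Goursat.

Section Goursat2.
Variable R : realType.
Local Notation C := R[i].
Implicit Types (f g : C -> C) (a b c d : R).

Lemma max_of_four (u x y z t : R) : u <= x + y + (z + t) ->
  [\/ u <= 4 * x, u <= 4 * y, u <= 4 * z | u <= 4 * t].
Proof.
move=> h.
have [?|l1] := lerP u (4 * x); first by constructor 1.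
have [?|l2] := lerP u (4 * y); first by constructor 2.
have [?|l3] := lerP u (4 * z); first by constructor 3.
have [?|l4] := lerP u (4 * t); first by constructor 4.
lra.
Qed.

(** The sides are written [w + w] and [h + h] so that all quarters have sides exactly [w] and [h];
    one of them carries at least a quarter of the integral. *)
Lemma rect_quarter f (x y w h : R) : 0 <= w -> 0 <= h ->
  (forall z, inrect x (x + (w + w)) y (y + (h + h)) z -> ccont f z) ->
  exists p : R * R, [/\ [/\ x <= p.1, p.1 + w <= x + (w + w), y <= p.2 & p.2 + h <= y + (h + h)]
    & cmod (rect f x (x + (w + w)) y (y + (h + h)))
       <= 4 * cmod (rect f p.1 (p.1 + w) p.2 (p.2 + h))].
Proof.
move=> w0 h0 hc.
have ww : x <= x + w <= x + (w + w) by rewrite addrA !lerDl w0.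
have hh : y <= y + h <= y + (h + h) by rewrite addrA !lerDl h0.
have e := rect_split ww hh hc.
have [] := @max_of_four (cmod (rect f x (x + (w + w)) y (y + (h + h))))
  (cmod (rect f x (x + w) y (y + h))) (cmod (rect f (x + w) (x + (w + w)) y (y + h)))
  (cmod (rect f x (x + w) (y + h) (y + (h + h))))
  (cmod (rect f (x + w) (x + (w + w)) (y + h) (y + (h + h)))).
- by rewrite e; apply: le_trans (cmodD _ _) _; apply: lerD; apply: cmodD.
- by move=> k; exists (x, y); rewrite /= !addrA !lerDl w0 h0 -!addrA.
- by move=> k; exists (x + w, y); rewrite /= !addrA !lerDl w0 h0 -!addrA.
- by move=> k; exists (x, y + h); rewrite /= !addrA !lerDl w0 h0 -!addrA.
- by move=> k; exists (x + w, y + h); rewrite /= !addrA !lerDl w0 h0 -!addrA.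
Qed.

Lemma goursat f a b c d : a <= b -> c <= d ->
  (forall z, inrect a b c d z -> exists l, cder f z l) -> rect f a b c d = 0.
Proof.
move=> ab cd hol.
have hc z : inrect a b c d z -> ccont f z by move=> /hol[l /cder_cont].
pose w n : R := (b - a) / 2 ^+ n; pose h n : R := (d - c) / 2 ^+ n.
have two n : (2 ^+ n : R) != 0 by rewrite expf_neq0 // pnatr_eq0.
have wS n : w n = w n.+1 + w n.+1.
  by rewrite /w exprS; field; rewrite two.
have hS n : h n = h n.+1 + h n.+1.
  by rewrite /h exprS; field; rewrite two.
have w0 n : 0 <= w n by rewrite /w divr_ge0 ?subr_ge0 ?exprn_ge0.
have h0 n : 0 <= h n by rewrite /h divr_ge0 ?subr_ge0 ?exprn_ge0.
pose Q n (p : R * R) := rect f p.1 (p.1 + w n) p.2 (p.2 + h n).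
pose ins n (p : R * R) := [/\ a <= p.1, p.1 + w n <= b, c <= p.2 & p.2 + h n <= d].
(* [choice] wants a total relation, so being inside is a premise within the existential, and a
   corner outside gets the dummy [(0, 0)]. *)
have step (np : nat * (R * R)) : exists p' : R * R, ins np.1 np.2 ->
  [/\ ins np.1.+1 p', [/\ np.2.1 <= p'.1, p'.1 + w np.1.+1 <= np.2.1 + w np.1,
    np.2.2 <= p'.2 & p'.2 + h np.1.+1 <= np.2.2 + h np.1]
    & cmod (Q np.1 np.2) <= 4 * cmod (Q np.1.+1 p')].
  case: np => n [x y] /=; have [hi|] := pselect (ins n (x, y)); last by exists (0, 0).
  have [/= i1 i2 i3 i4] := hi.
  have [|p [[k1 k2 k3 k4] k5]] := @rect_quarter f x y (w n.+1) (h n.+1) (w0 _) (h0 _).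
    rewrite -(wS n) -(hS n) => z /andP[/andP[z1 z2] /andP[z3 z4]].
    apply: hc; apply/andP; split; apply/andP; split.
    - exact: le_trans z1.
    - exact: le_trans i2.
    - exact: le_trans z3.
    - exact: le_trans i4.
  rewrite -(wS n) -(hS n) in k2 k4 k5.
  exists p => _; split => //; split.
  - exact: le_trans k1.
  - exact: le_trans i2.
  - exact: le_trans k3.
  - exact: le_trans i4.
have [nxt hn] := choice step.
pose s := fix s n := if n is m.+1 then nxt (m, s m) else (a, c).
have hn' n := hn (n, s n).
have s_ins n : ins n (s n).
  elim: n => [|n IH]; last by have [] := hn' n IH.
  by split; rewrite /= ?lexx // /w /h expr0 divr1 subrKC.
have sx n m : (s n).1 <= (s (n + m)%N).1 /\ (s (n + m)%N).1 + w (n + m)%N <= (s n).1 + w n.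
  elim: m => [|m [k1 k2]]; first by rewrite addn0.
  by rewrite addnS; have [_ [q1 q2 _ _] _] := hn' _ (s_ins (n + m)%N); split;
    [apply: le_trans k1 q1 | apply: le_trans q2 k2].
have sy n m : (s n).2 <= (s (n + m)%N).2 /\ (s (n + m)%N).2 + h (n + m)%N <= (s n).2 + h n.
  elim: m => [|m [k1 k2]]; first by rewrite addn0.
  by rewrite addnS; have [_ [_ _ q1 q2] _] := hn' _ (s_ins (n + m)%N); split;
    [apply: le_trans k1 q1 | apply: le_trans q2 k2].
have sQ n : cmod (rect f a b c d) <= 4 ^+ n * cmod (Q n (s n)).
  elim: n => [|n IH].
    by rewrite expr0 mul1r /Q /= /w /h expr0 !divr1 !subrKC.
  have [_ _ k] := hn' _ (s_ins n).
  by apply: le_trans IH _; rewrite exprSr -mulrA; apply: ler_wpM2l => //; rewrite exprn_ge0.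
(* Nested intervals [[u n, u n + v n]]: the supremum of the left ends lies in all of them. *)
have lim_pt (u v : nat -> R) : (forall n m, u n <= u (n + m)%N /\ u (n + m)%N + v (n + m)%N <= u n + v n) ->
    (forall n, 0 <= v n) -> exists x, forall n, u n <= x <= u n + v n.
  move=> uv v0; exists (sup (range u)) => n.
  have hb m : u m <= u n + v n.
    have [k1 _] := uv m n; have [_ k2] := uv n m; apply: le_trans k1 _.
    by rewrite addnC; apply: le_trans k2; rewrite lerDl.
  apply/andP; split.
    apply: sup_upper_bound; last by exists n.
    by split; [exists (u 0%N); exists 0%N | exists (u n + v n) => _ [m _ <-]].
  by apply: sup_le_ub; [exists (u 0%N); exists 0%N | move=> _ [m _ <-]].
have [x hx] := lim_pt (fun n => (s n).1) w sx w0.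
have [y hy] := lim_pt (fun n => (s n).2) h sy h0.
have inz n : inrect (s n).1 ((s n).1 + w n) (s n).2 ((s n).2 + h n) (x +i* y).
  by apply/andP; split; [apply: hx | apply: hy].
have sub n z : inrect (s n).1 ((s n).1 + w n) (s n).2 ((s n).2 + h n) z -> inrect a b c d z.
  have [i1 i2 i3 i4] := s_ins n; move=> /andP[/andP[z1 z2] /andP[z3 z4]].
  by apply/andP; split; apply/andP; split;
   [apply: le_trans z1 | apply: le_trans i2 | apply: le_trans z3 | apply: le_trans i4].
have [l hl] := hol _ (sub _ _ (inz 0%N)).
apply: cmod_small => e e0.
pose D := b - a + (d - c); have D0 : 0 <= D by rewrite addr_ge0 // subr_ge0.
have K0 : 0 < 4 * (D ^+ 2 + 1) by rewrite mulr_gt0 // ltr_wpDl // exprn_ge0.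
have e1 : 0 < e / (4 * (D ^+ 2 + 1)) by rewrite divr_gt0.
have [dl dl0 hd] := hl _ e1.
have [n hnD] : exists n, D / 2 ^+ n < dl.
  exists (Num.bound (D / dl)); rewrite ltr_pdivrMr ?exprn_gt0 // mulrC -ltr_pdivrMr //.
  apply: lt_trans (archi_boundP (divr_ge0 D0 (ltW dl0))) _.
  by rewrite -natrX ltr_nat ltn_expl.
apply: le_trans (sQ n) _.
have -> : e = 4 ^+ n * (e / 4 ^+ n) by rewrite mulrC divfK // expf_neq0 // pnatr_eq0.
apply: ler_wpM2l; first by rewrite exprn_ge0.
apply: le_trans (@rect_small R f _ _ _ _ (x +i* y) l _ _ _ (ltW e1) _ (inz n) _) _.
- by rewrite lerDl.
- by rewrite lerDl.
- by move=> z /sub /hc.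
- move=> z hz; apply: hd; apply: le_lt_trans hnD; apply: le_trans (cmod_le_ReIm _) _.
  rewrite !raddfB /= /D mulrDl -/(w n) -/(h n).
  move: hz (inz n) => /andP[/andP[p1 p2] /andP[p3 p4]] /andP[/= /andP[q1 q2] /andP[q3 q4]].
  by apply: lerD; rewrite ler_norml; apply/andP; split; lra.
(* The factor [4 ^+ n] from the subdivision is compensated by the squared half-perimeter, which
   shrinks at the same rate. *)
- rewrite ![_ + _ - _]addrAC !subrr !add0r -mulrDl -/D expr_div_n -exprM mulnC exprM.
  rewrite (_ : 2 ^+ 2 = 4 :> R); last by rewrite -natrX.
  rewrite [X in X <= _]mulrA; apply: ler_wpM2r; first by rewrite invr_ge0 exprn_ge0.
  have -> : 4 * (e / (4 * (D ^+ 2 + 1))) * D ^+ 2 = e * (D ^+ 2 / (D ^+ 2 + 1)).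
    by field; rewrite gt_eqF // ltr_wpDl // exprn_ge0.
  rewrite -[X in _ <= X]mulr1; apply: ler_wpM2l; first exact: ltW.
  by rewrite ler_pdivrMr ?mul1r ?lerDl // ltr_wpDl // exprn_ge0.
Qed.

End Goursat2.

(** * The exponential function is entire *)

Section Exponential.
Variable R : realType.
Local Notation C := R[i].

Lemma cexpD (z w : C) : cexp (z + w) = cexp z * cexp w.
Proof.
case: z w => [a b] [c d]; rewrite /cexp /= expRD cosD sinD.
by apply/eqP; rewrite eq_complex /=; apply/andP; split; apply/eqP; ring.
Qed.

Lemma cexp0 : cexp 0 = 1 :> C.
Proof. by rewrite /twopii /cexp /= expR0 cos0 sin0 mul1r. Qed.

Lemma cmod_cexp (z : C) : cmod (cexp z) = expR (complex.Re z).
Proof.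
rewrite /cexp cmodM cmodR ger0_norm ?expR_ge0 // -[RHS]mulr1; congr (_ * _).
apply/eqP; rewrite -(@eqrXn2 _ 2) ?cmod_ge0 // ?ler01 // cmod_sq /= expr1n.
by rewrite cos2Dsin2.
Qed.

Lemma cexp_neq0 (z : C) : cexp z != 0.
Proof. by rewrite -cmod_gt0 cmod_cexp expR_gt0. Qed.

Lemma cexpN (z : C) : cexp (- z) = (cexp z)^-1.
Proof.
by apply: (mulfI (cexp_neq0 z)); rewrite -cexpD subrr cexp0 divff // cexp_neq0.
Qed.

Lemma cexp_period (z : C) : cexp (z + twopii R) = cexp z.
Proof.
rewrite cexpD -[RHS]mulr1; congr (_ * _).
by rewrite /twopii /cexp /= expR0 mul1r mulr_natl cos2pi sin2pi.
Qed.

Lemma derive_ed (f : R -> R) t l : is_derive t (1 : R^o) (f : R^o -> R^o) l ->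
  forall e : R, 0 < e ->
  exists2 d : R, 0 < d & forall s, `|s - t| < d -> `|f s - f t - l * (s - t)| <= e * `|s - t|.
Proof.
move=> [dv lv] e e0.
have hc : (fun h : R => h^-1 *: (f (h *: (1 : R^o) + t) - f t)) @ 0^' --> l by rewrite -lv; exact: dv.
have /cvgrPdist_le /(_ e e0) := hc.
move=> [d /= d0 hd]; exists d => // s sd.
have [->|st] := eqVneq s t; first by rewrite !subrr mulr0 normr0 mulr0 subr0 normr0.
have s0 : s - t != 0 by rewrite subr_eq0.
have := hd (s - t); rewrite /= distrC subr0 => /(_ sd s0).
rewrite -[_ *: 1]/(_ * 1) mulr1 subrK distrC.
rewrite -(ler_pM2r (_ : 0 < `|s - t|)) ?normr_gt0 // -normrM mulrBl.
by rewrite -[_ *: _]/((s - t)^-1 * _) mulrAC mulVf // mul1r.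
Qed.

Lemma cder_cexp0 : cder (@cexp R) 0 1.
Proof.
(* The decomposition below has three terms, bounded by [e1 t], [4 e1 t] and [e1 t] with [t = |z|];
   hence [e / 6]. The bound 1 serves to get [|1 + x| <= 2]. *)
move=> e e0; pose e1 := Num.min 1 (e / 6).
have e10 : 0 < e1 by rewrite lt_min ltr01 divr_gt0.
have e1e : e1 <= e / 6 by rewrite ge_min lexx orbT.
have e11 : e1 <= 1 by rewrite ge_min lexx.
clearbody e1.
have [d1 d10 h1] := derive_ed (is_derive_expR (0 : R)) e10.
have [d2 d20 h2] := derive_ed (is_derive_cos (0 : R)) e10.
have [d3 d30 h3] := derive_ed (is_derive_sin (0 : R)) e10.
exists (Num.min (Num.min d1 d2) (Num.min d3 e1)); first by rewrite !lt_min d10 d20 d30.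
move=> z; rewrite subr0 !lt_min => /andP[/andP[z1 z2] /andP[z3 z4]].
have [zr zi] := (Re_le_cmod z, Im_le_cmod z).
case: z z1 z2 z3 z4 zr zi => x y; set t := cmod _ => z1 z2 z3 z4 /= zr zi.
have k1 : `|expR x - 1 - x| <= e1 * `|x|.
  by have := h1 x; rewrite subr0 expR0 mul1r; apply; apply: le_lt_trans z1.
have k2 : `|cos y - 1| <= e1 * `|y|.
  by have := h2 y; rewrite subr0 cos0 sin0 oppr0 mul0r subr0; apply; apply: le_lt_trans z2.
have k3 : `|sin y - y| <= e1 * `|y|.
  by have := h3 y; rewrite subr0 cos0 sin0 subr0 mul1r; apply; apply: le_lt_trans z3.
have t0 : 0 <= t by apply: cmod_ge0.
pose c := cos y +i* sin y : C.
have c1 : cmod c = 1.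
  by have := cmod_cexp (0 +i* y); rewrite /cexp /= expR0 mul1r => <-.
have -> : cexp (x +i* y) - cexp 0 - 1 * (x +i* y) =
   (expR x - 1 - x)%:C * c + (1 + x)%:C * ((cos y - 1)%:C + 'i * (sin y - y)%:C) + 'i * (x * y)%:C.
  rewrite /cexp /= expR0 cos0 sin0 mul1r; simpc.
  by apply/eqP; rewrite eq_complex /=; apply/andP; split; apply/eqP; ring.
apply: le_trans (cmodD _ _) _; apply: le_trans (lerD (cmodD _ _) (lexx _)) _.
rewrite !cmodM c1 cmod_i !cmodR mulr1 mul1r normrM.
have q1 : cmod ((cos y - 1)%:C + 'i * (sin y - y)%:C) <= 2 * e1 * t.
  apply: le_trans (cmodD _ _) _; rewrite cmodM cmod_i mul1r !cmodR.
  have : e1 * `|y| <= e1 * t by apply: ler_wpM2l => //; apply: ltW.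
  by lra.
have q2 : `|1 + x| <= 2.
  by apply: le_trans (ler_normD _ _) _; rewrite normr1; lra.
have q3 : `|1 + x| * cmod ((cos y - 1)%:C + 'i * (sin y - y)%:C) <= 2 * (2 * e1 * t).
  by apply: ler_pM; rewrite ?cmod_ge0 ?normr_ge0.
have q4 : `|x| * `|y| <= e1 * t by apply: ler_pM; rewrite ?normr_ge0 //; lra.
have q5 : e1 * `|x| <= e1 * t by apply: ler_wpM2l => //; apply: ltW.
have q6 : e1 * t <= e / 6 * t by apply: ler_wpM2r.
by lra.
Qed.

Lemma cder_cexp (z : C) : cder (@cexp R) z (cexp z).
Proof.
have h : cder (fun w => cexp z * cexp (w - z)) z (cexp z * (1 * (1 + 0))).
  apply: cderZ; apply: (@cder_comp _ (fun w => w - z)).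
    by apply: cderD (cder_id _) (cder_cst _ _).
  by rewrite subrr; apply: cder_cexp0.
by move: h; rewrite addr0 !mulr1; apply: cder_ext => w; rewrite -cexpD addrC subrK.
Qed.

Lemma entire_cexp : entire (@cexp R).
Proof. by move=> z; exists (cexp z); apply: cder_cexp. Qed.

End Exponential.

(** * Maximum principle with exceptional points *)

Section MaximumPrinciple.
Variable R : realType.
Local Notation C := R[i].
Implicit Types (f g : C -> C) (c z : C) (r M : R).

(* Goursat's theorem for g (c + exp w) on a rectangle of height 2 pi, whose left side is moved to -oo. *)
Lemma mean_bound g c r M : 0 < r -> ccont g c -> (forall z, z != c -> exists l, cder g z l) ->
  (forall z, cmod (z - c) = r -> cmod (g z) <= M) -> cmod (g c) <= 2 * M.
Proof.
move=> r0 gc gd gM.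
pose G w := g (c + cexp w).
have Gd w : exists l, cder G w l.
  have [l hl] : exists l, cder g (c + cexp w) l.
    by apply: gd; rewrite -subr_eq0 addrAC subrr add0r cexp_neq0.
  exists (l * (0 + cexp w)); apply: (@cder_comp _ (fun w => c + cexp w)) hl.
  exact: cderD (cder_cst _ _) (cder_cexp _).
have p0 : 0 < 2 * pi :> R by rewrite mulr_gt0 // pi_gt0.
have Gp x : G (x +i* (2 * pi)) = G (x +i* 0).
  rewrite /G -(cexp_period (x +i* 0)); congr (g (c + cexp _)).
  by rewrite -[RHS]/((x + 0) +i* (0 + 2 * pi)) addr0 add0r.
have Gcont x t : pcont (fun y => G (x +i* y)) t.
  by apply: pcont_vline; have [l /cder_cont] := Gd (x +i* t).
pose I s := cint (fun y => G (s +i* y)) 0 (2 * pi).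
have Ieq s : s <= ln r -> I s = I (ln r).
  move=> sr; have := @goursat _ G _ _ _ _ sr (ltW p0) (fun z _ => Gd z).
  rewrite /rect; under [X in X - _ + _ = _]eq_cint => x _ do rewrite -Gp.
  rewrite subrr add0r => /eqP; rewrite mulf_eq0 subr_eq0.
  rewrite (_ : ('i == 0 :> C) = false) => [/eqP e|]; first exact: esym e.
  by rewrite -cmod_eq0 cmod_i oner_eq0.
have mG s y : cmod (cexp (s +i* y)) = expR s by rewrite cmod_cexp.
have M0 : 0 <= M by apply: le_trans (cmod_ge0 (g (c + r%:C))) (gM _ _); rewrite addrAC subrr add0r cmodR gtr0_norm.
have IM : cmod (I (ln r)) <= 2 * M * (2 * pi).
  rewrite -[X in _ * X]subr0; apply: cint_le => //; first exact: ltW.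
  by move=> y _; apply: gM; rewrite addrAC subrr add0r mG lnK.
apply/ler_addgt0Pr => e e0.
have e2 : 0 < e / 2 by rewrite divr_gt0.
have [d d0 hd] := gc _ e2.
pose s := Num.min (ln r) (ln (d / 2)).
have Is : cmod (I s - g c * (2 * pi)%:C) <= 2 * (e / 2) * (2 * pi).
  have -> : g c * (2 * pi)%:C = cint (fun=> g c) 0 (2 * pi) by rewrite cint_cst ?subr0 // ltW.
  rewrite -cintB //; last by move=> t _; apply: pcont_cst.
  rewrite -[X in _ <= _ * X]subr0; apply: cint_le => //; first exact: ltW.
    move=> t _ e1 e10; have [d1 d10 k1] := Gcont s t _ e10; exists d1 => // u /k1.
    by rewrite (_ : forall x y k : C, x - k - (y - k) = x - y) // => x y k; ring.
  move=> y _; apply: hd; rewrite addrAC subrr add0r mG.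
  apply: (@le_lt_trans _ _ (d / 2)); last by rewrite ltr_pdivrMr // mulr_natr mulr2n ltrDl.
  by rewrite -[X in _ <= X]lnK ?posrE ?divr_gt0 // ler_expR ge_min lexx orbT.
have hs : s <= ln r by rewrite ge_min lexx.
rewrite -(ler_pM2r p0) -[X in cmod _ * X](gtr0_norm p0) -cmodR -cmodM.
apply: le_trans (cmod_tri _ (I s)) _; rewrite cmodBC.
apply: le_trans (lerD _ Is) _; first by rewrite (Ieq s hs); exact: IM.
by rewrite -mulrDl [2 * (e / 2)]mulrC divfK.
Qed.

Lemma cder_mul_root f p : ccont f p -> cder (fun z => (z - p) * f z) p (f p).
Proof.
move=> hf e e0; have [d d0 hd] := hf e e0; exists d => // z /hd h.
rewrite subrr mul0r subr0 (_ : _ - _ = (f z - f p) * (z - p)); last by ring.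
by rewrite cmodM ler_wpM2r ?cmod_ge0.
Qed.

(** Multiplying by [z - p] restores differentiability at an exceptional point [p], by
    [cder_mul_root]. At the centre [c] continuity is enough for [mean_bound], and there the factor
    must not vanish. *)
Definition root_factor c p z : C := if p == c then 1 else z - p.

Lemma root_factor_cont c p z : ccont (root_factor c p) z.
Proof.
rewrite /root_factor; case: (p == c); first exact: ccont_cst.
by apply: ccontD; [apply: entire_cont (@entire_id R)|apply: ccont_cst].
Qed.

Lemma root_factor_der c p f z : z != c -> ccont f z -> (z != p -> exists l, cder f z l) ->
  exists l, cder (fun w => root_factor c p w * f w) z l.
Proof.
move=> zc hf hd; have [zp|/hd [l hl]] := eqVneq z p.
  by subst p; exists (f z); rewrite /root_factor (negbTE zc); apply: cder_mul_root.
rewrite /root_factor; case: (p == c); first by exists (1 * l); apply: cderZ.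
eexists; apply: (@cderM _ (fun w => w - p)) hl.
exact: cderD (cder_id _) (cder_cst _ _).
Qed.

Lemma ccontX f z n : ccont f z -> ccont (fun w => f w ^+ n) z.
Proof.
move=> h; elim: n => [|n IH]; first exact: ccont_cst.
rewrite (_ : (fun w => _) = (fun w => f w * f w ^+ n)); first exact: ccontM.
by apply/funext => w; rewrite exprS.
Qed.

Lemma cderX f z l n : cder f z l -> exists m, cder (fun w => f w ^+ n) z m.
Proof.
move=> h; elim: n => [|n [m IH]]; first by exists 0; apply: cder_cst.
rewrite (_ : (fun w => _) = (fun w => f w * f w ^+ n)); first by eexists; apply: cderM; eassumption.
by apply/funext => w; rewrite exprS.
Qed.

Lemma bernoulli (x : R) n : 0 <= x -> 1 + n%:R * x <= (1 + x) ^+ n.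
Proof.
move=> x0; elim: n => [|n IH]; first by rewrite mul0r addr0 expr0.
rewrite exprS; apply: le_trans (_ : (1 + x) * (1 + n%:R * x) <= _); last first.
  by apply: ler_wpM2l => //; rewrite addr_ge0.
have : 0 <= n%:R * x * x by rewrite !mulr_ge0.
by rewrite -natr1; lra.
Qed.

(* The factors of 2 in mean_bound and of the exceptional points are killed by applying it to large powers. *)
Lemma max_principle g p q c r M : 0 < r -> (forall z, ccont g z) ->
  (forall z, z != p -> z != q -> exists l, cder g z l) ->
  (forall z, cmod (z - c) = r -> cmod (g z) <= M) -> cmod (g c) <= M.
Proof.
move=> r0 gc gd gM.
have M0 : 0 <= M by apply: le_trans (cmod_ge0 (g (c + r%:C))) (gM _ _); rewrite addrAC subrr add0r cmodR gtr0_norm.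
rewrite leNgt; apply/negP => lt.
pose N := (M + cmod (g c)) / 2.
have MN : M < N by rewrite /N; lra.
have NG : N < cmod (g c) by rewrite /N; lra.
have N0 : 0 < N by apply: le_lt_trans MN.
pose m z := root_factor c p z * root_factor c q z.
have m0 : 0 < cmod (m c).
  rewrite cmod_gt0 mulf_neq0 // /root_factor; case: ifP => [_|]; rewrite ?oner_neq0 //;
  by move=> /negbT; rewrite eq_sym subr_eq0.
pose K (p : C) := 1 + r + cmod (c - p).
have K0 u : 0 <= K u by rewrite !addr_ge0 ?cmod_ge0 // ltW.
have mK u z : cmod (z - c) = r -> cmod (root_factor c u z) <= K u.
  move=> zr; rewrite /root_factor /K; case: ifP => _.
    by rewrite cmod1; have := cmod_ge0 (c - u); lra.
  by have := cmod_dist z u c; rewrite zr; lra.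
have bd n : cmod (m c) * cmod (g c) ^+ n <= 2 * (K p * K q * N ^+ n).
  rewrite -cmodX -cmodM.
  apply: (@mean_bound (fun z => m z * g z ^+ n) c r) => //.
  - by apply: ccontM; [apply: ccontM; apply: root_factor_cont|apply: ccontX].
  - move=> z zc.
    have [l hl] : exists l, cder (fun w => root_factor c p w * (root_factor c q w * g w ^+ n)) z l.
      apply: root_factor_der => //.
        by apply: ccontM; [apply: root_factor_cont|apply: ccontX].
      move=> zp; apply: root_factor_der => //; first exact: ccontX.
      by move=> zq; have [l /cderX] := gd z zp zq; exact.
    by exists l; apply: cder_ext hl => w; rewrite mulrA.
  - move=> z zr; rewrite !cmodM cmodX; apply: ler_pM; rewrite ?mulr_ge0 ?cmod_ge0 ?exprn_ge0 ?cmod_ge0 //.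
      by apply: ler_pM; rewrite ?cmod_ge0 ?mK.
    by apply: lerXn2r; rewrite ?nnegrE ?cmod_ge0 ?(ltW N0) //; apply: le_trans (gM _ zr) (ltW MN).
pose x := cmod (g c) / N - 1.
have x0 : 0 < x by rewrite subr_gt0 ltr_pdivlMr // mul1r.
pose B := 2 * (K p * K q) / cmod (m c).
have B0 : 0 <= B by rewrite divr_ge0 ?mulr_ge0 ?K0 // ltW.
have hB n : (1 + x) ^+ n <= B.
  rewrite /x addrCA subrr addr0 expr_div_n ler_pdivrMr ?exprn_gt0 //.
  rewrite /B mulrAC ler_pdivlMr // mulrC; apply: le_trans (bd n) _.
  by rewrite !mulrA.
have := archi_boundP (divr_ge0 B0 (ltW x0)).
rewrite ltr_pdivrMr // ltNge => /negP; apply.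
by apply: le_trans (hB (Num.bound (B / x))); apply: le_trans (bernoulli _ (ltW x0)); rewrite lerDr.
Qed.

Lemma entire_max g c r M : 0 < r -> entire g ->
  (forall z, cmod (z - c) = r -> cmod (g z) <= M) -> cmod (g c) <= M.
Proof.
by move=> r0 ge; apply: (@max_principle g c c) => // z; apply: entire_cont.
Qed.

End MaximumPrinciple.

(** * Difference quotients; derivatives of entire functions are entire *)

Section Regularity.
Variable R : realType.
Local Notation C := R[i].
Implicit Types (f g : C -> C) (c z : C) (r M : R).

(* The difference quotient at 0, extended by the derivative. *)
Definition dquot g (l : C) z : C := if z == 0 then l else (g z - g 0) / z.

Lemma dquot_cont g l z : cder g 0 l -> (z != 0 -> ccont g z) -> ccont (dquot g l) z.
Proof.
move=> g0; have [-> _|z0 /(_ isT) gz] := eqVneq z 0.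
  move=> e e0; have [d d0 hd] := g0 _ e0; exists d => // w /hd; rewrite /dquot eqxx subr0.
  have [_|w0] := eqVneq w 0; first by move=> _; rewrite subrr cmod0 ltW.
  rewrite -{1}[g w - g 0](divfK w0) -mulrBl cmodM.
  by rewrite ler_pM2r // cmod_gt0.
have zz : 0 < cmod z by rewrite cmod_gt0.
apply: (@ccont_near _ (fun w => (g w - g 0) / w) _ _ _ zz).
  move=> w; rewrite /dquot; have [->|//] := eqVneq w 0.
  by rewrite add0r cmodN ltxx.
apply: ccontM; first by apply: ccontD => //; apply: ccont_cst.
by have /cder_cont := cderV z0.
Qed.

Lemma dquot_der g l z : z != 0 -> (exists m, cder g z m) -> exists m, cder (dquot g l) z m.
Proof.
move=> z0 [m hm]; have [k hk] := cder_quot z0 hm; exists k.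
have zz : 0 < cmod z by rewrite cmod_gt0.
apply: (cder_near zz _ hk) => w; rewrite /dquot subr0.
by have [->|//] := eqVneq w 0; rewrite add0r cmodN ltxx.
Qed.

Lemma entire_shift g a : entire g -> entire (fun w => g (a + w)).
Proof. by move=> h; apply: (@entire_comp _ (fun w => a + w)) => //; apply: entireD; [apply: entire_cst|apply: entire_id]. Qed.

Lemma cder_shift g a z l : cder (fun w => g (a + w)) z l <-> cder g (a + z) l.
Proof.
split=> h e e0; have [d d0 hd] := h e e0; exists d => // w.
  have := hd (w - a); rewrite (_ : w - a - z = w - (a + z)); last by ring.
  by rewrite (_ : a + (w - a) = w); last by ring.
by have := hd (a + w); rewrite (_ : a + w - (a + z) = w - z); last by ring.
Qed.

(** On the circle of radius 2 about [z] one has [1 <= |w| <= 4], so the quotient is at most [2 M]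
    there; [0] is the exceptional point of the maximum principle. *)
Lemma quot_bound g l M : entire g -> cder g 0 l ->
  (forall z, cmod z <= 4 -> cmod (g z) <= M) ->
  forall z, cmod z <= 1 -> cmod (dquot g l z) <= 2 * M.
Proof.
move=> ge gl gM z z1.
have M0 : 0 <= M by apply: le_trans (cmod_ge0 (g 0)) (gM _ _); rewrite cmod0.
apply: (@max_principle _ _ 0 0 z 2) => // w.
- by apply: dquot_cont => // _; apply: entire_cont.
- by move=> w0 _; apply: dquot_der.
- move=> hw; have w1 : 1 <= cmod w by have := cmod_tri (w - z) w; rewrite addrAC subrr add0r cmodN hw; lra.
  have w3 : cmod w <= 4 by have := cmod_tri w z; rewrite hw; lra.
  have w0 : w != 0 by rewrite -cmod_gt0; lra.
  rewrite /dquot (negbTE w0) cmodM cmodV ler_pdivrMr ?cmod_gt0 //.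
  apply: le_trans (cmodB _ _) _; have := gM _ w3; have := gM 0.
  rewrite cmod0 => /(_ (ltW _)) k1 k2.
  have : 2 * M <= 2 * M * cmod w by rewrite ler_peMr // mulr_ge0.
  by have := k1 (ltr0n _ 4); lra.
Qed.

(** The argument of [quot_bound], for the difference quotient of [dquot g l] at [z']. It is
    exceptional at its own centre and where [z' + w = 0], which is why [max_principle] admits two
    points. *)
Lemma quot_lipschitz g l M : entire g -> cder g 0 l ->
  (forall z, cmod z <= 4 -> cmod (g z) <= M) ->
  forall z z', cmod z <= 1 / 2 -> cmod z' <= 1 / 2 -> z' != 0 ->
  cmod (dquot g l z - dquot g l z') <= 4 * M * cmod (z - z').
Proof.
move=> ge gl gM z z' z1 z1' z0'.
have M0 : 0 <= M by apply: le_trans (cmod_ge0 (g 0)) (gM _ _); rewrite cmod0.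
pose q := dquot g l.
have qc w : ccont q w by apply: dquot_cont => // _; apply: entire_cont.
have qd w : w != 0 -> exists m, cder q w m by move=> w0; apply: dquot_der.
have [m hm] := qd _ z0'.
pose k w := dquot (fun w => q (z' + w)) m w.
have k0 : cder (fun w => q (z' + w)) 0 m by apply/cder_shift; rewrite addr0.
have q2 : cmod (q z') <= 2 * M by apply: quot_bound ge gl gM _ _; lra.
have : cmod (k (z - z')) <= 4 * M.
  apply: (@max_principle _ _ 0 (- z') (z - z') 2) => // w.
  - apply: dquot_cont => // _; apply: (@ccont_comp _ (fun w => z' + w)) => //.
    by apply: ccontD; [apply: ccont_cst|apply: entire_cont (@entire_id R)].
  - move=> w0 wz; apply: dquot_der => //.
    have [|n hn] := qd (z' + w); first by rewrite addrC -[z']opprK subr_eq0.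
    by exists n; apply/cder_shift.
  - move=> hw.
    have w1 : 1 <= cmod w.
      have := cmod_tri (w - (z - z')) w; rewrite addrAC subrr add0r cmodN hw.
      by have := cmodB z z'; lra.
    have h5 : cmod (z' + w - z) = 2 by rewrite -hw; congr cmod; ring.
    have w2 : 3 / 2 <= cmod (z' + w).
      have := cmod_tri (z' + w - z) (z' + w); rewrite [X in X <= _]h5.
      by rewrite (_ : z' + w - z - (z' + w) = - z) ?cmodN; [lra|ring].
    have w4 : cmod (z' + w) <= 4 by have := cmod_tri (z' + w) z; rewrite h5; lra.
    have w0 : w != 0 by rewrite -cmod_gt0; lra.
    have w0' : z' + w != 0 by rewrite -cmod_gt0; lra.
    rewrite /k /dquot (negbTE w0) cmodM cmodV ler_pdivrMr ?cmod_gt0 // addr0.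
    have q3 : cmod (q (z' + w)) <= 2 * M.
      rewrite /q /dquot (negbTE w0') cmodM cmodV ler_pdivrMr ?cmod_gt0 //.
      apply: le_trans (cmodB _ _) _; have := gM _ w4; have := gM 0.
      rewrite cmod0 => /(_ (ltW (ltr0n _ 4))) k1 k2.
      have : 2 * M <= 2 * M * cmod (z' + w) by rewrite ler_peMr ?mulr_ge0 //; lra.
      by lra.
    apply: le_trans (cmodB _ _) _; apply: le_trans (lerD q3 q2) _.
    have : 4 * M <= 4 * M * cmod w by rewrite ler_peMr // mulr_ge0.
    by lra.
have [->|zz] := eqVneq z z'; first by rewrite !subrr cmod0 mulr0.
rewrite /k {1}/dquot subr_eq0 (negbTE zz) addr0 (addrC z') subrK cmodM cmodV.
by rewrite ler_pdivrMr // cmod_gt0 subr_eq0.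
Qed.

(** The intervals [[f t - rho t, f t + rho t]] meet in pairs, hence have a common point, the
    supremum of the left ends. This is a Cauchy criterion for families indexed by any type. *)
Lemma approx_limit_real (T : Type) (t0 : T) (f rho : T -> R) :
  (forall s t, f s - f t <= rho s + rho t) -> exists L, forall t, `|f t - L| <= rho t.
Proof.
move=> h.
have hs : has_sup (range (fun s => f s - rho s)).
  by split; [exists (f t0 - rho t0), t0 | exists (f t0 + rho t0) => _ [s _ <-]; have := h s t0; lra].
exists (sup (range (fun s => f s - rho s))) => t.
rewrite ler_distl; apply/andP; split; last first.
  have : f t - rho t <= sup (range (fun s => f s - rho s)) by apply: sup_upper_bound => //; exists t.
  by lra.
rewrite lerBlDr; apply: sup_le_ub; first by exists (f t0 - rho t0), t0.
by move=> _ [s _ <-]; have := h s t; lra.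
Qed.

Lemma approx_limit (T : Type) (t0 : T) (f : T -> C) (rho : T -> R) :
  (forall s t, cmod (f s - f t) <= rho s + rho t) -> exists L, forall t, cmod (f t - L) <= 2 * rho t.
Proof.
move=> h.
have [x hx] := @approx_limit_real T t0 (fun t => complex.Re (f t)) rho (fun s t =>
  le_trans (ler_norm _) (le_trans (eq_ind _ (fun u => `|u| <= _) (Re_le_cmod _) _ (raddfB _ _ _)) (h s t))).
have [y hy] := @approx_limit_real T t0 (fun t => complex.Im (f t)) rho (fun s t =>
  le_trans (ler_norm _) (le_trans (eq_ind _ (fun u => `|u| <= _) (Im_le_cmod _) _ (raddfB _ _ _)) (h s t))).
exists (x +i* y) => t; apply: le_trans (cmod_le_ReIm _) _; rewrite !raddfB /=.
by rewrite mulr_natl mulr2n; apply: lerD.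
Qed.

Lemma disc_bounded g r : (forall z, ccont g z) ->
  exists2 M, 0 <= M & forall z, cmod z <= r -> cmod (g z) <= M.
Proof.
move=> gc.
have [r0|r0] := lerP 0 r; last first.
  by exists 0 => // z zr; have := le_trans (cmod_ge0 z) zr; rewrite leNgt r0.
pose f (p : R * R) : R := cmod (g (p.1 +i* p.2)).
have cf : continuous (f : R * R -> R^o).
  move=> [x y]; apply/cvgrPdist_le => e e0; have [d d0 hd] := gc (x +i* y) _ e0.
  have d2 : 0 < d / 2 by rewrite divr_gt0.
  near=> p; rewrite /f distrC.
  have hp : cmod (g (p.1 +i* p.2) - g (x +i* y)) <= e.
    apply: hd; apply: le_lt_trans (cmod_le_ReIm _) _ => /=.
    rewrite [d]splitr distrC [X in _ + X]distrC; apply: ltrD; near: p.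
      by exists (ball x (d / 2), setT) => /=; [split; [apply: nbhsx_ballx|apply: filterT]|move=> [u v] [/= ]].
    by exists (setT, ball y (d / 2)) => /=; [split; [apply: filterT|apply: nbhsx_ballx]|move=> [u v] [/= ]].
  apply: le_trans hp; set u := g _; set v := g _; rewrite ler_distl.
  by have := cmod_tri u v; have := cmod_tri v u; rewrite [cmod (v - u)]cmodBC; lra.
have cK : compact (f @` (`[- r, r]%classic `*` `[- r, r]%classic)).
  apply: continuous_compact; first exact: continuous_subspaceT.
  by apply: compact_setX; apply: segment_compact.
have [M [Mr hM]] := compact_bounded cK.
exists (Num.max 0 (M + 1)); first by rewrite le_max lexx.
move=> z zr; rewrite le_max; apply/orP; right.
have -> : cmod (g z) = `|f (complex.Re z, complex.Im z)|.
  by rewrite /f /= ger0_norm ?cmod_ge0 //; case: (z).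
apply: hM; first by rewrite ltrDl.
exists (complex.Re z, complex.Im z) => //; split; rewrite /= in_itv /= -ler_norml;
  apply: le_trans zr; [exact: Re_le_cmod | exact: Im_le_cmod].
Unshelve. all: by end_near. Qed.

Lemma ccontB f g z : ccont f z -> ccont g z -> ccont (fun w => f w - g w) z.
Proof.
move=> hf hg; have := ccontD hf (ccontM (ccont_cst (-1) z) hg).
by apply: (@ccont_near _ _ _ _ 1) => // w _; rewrite mulN1r.
Qed.

Lemma ex_cderB f g z : (exists m, cder f z m) -> (exists m, cder g z m) ->
  exists m, cder (fun w => f w - g w) z m.
Proof.
move=> [m hu] [n hv]; eexists; apply: (cder_ext _ (cderD hu (cderZ (-1) hv))).
by move=> w; rewrite mulN1r.
Qed.

(** Take the difference of the quotients of [f'] at [a] and at [b], and let [Psi h] be the same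
    expression with [f'] replaced by the difference quotient of step [h]. On [|h| = 1] it is a
    difference of quotients of the entire function [f (h + w) - f w], small by [quot_lipschitz]; the
    maximum principle carries the bound to [h = 0]. So the quotients of [f'] satisfy the Cauchy
    criterion of [approx_limit]. *)
Lemma entire_deriv g g' : (forall z, cder g z (g' z)) -> entire g'.
Proof.
move=> gg'.
suff H f f' : (forall z, cder f z (f' z)) -> exists l, cder f' 0 l.
  move=> z; have [l hl] : exists l, cder (fun w => g' (z + w)) 0 l.
    by apply: (H (fun w => g (z + w))) => w; apply/cder_shift.
  by exists l; move/cder_shift: hl; rewrite addr0.
move=> ff'; have fe : entire f by move=> z; exists (f' z).
(* Radius 5, because [f] is taken at [h + z] with [|h| = 1] and [|z| <= 4]. *)
have [M0 M00 hM0] := disc_bounded 5 (fun z => entire_cont z fe).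
pose M := 2 * M0.
pose T := {a : C | (a != 0) && (cmod a <= 1 / 2)}.
pose psi (a : T) := (f' (val a) - f' 0) / val a.
have hpsi (a b : T) : cmod (psi a - psi b) <= 4 * M * cmod (val a) + 4 * M * cmod (val b).
  have /andP[] := valP a; have /andP[] := valP b.
  rewrite /psi; move: (val a) (val b) => {a b} a b b0 b1 a0 a1.
  apply: le_trans (_ : _ <= 4 * M * cmod (a - b)) _; last first.
    by rewrite -mulrDr ler_wpM2l ?cmodB // mulr_ge0 // mulr_ge0.
  pose dq (a : C) h := dquot (fun w => f (a + w)) (f' a) h.
  pose Psi h := (dq a h - dq 0 h) / a - (dq b h - dq 0 h) / b.
  have -> : (f' a - f' 0) / a - (f' b - f' 0) / b = Psi 0 by rewrite /Psi /dq /dquot eqxx.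
  have dc u h : ccont (dq u) h.
    by apply: dquot_cont; [apply/cder_shift; rewrite addr0 | move=> _; apply/entire_cont/entire_shift].
  have dd u h : h != 0 -> exists m, cder (dq u) h m.
    by move=> h0; apply: dquot_der => //; apply: entire_shift.
  apply: (@max_principle _ _ 0 0 0 1) => // h.
  - apply: (@ccontB (fun h => (dq a h - dq 0 h) / a) (fun h => (dq b h - dq 0 h) / b)).
      exact: (ccontM (ccontB (dc a h) (dc 0 h)) (ccont_cst a^-1 h)).
    exact: (ccontM (ccontB (dc b h) (dc 0 h)) (ccont_cst b^-1 h)).
  - move=> h0 _; apply: (@ex_cderB (fun h => (dq a h - dq 0 h) / a)).
    + have [m hm] := ex_cderB (dd a h h0) (dd 0 h h0).
      by exists (a^-1 * m); apply: cder_ext (cderZ _ hm) => w; rewrite mulrC.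
    + have [m hm] := ex_cderB (dd b h h0) (dd 0 h h0).
      by exists (b^-1 * m); apply: cder_ext (cderZ _ hm) => w; rewrite mulrC.
  - rewrite subr0 => h1; have h0 : h != 0 by rewrite -cmod_gt0 h1.
    pose G w := f (h + w) - f w.
    have Ge : entire G.
      move=> w; apply: (@ex_cderB (fun w => f (h + w))); last by exists (f' w).
      exact: entire_shift.
    have [l hl] := Ge 0.
    have GM z : cmod z <= 4 -> cmod (G z) <= M.
      move=> z4; apply: le_trans (cmodB _ _) _; rewrite /M mulr_natl mulr2n.
      by apply: lerD; apply: hM0; [have := cmodD h z; rewrite h1|]; lra.
    have := quot_lipschitz Ge hl GM a1 b1 b0.
    have -> : Psi h = (dquot G l a - dquot G l b) / h; last first.
      by rewrite cmodM cmodV h1 invr1 mulr1.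
    rewrite /Psi /dq /dquot (negbTE h0) (negbTE a0) (negbTE b0) /G !(addr0, add0r).
    by rewrite [h + a]addrC [h + b]addrC; field; rewrite a0 b0 h0.
have t0 : T.
  exists ((1 / 2)%:C); apply/andP; split; last by rewrite cmodR ger0_norm.
  by rewrite -cmod_gt0 cmodR normr_gt0 // mulf_neq0 // ?invr_eq0 ?pnatr_eq0.
have [L hL] := approx_limit t0 hpsi.
have K0 : 0 < 8 * M + 1 by rewrite ltr_wpDl // mulr_ge0 // mulr_ge0.
exists L => e e0; exists (Num.min (1 / 2) (e / (8 * M + 1))).
  by rewrite lt_min !divr_gt0.
move=> w; rewrite !subr0 lt_min => /andP[w1 w2].
have [->|w0] := eqVneq w 0; first by rewrite subrr mulr0 subr0 cmod0 mulr0.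
have hw : (w != 0) && (cmod w <= 1 / 2) by rewrite w0 ltW.
have /= := hL (exist _ w hw); rewrite /psi /= => h.
rewrite -{1}[f' w - f' 0](divfK w0) -mulrBl cmodM ler_wpM2r ?cmod_ge0 //.
apply: le_trans h _; apply: le_trans (_ : _ <= (8 * M + 1) * cmod w) _.
  by have := cmod_ge0 w; lra.
by rewrite mulrC -ler_pdivlMr // ltW.
Qed.

(** At [0] the derivative is half of [m], the second derivative of [g]: the remainder [E] of order
    two has derivative [o(z)], and integration along the segment from [0] to [w] gives
    [E w = o(w^2)]. *)
Lemma entire_dquot g l : entire g -> cder g 0 l -> entire (dquot g l).
Proof.
move=> ge gl z; have [->|z0] := eqVneq z 0; last by apply: dquot_der.
have [g' hg'] := choice ge.
have g'e := entire_deriv hg'.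
have <- : g' 0 = l by apply: cder_uniq gl.
have [m hm] := g'e 0; exists (m / 2).
move=> e e0; have e2 : 0 < e / 2 by rewrite divr_gt0.
have [d d0 hd] := hm _ e2; exists d => // w; rewrite !subr0 => wd.
have [->|w0] := eqVneq w 0; first by rewrite subrr mulr0 subr0 cmod0 mulr0.
pose E z := g z - g 0 - g' 0 * z - m / 2 * z ^+ 2.
pose E' z := g' z - g' 0 - m * z.
have dE u : cder E u (E' u).
  rewrite /E /E'; have := cderD (cderD (cderD (hg' u) (cder_cst (- g 0) u)) (cderZ (- g' 0) (cder_id u)))
     (cderZ (- (m / 2)) (cderM (cder_id u) (cder_id u))).
  rewrite (_ : _ + _ = g' u - g' 0 - m * u); last by field.
  by apply: cder_ext => v /=; ring.
have E'c u : ccont E' u.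
  have [k hk] := g'e u; apply: (@cder_cont _ _ _ (k + 0 + (- m) * 1)).
  apply: cder_ext (cderD (cderD hk (cder_cst (- g' 0) u)) (cderZ (- m) (cder_id u))) => v.
  by rewrite mulNr.
have hE : cmod (E w) <= e * cmod w ^+ 2.
  have E0 : E 0 = 0 by rewrite /E; ring.
  pose p (t : R) := E (t%:C * w); pose q (t : R) := w * E' (t%:C * w).
  have tw (s t : R) : s%:C * w - t%:C * w = (s - t)%:C * w by rewrite rmorphB mulrBl.
  have wpos : 0 < cmod w by rewrite cmod_gt0.
  have qc t : pcont q t.
    move=> e1 e10; have [d1 d10 h1] := E'c (t%:C * w) _ (divr_gt0 e10 wpos).
    exists (d1 / cmod w); first exact: divr_gt0.
    move=> s hs; rewrite -mulrBr cmodM mulrC -ler_pdivlMr //; apply: h1.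
    by rewrite tw cmodM cmodR -ltr_pdivlMr.
  have pd t : pder p t (q t).
    move=> e1 e10; have [d1 d10 h1] := dE (t%:C * w) _ (divr_gt0 e10 wpos).
    exists (d1 / cmod w); first exact: divr_gt0.
    move=> s hs; have := h1 (s%:C * w); rewrite tw cmodM cmodR -ltr_pdivlMr // => /(_ hs).
    rewrite [_ / _ * _]mulrC -mulrA (mulrC (cmod w)) divfK ?gt_eqF // mulrC.
    by rewrite /p /q [(s - t)%:C * w]mulrC mulrA [E' _ * w]mulrC.
  have <- : cint q 0 1 = E w.
    by rewrite (@cint_ftc _ p) // /p mul1r mul0r E0 subr0.
  apply: le_trans (@cint_le _ q 0 1 (cmod w * (e / 2 * cmod w)) _ _ _) _ => //; last first.
    by rewrite subr0 mulr1 expr2; apply/eqP/eqP; rewrite le_eqVlt; apply/orP; left; apply/eqP; field.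
  move=> t /andP[t0 t1]; rewrite /q cmodM ler_wpM2l ?cmod_ge0 //.
  have ht : cmod (t%:C * w) <= cmod w by rewrite cmodM cmodR ger0_norm // ler_piMl ?cmod_ge0.
  have := hd (t%:C * w); rewrite !subr0 => /(_ (le_lt_trans ht wd)) k.
  by apply: le_trans k _; apply: ler_wpM2l => //; apply: ltW.
rewrite /dquot eqxx (negbTE w0).
have -> : (g w - g 0) / w - g' 0 - m / 2 * w = E w / w by rewrite /E; field.
by rewrite cmodM cmodV ler_pdivrMr ?cmod_gt0 // -mulrA -expr2.
Qed.

Lemma entire_factor g a : entire g -> g a = 0 ->
  exists2 h, entire h & forall z, g z = (z - a) * h z.
Proof.
move=> ge ga; have [l hl] := ge a.
have hl' : cder (fun w => g (a + w)) 0 l by apply/cder_shift; rewrite addr0.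
exists (fun z => dquot (fun w => g (a + w)) l (- a + z)).
  exact/(@entire_shift _ (- a))/entire_dquot/hl'/entire_shift.
move=> z; rewrite /dquot (addrC (- a)) subr_eq0; have [->|za] := eqVneq z a.
  by rewrite subrr mul0r.
by rewrite addr0 ga subr0 [a + _]addrC subrK mulrC divfK // subr_eq0.
Qed.

End Regularity.

(** * Boundary integrals of logarithmic derivatives *)

Section RectangleSums.
Variable R : realType.
Local Notation C := R[i].
Implicit Types (f g h : C -> C) (a b c d : R) (p z w : C).

Definition bcont f a b c d :=
  (forall x, a <= x <= b -> ccont f (x +i* c) /\ ccont f (x +i* d)) /\
  (forall y, c <= y <= d -> ccont f (a +i* y) /\ ccont f (b +i* y)).

Lemma rectD f g a b c d : bcont f a b c d -> bcont g a b c d ->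
  rect (fun z => f z + g z) a b c d = rect f a b c d + rect g a b c d.
Proof.
move=> [f1 f2] [g1 g2]; rewrite /rect.
rewrite (@cintD _ (fun x => f (x +i* c)) (fun x => g (x +i* c))); last 2 first.
- by move=> t /f1[h _]; apply: pcont_hline.
- by move=> t /g1[h _]; apply: pcont_hline.
rewrite (@cintD _ (fun x => f (x +i* d)) (fun x => g (x +i* d))); last 2 first.
- by move=> t /f1[_ h]; apply: pcont_hline.
- by move=> t /g1[_ h]; apply: pcont_hline.
rewrite (@cintD _ (fun x => f (a +i* x)) (fun x => g (a +i* x))); last 2 first.
- by move=> t /f2[h _]; apply: pcont_vline.
- by move=> t /g2[h _]; apply: pcont_vline.
rewrite (@cintD _ (fun x => f (b +i* x)) (fun x => g (b +i* x))); last 2 first.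
- by move=> t /f2[_ h]; apply: pcont_vline.
- by move=> t /g2[_ h]; apply: pcont_vline.
ring.
Qed.

Lemma bcontD f g a b c d : bcont f a b c d -> bcont g a b c d ->
  bcont (fun z => f z + g z) a b c d.
Proof.
move=> [f1 f2] [g1 g2]; split=> t tt.
  by have [? ?] := f1 _ tt; have [? ?] := g1 _ tt; split; apply: ccontD.
by have [? ?] := f2 _ tt; have [? ?] := g2 _ tt; split; apply: ccontD.
Qed.

(** The logarithmic derivative of [prodroots s]; repeated entries of [s] encode multiplicities. *)
Definition polesum (s : seq C) z : C := \sum_(p <- s) (z - p)^-1.

Lemma polesum_cons p s : polesum (p :: s) = (fun z => (z - p)^-1 + polesum s z).
Proof. by apply/funext => z; rewrite /polesum big_cons. Qed.

Lemma ccont_pole p z : z != p -> ccont (fun w => (w - p)^-1) z.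
Proof.
move=> zp; apply: (@ccont_comp _ (fun w => w - p) (fun w => w^-1)).
  by apply: ccontB; [apply: entire_cont (@entire_id R)|apply: ccont_cst].
by apply: cder_cont (cderV _); rewrite subr_eq0.
Qed.

Lemma cder_pole p z : z != p -> exists l, cder (fun w => (w - p)^-1) z l.
Proof.
move=> zp; eexists; apply: (@cder_comp _ (fun w => w - p) (fun w => w^-1)).
  exact: cderD (cder_id _) (cder_cst _ _).
by apply: cderV; rewrite subr_eq0.
Qed.

Definition off_lines a b c d (p : C) :=
  [&& complex.Re p != a, complex.Re p != b, complex.Im p != c & complex.Im p != d].

Lemma bcont_pole a b c d p : off_lines a b c d p -> bcont (fun z => (z - p)^-1) a b c d.
Proof.
move=> /and4P[pa pb pc pd]; split=> t tt; split; apply: ccont_pole.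
- by apply: contra pc => /eqP <-.
- by apply: contra pd => /eqP <-.
- by apply: contra pa => /eqP <-.
- by apply: contra pb => /eqP <-.
Qed.

Lemma rect_polesum s a b c d : all (off_lines a b c d) s ->
  bcont (polesum s) a b c d /\
  rect (polesum s) a b c d = \sum_(p <- s) rect (fun z => (z - p)^-1) a b c d.
Proof.
elim: s => [_|p s IH /= /andP[hp /IH[h1 h2]]].
  have -> : polesum [::] = (fun=> 0) by apply/funext => z; rewrite /polesum big_nil.
  split; first by split=> t _; split; apply: ccont_cst.
  by rewrite big_nil /rect !subrr mulr0 addr0.
rewrite polesum_cons; split; first by apply: bcontD => //; apply: bcont_pole.
by rewrite rectD ?h2 ?big_cons //; apply: bcont_pole.
Qed.

Definition prodroots (s : seq C) z : C := \prod_(p <- s) (z - p).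

Lemma cder_logder s h h' z : (forall z, cder h z (h' z)) -> z \notin s -> h z != 0 ->
  cder (fun z => prodroots s z * h z) z
    ((polesum s z + h' z / h z) * (prodroots s z * h z)).
Proof.
move=> hh + hz; elim: s => [_|p s IH]; last rewrite inE negb_or => /andP[zp /IH k].
  rewrite /polesum /prodroots big_nil add0r big_nil mul1r divfK //.
  by apply: cder_ext (hh z) => w; rewrite big_nil mul1r.
have := cderM (cderD (cder_id z) (cder_cst (- p) z)) k.
rewrite addr0 mul1r /polesum /prodroots !big_cons.
have zp' : z - p != 0 by rewrite subr_eq0.
set A := \prod_(j <- s) _; set B := \sum_(j <- s) _.
rewrite (_ : A * h z + _ = ((z - p)^-1 + B + h' z / h z) * ((z - p) * A * h z)); last first.
  by field; rewrite zp' hz.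
by apply: cder_ext => w; rewrite big_cons mulrA.
Qed.

Lemma prodroots_eq0 s z : (prodroots s z == 0) = (z \in s).
Proof.
elim: s => [|p s IH]; first by rewrite /prodroots big_nil oner_eq0.
by rewrite /prodroots big_cons mulf_eq0 subr_eq0 inE -IH.
Qed.

End RectangleSums.

(** * Splitting off all zeros in a bounded set *)

Section ZeroFactorization.
Variable R : realType.
Local Notation C := R[i].

(* Compare g with prod (z - p) on a circle three times as large as the distance to the p's. *)
Lemma factor_bound (g : C -> C) (z0 : C) : entire g -> exists2 M : R, 0 <= M &
  forall s h, entire h -> (forall z, g z = prodroots s z * h z) ->
  (forall p, p \in s -> cmod p <= 2) -> cmod (g z0) <= M / 2 ^+ size s.
Proof.
move=> ge; pose rho := cmod z0 + 2; have rho0 : 0 < rho by rewrite ltr_wpDl ?cmod_ge0.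
have [M M0 hM] := @disc_bounded _ g (cmod z0 + 3 * rho) (fun z => entire_cont z ge).
exists M => // s h he gs sp.
have r0 : 0 < 3 * rho by rewrite mulr_gt0.
have pr_le : cmod (prodroots s z0) <= rho ^+ size s.
  rewrite /prodroots; elim: s sp {gs} => [|p s IH] sp; first by rewrite big_nil cmod1 expr0.
  rewrite big_cons cmodM exprS; apply: ler_pM; rewrite ?cmod_ge0 //.
    by apply: le_trans (cmodB _ _) _; rewrite lerD2l sp // inE eqxx.
  by apply: IH => q qs; rewrite sp // inE qs orbT.
have pr_ge w : cmod (w - z0) = 3 * rho -> (2 * rho) ^+ size s <= cmod (prodroots s w).
  move=> wr; rewrite /prodroots; elim: s sp {gs pr_le} => [|p s IH] sp; first by rewrite big_nil cmod1 expr0.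
  have r2 : 0 <= 2 * rho by rewrite mulr_ge0 // ltW.
  rewrite big_cons cmodM exprS; apply: ler_pM; [exact: r2 | exact: exprn_ge0 | |].
    have := cmod_dist w z0 p; rewrite wr; have := cmodB p z0; have := sp p; rewrite inE eqxx => /(_ isT).
    by rewrite /rho; lra.
  by apply: IH => q qs; rewrite sp // inE qs orbT.
have hM' : cmod (h z0) <= M / (2 * rho) ^+ size s.
  apply: (@entire_max _ h z0 (3 * rho)) => // w wr.
  rewrite ler_pdivlMr ?exprn_gt0 ?mulr_gt0 //.
  apply: le_trans (ler_wpM2l (cmod_ge0 _) (pr_ge w wr)) _; rewrite mulrC -cmodM -gs.
  by apply: hM; apply: le_trans (cmod_tri w z0) _; rewrite wr.
rewrite gs cmodM; apply: le_trans (ler_pM (cmod_ge0 _) (cmod_ge0 _) pr_le hM') _.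
rewrite exprMn le_eqVlt; apply/orP; left; apply/eqP; field.
by rewrite !expf_neq0 ?pnatr_eq0 // gt_eqF.
Qed.

(** Zeros in [D] are divided out one at a time. Since [g z0 != 0], [factor_bound] limits their
    number, so the process stops, and it stops only when the cofactor has no zero in [D]. *)
Lemma maximal_factorization (g : C -> C) (D : pred C) s0 h0 z0 : entire g -> g z0 != 0 ->
  entire h0 -> (forall z, g z = prodroots s0 z * h0 z) -> all D s0 ->
  (forall p, D p -> cmod p <= 2) ->
  exists s h, [/\ entire h, forall z, g z = prodroots (s ++ s0) z * h z,
    all D (s ++ s0) & forall z, D z -> h z != 0].
Proof.
move=> ge gz0 h0e g0 Ds0 hD.
have [M M0 hM] := factor_bound z0 ge.
have gpos : 0 < cmod (g z0) by rewrite cmod_gt0.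
pose N := Num.bound (M / cmod (g z0)).
have sz s h : entire h -> (forall z, g z = prodroots s z * h z) -> all D s -> (size s <= N)%N.
  move=> he gs /allP Ds; have := hM s h he gs (fun p ps => hD p (Ds p ps)).
  rewrite ler_pdivlMr ?exprn_gt0 // mulrC -ler_pdivlMr // => k.
  have := le_lt_trans k (archi_boundP (divr_ge0 M0 (ltW gpos))); rewrite -/N -natrX ltr_nat.
  by move=> k2; apply: ltnW; apply: leq_ltn_trans k2; apply: ltnW; apply: ltn_expl.
suff H n : forall s h, (N - size (s ++ s0) <= n)%N -> entire h ->
    (forall z, g z = prodroots (s ++ s0) z * h z) -> all D (s ++ s0) ->
  exists s h, [/\ entire h, forall z, g z = prodroots (s ++ s0) z * h z,
    all D (s ++ s0) & forall z, D z -> h z != 0].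
  by apply: (H N [::] h0) => //; apply: leq_subr.
elim: n => [|n IH] s h sn he gs Ds.
all: have [hz|] := pselect (forall z, D z -> h z != 0); first by exists s, h.
all: move=> /existsNP[p /not_implyP[Dp /negP]]; rewrite negbK => /eqP hp.
all: have [k ke hk] := entire_factor he hp.
all: have gs' z : g z = prodroots ((p :: s) ++ s0) z * k z
  by rewrite gs hk /prodroots big_cons mulrCA mulrA.
all: have Ds' : all D ((p :: s) ++ s0) by rewrite /= Dp.
all: have := sz _ _ ke gs' Ds'.
  by move: sn; rewrite /= leqn0 subn_eq0 => k1 k2; have := leq_ltn_trans k1 k2; rewrite ltnn.
move=> k2; apply: (IH (p :: s) k) => //.
by move: sn k2; rewrite /=; lia.
Qed.

End ZeroFactorization.

(** * Winding number of a rectangle *)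

Section Winding.
Variable R : realType.
Local Notation C := R[i].

Lemma atan_inv (x : R) : 0 < x -> atan x + atan x^-1 = pi / 2.
Proof.
move=> x0; have [h1 h2] := (atan_gtNpi2 x, atan_ltpi2 x).
have a0 : 0 < atan x by rewrite -atan0 lt_atan.
have e : tan (pi / 2 - atan x) = x^-1.
  have -> : pi / 2 - atan x = - atan x + pi / 2 by rewrite addrC.
  rewrite /tan sinDpihalf cosDpihalf sinN cosN opprK.
  by rewrite -{3}(atanK x) /tan invf_div.
rewrite -e tanK; first by rewrite addrC subrK.
by rewrite in_itv /=; apply/andP; split; lra.
Qed.

Lemma atan_inv_neg (x : R) : x < 0 -> atan x + atan x^-1 = - (pi / 2).
Proof.
move=> x0; rewrite -(@atan_inv (- x)) ?oppr_gt0 //.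
by rewrite invrN !atanN opprD !opprK.
Qed.

Lemma pder_ReIm (f g : R -> R) (t l m : R) :
  is_derive t (1 : R^o) (f : R^o -> R^o) l -> is_derive t (1 : R^o) (g : R^o -> R^o) m ->
  pder (fun x => f x +i* g x) t (l +i* m).
Proof.
move=> df dg e e0; have e2 : 0 < e / 2 by rewrite divr_gt0.
have [d d0 hd] := derive_ed df e2; have [d' d0' hd'] := derive_ed dg e2.
exists (Num.min d d'); first by rewrite lt_min d0.
move=> s; rewrite lt_min => /andP[/hd k1 /hd' k2].
rewrite (_ : _ - _ = (f s - f t - l * (s - t)) +i* (g s - g t - m * (s - t))); last first.
  by apply/eqP; rewrite eq_complex /= !mulr0 subr0 add0r !eqxx.
apply: le_trans (cmod_le_ReIm _) _ => /=.
by apply: le_trans (lerD k1 k2) _; rewrite -mulrDl -splitr.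
Qed.

Lemma is_derive_log (u y t : R) : y != 0 ->
  is_derive t (1 : R^o) ((fun x => ln ((x - u) ^+ 2 + y ^+ 2) / 2) : R^o -> R^o)
    ((t - u) / ((t - u) ^+ 2 + y ^+ 2)).
Proof.
move=> y0; have p0 : 0 < (t - u) ^+ 2 + y ^+ 2.
  by rewrite ltr_wpDl ?sqr_ge0 // exprn_even_gt0.
have h1 : is_derive t (1 : R^o) ((fun x => (x - u) ^+ 2 + y ^+ 2) : R^o -> R^o) (2 * (t - u)).
  by apply: is_derive_eq; rewrite /GRing.scale /=; ring.
have h2 := is_derive1_ln p0.
have h3 : is_derive t (1 : R^o) ((fun x => ln ((x - u) ^+ 2 + y ^+ 2)) : R^o -> R^o)
   (((t - u) ^+ 2 + y ^+ 2)^-1 * (2 * (t - u))).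
  exact: (@is_derive1_comp _ (@ln R) (fun x => (x - u) ^+ 2 + y ^+ 2)).
have -> : (t - u) / ((t - u) ^+ 2 + y ^+ 2) = 2^-1 * (((t - u) ^+ 2 + y ^+ 2)^-1 * (2 * (t - u))).
  by field; rewrite gt_eqF.
rewrite (_ : (fun x => _) = (fun x => 2^-1 * ln ((x - u) ^+ 2 + y ^+ 2))); last by apply/funext => x; rewrite mulrC.
exact: (is_deriveZ 2^-1 h3).
Qed.

Lemma is_derive_atan_div (u y t : R) : y != 0 ->
  is_derive t (1 : R^o) ((fun x => atan ((x - u) / y)) : R^o -> R^o)
    (y / ((t - u) ^+ 2 + y ^+ 2)).
Proof.
move=> y0; have p0 : 0 < (t - u) ^+ 2 + y ^+ 2.
  by rewrite ltr_wpDl ?sqr_ge0 // exprn_even_gt0.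
have h1 : is_derive t (1 : R^o) ((fun x => (x - u) / y) : R^o -> R^o) y^-1.
  rewrite (_ : (fun x => _) = (fun x => y^-1 * (x - u))); last by apply/funext => x; rewrite mulrC.
  by apply: is_derive_eq; rewrite /GRing.scale /=; ring.
have -> : y / ((t - u) ^+ 2 + y ^+ 2) = (1 + ((t - u) / y) ^+ 2)^-1 * y^-1.
  field; rewrite y0 /= gt_eqF //; rewrite (_ : _ + _ = (t - u) ^+ 2 + y ^+ 2) ?gt_eqF //; ring.
exact: (@is_derive1_comp _ (@atan R) (fun x => (x - u) / y)).
Qed.

Lemma invc_re_im (x y : R) : x ^+ 2 + y ^+ 2 != 0 ->
  (x +i* y)^-1 = (x / (x ^+ 2 + y ^+ 2)) +i* (- (y / (x ^+ 2 + y ^+ 2))) :> C.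
Proof.
move=> h; have h0 : x +i* y != 0 :> C by rewrite -cmod_eq0 -sqrf_eq0 cmod_sq.
apply: (mulfI h0); rewrite divff //.
Qed.

(** Along each side [1 / (z - p)] has a primitive made of a real logarithm and an arctangent. The
    logarithms cancel at the corners; the two arctangents at each corner add up to [pi / 2] or
    [- pi / 2] by [atan_inv] and [atan_inv_neg], with signs that make [2 pi] in total. No branch of
    the complex logarithm has to be chosen. *)
Lemma winding_number (p : C) (a b c d : R) : a < complex.Re p < b -> c < complex.Im p < d ->
  rect (fun z => (z - p)^-1) a b c d = twopii R.
Proof.
case: p => u v /= /andP[au ub] /andP[cv vd].
have hor (y : R) : y != v -> cint (fun x => ((x +i* y) - (u +i* v))^-1) a b =
   (ln ((b - u) ^+ 2 + (y - v) ^+ 2) / 2 +i* - atan ((b - u) / (y - v)))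
   - (ln ((a - u) ^+ 2 + (y - v) ^+ 2) / 2 +i* - atan ((a - u) / (y - v))).
  move=> yv; have y0 : y - v != 0 by rewrite subr_eq0.
  have pd t : pder (fun x => ln ((x - u) ^+ 2 + (y - v) ^+ 2) / 2 +i* - atan ((x - u) / (y - v))) t
     ((t +i* y) - (u +i* v))^-1.
    rewrite -[(t +i* y) - _]/((t - u) +i* (y - v)) invc_re_im ?paddr_eq0 ?sqr_ge0 ?sqrf_eq0 ?negb_and ?y0 ?orbT //.
    by apply: pder_ReIm; [apply: is_derive_log | apply: is_deriveN; apply: is_derive_atan_div].
  rewrite (cint_ftc _ _ (fun t _ => pd t)) ?(lt_trans au ub) // => t _.
  apply: (@pcont_hline _ (fun z => (z - (u +i* v))^-1)); apply: ccont_pole.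
  by rewrite eq_complex /= negb_and yv orbT.
have ver (x : R) : x != u -> cint (fun y => ((x +i* y) - (u +i* v))^-1) c d =
   (atan ((d - v) / (x - u)) +i* - (ln ((d - v) ^+ 2 + (x - u) ^+ 2) / 2))
   - (atan ((c - v) / (x - u)) +i* - (ln ((c - v) ^+ 2 + (x - u) ^+ 2) / 2)).
  move=> xu; have x0 : x - u != 0 by rewrite subr_eq0.
  have pd t : pder (fun y => atan ((y - v) / (x - u)) +i* - (ln ((y - v) ^+ 2 + (x - u) ^+ 2) / 2)) t
     ((x +i* t) - (u +i* v))^-1.
    rewrite -[(x +i* t) - _]/((x - u) +i* (t - v)) invc_re_im ?paddr_eq0 ?sqr_ge0 ?sqrf_eq0 ?negb_and ?x0 // [X in _ / X]addrC [X in - (_ / X)]addrC.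
    by apply: pder_ReIm; [apply: is_derive_atan_div | apply: is_deriveN; apply: is_derive_log].
  rewrite (cint_ftc _ _ (fun t _ => pd t)) ?(lt_trans cv vd) // => t _.
  apply: (@pcont_vline _ (fun z => (z - (u +i* v))^-1)); apply: ccont_pole.
  by rewrite eq_complex /= negb_and xu.
rewrite /rect !hor ?ver ?(lt_eqF cv) ?(gt_eqF vd) ?(lt_eqF au) ?(gt_eqF ub) //.
have e1 : atan ((b - u) / (d - v)) + atan ((d - v) / (b - u)) = pi / 2.
  by rewrite -[(d - v) / _]invf_div atan_inv // divr_gt0 // subr_gt0.
have e2 : atan ((b - u) / (c - v)) + atan ((c - v) / (b - u)) = - (pi / 2).
  rewrite -[(c - v) / _]invf_div atan_inv_neg // pmulr_rlt0 ?subr_gt0 //.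
  by rewrite invr_lt0 subr_lt0.
have e3 : atan ((a - u) / (d - v)) + atan ((d - v) / (a - u)) = - (pi / 2).
  rewrite -[(d - v) / _]invf_div atan_inv_neg // nmulr_rlt0 ?subr_lt0 //.
  by rewrite invr_gt0 subr_gt0.
have e4 : atan ((a - u) / (c - v)) + atan ((c - v) / (a - u)) = pi / 2.
  rewrite -[(c - v) / _]invf_div atan_inv // nmulr_rgt0 ?subr_lt0 //.
  by rewrite invr_lt0 subr_lt0.
rewrite /twopii; simpc; apply/eqP; rewrite eq_complex /=; apply/andP; split; apply/eqP.
  by rewrite ![(_ - v) ^+ 2 + _]addrC; ring.
have -> : 2 * pi = pi / 2 + pi / 2 + pi / 2 + pi / 2 :> R by field.
move: e1 e2 e3 e4; move: (atan ((b - u) / (d - v))) (atan ((d - v) / (b - u)))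
  (atan ((b - u) / (c - v))) (atan ((c - v) / (b - u))) (atan ((a - u) / (d - v)))
  (atan ((d - v) / (a - u))) (atan ((a - u) / (c - v))) (atan ((c - v) / (a - u))) (pi / 2).
by move=> *; lra.
Qed.

End Winding.

(** * Counting zeros of quasi-periodic functions *)

Section ZeroCount.
Variable R : realType.
Local Notation C := R[i].

Lemma avoid_finite (s : seq R) (l u : R) : l < u -> exists2 x, l < x < u & x \notin s.
Proof.
elim: s l u => [|y s IH] l u lu; first by exists ((l + u) / 2) => //; apply/andP; split; lra.
have [h|h] := lerP y ((l + u) / 2).
  have [x /andP[x1 x2] xs] := IH ((l + u) / 2) u ltac:(lra).
  exists x; first by apply/andP; split; lra.
  by rewrite inE negb_or xs gt_eqF //; lra.
have [x /andP[x1 x2] xs] := IH l ((l + u) / 2) ltac:(lra).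
exists x; first by apply/andP; split; lra.
by rewrite inE negb_or xs lt_eqF //; lra.
Qed.

Lemma pder_hline (f : C -> C) (x y : R) l : cder f (x +i* y) l -> pder (fun t => f (t +i* y)) x l.
Proof.
move=> h e e0; have [d d0 hd] := h e e0; exists d => // s hs.
by have := hd (s +i* y); rewrite hdiff cmodR; apply.
Qed.

Lemma pder_vline (f : C -> C) (x y : R) l : cder f (x +i* y) l -> pder (fun t => f (x +i* t)) y ('i * l).
Proof.
move=> h e e0; have [d d0 hd] := h e e0; exists d => // s hs.
have := hd (x +i* s); rewrite vdiff cmodM cmod_i mul1r cmodR => /(_ hs).
by rewrite mulrA [l * 'i]mulrC.
Qed.

Lemma pderZ (p : R -> C) t l (k : C) : pder p t l -> pder (fun x => k * p x) t (k * l).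
Proof.
move=> hf e e0; have k0 : 0 < 1 + cmod k by rewrite ltr_wpDr // cmod_ge0.
have [d d0 hd] := hf _ (divr_gt0 e0 k0); exists d => // s /hd h.
have -> : k * p s - k * p t - k * l * (s - t)%:C = k * (p s - p t - l * (s - t)%:C) by ring.
rewrite cmodM; apply: le_trans (ler_wpM2l (cmod_ge0 _) h) _.
rewrite mulrA ler_wpM2r // mulrCA ler_piMr ?ltW //.
by rewrite ltr_pdivrMr // mul1r ltrDr.
Qed.

Lemma sum_winding (S : seq C) (a b c d : R) : a <= b -> c <= d ->
  all (off_lines a b c d) S ->
  \sum_(p <- S) rect (fun z => (z - p)^-1) a b c d =
  twopii R * (count (fun p => (a < complex.Re p < b) && (c < complex.Im p < d)) S)%:R.
Proof.
move=> aa cc; elim: S => [_|p S IH /= /andP[poff /IH IHS]].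
  by rewrite big_nil /= mulr0.
rewrite big_cons IHS natrD mulrDr; congr (_ + _).
case k: ((a < complex.Re p < b) && (c < complex.Im p < d)).
  by move/andP: k => [k1 k2]; rewrite winding_number // mulr1.
rewrite mulr0; apply: goursat => // z hz; apply: cder_pole; apply/negP => /eqP e; subst z.
move: poff hz k => /and4P[q1 q2 q3 q4] /andP[/andP[k1 k2] /andP[k3 k4]].
by rewrite !lt_neqAle ![_ == complex.Re p]eq_sym ![_ == complex.Im p]eq_sym q1 q2 q3 q4 k1 k2 k3 k4.
Qed.

(** Every unit square with lower left corner in the box [(-5/8, -3/8)^2] contains these points in
    its interior; the freedom in choosing the corner serves to keep the sides off the zeros. *)
Definition small_point (p : C) := (`|complex.Re p| < 3 / 8) && (`|complex.Im p| < 3 / 8).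

(** The argument principle: [n] is the number of zeros of a nonzero [g] in a unit square. Opposite
    sides cancel up to the derivatives of [p1] and [p2], and these integrate to the cocycle that the
    hypothesis equates with [n]. *)
Lemma zero_count (g p1 p2 : C -> C) (n : nat) s0 h0 :
  entire g -> entire p1 -> entire p2 ->
  (forall z, g (z + 1) = cexp (twopii R * p1 z) * g z) ->
  (forall z, g (z + 'i) = cexp (twopii R * p2 z) * g z) ->
  (forall z, p1 (z + 'i) + p2 z - p2 (z + 1) - p1 z = n%:R) ->
  entire h0 -> (forall z, g z = prodroots s0 z * h0 z) -> all small_point s0 ->
  (n < size s0)%N -> forall z, g z = 0.
Proof.
move=> ge p1e p2e g1 gi pn h0e g0 small0 ns z0; apply/eqP; apply/negPn/negP => gz0.
(* A closed box that contains every admissible unit square; with all zeros in it split off, [h] has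
   none on the square. *)
pose D (p : C) := (`|complex.Re p| <= 1) && (`|complex.Im p| <= 1).
have D2 p : D p -> cmod p <= 2.
  by move=> /andP[k1 k2]; apply: le_trans (cmod_le_ReIm _) _; lra.
have Ds0 : all D s0 by apply: sub_all small0 => p /andP[k1 k2]; apply/andP; split; lra.
have [s [h [he gs Ds hD]]] := maximal_factorization ge gz0 h0e g0 Ds0 D2.
set S := s ++ s0 in gs Ds *.
have [h' hh'] := choice he.
have h'e := entire_deriv hh'.
have [p1' hp1'] := choice p1e; have [p2' hp2'] := choice p2e.
have p1'e := entire_deriv hp1'; have p2'e := entire_deriv hp2'.
(* The vertical sides lie at [a] and at [a + 1], hence the second list. *)
pose X := [seq complex.Re p | p <- S] ++ [seq complex.Re p - 1 | p <- S].
pose Y := [seq complex.Im p | p <- S] ++ [seq complex.Im p - 1 | p <- S].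
have lu : - (5 / 8) < - (3 / 8) :> R by lra.
have [a /andP[a1 a2]] := @avoid_finite X _ _ lu; rewrite mem_cat negb_or => /andP[aX aX1].
have [c /andP[c1 c2]] := @avoid_finite Y _ _ lu; rewrite mem_cat negb_or => /andP[cY cY1].
have offS : all (off_lines a (a + 1) c (c + 1)) S.
  apply/allP => p pS; rewrite /off_lines; apply/and4P; split.
  - by apply: contra aX => /eqP <-; apply: map_f.
  - by apply: contra aX1 => /eqP e; apply/mapP; exists p => //; rewrite e addrK.
  - by apply: contra cY => /eqP <-; apply: map_f.
  - by apply: contra cY1 => /eqP e; apply/mapP; exists p => //; rewrite e addrK.
have inD z : inrect a (a + 1) c (c + 1) z -> D z.
  by move=> /andP[/andP[k1 k2] /andP[k3 k4]]; rewrite /D !ler_norml; apply/andP; split; apply/andP; split; lra.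
have aa : a <= a + 1 by rewrite lerDl.
have cc : c <= c + 1 by rewrite lerDl.
pose H z := h' z / h z; pose L z := polesum S z + H z.
have Hd z : inrect a (a + 1) c (c + 1) z -> exists l, cder H z l.
  move=> /inD/hD hz; have [l hl] := h'e z; eexists; apply: cderM hl _.
  exact: cder_comp (hh' z) (cderV hz).
have bH : bcont H a (a + 1) c (c + 1).
  by split=> t tt; split; [have [l /cder_cont] := Hd (t +i* c) ltac:(by rewrite /inrect /= tt lexx cc)
  | have [l /cder_cont] := Hd (t +i* (c + 1)) ltac:(by rewrite /inrect /= tt lexx cc)
  | have [l /cder_cont] := Hd (a +i* t) ltac:(by rewrite /inrect /= tt lexx aa)
  | have [l /cder_cont] := Hd ((a + 1) +i* t) ltac:(by rewrite /inrect /= tt lexx aa)].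
have [bS rS] := rect_polesum offS.
have bL := bcontD bS bH.
have rL : rect L a (a + 1) c (c + 1) =
    twopii R * (count (fun p => (a < complex.Re p < a + 1) && (c < complex.Im p < c + 1)) S)%:R.
  rewrite rectD // (goursat aa cc Hd) addr0 rS {bS rS bL gs Ds}.
  exact: sum_winding aa cc offS.
have nz0 : twopii R != 0 by rewrite eq_complex /= negb_and orbC mulf_neq0 // ?pnatr_eq0 // gt_eqF // pi_gt0.
have dg z : z \notin S -> h z != 0 -> cder g z (L z * g z).
  by move=> zS hz; rewrite gs; apply: cder_ext (cder_logder hh' zS hz) => w; rewrite gs.
have gn0 z : z \notin S -> h z != 0 -> g z != 0.
  by move=> zS hz; rewrite gs mulf_neq0 // prodroots_eq0.
(* Differentiate the functional equation for the shift by [u] and divide by [g (z + u)], which is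
   nonzero on the sides. *)
have quasi (u : C) (p p' : C -> C) z : (forall z, cder p z (p' z)) ->
    (forall z, g (z + u) = cexp (twopii R * p z) * g z) ->
    z \notin S -> z + u \notin S -> h z != 0 -> h (z + u) != 0 ->
    L (z + u) - L z = twopii R * p' z.
  move=> pp' gp zS zuS hz hzu.
  have k1 : cder (fun z => g (z + u)) z (L (z + u) * g (z + u)).
    have : cder (fun w => g (u + w)) z (L (u + z) * g (u + z)).
      by apply/cder_shift; rewrite [u + z]addrC; exact: dg.
    by rewrite [u + z]addrC; apply: cder_ext => w; rewrite addrC.
  have k2 : cder (fun z => cexp (twopii R * p z) * g z) z
      (cexp (twopii R * p z) * (twopii R * p' z) * g z + cexp (twopii R * p z) * (L z * g z)).
    apply: cderM (dg _ zS hz); apply: (@cder_comp _ (fun z => twopii R * p z)).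
      exact: cderZ.
    exact: cder_cexp.
  have := cder_uniq k1 (cder_ext (fun w => esym (gp w)) k2); rewrite gp => e.
  apply: (mulIf (mulf_neq0 (cexp_neq0 (twopii R * p z)) (gn0 _ zS hz))).
  by rewrite mulrBl e; ring.
have notS z : (complex.Re z == a) || (complex.Re z == a + 1) || (complex.Im z == c) || (complex.Im z == c + 1) -> z \notin S.
  move=> hz; apply/negP => /(allP offS) /and4P[q1 q2 q3 q4].
  by move: hz; rewrite (negbTE q1) (negbTE q2) (negbTE q3) (negbTE q4).
have rL2 : rect L a (a + 1) c (c + 1) = twopii R * n%:R.
  rewrite /rect; case: bL => [bh bv].
  have -> : cint (fun x => L (x +i* c)) a (a + 1) - cint (fun x => L (x +i* (c + 1))) a (a + 1)
     = - twopii R * p2 ((a + 1) +i* c) - - twopii R * p2 (a +i* c).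
    rewrite -cintB; last 2 first.
    - by move=> t /bh[? _]; apply: pcont_hline.
    - by move=> t /bh[_ ?]; apply: pcont_hline.
    rewrite (@eq_cint _ _ (fun x => - twopii R * p2' (x +i* c))); last first.
      move=> t tt; have e : t +i* (c + 1) = t +i* c + 'i.
        by rewrite -[RHS]/((t + 0) +i* (c + 1)) addr0.
      have := quasi 'i p2 p2' (t +i* c) hp2' gi; rewrite -e mulNr => <-; first by rewrite opprB.
      - by apply: notS; rewrite /= eqxx !orbT.
      - by apply: notS; rewrite /= eqxx !orbT.
      - by apply: hD; apply: inD; rewrite /inrect /= tt lexx cc.
      - by apply: hD; apply: inD; rewrite /inrect /= tt lexx cc.
    apply: (@cint_ftc _ (fun x => - twopii R * p2 (x +i* c))); first by rewrite ltrDl.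
      move=> t _; apply: (@pcont_hline _ (fun z => - twopii R * p2' z)).
      by apply: ccontM; [apply: ccont_cst|apply: entire_cont].
    by move=> t _; apply/pderZ/pder_hline.
  have -> : cint (fun y => L ((a + 1) +i* y)) c (c + 1) - cint (fun y => L (a +i* y)) c (c + 1)
     = - 'i * twopii R * p1 (a +i* (c + 1)) - - 'i * twopii R * p1 (a +i* c).
    rewrite -cintB; last 2 first.
    - by move=> t /bv[_ ?]; apply: pcont_vline.
    - by move=> t /bv[? _]; apply: pcont_vline.
    rewrite (@eq_cint _ _ (fun y => twopii R * p1' (a +i* y))); last first.
      move=> t tt; have e : (a + 1) +i* t = a +i* t + 1.
        by rewrite -[RHS]/((a + 1) +i* (t + 0)) addr0.
      have := quasi 1 p1 p1' (a +i* t) hp1' g1; rewrite -e => -> //.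
      - by apply: notS; rewrite /= eqxx ?orbT.
      - by apply: notS; rewrite /= eqxx ?orbT.
      - by apply: hD; apply: inD; rewrite /inrect /= tt lexx aa.
      - by apply: hD; apply: inD; rewrite /inrect /= tt lexx aa.
    apply: (@cint_ftc _ (fun y => - 'i * twopii R * p1 (a +i* y))); first by rewrite ltrDl.
      move=> t _; apply: (@pcont_vline _ (fun z => twopii R * p1' z)).
      by apply: ccontM; [apply: ccont_cst|apply: entire_cont].
    move=> t _; have := @pderZ _ t _ (- 'i * twopii R) (pder_vline (hp1' (a +i* t))).
    rewrite (_ : - 'i * twopii R * ('i * p1' (a +i* t)) = twopii R * p1' (a +i* t)) //.
    by rewrite mulrACA mulNr -expr2 sqr_i opprK; ring.
  have := pn (a +i* c).
  have -> : a +i* c + 'i = a +i* (c + 1) by rewrite -[LHS]/((a + 0) +i* (c + 1)) addr0.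
  have -> : a +i* c + 1 = (a + 1) +i* c by rewrite -[LHS]/((a + 1) +i* (c + 0)) addr0.
  move=> <-; rewrite mulrBr !mulrA mulrN -expr2 sqr_i opprK; ring.
(* The two values of the integral of [L]: the square contains exactly [n] of the listed zeros, yet
   all of [s0] lies in it. *)
have := mulfI nz0 (etrans (esym rL) rL2) => /eqP; rewrite eqr_nat => /eqP cn.
move: ns; rewrite -cn /S count_cat ltnNge => /negP; apply.
apply: leq_trans (leq_addl _ _); rewrite -[X in (X <= _)%N](count_predT s0).
rewrite -[count xpredT s0](@eq_in_count _ (fun p => (a < complex.Re p < a + 1) && (c < complex.Im p < c + 1))) //.
move=> p /(allP small0) /andP[]; rewrite !ltr_norml => /andP[k1 k2] /andP[k3 k4].
by apply/andP; split; apply/andP; split; lra.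
Qed.

End ZeroCount.

(** * Uniform limits, Liouville's theorem and the identity theorem *)

Section Liouville.
Variable R : realType.
Local Notation C := R[i].
Implicit Types (f g : C -> C).

Lemma cder_of_lipschitz_quotients f (K : R) : 0 <= K ->
  (forall a b, a != 0 -> b != 0 -> cmod a <= 1 / 2 -> cmod b <= 1 / 2 ->
    cmod ((f a - f 0) / a - (f b - f 0) / b) <= K * cmod a + K * cmod b) ->
  exists l, cder f 0 l.
Proof.
move=> K0 h.
pose T := {a : C | (a != 0) && (cmod a <= 1 / 2)}.
pose psi (a : T) := (f (val a) - f 0) / val a.
have hpsi (a b : T) : cmod (psi a - psi b) <= K * cmod (val a) + K * cmod (val b).
  by have /andP[? ?] := valP a; have /andP[? ?] := valP b; apply: h.
have t0 : T.
  exists ((1 / 2)%:C); apply/andP; split; last by rewrite cmodR ger0_norm.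
  by rewrite -cmod_gt0 cmodR normr_gt0 // mulf_neq0 // ?invr_eq0 ?pnatr_eq0.
have [L hL] := approx_limit t0 hpsi.
have K1 : 0 < 2 * K + 1 by rewrite ltr_wpDl // mulr_ge0.
exists L => e e0; exists (Num.min (1 / 2) (e / (2 * K + 1))).
  by rewrite lt_min !divr_gt0.
move=> w; rewrite !subr0 lt_min => /andP[w1 w2].
have [->|w0] := eqVneq w 0; first by rewrite subrr mulr0 subr0 cmod0 mulr0.
have hw : (w != 0) && (cmod w <= 1 / 2) by rewrite w0 ltW.
have /= := hL (exist _ w hw); rewrite /psi /= => k.
rewrite -{1}[f w - f 0](divfK w0) -mulrBl cmodM ler_wpM2r ?cmod_ge0 //.
apply: le_trans k _; apply: le_trans (_ : _ <= (2 * K + 1) * cmod w) _.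
  by have := cmod_ge0 w; lra.
by rewrite mulrC -ler_pdivlMr // ltW.
Qed.

(** The constant in [quot_lipschitz] depends only on a bound on the disc of radius 4, so it is the
    same for all close approximations and passes to the quotients of [f]. *)
Lemma uniform_limit_der f : (forall e : R, 0 < e ->
    exists2 g, entire g & forall z, cmod z <= 4 -> cmod (g z - f z) <= e) ->
  exists l, cder f 0 l.
Proof.
move=> h; have [g1 g1e hg1] := h 1 ltr01.
have [M0 M00 hM0] := @disc_bounded _ g1 4 (fun z => entire_cont z g1e).
pose M := M0 + 2; have M1 : 0 <= M by rewrite addr_ge0.
have K0 : 0 <= 4 * M by rewrite mulr_ge0.
apply: (cder_of_lipschitz_quotients K0) => a b a0 b0 a1 b1.
have ca : 0 < cmod a by rewrite cmod_gt0.
have cb : 0 < cmod b by rewrite cmod_gt0.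
apply/ler_addgt0Pr => e e0.
(* The approximation may depend on [a] and [b]: replacing [f] by it changes the two quotients by at
   most [e] in all. The bound 1 keeps it below [M]. *)
pose d := Num.min 1 (e / (2 / cmod a + 2 / cmod b)).
have d0 : 0 < d by rewrite lt_min ltr01 divr_gt0 // addr_gt0 // divr_gt0.
have [g ge hg] := h d d0.
have gM z : cmod z <= 4 -> cmod (g z) <= M.
  move=> z4; have := hg z z4; have := hg1 z z4; have := hM0 z z4.
  have : d <= 1 by rewrite ge_min lexx.
  have := cmod_dist (g z) (g1 z) (f z); rewrite [cmod (f z - _)]cmodBC.
  have := cmod_tri (g z) (g1 z); rewrite /M; lra.
have [l hl] := ge 0.
have q z : z != 0 -> cmod z <= 1 / 2 -> cmod ((g z - g 0) / z - l) <= 4 * M * cmod z.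
  move=> z0 z1; have := quot_lipschitz ge hl gM (_ : cmod 0 <= 1 / 2) z1 z0.
  rewrite cmod0 sub0r cmodN /dquot eqxx (negbTE z0) cmodBC; apply; lra.
have diff z : z != 0 -> cmod z <= 1 / 2 -> cmod ((f z - f 0) / z - (g z - g 0) / z) <= d * (2 / cmod z).
  move=> z0 z1; rewrite -mulrBl cmodM cmodV mulrA ler_wpM2r ?invr_ge0 ?cmod_ge0 //.
  have -> : f z - f 0 - (g z - g 0) = (g 0 - f 0) - (g z - f z) by ring.
  apply: le_trans (cmodB _ _) _; rewrite mulr_natr mulr2n.
  by apply: lerD; apply: hg; rewrite ?cmod0 //; lra.
have := diff a a0 a1; have := diff b b0 b1; have := q a a0 a1; have := q b b0 b1.
set fa := (f a - f 0) / a; set fb := (f b - f 0) / b.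
set ga := (g a - g 0) / a; set gb := (g b - g 0) / b.
move=> h1 h2 h3 h4.
have h5 : d * (2 / cmod a) + d * (2 / cmod b) <= e.
  by rewrite -mulrDr -ler_pdivlMr ?ge_min ?lexx ?orbT // addr_gt0 // divr_gt0.
have -> : fa - fb = (fa - ga) - (fb - gb) + ((ga - l) - (gb - l)) by ring.
apply: le_trans (cmodD _ _) _; apply: le_trans (lerD (cmodB _ _) (cmodB _ _)) _.
by lra.
Qed.

Lemma uniform_limit_entire f : (forall (e r : R), 0 < e ->
    exists2 g, entire g & forall z, cmod z <= r -> cmod (g z - f z) <= e) ->
  entire f.
Proof.
move=> h z.
suff [l hl] : exists l, cder (fun w => f (z + w)) 0 l.
  by exists l; move/cder_shift: hl; rewrite addr0.
apply: uniform_limit_der => e e0; have [g ge hg] := h e (cmod z + 4) e0.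
exists (fun w => g (z + w)); first exact: entire_shift.
by move=> w w4; apply: hg; apply: le_trans (cmodD _ _) _; rewrite lerD2l.
Qed.

Lemma liouville f (K : R) : entire f -> (forall z, cmod (f z) <= K) -> forall z, f z = f 0.
Proof.
move=> fe fK z; have [l hl] := fe 0; have qe := entire_dquot fe hl.
have [->//|z0] := eqVneq z 0.
suff q0 : dquot f l z = 0.
  move: q0; rewrite /dquot (negbTE z0) => /eqP; rewrite mulf_eq0 invr_eq0 (negbTE z0) orbF subr_eq0.
  by move=> /eqP.
have K0 : 0 <= K by apply: le_trans (fK 0); apply: cmod_ge0.
apply: cmod_small => e e0.
have r0 : 0 < cmod z + (2 * K + 1) / e by rewrite ltr_wpDl ?cmod_ge0 // divr_gt0 // ltr_wpDl // mulr_ge0.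
apply: (@entire_max _ _ z _ _ r0 qe) => w hw.
have hw' : (2 * K + 1) / e <= cmod w by have := cmod_tri (w - z) w; rewrite addrAC subrr add0r cmodN hw; lra.
have w0 : 0 < cmod w by apply: lt_le_trans hw'; rewrite divr_gt0 // ltr_wpDl // mulr_ge0.
rewrite /dquot; have := w0; rewrite cmod_gt0 => /negbTE ->.
rewrite cmodM cmodV ler_pdivrMr //; apply: le_trans (cmodB _ _) _.
move: hw'; rewrite ler_pdivrMr // mulrC => hw'; have := fK w; have := fK 0; lra.
Qed.

(** The second difference quotient at [0] is bounded on the unit disc by continuity and outside it
    by the growth of [f], hence constant. *)
Lemma entire_quadratic f (K : R) : entire f -> (forall z, cmod (f z) <= K * (1 + cmod z) ^+ 2) ->
  exists b c, forall z, f z = f 0 + b * z + c * z ^+ 2.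
Proof.
move=> fe fK; have [l hl] := fe 0; have qe := entire_dquot fe hl.
have [m hm] := qe 0; have qqe := entire_dquot qe hm.
pose qq := dquot (dquot f l) m.
have [M M0 hM] := @disc_bounded _ qq 1 (fun z => entire_cont z qqe).
have K0 : 0 <= K by apply: le_trans (cmod_ge0 (f 0)) _; apply: le_trans (fK 0) _; rewrite cmod0 addr0 expr1n mulr1.
have qE z : f z = f 0 + l * z + qq z * z ^+ 2.
  rewrite /qq /dquot eqxx; have [->|z0] := eqVneq z 0; first by ring.
  by field.
have hb z : cmod (qq z) <= M + (5 * K + cmod l).
  have [z1|z1] := lerP (cmod z) 1; first by apply: le_trans (hM z z1) _; rewrite lerDl addr_ge0 ?cmod_ge0 // mulr_ge0.
  have z0 : 0 < cmod z by apply: lt_trans z1.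
  have e : qq z * z ^+ 2 = f z - (f 0 + l * z) by rewrite [f z]qE; ring.
  rewrite -(ler_pM2r (exprn_gt0 2 z0)) -cmodX -cmodM e cmodX.
  apply: le_trans (cmodB _ _) _; apply: le_trans (lerD (fK z) (cmodD _ _)) _.
  rewrite cmodM; have := fK 0; rewrite cmod0 addr0 expr1n mulr1 => k0.
  have k1 : K * (1 + cmod z) ^+ 2 <= K * (4 * cmod z ^+ 2).
    apply: ler_wpM2l => //; rewrite !expr2; nra.
  have k2 : K <= K * cmod z ^+ 2 by rewrite ler_peMr // expr2; nra.
  have k3 : cmod l * cmod z <= cmod l * cmod z ^+ 2 by apply: ler_wpM2l; rewrite ?cmod_ge0 // expr2; nra.
  have k4 : 0 <= M * cmod z ^+ 2 by rewrite mulr_ge0 // exprn_ge0 // ltW.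
  lra.
exists l, (qq 0) => z; rewrite [LHS]qE; congr (_ + _ * _); exact: liouville qqe hb z.
Qed.

(* An entire function vanishing near 0 vanishes: it is divisible by every power of z. *)
Lemma entire_zero_near g (d : R) : entire g -> 0 < d ->
  (forall z, 0 < cmod z -> cmod z < d -> g z = 0) -> forall z, g z = 0.
Proof.
move=> ge d0 gz z0; apply/eqP/negPn/negP => gn0.
have [M M0 hM] := factor_bound z0 ge.
have g00 : g 0 = 0.
  apply: cmod_small => e e0; have [d1 d10 hd] := entire_cont 0 ge e0.
  pose t := Num.min d d1 / 2; have t0 : 0 < t by rewrite divr_gt0 // lt_min d0.
  have : t < Num.min d d1 by rewrite ltr_pdivrMr // mulr_natr mulr2n ltrDl lt_min d0.
  rewrite lt_min => /andP[t1 t2].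
  have ct : cmod t%:C = t by rewrite cmodR gtr0_norm.
  by have := hd t%:C; rewrite subr0 ct (gz t%:C) ?ct // sub0r cmodN; apply.
have H n : exists h, [/\ entire h, forall z, g z = prodroots (nseq n 0) z * h z
   & forall z, cmod z < d -> h z = 0].
  elim: n => [|n [h [he gh hz]]].
    exists g; split=> // [z|z zd]; first by rewrite /prodroots big_nil mul1r.
    by have [->//|z1] := eqVneq z 0; apply: gz; rewrite ?cmod_gt0.
  have h00 : h 0 = 0 by apply: hz; rewrite cmod0.
  have [k ke hk] := entire_factor he h00.
  have kz z : z != 0 -> cmod z < d -> k z = 0.
    move=> z1 /hz; rewrite hk => /eqP; rewrite subr0 mulf_eq0 (negbTE z1) => /eqP.
    by [].
  exists k; split => //.
    by move=> z; rewrite gh hk /prodroots /= big_cons; ring.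
  move=> z zd; have [->|z1] := eqVneq z 0; last exact: kz.
  apply: cmod_small => e e0; have [d1 d10 hd] := entire_cont 0 ke e0.
  pose t := Num.min d d1 / 2; have t0 : 0 < t by rewrite divr_gt0 // lt_min d0.
  have : t < Num.min d d1 by rewrite ltr_pdivrMr // mulr_natr mulr2n ltrDl lt_min d0.
  rewrite lt_min => /andP[t1 t2].
  have ct : cmod t%:C = t by rewrite cmodR gtr0_norm.
  by have := hd t%:C; rewrite subr0 ct (kz t%:C) ?ct // ?sub0r ?cmodN -?cmod_gt0 ?ct //; apply.
have [h [he gh _]] := H (Num.bound (M / cmod (g z0))).
have n0 (p : C) : p \in nseq (Num.bound (M / cmod (g z0))) 0 -> cmod p <= 2.
  by rewrite mem_nseq => /andP[_ /eqP->]; rewrite cmod0.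
have := hM _ h he gh n0; rewrite size_nseq.
have gp : 0 < cmod (g z0) by rewrite cmod_gt0.
rewrite ler_pdivlMr ?exprn_gt0 // mulrC -ler_pdivlMr // => k.
have := le_lt_trans k (archi_boundP (divr_ge0 M0 (ltW gp))).
by rewrite -natrX ltr_nat ltnNge ltnW // ltn_expl.
Qed.

End Liouville.

(** * Taylor expansion along lines of a function of four variables *)

Section Frechet.
Variable R : realType.
Local Notation C := R[i].
Local Notation V := ('rV[R[i]]_4 : normedModType R[i]).

Definition vnorm (x : V) : R := complex.Re (`|x| : C).

Lemma vnormE (x : V) : (`|x| : C) = (vnorm x)%:C.
Proof. by rewrite /vnorm RRe_real // normr_real. Qed.

Lemma vnorm_ge0 (x : V) : 0 <= vnorm x.
Proof. by rewrite -lecR -vnormE normr_ge0. Qed.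

Lemma vnormZ (z : C) (x : V) : vnorm (z *: x) = cmod z * vnorm x.
Proof. by apply: (@complexI R); rewrite rmorphM /= -!vnormE -cmodE normrZ. Qed.

Lemma vnormD (x y : V) : vnorm (x + y) <= vnorm x + vnorm y.
Proof. by rewrite -lecR rmorphD /= -!vnormE ler_normD. Qed.

Lemma vnorm_eq0 (x : V) : (vnorm x == 0) = (x == 0).
Proof. by rewrite -(inj_eq (@complexI R)) -vnormE normr_eq0. Qed.

Lemma vnorm_gt0 (x : V) : (0 < vnorm x) = (x != 0).
Proof. by rewrite lt_def vnorm_eq0 vnorm_ge0 andbT. Qed.

Lemma pos_complex (e : C) : 0 < e -> e = (complex.Re e)%:C /\ 0 < complex.Re e.
Proof. by case: e => a b; rewrite ltcE /= => /andP[h a0]; split => //; apply/eqP; rewrite eq_complex /= eqxx ?h // eq_sym. Qed.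

Lemma near_vnorm (x : V) (P : V -> Prop) : (\forall y \near x, P y) <->
  exists2 d : R, 0 < d & forall y, vnorm (y - x) < d -> P y.
Proof.
split=> [/nbhs_ballP[e /= e0 he]|[d d0 hd]].
  have [ee er] := pos_complex e0; exists (complex.Re e) => // y hy; apply: he.
  by rewrite -ball_normE /= ee distrC vnormE ltcR.
apply/nbhs_ballP; exists d%:C; first by rewrite /= ltcR.
by move=> y; rewrite -ball_normE /= distrC vnormE ltcR; apply: hd.
Qed.

Lemma norm_regular (z : C^o) : (`|z| : C) = (cmod z)%:C.
Proof. exact: cmodE. Qed.

Definition fder (F : V -> C) (x : V) (L : V -> C) := forall e : R, 0 < e ->
  exists2 d : R, 0 < d & forall y, vnorm (y - x) < d ->
    cmod (F y - F x - L (y - x)) <= e * vnorm (y - x).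

Lemma differentiable_fder (F : V -> C^o) (x : V) : differentiable F x -> fder F x ('d F x).
Proof.
move=> /diff_locallyP[_ /eqaddoP h] e e0.
have /h : 0 < e%:C by rewrite ltcR.
move=> /near_vnorm[d d0 hd]; exists d => // y hy.
have := hd (y - x); rewrite subr0 => /(_ hy).
rewrite -[X in `|X|]/(F (y - x + x) - (F x + 'd F x (y - x))) subrK.
by rewrite norm_regular vnormE -rmorphM lecR opprD addrA.
Qed.

Lemma hol_cont (F : V -> C^o) (x : V) (e : R) : differentiable F x -> 0 < e ->
  exists2 d : R, 0 < d & forall y, vnorm (y - x) < d -> cmod (F y - F x) <= e.
Proof.
move=> /differentiable_continuous /cvgrPdist_le h e0.
have /h : 0 < e%:C by rewrite ltcR.
move=> /near_vnorm[d d0 hd]; exists d => // y /hd.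
by rewrite distrC norm_regular lecR.
Qed.

Lemma cder_line (F : V -> C^o) (a v : V) (z : C) : differentiable F (a + z *: v) ->
  cder (fun w => F (a + w *: v)) z ('d F (a + z *: v) v).
Proof.
move=> /differentiable_fder h e e0.
have k0 : 0 < 1 + vnorm v by rewrite ltr_wpDr // vnorm_ge0.
have [d d0 hd] := h _ (divr_gt0 e0 k0).
have e1 w : a + w *: v - (a + z *: v) = (w - z) *: v by rewrite opprD addrACA subrr add0r scalerBl.
exists (d / (1 + vnorm v)); first exact: divr_gt0.
move=> w hw; have := hd (a + w *: v); rewrite e1 vnormZ linearZ /= => k.
rewrite mulrC; apply: le_trans (k _) _.
  apply: le_lt_trans (_ : _ <= cmod (w - z) * (1 + vnorm v)) _; last by rewrite -ltr_pdivlMr.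
  by apply: ler_wpM2l; rewrite ?cmod_ge0 // lerDr.
rewrite mulrCA mulrC; apply: ler_wpM2r; first exact: cmod_ge0.
by rewrite mulrAC ler_pdivrMr // ler_wpM2l ?ltW // ltrDr.
Qed.

Lemma entire_line (F : V -> C^o) (a v : V) : holomorphic F -> entire (fun w => F (a + w *: v)).
Proof. by move=> h z; eexists; apply: cder_line; apply: h. Qed.

Section Taylor.
Variable F : V -> C^o.
Hypotheses (hF : holomorphic F) (F0 : F 0 = 0) (dF0 : forall v, 'd F 0 v = 0).

Let Fl v z := F (z *: v).

Let Fl_entire v : entire (Fl v).
Proof.
move=> z; have [l hl] := entire_line 0 v hF z.
by exists l; apply: cder_ext hl => w; rewrite add0r.
Qed.

Let k1 v := dquot (Fl v) 0.

Let Fl_der v : cder (Fl v) 0 0.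
Proof.
have := @cder_line F 0 v 0 (hF _); rewrite scale0r addr0 dF0.
by apply: cder_ext => w; rewrite add0r.
Qed.

Let k1_entire v : entire (k1 v).
Proof. exact: entire_dquot (@Fl_entire v) (@Fl_der v). Qed.

(** The coefficient of [z^2] in [F (z v)]. Under the hypotheses of the section [k1 v] is entire, so
    [xget] finds a derivative and does not fall back on its default. *)
Definition second_order v : C := xget 0 [set l | cder (k1 v) 0 l].

Let second_der v : cder (k1 v) 0 (second_order v).
Proof.
rewrite /second_order; case: xgetP => [l _ //|hn].
by have [l hl] := @k1_entire v 0; case: (hn l).
Qed.

Let k2 v := dquot (k1 v) (second_order v).

Let k2_entire v : entire (k2 v).
Proof. exact: entire_dquot (@k1_entire v) (@second_der v). Qed.

Lemma second_factor v : exists k, [/\ entire k, k 0 = second_order v & forall z, F (z *: v) = z ^+ 2 * k z].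
Proof.
exists (k2 v); split; [exact: k2_entire|by rewrite /k2 /dquot eqxx|].
move=> z; rewrite /k2 /k1 /dquot eqxx subr0 /Fl scale0r F0 subr0.
have [->|z0] := eqVneq z 0; first by rewrite scale0r F0 expr0n mul0r.
by field.
Qed.

Lemma second_order_uniq v k : entire k -> (forall z, z != 0 -> F (z *: v) = z ^+ 2 * k z) -> k 0 = second_order v.
Proof.
move=> ke hk; have [k' [k'e <- hk']] := second_factor v.
apply/eqP; rewrite -subr_eq0; apply/eqP; apply: cmod_small => e e0.
have e2 : 0 < e / 2 by rewrite divr_gt0.
have [d d0 hd] := entire_cont 0 ke e2; have [d' d0' hd'] := entire_cont 0 k'e e2.
pose t := Num.min d d' / 2; have t0 : 0 < t by rewrite divr_gt0 // lt_min d0.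
have : t < Num.min d d' by rewrite ltr_pdivrMr // mulr_natr mulr2n ltrDl lt_min d0.
rewrite lt_min => /andP[t1 t2].
have ct : cmod t%:C = t by rewrite cmodR gtr0_norm.
have t0' : t%:C != 0 by rewrite -cmod_gt0 ct.
have kk : k t%:C = k' t%:C by apply: (mulfI (expf_neq0 2 t0')); rewrite -hk // hk'.
have := hd t%:C; have := hd' t%:C; rewrite subr0 ct kk => /(_ t2) h1 /(_ t1) h2.
rewrite (_ : k 0 - k' 0 = (k' t%:C - k' 0) - (k' t%:C - k 0)); last by ring.
by apply: le_trans (cmodB _ _) _; rewrite [e]splitr; exact: lerD.
Qed.

Lemma second_orderZ z v : second_order (z *: v) = z ^+ 2 * second_order v.
Proof.
have [k [ke <- hk]] := second_factor v.
rewrite -(@second_order_uniq (z *: v) (fun w => z ^+ 2 * k (w * z))).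
- by rewrite mul0r.
- apply: entireM; first exact: entire_cst.
  by apply: (@entire_comp _ (fun w => w * z)) => //; apply: entireM; [apply: entire_id|apply: entire_cst].
- by move=> w _; rewrite scalerA hk exprMn mulrA.
Qed.

(** Cauchy estimates with constants independent of the direction: [F] is bounded by 1 on one ball,
    and the maximum principle on circles of radius [d] and [2 d] bounds the coefficient and the
    cubic remainder. *)
Lemma second_order_remainder : exists d K : R, [/\ 0 < d, 0 <= K &
  forall v, vnorm v <= 1 -> cmod (second_order v) <= K /\
  forall z, cmod z <= d -> cmod (F (z *: v) - z ^+ 2 * second_order v) <= K * cmod z ^+ 3].
Proof.
have [d1 d10 hd1] := hol_cont (hF 0) ltr01.
pose d := d1 / 4; have d0 : 0 < d by rewrite divr_gt0.
have dn : d != 0 by rewrite gt_eqF.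
have Fb v z : vnorm v <= 1 -> cmod z <= 3 * d -> cmod (F (z *: v)) <= 1.
  move=> v1 z3; have := hd1 (z *: v); rewrite F0 !subr0; apply.
  rewrite vnormZ; apply: le_lt_trans (_ : _ <= 3 * d * 1) _.
    by apply: ler_pM; rewrite ?cmod_ge0 ?vnorm_ge0.
  by rewrite mulr1 /d; lra.
pose K := 1 / d ^+ 2 + 2 / d ^+ 3.
have K1 : 0 < 1 / d ^+ 2 by rewrite divr_gt0 // exprn_gt0.
have K2 : 0 < 2 / d ^+ 3 by rewrite divr_gt0 // exprn_gt0.
exists d, K; split => //; first by rewrite addr_ge0 // ltW.
move=> v v1; have [k [ke <- hk]] := second_factor v.
have kb w c : cmod (w - c) = d -> c = 0 -> cmod (k w) <= 1 / d ^+ 2.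
  move=> + c0; rewrite c0 subr0 => wd; rewrite ler_pdivlMr ?exprn_gt0 // -wd mulrC -cmodX -cmodM -hk.
  by apply: Fb => //; rewrite wd; lra.
have k0 : cmod (k 0) <= 1 / d ^+ 2 by apply: (entire_max d0 ke) => w hw; apply: kb hw erefl.
split; first by apply: le_trans k0 _; rewrite /K; lra.
move=> z zd; have [l hl] := ke 0; have qe := entire_dquot ke hl.
have qb : cmod (dquot k l z) <= 2 / d ^+ 3.
  apply: (@entire_max _ _ z (2 * d)) => //; first by rewrite mulr_gt0.
  move=> w hw; have w1 : d <= cmod w.
    by have := cmod_tri (w - z) w; rewrite addrAC subrr add0r cmodN hw; lra.
  have w3 : cmod w <= 3 * d by have := cmod_tri w z; rewrite hw; lra.
  have w0 : 0 < cmod w by apply: lt_le_trans w1.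
  have kw : cmod (k w) <= 1 / d ^+ 2.
    have : cmod (w ^+ 2 * k w) <= 1 by rewrite -hk; apply: Fb.
    rewrite cmodM cmodX => h; rewrite ler_pdivlMr ?exprn_gt0 // mulrC.
    apply: le_trans h; apply: ler_wpM2r; first exact: cmod_ge0.
    by apply: lerXn2r; rewrite ?nnegrE ?cmod_ge0 // ltW.
  rewrite /dquot; have := w0; rewrite cmod_gt0 => /negbTE ->.
  rewrite cmodM cmodV ler_pdivrMr //; apply: le_trans (cmodB _ _) _.
  have e : 1 / d ^+ 2 = d / d ^+ 3 by field.
  have : d / d ^+ 3 <= cmod w / d ^+ 3 by rewrite ler_wpM2r // invr_ge0 exprn_ge0 // ltW.
  by rewrite -e mulrAC; lra.
have e : F (z *: v) - z ^+ 2 * k 0 = z ^+ 3 * dquot k l z.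
  rewrite hk /dquot; have [->|z0] := eqVneq z 0; first by ring.
  by field.
rewrite e cmodM cmodX mulrC; apply: ler_wpM2r; first by rewrite exprn_ge0 // cmod_ge0.
by apply: le_trans qb _; rewrite /K; lra.
Qed.

Lemma second_order_bound : exists2 K : R, 0 <= K & forall v, cmod (second_order v) <= K * vnorm v ^+ 2.
Proof.
have [d [K [_ K0 h]]] := second_order_remainder; exists K => // v.
have [->|v0] := eqVneq v 0.
  by rewrite -(scale0r (0 : V)) second_orderZ expr0n mul0r cmod0 mulr_ge0 // exprn_ge0 // vnorm_ge0.
have vn0 : 0 < vnorm v by rewrite vnorm_gt0.
have e : v = (vnorm v)%:C *: ((vnorm v)^-1%:C *: v).
  by rewrite scalerA -rmorphM /= divff ?gt_eqF // scale1r.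
rewrite [in X in X <= _]e second_orderZ cmodM cmodX cmodR ger0_norm ?vnorm_ge0 // mulrC.
apply: ler_wpM2r; first by rewrite exprn_ge0 // vnorm_ge0.
by apply: (h _ _).1; rewrite vnormZ cmodR ger0_norm ?invr_ge0 ?vnorm_ge0 // mulVf // gt_eqF.
Qed.

(** It is the locally uniform limit of [t^-2 F (t (v + s w))] as [t] tends to [0], by the remainder
    estimate that is uniform in the direction. *)
Lemma second_order_line_entire v w : entire (fun s => second_order (v + s *: w)).
Proof.
apply: uniform_limit_entire => e r e0.
have [d [K [d0 K0 h]]] := second_order_remainder.
(* A bound for the norm of [v + s w] with [|s| <= r]; the absolute value is there because [r] may be
   negative. *)
pose rho := 1 + vnorm v + `|r| * vnorm w.
have rho0 : 0 < rho by rewrite /rho -addrA ltr_pwDl // addr_ge0 ?mulr_ge0 ?vnorm_ge0.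
have re : 0 < e / (K * rho ^+ 3 + 1) by rewrite divr_gt0 // ltr_wpDl // mulr_ge0 // exprn_ge0 // ltW.
pose t := Num.min (d / rho) (e / (K * rho ^+ 3 + 1)).
have t0 : 0 < t by rewrite lt_min re divr_gt0.
have ct : cmod t%:C = t by rewrite cmodR gtr0_norm.
have tn0 : t%:C != 0 by rewrite -cmod_gt0 ct.
exists (fun s => t%:C ^- 2 * F (t%:C *: (v + s *: w))).
  apply: entireM; first exact: entire_cst.
  move=> s; have [l hl] := entire_line (t%:C *: v) (t%:C *: w) hF s.
  by exists l; apply: cder_ext hl => u; rewrite scalerDr !scalerA mulrC.
move=> s sr; pose x := v + s *: w.
have xr : vnorm x <= rho.
  rewrite /x /rho; apply: le_trans (vnormD _ _) _; rewrite vnormZ.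
  have : cmod s * vnorm w <= `|r| * vnorm w by apply: ler_wpM2r; [apply: vnorm_ge0|apply: le_trans sr (ler_norm _)].
  by lra.
pose y := rho^-1%:C *: x.
have y1 : vnorm y <= 1.
  by rewrite vnormZ cmodR ger0_norm ?invr_ge0 ?(ltW rho0) // mulrC ler_pdivrMr // mul1r.
have [_ /(_ (t * rho)%:C)] := h y y1.
have xe : x = rho%:C *: y by rewrite /y scalerA -rmorphM /= divff ?gt_eqF // scale1r.
have ctr : cmod (t * rho)%:C = t * rho by rewrite cmodR ger0_norm // mulr_ge0 // ltW.
have tr : t * rho <= d by rewrite -ler_pdivlMr // ge_min lexx.
rewrite ctr => /(_ tr) hb.
rewrite -/x -(ler_pM2l (_ : 0 < t ^+ 2)) ?exprn_gt0 // -{1}ct -cmodX -cmodM mulrBr mulVKf ?expf_neq0 //.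
move: hb; rewrite rmorphM /= -scalerA -xe exprMn -mulrA -second_orderZ -xe.
move=> hb; apply: le_trans hb _; rewrite exprMn (exprSr t 2) mulrA -mulrA mulrCA.
rewrite -mulrA; apply: ler_wpM2l; first by rewrite exprn_ge0 // ltW.
apply: le_trans (_ : t * (K * rho ^+ 3 + 1) <= _); first by rewrite ler_wpM2l ?lerDl // ltW.
by rewrite -ler_pdivlMr ?ge_min ?lexx ?orbT // ltr_wpDl // mulr_ge0 // exprn_ge0 // ltW.
Qed.

End Taylor.

End Frechet.

(** * Functions that are quadratic on every line *)

Section QuadraticForm.
Variable R : realType.
Local Notation C := R[i].
Local Notation V := 'rV[R[i]]_4.

Lemma poly2_eq (a b c a' b' c' : C) :
  (forall s, s != 0 -> a + b * s + c * s ^+ 2 = a' + b' * s + c' * s ^+ 2) ->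
  [/\ a = a', b = b' & c = c'].
Proof.
move=> h; have h1 := h 1 (oner_neq0 _).
have hm : (-1 : C) != 0 by rewrite oppr_eq0 oner_neq0.
have h2 := h (-1) hm.
have two : (2 : C) != 0 by rewrite pnatr_eq0.
have h3 := h 2 two.
have eb : b = b'.
  apply: (mulfI two); rewrite !(mulr1, mulrN1, expr1n, sqrrN) in h1 h2.
  have -> : 2 * b = (a + b + c) - (a - b + c) by ring.
  by rewrite h1 h2; ring.
have ec : c = c'.
  apply: (mulfI (_ : (3 : C) != 0)); first by rewrite pnatr_eq0.
  have -> : 3 * c = (a + b * 2 + c * 2 ^+ 2) - (a + b * 1 + c * 1 ^+ 2) - b by ring.
  by rewrite h1 h3 eb; ring.
split => //; move: h1; rewrite eb ec !mulr1 => /addIr/addIr.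
exact.
Qed.

Variable q : V -> C.
Hypothesis qZ : forall z v, q (z *: v) = z ^+ 2 * q v.
Hypothesis q_line : forall v w, exists b c, forall s, q (v + s *: w) = q v + b * s + c * s ^+ 2.

Definition polar (v w : V) : C := q (v + w) - q v - q w.

(** The leading coefficient is [q w] because [s^-2 q (v + s w) = q (w + s^-1 v)]: homogeneity
    reverses the polynomial on the line. *)
Lemma quadratic_line v w s : q (v + s *: w) = q v + polar v w * s + q w * s ^+ 2.
Proof.
have [b [c h]] := q_line v w; have [b' [c' h']] := q_line w v.
have [_ _ cw] : [/\ c' = q v, b' = b & q w = c].
  apply: poly2_eq => u s0; apply: (mulfI (expf_neq0 2 (invr_neq0 s0))).
  have -> : u^-1 ^+ 2 * (q v + b * u + c * u ^+ 2) = q (w + u^-1 *: v).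
    by rewrite -h -qZ scalerDr scalerA mulVf // scale1r addrC.
  by rewrite h'; field.
have e := h 1; rewrite scale1r mulr1 expr1n mulr1 in e.
by rewrite h -cw /polar e -cw; congr (_ + _ * _ + _); ring.
Qed.

Lemma polarC v w : polar v w = polar w v.
Proof. by rewrite /polar (addrC v w); ring. Qed.

Lemma polarZ v w s : polar v (s *: w) = s * polar v w.
Proof. by rewrite {1}/polar quadratic_line qZ; ring. Qed.

(** [polar (v + s v') w] is affine in [s], with slope [c v v']. Writing [v + s v' = s (v' + s^-1 v)]
    exchanges constant term and slope, so comparing coefficients gives [c v v' = polar v' w]. *)
Lemma polarD v v' w : polar (v + v') w = polar v w + polar v' w.
Proof.
pose c (v v' : V) : C := polar (v + w) v' - polar v v'.
have h (u u' : V) (s : C) : polar (u + s *: u') w = polar u w + s * c u u'.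
  rewrite [LHS]/polar (addrAC u) !quadratic_line /c [polar u w]/polar; ring.
suff e : c v v' = polar v' w by have := h v v' 1; rewrite scale1r mul1r e.
have [_ e _] : [/\ polar v w = c v' v, c v v' = polar v' w & 0 = 0 :> C].
  apply: poly2_eq => s s0; rewrite !mul0r !addr0.
  rewrite [c v v' * s]mulrC -h.
  have -> : v + s *: v' = s *: (v' + s^-1 *: v).
    by rewrite scalerDr scalerA divff // scale1r addrC.
  by rewrite polarC polarZ polarC h; field.
exact: e.
Qed.

Lemma quadratic_expansion x :
  q x = \sum_(i < 4) \sum_(j < 4) (2^-1 * polar (delta_mx 0 i) (delta_mx 0 j)) * x 0 i * x 0 j.
Proof.
have two : (2 : C) != 0 by rewrite pnatr_eq0.
have polarDr v w w' : polar v (w + w') = polar v w + polar v w'.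
  by rewrite polarC polarD !(polarC v).
have polar_sumr v (f : 'I_4 -> V) : polar v (\sum_(i < 4) f i) = \sum_(i < 4) polar v (f i).
  by rewrite !big_ord_recl !big_ord0 !polarDr (_ : polar v 0 = 0) // -(scale0r (0 : V)) polarZ mul0r.
have polar_suml (f : 'I_4 -> V) v : polar (\sum_(i < 4) f i) v = \sum_(i < 4) polar (f i) v.
  by rewrite polarC polar_sumr; apply: eq_bigr => i _; rewrite polarC.
have -> : q x = 2^-1 * polar x x.
  have e2 : x + x = (2 : C) *: x by rewrite scaler_nat mulr2n.
  by rewrite /polar e2 qZ; field.
rewrite {1 2}(row_sum_delta x) polar_suml mulr_sumr; apply: eq_bigr => i _.
rewrite polar_sumr mulr_sumr; apply: eq_bigr => j _.
by rewrite polarZ polarC polarZ polarC; ring.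
Qed.

End QuadraticForm.

(** * The quadratic Taylor term is a quadratic form *)

Section SecondOrderForm.
Variable R : realType.
Local Notation C := R[i].
Local Notation V := ('rV[R[i]]_4 : normedModType R[i]).
Variable F : V -> C^o.
Hypotheses (hF : holomorphic F) (F0 : F 0 = 0) (dF0 : forall v, 'd F 0 v = 0).

(** On each line the term is entire with quadratic growth, hence a polynomial of degree at most two;
    no second partial derivatives are formed. *)
Lemma second_order_quadratic : exists c : 'I_4 -> 'I_4 -> C, (forall i j, c i j = c j i) /\
  forall x, second_order F x = \sum_(i < 4) \sum_(j < 4) c i j * x 0 i * x 0 j.
Proof.
have qZ := second_orderZ hF F0 dF0.
have ql v w : exists b c, forall s, second_order F (v + s *: w) = second_order F v + b * s + c * s ^+ 2.
  have [K K0 hK] := second_order_bound hF F0 dF0.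
  have fe := second_order_line_entire hF F0 dF0 v w.
  have [|b [c h]] := @entire_quadratic _ _ (K * (1 + vnorm v + vnorm w) ^+ 2) fe.
    move=> z; apply: le_trans (hK _) _; rewrite -mulrA -exprMn; apply: ler_wpM2l => //.
    have v0 := vnorm_ge0 v; have w0 := vnorm_ge0 w; have z0 := cmod_ge0 z.
    apply: lerXn2r; rewrite ?nnegrE ?vnorm_ge0 ?mulr_ge0 ?addr_ge0 //.
    apply: le_trans (vnormD _ _) _; rewrite vnormZ.
    have := mulr_ge0 z0 v0; nra.
  by exists b, c => s; rewrite h scale0r addr0.
exists (fun i j => 2^-1 * polar (second_order F) (delta_mx 0 i) (delta_mx 0 j)); split.
  by move=> i j; rewrite polarC.
by move=> x; apply: quadratic_expansion.
Qed.

Lemma second_order_little_o (e : R) : 0 < e -> exists2 d : R, 0 < d &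
  forall x, vnorm x < d -> cmod (F x - second_order F x) <= e * vnorm x ^+ 2.
Proof.
move=> e0; have [d [K [d0 K0 h]]] := second_order_remainder hF F0 dF0.
exists (Num.min d (e / (K + 1))).
  by rewrite lt_min d0 divr_gt0 // ltr_wpDl.
move=> x; rewrite lt_min => /andP[x1 x2].
have [->|xn] := eqVneq x 0.
  rewrite F0 -(scale0r (0 : V)) (second_orderZ hF F0 dF0) expr0n mul0r subr0 cmod0.
  by rewrite mulr_ge0 ?exprn_ge0 ?vnorm_ge0 // ltW.
have vx : 0 < vnorm x by rewrite vnorm_gt0.
pose y := (vnorm x)^-1%:C *: x.
have xe : x = (vnorm x)%:C *: y by rewrite /y scalerA -rmorphM /= divff ?gt_eqF // scale1r.
have cx : cmod (vnorm x)%:C = vnorm x by rewrite cmodR gtr0_norm.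
have [|_ /(_ (vnorm x)%:C)] := h y.
  by rewrite vnormZ cmodR ger0_norm ?invr_ge0 ?vnorm_ge0 // mulVf // gt_eqF.
rewrite cx -second_orderZ // -xe => /(_ (ltW x1)) k; apply: le_trans k _.
rewrite exprS mulrA; apply: ler_wpM2r; first by rewrite exprn_ge0 // vnorm_ge0.
apply: le_trans (_ : (K + 1) * vnorm x <= _); first by rewrite ler_wpM2r ?vnorm_ge0 // lerDl.
by rewrite mulrC -ler_pdivlMr ?ltW // ltr_wpDl.
Qed.

End SecondOrderForm.

(** * Vanishing to order three at 0 implies vanishing identically *)

Section ThetaZeros.
Variable R : realType.
Local Notation C := R[i].
Local Notation V := ('rV[R[i]]_4 : normedModType R[i]).

Definition ev (i : 'I_4) : 'rV[R[i]]_4 := delta_mx 0 i.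

Lemma ord4_cover (i j k l m : 'I_4) : uniq [:: i; j; k; l] -> m \in [:: i; j; k; l].
Proof.
move=> h; apply/negPn/negP => hm.
have := max_card (mem [:: m; i; j; k; l]).
by rewrite card_ord (card_uniqP _) // cons_uniq hm.
Qed.

Lemma ev_decomp (x : 'rV[R[i]]_4) i j k l : uniq [:: i; j; k; l] ->
  x = x 0 i *: ev i + x 0 j *: ev j + x 0 k *: ev k + x 0 l *: ev l.
Proof.
move=> h; apply/rowP => m; have := ord4_cover m h; rewrite !mxE !eqxx /=.
move: h; rewrite /= !inE !negb_or => /and4P[/and3P[ij ik il] /andP[jk jl] kl _].
have ne (a b : 'I_4) : a != b -> (b == a) = false by rewrite eq_sym; apply: negbTE.
have E := (eqxx, negbTE ij, negbTE ik, negbTE il, negbTE jk, negbTE jl, negbTE kl,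
  ne _ _ ij, ne _ _ ik, ne _ _ il, ne _ _ jk, ne _ _ jl, ne _ _ kl).
by case/or4P => /eqP ->; rewrite !E /= !(mulr1, mulr0, addr0, add0r).
Qed.

(** Vectors of standard Hermitian square 4, that is with [H(l,l) = 2] after the change of
    coordinates by [Bmx]. The four shapes are those along which zeros are propagated. *)
Inductive root_vector : 'rV[R[i]]_4 -> Prop :=
  | root_axis j : root_vector (2 *: ev j)
  | root_plus i j of i != j : root_vector ((1 + 'i) *: (ev i + ev j))
  | root_minus i j of i != j : root_vector ((1 + 'i) *: (ev i - ev j))
  | root_diag : root_vector (const_mx 1).

Lemma factor3_distinct (g : C -> C) z1 z2 z3 : entire g -> g z1 = 0 -> g z2 = 0 -> g z3 = 0 ->
  uniq [:: z1; z2; z3] -> exists2 h, entire h & forall z, g z = prodroots [:: z1; z2; z3] z * h z.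
Proof.
move=> ge g1 g2 g3; rewrite /= !inE !negb_or => /and3P[/andP[z12 z13] z23 _].
have [h1 h1e e1] := entire_factor ge g1.
have k2 : h1 z2 = 0.
  by move: g2; rewrite e1 => /eqP; rewrite mulf_eq0 subr_eq0 eq_sym (negbTE z12) => /eqP.
have [h2 h2e e2] := entire_factor h1e k2.
have k3 : h2 z3 = 0.
  move: g3; rewrite e1 e2 => /eqP; rewrite !mulf_eq0 !subr_eq0 ![z3 == _]eq_sym.
  by rewrite (negbTE z13) (negbTE z23) => /eqP.
have [h3 h3e e3] := entire_factor h2e k3.
by exists h3 => // z; rewrite e1 e2 e3 /prodroots !big_cons big_nil; ring.
Qed.

Lemma factor3_double (g : C -> C) z2 : entire g -> g 0 = 0 -> cder g 0 0 -> g z2 = 0 ->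
  z2 != 0 -> exists2 h, entire h & forall z, g z = prodroots [:: 0; 0; z2] z * h z.
Proof.
move=> ge g0 gd g2 z20; have qe := entire_dquot ge gd.
have q0 : dquot g 0 0 = 0 by rewrite /dquot eqxx.
have q2 : dquot g 0 z2 = 0 by rewrite /dquot (negbTE z20) g2 g0 subrr mul0r.
have [h2 h2e e2] := entire_factor qe q0.
have k3 : h2 z2 = 0.
  by move: q2; rewrite e2 => /eqP; rewrite subr0 mulf_eq0 (negbTE z20) => /eqP.
have [h3 h3e e3] := entire_factor h2e k3.
exists h3 => // z; rewrite /prodroots !big_cons big_nil.
have -> : g z = z * dquot g 0 z.
  by rewrite /dquot; have [->|z0] := eqVneq z 0; [rewrite mul0r | rewrite g0 subr0 mulrC divfK].
by rewrite e2 e3; ring.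
Qed.

Lemma small_of_cmod (z : C) : cmod z < 3 / 8 -> small_point z.
Proof.
by move=> h; apply/andP; split; apply: le_lt_trans h; [apply: Re_le_cmod|apply: Im_le_cmod].
Qed.

Lemma linear_scale_add (L : {linear V -> C^o}) c x y : L (c *: (x + y)) = c *: (L x + L y).
Proof. by rewrite linearZ linearD. Qed.

Lemma addrCA_sub (W : zmodType) (p q s : W) : p + q + (- s - p) = q - s.
Proof. by rewrite [- s - p]addrC addrA [p + q - p]addrAC subrr add0r. Qed.

Variable Phi : V -> C^o.
Hypotheses (hPhi : holomorphic Phi) (Phi0 : Phi 0 = 0).

(** The constant 2 is [Im H(i l, l) = H(l,l)], the number of zeros in a unit square on a line in
    direction [l]. *)
Definition quasi_periodic2 (l : V) := exists p1 p2 : V -> C^o,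
  [/\ holomorphic p1, holomorphic p2,
      forall x, Phi (x + l) = cexp (twopii R * p1 x) * Phi x,
      forall x, Phi (x + 'i *: l) = cexp (twopii R * p2 x) * Phi x
    & forall x, p1 (x + 'i *: l) + p2 x - p2 (x + l) - p1 x = 2].

Hypothesis hroot : forall l, root_vector l -> quasi_periodic2 l.

(** Zeros are handed over as a factorization so that multiplicities count: three exceed the two that
    are allowed. *)
Lemma root_line_zero a l s0 h0 : root_vector l -> entire h0 ->
  (forall z, Phi (a + z *: l) = prodroots s0 z * h0 z) -> all (@small_point R) s0 ->
  (2 < size s0)%N -> forall z, Phi (a + z *: l) = 0.
Proof.
move=> /hroot[p1 [p2 [p1e p2e e1 e2 ep]]] h0e hs s0s sz.
apply: (@zero_count _ (fun z => Phi (a + z *: l)) (fun z => p1 (a + z *: l)) (fun z => p2 (a + z *: l)) 2 s0 h0) => //.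
- exact: entire_line.
- exact: entire_line.
- exact: entire_line.
- by move=> z; rewrite scalerDl scale1r addrA e1.
- by move=> z; rewrite scalerDl addrA e2.
- by move=> z; rewrite !scalerDl scale1r !addrA ep.
Qed.

Hypothesis dPhi0 : forall v, 'd Phi 0 v = 0.
Hypothesis so0 : forall v, second_order Phi v = 0.

Lemma root_line_zero0 l z : root_vector l -> Phi (z *: l) = 0.
Proof.
move=> rl; have [k [ke k0 hk]] := second_factor hPhi Phi0 dPhi0 l.
rewrite so0 in k0; have [h he hh] := entire_factor ke k0.
rewrite -[z *: l]add0r; apply: (@root_line_zero 0 l [:: 0; 0; 0] h) => //.
- by move=> w; rewrite add0r hk hh /prodroots !big_cons big_nil; ring.
- by apply/and4P; split => //; apply: small_of_cmod; rewrite cmod0; lra.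
Qed.

Lemma axis_zero i s : Phi (s *: ev i) = 0.
Proof.
have -> : s *: ev i = (s / 2) *: (2 *: ev i) by rewrite scalerA divfK // pnatr_eq0.
exact: root_line_zero0 (root_axis i).
Qed.

Lemma onei_neq0 : 1 + 'i != 0 :> C.
Proof. by rewrite eq_complex /= negb_and addr0 oner_eq0. Qed.

Lemma solid_decomp (yi yj yk s : C) i j k :
  s *: (yi *: ev i + yj *: ev j + yk *: ev k) =
  (s * (yi - yk)) *: ev i + (s * yj) *: ev j + (s * (yk / (1 + 'i))) *: ((1 + 'i) *: (ev k + ev i)).
Proof.
rewrite [(_ * (yk / _)) *: _]scalerA -[s * (yk / _) * _]mulrA divfK; last exact: onei_neq0.
rewrite !scalerDr !scalerA mulrBr scalerBl.
move: (_ *: ev i) (_ *: ev j) (_ *: ev k) ((s * yk) *: ev i) => A B D E.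
by rewrite [A - E + B]addrAC [D + E]addrC addrA subrK.
Qed.

(** On the line [t e_i + z (2 e_j)] there are three zeros: [z = 0] on an axis, [z = t/2] and
    [z = -t/2] on the root lines of [e_i + e_j] and [e_i - e_j]. They are small for small [t], and
    the identity theorem in [t] does the rest. *)
Lemma plane_zero i j s w : i != j -> Phi (s *: ev i + w *: ev j) = 0.
Proof.
move=> ij.
have key t : t != 0 -> cmod t < 3 / 8 -> Phi (t *: ev i + w *: ev j) = 0.
  move=> t0 ts.
  have two : (2 : C) != 0 by rewrite pnatr_eq0.
  have th0 : t / 2 != 0 by rewrite mulf_neq0 // invr_eq0.
  have ct : cmod (t / 2) < 3 / 8.
    by rewrite cmodM cmodV cmod_nat; have := cmod_ge0 t; lra.
  pose g z := Phi (t *: ev i + z *: (2 *: ev j)).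
  have ge : entire g by apply: entire_line.
  have g1 : g 0 = 0 by rewrite /g scale0r addr0 axis_zero.
  have g2 : g (t / 2) = 0.
    rewrite /g scalerA divfK //.
    have -> : t *: ev i + t *: ev j = (t / (1 + 'i)) *: ((1 + 'i) *: (ev i + ev j)).
      by rewrite scalerA divfK ?onei_neq0 // scalerDr.
    exact: root_line_zero0 (root_plus ij).
  have g3 : g (- (t / 2)) = 0.
    rewrite /g scalerA mulNr divfK; last exact: two.
    have -> : t *: ev i + - t *: ev j = (t / (1 + 'i)) *: ((1 + 'i) *: (ev i - ev j)).
      by rewrite scalerA divfK ?onei_neq0 // scalerBr scaleNr.
    exact: root_line_zero0 (root_minus ij).
  have [|h he hh] := factor3_distinct ge g1 g2 g3.
    rewrite /= !inE negb_or eq_sym th0 eq_sym oppr_eq0 th0 /= andbT.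
    by rewrite -subr_eq0 opprK -splitr.
  have := @root_line_zero (t *: ev i) (2 *: ev j) _ h (root_axis j) he hh _ _ (w / 2).
  rewrite scalerA divfK; last exact: two.
  apply; last by [].
  by apply/and4P; split => //; apply: small_of_cmod; rewrite ?cmodN ?cmod0 //; lra.
have ge : entire (fun t => Phi (w *: ev j + t *: ev i)) by apply: entire_line.
rewrite addrC; apply: (entire_zero_near ge (_ : 0 < 3 / 8)); first by lra.
by move=> z z0 z1; rewrite addrC; apply: key; rewrite // -cmod_gt0.
Qed.

(* The reflection in the coordinates k and l has factor 1 along its fixed plane. *)
Definition trivial_reflection k l := exists u : V -> C^o,
  [/\ holomorphic u,
      forall (i j : 'I_4) ai aj s, uniq [:: i; j; k; l] ->
        Phi (ai *: ev i + aj *: ev j - s *: ev k) =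
        u (ai *: ev i + aj *: ev j + s *: ev k) * Phi (ai *: ev i + aj *: ev j + s *: ev k)
    & exists2 d : R, 0 < d & forall (i j : 'I_4) ai aj, uniq [:: i; j; k; l] ->
        cmod ai < d -> cmod aj < d -> u (ai *: ev i + aj *: ev j) = 1].

(** Through a point [a] of the plane of [e_i] and [e_j], the line in direction [e_k + e_i] has a
    double zero: ['d Phi a] kills [e_i] because the plane consists of zeros, and kills [e_k] because
    the reflection sending [e_k] to [- e_k] fixes the plane with factor 1. The third zero is where
    the line meets the plane of [e_j] and [e_k]. *)
Lemma solid_zero (i j k l : 'I_4) (x : 'rV[R[i]]_4) : uniq [:: i; j; k; l] -> trivial_reflection k l ->
  x 0 l = 0 -> Phi x = 0.
Proof.
move=> un [u [hu hD [d d0 hd]]] xl.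
have := un; rewrite /= !inE !negb_or => /and4P[/and3P[ij ik il] /andP[jk jl] kl _].
pose r : V := (1 + 'i) *: (ev k + ev i).
have rr : root_vector r by apply: root_plus; rewrite eq_sym.
have key ai aj z : ai != 0 -> cmod ai < 3 / 8 -> cmod ai < d -> cmod aj < d ->
    Phi (ai *: ev i + aj *: ev j + z *: r) = 0.
  move=> ai0 ai1 aid ajd; pose a : V := ai *: ev i + aj *: ev j.
  pose g w := Phi (a + w *: r); have ge : entire g by apply: entire_line.
  have g0 : g 0 = 0 by rewrite /g scale0r addr0 plane_zero.
  have dk : 'd Phi a (ev k) = 0.
    have c1 : cder (fun s => Phi (a + s *: ev k)) 0 ('d Phi a (ev k)).
      by have := @cder_line _ Phi a (ev k) 0 (hPhi _); rewrite scale0r addr0.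
    have c2 : cder (fun s => Phi (a + s *: - ev k)) 0 ('d Phi a (- ev k)).
      by have := @cder_line _ Phi a (- ev k) 0 (hPhi _); rewrite scale0r addr0.
    have [m c3] := entire_line a (ev k) hu 0.
    have e s : u (a + s *: ev k) * Phi (a + s *: ev k) = Phi (a + s *: - ev k).
      by rewrite scalerN -hD.
    have := cder_uniq (cder_ext e (cderM c3 c1)) c2.
    have A0 : a + 0 *: ev k = a by rewrite scale0r addr0.
    have ua : u a = 1 := hd _ _ _ _ un aid ajd.
    have Pa : Phi a = 0 := plane_zero ai aj ij.
    have dN : 'd Phi a (- ev k) = - 'd Phi a (ev k) := linearN _ _.
    rewrite A0 ua Pa dN mulr0 add0r mul1r.
    move=> /eqP; rewrite -subr_eq0 opprK -mulr2n -mulr_natr mulf_eq0 pnatr_eq0 orbF.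
    by move/eqP.
  have di : 'd Phi a (ev i) = 0.
    have c1 : cder (fun s => Phi (a + s *: ev i)) 0 ('d Phi a (ev i)).
      by have := @cder_line _ Phi a (ev i) 0 (hPhi _); rewrite scale0r addr0.
    apply: cder_uniq c1 _; apply: cder_ext (cder_cst 0 0) => s.
    by rewrite /a addrAC -scalerDl plane_zero.
  have gd : cder g 0 0.
    have A0 : a + 0 *: r = a by rewrite scale0r addr0.
    have dr : 'd Phi a r = (1 + 'i) *: ('d Phi a (ev k) + 'd Phi a (ev i)).
      exact: linear_scale_add.
    have := @cder_line _ Phi a r 0 (hPhi _); rewrite A0 dr dk di addr0 scaler0.
    exact.
  have z20 : - ai / (1 + 'i) != 0 by rewrite mulf_neq0 ?oppr_eq0 // invr_eq0 onei_neq0.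
  have g2 : g (- ai / (1 + 'i)) = 0.
    have e : a + (- ai / (1 + 'i)) *: r = aj *: ev j + (- ai) *: ev k.
      rewrite /r scalerA divfK; last exact: onei_neq0.
      rewrite scalerDr !scaleNr addrCA_sub; exact: erefl.
    by rewrite /g e plane_zero.
  have [h he hh] := factor3_double ge g0 gd g2 z20.
  apply: (root_line_zero rr he hh) => //=.
  have s0 : @small_point R 0 by apply: small_of_cmod; rewrite cmod0; lra.
  rewrite !s0 /= andbT; apply: small_of_cmod; rewrite cmodM cmodV cmodN.
  have : 1 <= cmod (1 + 'i : C) by apply: le_trans (Re_le_cmod _); rewrite /= addr0 normr1.
  move=> c1; rewrite ltr_pdivrMr; last by lra.
  apply: lt_le_trans ai1 _; have : 3 / 8 * 1 <= 3 / 8 * cmod (1 + 'i : C) by apply: ler_wpM2l => //; lra.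
  by rewrite mulr1.
have gen (y : 'rV[R[i]]_4) : y 0 l = 0 -> y 0 i != y 0 k -> Phi y = 0.
  move=> yl yik.
  pose ai := y 0 i - y 0 k; have ai0 : ai != 0 by rewrite subr_eq0.
  pose K := 1 + cmod ai + cmod (y 0 j).
  have K0 : 0 < K by rewrite /K -addrA ltr_pwDl // addr_ge0 ?cmod_ge0.
  pose dd := Num.min (3 / 8) d / K.
  have m0 : 0 < Num.min (3 / 8) d by rewrite lt_min d0 andbT; lra.
  have ge : entire (fun s => Phi (s *: y)).
    by move=> z; have [m hm] := entire_line 0 y hPhi z; exists m; apply: cder_ext hm => w; rewrite add0r.
  rewrite -[y]scale1r; apply: (entire_zero_near ge (_ : 0 < dd)); first exact: divr_gt0.
  move=> s s0 sd; have := ev_decomp y un; rewrite yl scale0r addr0 => ->.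
  have := key (s * ai) (s * y 0 j) (s * (y 0 k / (1 + 'i))).
  rewrite mulf_neq0 -?cmod_gt0 //; last by rewrite cmod_gt0.
  have sK c : 0 <= c -> c <= K -> cmod s * c < Num.min (3 / 8) d.
    move=> c0 cK; apply: le_lt_trans (_ : cmod s * K < _); first by apply: ler_wpM2l; rewrite ?cmod_ge0.
    by rewrite -ltr_pdivlMr.
  have := sK (cmod ai) (cmod_ge0 _); rewrite lt_min -cmodM /K => /(_ _)/andP.
  have := cmod_ge0 ai; have := cmod_ge0 (y 0 j) => q1 q2 /(_ ltac:(lra))[k1 k2].
  have := sK (cmod (y 0 j)) (cmod_ge0 _); rewrite lt_min -cmodM /K => /(_ ltac:(lra))/andP[_ k3].
  move=> /(_ isT k1 k2 k3) <-; congr (Phi _).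
  exact: solid_decomp.
(* The three zeros are distinct enough only if the coordinates [i] and [k] differ; otherwise the
   point is moved along [e_i]. *)
have [e|ne] := eqVneq (x 0 i) (x 0 k); last exact: gen.
have ge : entire (fun s => Phi (x + s *: ev i)) by apply: entire_line.
rewrite -[x]addr0 -(scale0r (ev i)); apply: (entire_zero_near ge ltr01) => s s0 _.
apply: gen; rewrite !mxE !eqxx /= ?(eq_sym l) ?(negbTE il) ?mulr0 ?addr0 //.
by rewrite (eq_sym k) (negbTE ik) mulr0 addr0 mulr1 e -subr_eq0 addrAC subrr add0r -cmod_gt0.
Qed.

(** The line [x + z (1,1,1,1)] meets the coordinate hyperplanes, where [Phi] vanishes, at
    [z = - x_l]. Three distinct small values suffice; smallness is reached by scaling [x],
    distinctness by moving it along [(0,1,2,3)]. *)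
Lemma theta_zero : (forall l : 'I_4, exists i j k, uniq [:: i; j; k; l] /\ trivial_reflection k l) ->
  forall x : 'rV[R[i]]_4, Phi x = 0.
Proof.
move=> htriv.
have hyp (x : 'rV[R[i]]_4) l : x 0 l = 0 -> Phi x = 0.
  by have [i [j [k [un tr]]]] := htriv l; apply: solid_zero un tr.
have small (x : 'rV[R[i]]_4) : (forall l, cmod (x 0 l) < 3 / 8) -> injective (x 0) -> Phi x = 0.
  move=> xs xi; pose g z := Phi (x + z *: (const_mx 1 : V)).
  have ge : entire g by apply: entire_line.
  have g0 l : g (- x 0 l) = 0 by apply: (hyp _ l); rewrite !mxE mulr1 subrr.
  pose i0 : 'I_4 := inord 0; pose i1 : 'I_4 := inord 1; pose i2 : 'I_4 := inord 2.
  have neq (a b : nat) : (a < 4)%N -> (b < 4)%N -> a != b -> x 0 (inord a) != x 0 (inord b).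
    move=> a4 b4; apply: contra => /eqP/xi e; apply/eqP.
    by rewrite -(@inordK 3 a) // e inordK.
  have [|h he hh] := factor3_distinct ge (g0 i0) (g0 i1) (g0 i2).
    by rewrite /= !inE !eqr_opp !negb_or !neq.
  rewrite -[x]addr0 -(scale0r (const_mx 1 : V)).
  apply: (root_line_zero root_diag he hh) => //=.
  by rewrite !small_of_cmod // cmodN.
have gen (x : 'rV[R[i]]_4) : injective (x 0) -> Phi x = 0.
  move=> xi; pose K := 1 + \sum_l cmod (x 0 l).
  have K0 : 0 < K by rewrite /K ltr_pwDl // sumr_ge0 // => l _; apply: cmod_ge0.
  have ge : entire (fun s => Phi (s *: x)).
    by move=> z; have [m hm] := entire_line 0 x hPhi z; exists m; apply: cder_ext hm => w; rewrite add0r.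
  rewrite -[x]scale1r; apply: (entire_zero_near ge (_ : 0 < 3 / 8 / K)); first by rewrite divr_gt0 //; lra.
  move=> s s0 sK; apply: small => [l|l m].
    rewrite mxE cmodM; apply: le_lt_trans (_ : cmod s * K < _).
      apply: ler_wpM2l; first exact: cmod_ge0.
      rewrite /K (bigD1 l) //= addrCA lerDl addr_ge0 // sumr_ge0 // => m _; apply: cmod_ge0.
    by rewrite -ltr_pdivlMr.
  by rewrite !mxE => /(mulfI (_ : s != 0)) h; apply: xi; apply: h; rewrite -cmod_gt0.
move=> x; pose w : 'rV[R[i]]_4 := \row_l (l%:R : C).
have ge : entire (fun s => Phi (x + s *: w)) by apply: entire_line.
(* The finitely many [s] for which two coordinates of [x + s w] agree. Diagonal pairs contribute
   only the value [0], and [d] is a lower bound for the moduli of the others. *)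
pose bad := [seq (x 0 p.1 - x 0 p.2) / (p.2%:R - p.1%:R) | p <- enum [the finType of ('I_4 * 'I_4)%type]].
have [d d0 hd] : exists2 d : R, 0 < d & forall s, s \in bad -> s != 0 -> d <= cmod s.
  elim: bad => [|b bad [d d0 hd]]; first by exists 1.
  exists (if b == 0 then d else Num.min d (cmod b)).
    by case: ifPn => // b0; rewrite lt_min d0 cmod_gt0.
  move=> s; rewrite inE => /orP[/eqP-> b0|sb s0]; first by rewrite (negbTE b0) ge_min lexx orbT.
  by case: ifPn => _; rewrite ?ge_min hd.
rewrite -[x]addr0 -(scale0r w); apply: (entire_zero_near ge d0) => s s0 sd.
apply: gen => l m; rewrite !mxE => e; apply/eqP/negPn/negP => lm.
have lm0 : (m%:R - l%:R : C) != 0 by rewrite subr_eq0 eqr_nat eq_sym.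
have se : s = (x 0 l - x 0 m) / (m%:R - l%:R).
  apply: (mulIf lm0); rewrite divfK //.
  have -> : x 0 l - x 0 m = (x 0 l + s * l%:R) - x 0 m - s * l%:R by ring.
  by rewrite e; ring.
have sbad : s \in bad by rewrite se; apply/mapP; exists (l, m) => //; rewrite mem_enum.
by have := hd s sbad; rewrite -cmod_gt0 => /(_ s0); rewrite leNgt sd.
Qed.

End ThetaZeros.

(** * Semi-invariants of the Pauli group *)

Section PauliSemiInvariants.
Variable R : realType.
Local Notation C := R[i].
Local Notation V := ('rV[R[i]]_4 : normedModType R[i]).

Definition o0 : 'I_4 := @Ordinal 4 0 isT.
Definition o1 : 'I_4 := @Ordinal 4 1 isT.
Definition o2 : 'I_4 := @Ordinal 4 2 isT.
Definition o3 : 'I_4 := @Ordinal 4 3 isT.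

Lemma ord4_ind (P : 'I_4 -> Prop) : P o0 -> P o1 -> P o2 -> P o3 -> forall i, P i.
Proof.
move=> p0 p1 p2 p3 [[|[|[|[|//]]]] h].
- by rewrite (_ : Ordinal h = o0) //; apply: val_inj.
- by rewrite (_ : Ordinal h = o1) //; apply: val_inj.
- by rewrite (_ : Ordinal h = o2) //; apply: val_inj.
- by rewrite (_ : Ordinal h = o3) //; apply: val_inj.
Qed.

Lemma sum4 (W : nmodType) (f : 'I_4 -> W) : \sum_(i < 4) f i = f o0 + f o1 + f o2 + f o3.
Proof.
rewrite !big_ord_recr big_ord0 /= add0r.
by congr (f _ + f _ + f _ + f _); apply: val_inj.
Qed.

Definition mono (s : 'I_4 -> 'I_4) (e : 'I_4 -> C) : 'M[C]_4 :=
  \matrix_(i, j) (e i * (j == s i)%:R).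

Lemma ev_mono i s e : ev R i *m mono s e = e i *: ev R (s i).
Proof. by rewrite -rowE; apply/rowP => j; rewrite !mxE !eqxx. Qed.

Lemma eq_mx_ev (M N : 'M[C]_4) : (forall i, ev R i *m M = ev R i *m N) -> M = N.
Proof. by move=> h; apply/row_matrixP => i; rewrite !rowE; exact: h. Qed.

Lemma monoM s e s' e' : mono s e *m mono s' e' = mono (s' \o s) (fun i => e i * e' (s i)).
Proof. by apply: eq_mx_ev => i; rewrite mulmxA !ev_mono -scalemxAl ev_mono scalerA. Qed.

Definition neg2 (k l i : 'I_4) : C := if (i == k) || (i == l) then -1 else 1.
Definition refl k l : 'M[C]_4 := mono id (neg2 k l).
Definition sw1 (i : 'I_4) : 'I_4 := nth o0 [:: o1; o0; o3; o2] i.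
Definition sw2 (i : 'I_4) : 'I_4 := nth o0 [:: o2; o3; o0; o1] i.
Definition perm1 : 'M[C]_4 := mono sw1 (fun=> 1).
Definition perm2 : 'M[C]_4 := mono sw2 (fun=> 1).

(** If the values at [0] differed, [K1] and [K2] would differ near [0], so [g] would vanish near [0]
    and hence everywhere. *)
Lemma cancel_continuous (K1 K2 g : C -> C) : ccont K1 0 -> ccont K2 0 -> entire g -> g 1 != 0 ->
  (forall z, K1 z * g z = K2 z * g z) -> K1 0 = K2 0.
Proof.
move=> c1 c2 ge g1 h; apply/eqP/negPn/negP => ne.
have e0 : 0 < cmod (K1 0 - K2 0) / 2 by rewrite divr_gt0 // cmod_gt0 subr_eq0.
have [d d0 hd] := ccontB c1 c2 e0.
move: g1; rewrite (entire_zero_near ge d0 _ 1) ?eqxx // => z _ zd.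
apply/eqP; have /eqP := h z; rewrite -subr_eq0 -mulrBl mulf_eq0 => /orP[/eqP k|//].
have := hd z; rewrite subr0 k sub0r cmodN => /(_ zd).
by have := cmod_gt0 (K1 0 - K2 0); rewrite subr_eq0 ne; lra.
Qed.

(** Klein's fundamental quadrics: quadratic forms in four variables split into ten distinct
    characters of the group of double sign changes and double transpositions. *)
Definition ten_quadrics (x : 'rV[R[i]]_4) : seq C :=
  let a := x 0 o0 in let b := x 0 o1 in let c := x 0 o2 in let d := x 0 o3 in
  [:: a ^+ 2 + b ^+ 2 + c ^+ 2 + d ^+ 2; a ^+ 2 - b ^+ 2 + c ^+ 2 - d ^+ 2;
      a ^+ 2 + b ^+ 2 - c ^+ 2 - d ^+ 2; a ^+ 2 - b ^+ 2 - c ^+ 2 + d ^+ 2;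
      a * b + c * d; a * b - c * d; a * c + b * d; a * c - b * d;
      a * d + b * c; a * d - b * c].

Definition quadric (k : nat) x : C := nth 0 (ten_quadrics x) k.

Lemma opp_eq0 (x : C) : x = - x -> x = 0.
Proof.
by move=> /eqP; rewrite -subr_eq0 opprK -mulr2n -mulr_natr mulf_eq0 pnatr_eq0 orbF => /eqP.
Qed.

(** The signs [a] and [b] decide which monomials survive: the four squares, or one of the three
    pairs such as [x_0 x_1] and [x_2 x_3]. Then [p] and [r] fix the coefficients up to a scalar,
    which gives [4 + 2 + 2 + 2] quadrics. Incompatible signs force [q = 0], covered by [e = 0]. *)
Lemma semi_invariant_quadric (q : 'rV[R[i]]_4 -> C) (c : 'I_4 -> 'I_4 -> C) (a b p r : C) :
  (forall i j, c i j = c j i) ->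
  (forall x, q x = \sum_(i < 4) \sum_(j < 4) c i j * x 0 i * x 0 j) ->
  a * a = 1 -> b * b = 1 -> p * p = 1 -> r * r = 1 ->
  (forall x, q (x *m refl o0 o1) = a * q x) -> (forall x, q (x *m refl o0 o2) = b * q x) ->
  (forall x, q (x *m perm1) = p * q x) -> (forall x, q (x *m perm2) = r * q x) ->
  exists k e, (k < 10)%N /\ forall x, q x = e * quadric k x.
Proof.
move=> cs qE aa bb pp rr ha hb hp hr.
have pm (x : C) : x * x = 1 -> x = 1 \/ x = -1.
  by move=> /eqP; rewrite -expr2 sqrf_eq1 => /orP[] /eqP; [left|right].
have qe i s : q (s *: ev R i) = s ^+ 2 * c i i.
  by rewrite qE !sum4 !mxE; elim/ord4_ind: i; rewrite /= !(mulr0n, mulr1n); ring.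
have qee i j s t : i != j -> q (s *: ev R i + t *: ev R j) = s ^+ 2 * c i i + t ^+ 2 * c j j + 2 * s * t * c i j.
  move=> ij; rewrite qE !sum4 !mxE; move: ij; elim/ord4_ind: i; elim/ord4_ind: j => // _;
    rewrite /= ?(cs o1 o0) ?(cs o2 o0) ?(cs o3 o0) ?(cs o2 o1) ?(cs o3 o1) ?(cs o3 o2); ring.
have diag s e m i : (forall x, q (x *m mono s e) = m * q x) -> e i ^+ 2 * c (s i) (s i) = m * c i i.
  by move=> /(_ (1 *: ev R i)); rewrite -scalemxAl ev_mono scalerA !qe expr1n !mul1r.
have off s e m i j : (forall x, q (x *m mono s e) = m * q x) -> i != j -> s i != s j ->
    e i * e j * c (s i) (s j) = m * c i j.
  move=> h ij sij; have := h (1 *: ev R i + 1 *: ev R j).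
  rewrite mulmxDl -!scalemxAl !ev_mono !scalerA !qee // !mul1r !expr1n !mul1r (diag _ _ _ _ h) (diag _ _ _ _ h).
  move=> e1; have two : (2 : C) != 0 by rewrite pnatr_eq0.
  apply: (mulfI two); transitivity (2 * e i * e j * c (s i) (s j)); first by ring.
  apply: (addrI (m * c i i + m * c j j)); rewrite e1; ring.
have p11 := diag _ _ _ o0 hp; have p22 := diag _ _ _ o0 hr; have p33 := diag _ _ _ o2 hp.
have pf01 := off _ _ _ o0 o1 hp isT isT; have rf01 := off _ _ _ o0 o1 hr isT isT.
have pf02 := off _ _ _ o0 o2 hp isT isT; have rf02 := off _ _ _ o0 o2 hr isT isT.
have pf03 := off _ _ _ o0 o3 hp isT isT; have rf03 := off _ _ _ o0 o3 hr isT isT.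
have a0 := diag _ _ _ o0 ha; have a1 := diag _ _ _ o1 ha; have a2 := diag _ _ _ o2 ha; have a3 := diag _ _ _ o3 ha.
have b0 := diag _ _ _ o0 hb; have b1 := diag _ _ _ o1 hb; have b2 := diag _ _ _ o2 hb; have b3 := diag _ _ _ o3 hb.
have a01 := off _ _ _ o0 o1 ha isT isT; have a02 := off _ _ _ o0 o2 ha isT isT; have a03 := off _ _ _ o0 o3 ha isT isT.
have a12 := off _ _ _ o1 o2 ha isT isT; have a13 := off _ _ _ o1 o3 ha isT isT; have a23 := off _ _ _ o2 o3 ha isT isT.
have b01 := off _ _ _ o0 o1 hb isT isT; have b02 := off _ _ _ o0 o2 hb isT isT; have b03 := off _ _ _ o0 o3 hb isT isT.
have b12 := off _ _ _ o1 o2 hb isT isT; have b13 := off _ _ _ o1 o3 hb isT isT; have b23 := off _ _ _ o2 o3 hb isT isT.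
move: p11 p22 p33 pf01 rf01 pf02 rf02 pf03 rf03.
move: a0 a1 a2 a3 b0 b1 b2 b3 a01 a02 a03 a12 a13 a23 b01 b02 b03 b12 b13 b23.
rewrite /neg2 /sw1 /sw2 /= !(sqrrN, expr1n, mul1r, mulr1, mulN1r, mulrN1, opprK).
move=> a0 a1 a2 a3 b0 b1 b2 b3 a01 a02 a03 a12 a13 a23 b01 b02 b03 b12 b13 b23.
move=> p11 p22 p33 pf01 rf01 pf02 rf02 pf03 rf03.
have nz (x : C) : - x = 1 * x -> x = 0 by rewrite mul1r => /esym; apply: opp_eq0.
have nz' (x : C) : x = -1 * x -> x = 0 by rewrite mulN1r; apply: opp_eq0.
have sym := (cs o1 o0, cs o2 o0, cs o3 o0, cs o2 o1, cs o3 o1, cs o3 o2).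
have [] := pm _ aa => ea; have [] := pm _ bb => eb; subst a b.
- have z := (nz _ a02, nz _ a03, nz _ a12, nz _ a13, nz _ b01, nz _ b23).
  have [] := pm _ pp => ep; have [] := pm _ rr => er; subst p r; [exists 0%N|exists 2%N|exists 1%N|exists 3%N];
    exists (c o0 o0); split => // x; rewrite qE !sum4 !sym !z p33 p11 p22 /quadric /=; ring.
- have z := (nz _ a02, nz _ a03, nz _ a12, nz _ a13, nz' _ b0, nz' _ b1, nz' _ b2, nz' _ b3).
  have [] := pm _ rr => er; subst r; [exists 4%N|exists 5%N];
    exists (2 * c o0 o1); split => // x; rewrite qE !sum4 !sym !z rf01 /quadric /=; ring.
- have z := (nz' _ a0, nz' _ a1, nz' _ a2, nz' _ a3, nz' _ a01, nz' _ a23, nz _ b03, nz _ b12).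
  have [] := pm _ pp => ep; subst p; [exists 6%N|exists 7%N];
    exists (2 * c o0 o2); split => // x; rewrite qE !sum4 !sym !z pf02 /quadric /=; ring.
- have z := (nz' _ a0, nz' _ a1, nz' _ a2, nz' _ a3, nz' _ a01, nz' _ a23, nz' _ b02, nz' _ b13).
  have [] := pm _ pp => ep; subst p; [exists 8%N|exists 9%N];
    exists (2 * c o0 o3); split => // x; rewrite qE !sum4 !sym !z pf03 /quadric /=; ring.
Qed.

Variable Phi : V -> C^o.
Hypotheses (hPhi : holomorphic Phi) (Phi0 : Phi 0 = 0).
Variable v0 : V.
Hypothesis Phiv0 : Phi v0 != 0.
Hypothesis hroot : forall l, root_vector l -> quasi_periodic2 Phi l.

Definition semi_invariant (M : 'M[C]_4) (u : V -> C^o) :=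
  [/\ holomorphic u, forall x, u x != 0 & forall x : 'rV[R[i]]_4, Phi (x *m M) = u x * Phi x].

Lemma line_scale (x v : 'rV[R[i]]_4) (M : 'M[C]_4) z : (x + z *: v) *m M = x *m M + z *: (v *m M).
Proof. by rewrite mulmxDl -scalemxAl. Qed.

(** The cocycle rule is clear where [Phi] does not vanish. The line from [a] to [v0] is not
    contained in the zero set, and [cancel_continuous] brings the rule back to [a]. *)
Lemma semi_mul M N u uM uN (a : 'rV[R[i]]_4) : semi_invariant (M *m N) u -> semi_invariant M uM -> semi_invariant N uN ->
  u a = uN (a *m M) * uM a.
Proof.
move=> [hu _ eu] [hM _ eM] [hN _ eN].
have := @cancel_continuous (fun z => u (a + z *: (v0 - a)))
   (fun z => uN ((a + z *: (v0 - a)) *m M) * uM (a + z *: (v0 - a))) (fun z => Phi (a + z *: (v0 - a))).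
rewrite scale0r addr0; apply.
- exact: entire_cont (entire_line _ _ hu).
- apply: ccontM; last exact: entire_cont (entire_line _ _ hM).
  rewrite (_ : (fun w => _) = (fun w => uN (a *m M + w *: ((v0 - a) *m M)))).
    exact: entire_cont (entire_line _ _ hN).
  by apply/funext => w; rewrite line_scale.
- exact: entire_line.
- by rewrite scale1r addrC subrK.
- by move=> z; rewrite -eu mulmxA eN eM mulrA.
Qed.

Lemma semi_one u (a : 'rV[R[i]]_4) : semi_invariant 1%:M u -> u a = 1.
Proof.
move=> [hu _ eu].
have := @cancel_continuous (fun z => u (a + z *: (v0 - a))) (fun=> 1) (fun z => Phi (a + z *: (v0 - a))).
rewrite scale0r addr0; apply.
- exact: entire_cont (entire_line _ _ hu).
- exact: ccont_cst.
- exact: entire_line.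
- by rewrite scale1r addrC subrK.
- by move=> z; rewrite -eu mulmx1 mul1r.
Qed.

(** Kept abstract to separate the analysis from matrix computations; it will be the group [(G,i)] in
    the coordinates of [Bmx]. *)
Variable pauli : 'M[C]_4 -> Prop.
Hypothesis pauliM : forall M N, pauli M -> pauli N -> pauli (M *m N).
Hypothesis pauli_refl : forall k l, k != l -> pauli (refl k l).
Hypotheses (pauli1 : pauli perm1) (pauli2 : pauli perm2).
Hypothesis hsemi : forall M, pauli M -> exists u, semi_invariant M u.

Lemma refl2 k l : refl k l *m refl k l = 1%:M.
Proof.
apply: eq_mx_ev => i; rewrite monoM ev_mono mulmx1 /neg2 /=.
by case: ifP => _; rewrite ?mulrNN mulr1 scale1r.
Qed.

Lemma perm1K : perm1 *m perm1 = 1%:M.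
Proof.
by apply: eq_mx_ev => i; rewrite monoM ev_mono mulmx1 mulr1 scale1r; congr ev; elim/ord4_ind: i; apply: val_inj.
Qed.

Lemma perm2K : perm2 *m perm2 = 1%:M.
Proof.
by apply: eq_mx_ev => i; rewrite monoM ev_mono mulmx1 mulr1 scale1r; congr ev; elim/ord4_ind: i; apply: val_inj.
Qed.

Lemma dPhi_semi M u : semi_invariant M u -> forall v : 'rV[R[i]]_4, 'd Phi 0 (v *m M) = u 0 * 'd Phi 0 v.
Proof.
move=> [hu _ eu] v.
have A0 : (0 : V) + 0 *: (v : V) = 0 by rewrite scale0r addr0.
have B0 : (0 : V) + 0 *: (v *m M : V) = 0 by rewrite scale0r addr0.
have c1 := @cder_line _ Phi 0 (v *m M) 0 (hPhi _).
have c2 := @cder_line _ Phi 0 v 0 (hPhi _).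
have [m c3] := entire_line 0 v hu 0.
rewrite A0 in c2; rewrite B0 in c1.
have e z : u (0 + z *: v) * Phi (0 + z *: v) = Phi (0 + z *: (v *m M)).
  by rewrite -eu line_scale mul0mx.
have := cder_uniq c1 (cder_ext e (cderM c3 c2)).
by rewrite A0 Phi0 mulr0 add0r.
Qed.

(** [refl o0 o1] has eigenvalue -1 on [e_0] and 1 on [e_2], so a semi-invariant linear form kills
    one of them; the double transpositions are transitive on the axes. *)
Lemma dPhi_zero v : 'd Phi 0 v = 0.
Proof.
have lin (c : C) x : 'd Phi 0 (c *: x) = c * 'd Phi 0 x := linearZ _ _.
have tr i j : 'd Phi 0 (ev R i) = 0 -> j \in [:: sw1 i; sw2 i; sw2 (sw1 i)] -> 'd Phi 0 (ev R j) = 0.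
  move=> h; have t1 k : 'd Phi 0 (ev R k) = 0 -> 'd Phi 0 (ev R (sw1 k)) = 0.
    have [u hu] := hsemi pauli1; have := dPhi_semi hu (ev R k).
    by rewrite ev_mono scale1r => -> ->; rewrite mulr0.
  have t2 k : 'd Phi 0 (ev R k) = 0 -> 'd Phi 0 (ev R (sw2 k)) = 0.
    have [u hu] := hsemi pauli2; have := dPhi_semi hu (ev R k).
    by rewrite ev_mono scale1r => -> ->; rewrite mulr0.
  by rewrite !inE => /or3P[] /eqP ->; [apply: t1|apply: t2|apply/t2/t1].
have [u hu] := hsemi (pauli_refl (isT : o0 != o1)).
have h0 := dPhi_semi hu (ev R o0); have h2 := dPhi_semi hu (ev R o2).
rewrite !ev_mono /neg2 /= !lin in h0 h2.
have [i hi] : exists i, 'd Phi 0 (ev R i) = 0.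
  have [e|ne] := eqVneq (u 0) 1.
    exists o0; move: h0; rewrite e mul1r mulN1r => /eqP; rewrite eq_sym -subr_eq0 opprK -mulr2n -mulr_natr mulf_eq0 pnatr_eq0 orbF.
    by move/eqP.
  exists o2; move: h2; rewrite mul1r => /eqP; rewrite -subr_eq0 -{1}['d Phi 0 (ev R o2)]mul1r -mulrBl mulf_eq0 subr_eq0 eq_sym (negbTE ne).
  by move/eqP.
have all j : 'd Phi 0 (ev R j) = 0.
  have [->//|ji] := eqVneq j i; apply: (tr i j hi).
  by move: ji; elim/ord4_ind: i {hi}; elim/ord4_ind: j.
rewrite (row_sum_delta v); rewrite [LHS](raddf_sum ('d Phi 0)) big1 // => j _.
by rewrite [LHS]lin [X in _ * X]all mulr0.
Qed.

Lemma second_semi M u : semi_invariant M u -> forall v : 'rV[R[i]]_4, second_order Phi (v *m M) = u 0 * second_order Phi v.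
Proof.
move=> [hu _ eu] v.
have [k1 [k1e <- h1]] := second_factor hPhi Phi0 dPhi_zero v.
have [k2 [k2e <- h2]] := second_factor hPhi Phi0 dPhi_zero (v *m M).
have ul := entire_line 0 v hu.
have := @cancel_continuous k2 (fun z => u (0 + z *: v) * k1 z) (fun z => z ^+ 2).
rewrite scale0r addr0; apply.
- exact: entire_cont.
- by apply: ccontM; apply: entire_cont.
- by move=> z; have [m hm] := cderX 2 (cder_id z); exists m.
- by rewrite expr1n oner_eq0.
- by move=> z; rewrite mulrC -h2 scalemxAl eu h1 add0r; ring.
Qed.

Lemma chi_sq M u : pauli M -> M *m M = 1%:M -> semi_invariant M u -> forall a : 'rV[R[i]]_4, u (a *m M) * u a = 1.
Proof.
move=> pM MM hu a; have [w hw] := hsemi (pauliM pM pM).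
by rewrite -(semi_mul a hw hu hu) (@semi_one w a) // -MM.
Qed.

(** On the plane fixed by the reflection the factor satisfies [u a * u a = 1]. It is 1 at the
    origin, so by continuity it cannot be -1 nearby. *)
Lemma trivial_reflection_intro k l u : k != l -> semi_invariant (refl k l) u -> u 0 = 1 ->
  trivial_reflection Phi k l.
Proof.
move=> kl hu u0; have [hu1 _ eu] := hu.
have reflk : ev R k *m refl k l = - ev R k by rewrite ev_mono /neg2 eqxx /= scaleN1r.
have reflo i : i != k -> i != l -> ev R i *m refl k l = ev R i.
  by move=> ik il; rewrite ev_mono /neg2 (negbTE ik) (negbTE il) /= scale1r.
have plane i j ai aj : uniq [:: i; j; k; l] -> (ai *: ev R i + aj *: ev R j) *m refl k l = ai *: ev R i + aj *: ev R j.
  rewrite /= !inE !negb_or => /and4P[/and3P[ij ik il] /andP[jk jl] _ _].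
  by rewrite mulmxDl -!scalemxAl !reflo.
exists u; split => //.
  move=> i j ai aj s un; rewrite -eu; congr (Phi _).
  by rewrite mulmxDl plane // -scalemxAl reflk scalerN.
have [d d0 hd] := hol_cont (hu1 0) (ltr01 : 0 < 1 :> R).
pose K := 1 + \sum_(i < 4) vnorm (ev R i).
have vK i : vnorm (ev R i) <= K.
  rewrite /K (bigD1 i) //= addrCA lerDl addr_ge0 // sumr_ge0 // => j _; exact: vnorm_ge0.
have K0 : 0 < K by rewrite /K ltr_pwDl // sumr_ge0 // => j _; exact: vnorm_ge0.
exists (d / (2 * K)); first by rewrite divr_gt0 // mulr_gt0.
move=> i j ai aj un hi hj; set a := _ + _.
have aM : a *m refl k l = a by apply: plane.
have := chi_sq (pauli_refl kl) (refl2 k l) hu a; rewrite aM => /eqP.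
rewrite -expr2 sqrf_eq1 => /orP[/eqP //|/eqP ua].
have ad : vnorm (a - 0) < d.
  rewrite subr0; apply: le_lt_trans (vnormD _ _) _; rewrite !vnormZ.
  have b c m : cmod c < d / (2 * K) -> cmod c * vnorm (ev R m) < d / 2.
    move=> hc; apply: le_lt_trans (_ : cmod c * K < _); first by apply: ler_wpM2l; rewrite ?cmod_ge0.
    by rewrite -ltr_pdivlMr // -mulrA -invfM.
  by have := b _ i hi; have := b _ j hj; lra.
have : (2%:R : R) <= 1%:R by have := hd a ad; rewrite u0 ua -opprD cmodN -[1 + 1]/(2%:R) cmod_nat.
by rewrite ler_nat.
Qed.

(** The left side changes the signs of the coordinates [k] and [k'], and [perm1] carries the pair
    [k''], [l] to this pair. At the origin it becomes a relation between characters. *)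
Lemma refl_relation l : exists k k' k'', [/\ uniq [:: k; k'; k''; l] &
  refl k l *m refl k' l = perm1 *m refl k'' l *m perm1].
Proof.
elim/ord4_ind: l; [exists o1, o2, o3|exists o0, o3, o2|exists o3, o0, o1|exists o2, o1, o0];
  split => //; apply: eq_mx_ev => i; rewrite !monoM !ev_mono;
  by elim/ord4_ind: i; rewrite /neg2 /= !(mulr1, mul1r, mulrN1, opprK, mulN1r);
    (do 2 f_equal); apply: val_inj.
Qed.

(** At the origin the three factors are signs, and by [refl_relation] the third is the product of
    the other two, so they cannot all be -1. *)
Lemma some_trivial_reflection l : exists i j k, uniq [:: i; j; k; l] /\ trivial_reflection Phi k l.
Proof.
have [k [k' [k'' [un rel]]]] := refl_relation l.
have := un; rewrite /= !inE !negb_or => /and4P[/and3P[kk' kk'' kl] /andP[kk''' k'l] k''l _].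
have [u hu] := hsemi (pauli_refl kl); have [u' hu'] := hsemi (pauli_refl k'l).
have [u'' hu''] := hsemi (pauli_refl k''l); have [p hp] := hsemi pauli1.
have [w hw] := hsemi (pauliM (pauli_refl kl) (pauli_refl k'l)).
have [w' hw'] := hsemi (pauliM pauli1 (pauli_refl k''l)).
have e1 := semi_mul 0 hw hu hu'; rewrite mul0mx in e1.
have hw2 := hw; rewrite rel in hw2.
have e2 := semi_mul 0 hw2 hw' hp; rewrite mul0mx in e2.
have e3 := semi_mul 0 hw' hp hu''; rewrite mul0mx in e3.
have sq := chi_sq (pauli_refl kl) (refl2 k l) hu 0; rewrite mul0mx in sq.
have sq' := chi_sq (pauli_refl k'l) (refl2 k' l) hu' 0; rewrite mul0mx in sq'.
have sp := chi_sq pauli1 perm1K hp 0; rewrite mul0mx in sp.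
have e4 : u' 0 * u 0 = u'' 0 by rewrite -e1 e2 e3 mulrCA sp mulr1.
have [h|h] := eqVneq (u 0) 1.
  exists k', k'', k; split; last exact: trivial_reflection_intro hu h.
  by rewrite /= !inE !negb_or kk''' k'l (eq_sym k') kk' (eq_sym k'') kk'' k''l kl.
have [h'|h'] := eqVneq (u' 0) 1.
  exists k, k'', k'; split; last exact: trivial_reflection_intro hu' h'.
  by rewrite /= !inE !negb_or kk' kk'' kl k'l (eq_sym k'') kk''' k''l.
exists k, k', k''; split => //; apply: trivial_reflection_intro hu'' _ => //.
have m (x : C) : x * x = 1 -> x != 1 -> x = -1.
  by move=> /eqP; rewrite -expr2 sqrf_eq1 => /orP[/eqP->|/eqP//]; rewrite eqxx.
by rewrite -e4 (m _ sq h) (m _ sq' h') mulrNN mulr1.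
Qed.

Lemma second_order_neq0 : exists v, second_order Phi v != 0.
Proof.
apply: contrapT => /forallNP h.
have so v : second_order Phi v = 0 by apply/eqP/negPn/negP; exact: h.
move/eqP: Phiv0; apply.
exact: (theta_zero hPhi Phi0 hroot dPhi_zero so some_trivial_reflection).
Qed.

Lemma second_order_ten : exists k e, [/\ (k < 10)%N, e != 0 &
  forall x : 'rV[R[i]]_4, second_order Phi x = e * quadric k x].
Proof.
have [c [cs qE]] := second_order_quadratic hPhi Phi0 dPhi_zero.
have sq M u : pauli M -> M *m M = 1%:M -> semi_invariant M u -> u 0 * u 0 = 1.
  by move=> pM MM hu; have := chi_sq pM MM hu 0; rewrite mul0mx.
have [u1 hu1] := hsemi (pauli_refl (isT : o0 != o1)); have [u2 hu2] := hsemi (pauli_refl (isT : o0 != o2)).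
have [u3 hu3] := hsemi pauli1; have [u4 hu4] := hsemi pauli2.
have [k [e [k10 he]]] := semi_invariant_quadric cs qE
  (sq _ _ (pauli_refl (isT : o0 != o1)) (refl2 o0 o1) hu1) (sq _ _ (pauli_refl (isT : o0 != o2)) (refl2 o0 o2) hu2)
  (sq _ _ pauli1 perm1K hu3) (sq _ _ pauli2 perm2K hu4)
  (second_semi hu1) (second_semi hu2) (second_semi hu3) (second_semi hu4).
exists k, e; split => //; apply/eqP => e0.
by have [v] := second_order_neq0; rewrite he e0 mul0r eqxx.
Qed.

End PauliSemiInvariants.

(** * Gaussian integer matrices as lists, for computation *)

Section GaussianLists.
Import BinInt.

(** Binary integers in lists reduce well under [vm_compute]; [gc], [rvec] and [mxr] carry the
    results over to [R[i]]. *)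
Definition gi := (Z * Z)%type.
Definition g0 : gi := (0%Z, 0%Z).
Definition g1 : gi := (1%Z, 0%Z).
Definition gadd (p q : gi) : gi := (Z.add p.1 q.1, Z.add p.2 q.2).
Definition gmul (p q : gi) : gi :=
  (Z.sub (Z.mul p.1 q.1) (Z.mul p.2 q.2), Z.add (Z.mul p.1 q.2) (Z.mul p.2 q.1)).
Definition gconj (p : gi) : gi := (p.1, Z.opp p.2).
Definition vadd (u v : seq gi) := [seq gadd p.1 p.2 | p <- zip u v].
Definition vecm (u : seq gi) (A : seq (seq gi)) : seq gi :=
  foldr (fun p acc => vadd [seq gmul p.1 x | x <- p.2] acc) [:: g0; g0; g0; g0] (zip u A).
Definition mulm (A B : seq (seq gi)) := [seq vecm u B | u <- A].
Definition ctr (A : seq (seq gi)) := [seq [seq gconj (nth g0 u j) | u <- A] | j <- [:: 0; 1; 2; 3]%N].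
Definition wf (A : seq (seq gi)) := (size A == 4) && all (fun u => size u == 4) A.

Lemma size4 (T : Type) (s : seq T) : size s = 4%N -> exists a b c d, s = [:: a; b; c; d].
Proof. by case: s => [|a [|b [|c [|d []]]]] // _; exists a, b, c, d. Qed.

Variable R : realType.
Local Notation C := R[i].

Definition zr (z : Z) : R := (int_of_Z z)%:~R.
Definition gc (p : gi) : C := zr p.1 +i* zr p.2.

Lemma zrD x y : zr (Z.add x y) = zr x + zr y.
Proof. by rewrite /zr -[Z.add x y]/(x + y) rmorphD /= rmorphD. Qed.

Lemma zrM x y : zr (Z.mul x y) = zr x * zr y.
Proof. by rewrite /zr -[Z.mul x y]/(x * y) rmorphM /= rmorphM. Qed.

Lemma zrN x : zr (Z.opp x) = - zr x.
Proof. by rewrite /zr -[Z.opp x]/(- x) rmorphN /= rmorphN. Qed.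

Lemma zr_inj : injective zr.
Proof. by move=> x y /intr_inj/(can_inj int_of_ZK). Qed.

Lemma gcD p q : gc (gadd p q) = gc p + gc q.
Proof. by rewrite /gc /= !zrD. Qed.

Lemma gcM p q : gc (gmul p q) = gc p * gc q.
Proof.
case: p q => [a b] [c d]; rewrite /gc /gmul /=.
by rewrite -[Z.sub _ _]/(Z.add _ (Z.opp (Z.mul b d))) !zrD zrN !zrM; simpc.
Qed.

Lemma gcJ p : gc (gconj p) = (gc p)^*%C.
Proof. by rewrite /gc /= zrN. Qed.

Lemma gc0 : gc g0 = 0. Proof. by []. Qed.
Lemma gc1 : gc g1 = 1. Proof. by []. Qed.

Lemma gc_inj : injective gc.
Proof. by move=> [a b] [c d] [/zr_inj -> /zr_inj ->]. Qed.

Lemma gaussInt_gc z : gaussInt z -> exists p, z = gc p.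
Proof.
case: z => x y; rewrite /gaussInt /= => /andP[/intrP[m ->] /intrP[n ->]].
by exists (Z_of_int m, Z_of_int n); rewrite /gc /zr /= !Z_of_intK.
Qed.

Lemma gc_gaussInt p : gaussInt (gc p).
Proof. by rewrite /gaussInt /= /zr !intr_int. Qed.

Definition rvec (u : seq gi) : 'rV[C]_4 := \row_j gc (nth g0 u j).
Definition mxr (A : seq (seq gi)) : 'M[C]_4 := \matrix_(i, j) gc (nth g0 (nth [::] A i) j).

Lemma vecm_size u A : wf A -> size (vecm u A) = 4%N.
Proof.
move=> /andP[_ /allP h]; rewrite /vecm.
elim: u A h => [|p u IH] [|v A] h //=; rewrite /vadd size_map size_zip size_map (eqP (h v _)) ?inE ?eqxx //.
by rewrite IH // => w wA; apply: h; rewrite inE wA orbT.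
Qed.

Lemma rvec_vecm u A : size u = 4%N -> wf A -> rvec (vecm u A) = rvec u *m mxr A.
Proof.
move=> /size4[a [b [c [d ->]]]] /andP[/eqP/size4[u1 [u2 [u3 [u4 ->]]]] /=].
move=> /and5P[/eqP/size4[? [? [? [? ->]]]] /eqP/size4[? [? [? [? ->]]]]
  /eqP/size4[? [? [? [? ->]]]] /eqP/size4[? [? [? [? ->]]]] _].
apply/rowP => j; rewrite !mxE sum4 !mxE /vecm /=.
by elim/ord4_ind: j => /=; rewrite !gcD !gcM gc0 addr0 !addrA.
Qed.

Lemma row_mxr A i : row i (mxr A) = rvec (nth [::] A i).
Proof. by apply/rowP => j; rewrite !mxE. Qed.

Lemma wf_nth A (i : 'I_4) : wf A -> size (nth [::] A i) = 4%N.
Proof. by move=> /andP[/eqP s /allP h]; apply/eqP/h/mem_nth; rewrite s. Qed.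

Lemma wf_mulm A B : wf A -> wf B -> wf (mulm A B).
Proof.
move=> /andP[/eqP sA _] wB; rewrite /wf size_map sA eqxx /=.
by apply/allP => _ /mapP[u _ ->]; rewrite vecm_size.
Qed.

Lemma mxrM A B : wf A -> wf B -> mxr (mulm A B) = mxr A *m mxr B.
Proof.
move=> wA wB; apply/row_matrixP => i; rewrite row_mul !row_mxr -rvec_vecm ?wf_nth //.
by rewrite /mulm (nth_map [::]) //; case/andP: wA => /eqP ->.
Qed.

Lemma wf_ctr A : wf A -> wf (ctr A).
Proof. by move=> /andP[/eqP sA _]; rewrite /wf /ctr /= !size_map sA. Qed.

Lemma mxr_ctr A : wf A -> mxr (ctr A) = (map_mx (@conjc R) (mxr A))^T.
Proof.
move=> /andP[/eqP/size4[u1 [u2 [u3 [u4 ->]]]] _].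
by apply/matrixP => i j; rewrite !mxE -gcJ; elim/ord4_ind: i; elim/ord4_ind: j.
Qed.

Lemma rvec_inj u v : size u = 4%N -> size v = 4%N -> rvec u = rvec v -> u = v.
Proof.
move=> su sv /rowP h; apply: (@eq_from_nth _ g0) => [|i]; rewrite su ?sv // => i4.
by have := h (Ordinal i4); rewrite !mxE => /gc_inj.
Qed.

Lemma mxr_inj A B : wf A -> wf B -> mxr A = mxr B -> A = B.
Proof.
move=> wA wB h; have [/eqP sA _] := andP wA; have [/eqP sB _] := andP wB.
apply: (@eq_from_nth _ [::]) => [|i]; rewrite sA ?sB // => i4.
apply: rvec_inj; [exact: (wf_nth (Ordinal i4) wA)|exact: (wf_nth (Ordinal i4) wB)|].
by rewrite -!(row_mxr _ (Ordinal i4)) h.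
Qed.

Lemma mxOver_mxr M : M \is a mxOver (@gaussInt R) -> exists2 A, wf A & M = mxr A.
Proof.
move=> /mxOverP h; have [f hf] := choice (fun p : 'I_4 * 'I_4 => gaussInt_gc (h p.1 p.2)).
exists [seq [seq f (i, j) | j <- [:: o0; o1; o2; o3]] | i <- [:: o0; o1; o2; o3]] => //.
by apply/matrixP => i j; rewrite mxE (hf (i, j)); elim/ord4_ind: i; elim/ord4_ind: j.
Qed.

Lemma mxr_over A : mxr A \is a mxOver (@gaussInt R).
Proof. by apply/mxOverP => i j; rewrite mxE; apply: gc_gaussInt. Qed.

End GaussianLists.

(** * Computed tables for the unitary group: roots, stabilizer, kernel *)

Section UnitaryData.
Import BinInt.
Local Open Scope Z_scope.

Definition gI : gi := (0, 1).
Definition id4 : seq (seq gi) := [:: [:: g1; g0; g0; g0]; [:: g0; g1; g0; g0]; [:: g0; g0; g1; g0]; [:: g0; g0; g0; g1]].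
Definition H4 : seq (seq gi) :=
  [:: [:: (2,0); (0,0); (1,0); (1,1)]; [:: (0,0); (2,0); (1,1); (0,-1)];
      [:: (1,0); (1,-1); (2,0); (0,0)]; [:: (1,-1); (0,1); (0,0); (2,0)]].
(* Reflections, mapped to the transpositions (1 2), (2 3), (3 4), (4 6), (5 6) of the y_j. *)
Definition gens4 : seq (seq (seq gi)) := [::
  [:: [:: (1,1); (0,1); (0,-1); (0,-1)]; [:: (-1,0); (0,0); (1,0); (1,0)];
      [:: (0,1); (0,1); (1,-1); (0,-1)]; [:: (1,0); (1,0); (-1,0); (0,0)]];
  [:: [:: (1,0); (0,0); (0,0); (0,0)]; [:: (0,-1); (1,-1); (-1,1); (0,1)];
      [:: (0,-1); (0,-1); (0,1); (0,1)]; [:: (1,0); (1,0); (-1,-1); (0,0)]];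
  [:: [:: (0,0); (-1,1); (1,0); (0,0)]; [:: (-1,-1); (-1,0); (1,1); (0,0)];
      [:: (-1,0); (-1,1); (2,0); (0,0)]; [:: (0,0); (0,0); (0,0); (1,0)]];
  [:: [:: (0,1); (-1,0); (1,0); (1,-1)]; [:: (0,0); (1,0); (0,0); (0,0)];
      [:: (0,0); (0,0); (1,0); (0,0)]; [:: (1,1); (0,1); (0,-1); (0,-1)]];
  [:: [:: (1,0); (0,0); (0,0); (0,0)]; [:: (-1,-1); (0,0); (1,1); (0,1)];
      [:: (0,0); (0,0); (1,0); (0,0)]; [:: (1,-1); (0,-1); (-1,1); (0,0)]]].

End UnitaryData.

Section UnitaryWords.
Local Open Scope nat_scope.

Definition gen (k : nat) := nth id4 gens4 k.
Definition wmat (w : seq nat) := foldr (fun k A => mulm (gen k) A) id4 w.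

Definition row0 := [:: g1; g0; g0; g0].

Section Closure.
Variables (T : eqType) (act : T -> nat -> T) (gs : seq nat).

Definition extend (acc : seq (T * seq nat)) (p : T * seq nat) (k : nat) :=
  let b := act p.1 k in if b \in [seq q.1 | q <- acc] then None else Some (b, rcons p.2 k).

(** Breadth-first search: [acc] holds the elements found, each with a word that reaches it, [fr] is
    the last layer and [new] collects the next one. The outcome is certified afterwards, when
    [tables_ok] recomputes every word. *)
Fixpoint closure_step (acc fr new : seq (T * seq nat)) (todo : seq nat) :=
  if fr is p :: fr' then
    foldl (fun st k => if extend st.1 p k is Some q then (q :: st.1, q :: st.2) else st)
      (closure_step acc fr' new todo) todo
  else (acc, new).

Fixpoint closure_from n (acc fr : seq (T * seq nat)) :=
  if n is m.+1 then let st := closure_step acc fr [::] gs in closure_from m st.1 st.2 else acc.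

End Closure.

Definition orbit0 := closure_from (fun u k => vecm u (gen k)) [:: 0; 1; 2; 3; 4] 11 [:: (row0, [::])] [:: (row0, [::])].
(** Generators and conjugates of generators, hence reflections, that fix the row [(1,0,0,0)]. *)
Definition stab_words : seq (seq nat) := [:: [:: 1]; [:: 4]; [:: 2; 3; 2]; [:: 0; 1; 2; 1; 0]].
Definition stab0 := closure_from (fun A k => mulm A (wmat (nth [::] stab_words k))) [:: 0; 1; 2; 3] 30 [:: (id4, [::])] [:: (id4, [::])].

End UnitaryWords.

Section UnitaryChecks.
Import BinInt.
Local Open Scope Z_scope.

(** [B4] times its conjugate transpose is [2 H], and [F4] is twice its inverse. So vectors with
    [H(u,u) = 2] become Gaussian vectors of standard square 4, a finite search space. The entries
    are units, which later turns translations by the rows into half-period shifts of theta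
    functions. *)
Definition B4 : seq (seq gi) :=
  [:: [:: (0,1); (-1,0); (0,-1); (-1,0)]; [:: (-1,0); (1,0); (0,-1); (0,1)];
      [:: (0,1); (0,-1); (0,-1); (0,1)]; [:: (1,0); (0,1); (0,-1); (-1,0)]].
Definition F4 : seq (seq gi) :=
  [:: [:: (-1,0); (-1,0); (1,0); (1,0)]; [:: (-1,0); (0,-1); (0,1); (1,0)];
      [:: (-1,0); (0,1); (1,0); (0,1)]; [:: (-1,0); (1,0); (0,-1); (0,1)]].

Definition gnorm (p : gi) : Z := Z.add (Z.mul p.1 p.1) (Z.mul p.2 p.2).
Definition small_gi : seq gi :=
  [seq p <- [seq (a, b) | a <- [:: -2; -1; 0; 1; 2], b <- [:: -2; -1; 0; 1; 2]] | Z.leb (gnorm p) 4].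
Definition half_gi (p : gi) : gi := (Z.div p.1 2, Z.div p.2 2).
Definition double (p : gi) : gi := gadd p p.

End UnitaryChecks.

Section UnitaryWordChecks.
Import BinInt.
Local Open Scope nat_scope.

(** All Gaussian vectors of square 4 are tried, and those in the image of the lattice are recognized
    by [y] being even: [half_gi] rounds, and doubling again tests divisibility. Nested [if]s are
    used because [vm_compute] would evaluate both arguments of a boolean connective. *)
Definition roots_complete (roots : seq (seq gi)) := all (fun a => all (fun b => all (fun c => all (fun d =>
    if Z.eqb (Z.add (gnorm a) (Z.add (gnorm b) (Z.add (gnorm c) (gnorm d)))) 4%Z then
      let y := vecm [:: a; b; c; d] F4 in let h := map half_gi y in
      if map double h == y then h \in roots else true
    else true)
  small_gi) small_gi) small_gi) small_gi.

Definition herm (u v : seq gi) : gi :=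
  foldr (fun p s => gadd (gmul p.1 (gconj p.2)) s) g0 (zip (vecm u H4) v).
Definition hentry i j := nth g0 (nth [::] H4 i) j.

Definition with_row0 (roots : seq (seq gi)) (i : nat) := [seq r <- roots | herm r row0 == hentry i 0].
(** The rows of a unitary matrix have [H]-square 2, hence are roots, and their mutual products are
    prescribed. With first row [row0] the others are chosen one after the other, so that most
    branches die early. *)
Definition stab_complete (roots : seq (seq gi)) (stab : seq (seq (seq gi))) :=
  let c2 := with_row0 roots 2 in let c3 := with_row0 roots 3 in
  all (fun a => all (fun b => if herm b a == hentry 2 1 then
    all (fun c => if herm c a == hentry 3 1 then if herm c b == hentry 3 2 then
      [:: row0; a; b; c] \in stab else true else true) c3 else true) c2) (with_row0 roots 1).

Definition orbit_ok := all (fun p : seq gi * seq nat => nth [::] (wmat p.2) 0 == p.1).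
Definition stab_word (w : seq nat) := flatten [seq nth [::] stab_words k | k <- w].
Definition stab_ok := all (fun p : seq (seq gi) * seq nat => wmat (stab_word p.2) == p.1).
Definition swap2 (p : nat * nat) (j : nat) := if j == p.1 then p.2 else if j == p.2 then p.1 else j.
Definition transp := [:: (0, 1); (1, 2); (2, 3); (3, 5); (4, 5)].
Definition word_perm (w : seq nat) (j : nat) := foldl (fun j k => swap2 (nth (0, 0) transp k) j) j w.
Definition perm_list w := map (word_perm w) [:: 0; 1; 2; 3; 4; 5].

(* Words for the five T_j and for multiplication by i. *)
Definition twords := [:: [:: 0; 2; 1; 3; 1; 3; 2; 0]; [:: 0; 3; 1; 3; 4; 1; 4; 0]; [:: 0; 2; 0; 2];
  [:: 2; 3; 1; 3; 4; 1; 4; 2]; [:: 1; 3; 1; 3]; [:: 0; 1; 3; 1; 2; 0; 3; 1; 4; 1; 2; 4; 3; 2]].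
Definition tmat k := wmat (nth [::] twords k).
Definition tprod w := foldl (fun A k => mulm A (tmat k)) id4 w.
Definition group0 := closure_from (fun A k => mulm A (tmat k)) [:: 0; 1; 2; 3; 4; 5] 10 [:: (id4, [::])] [:: (id4, [::])].
Definition group_ok := all (fun p : seq (seq gi) * seq nat => tprod p.2 == p.1).

(** The generators are involutions, so [p ++ q] acts trivially on the letters exactly when [p] and
    [rev q] induce the same permutation. Matrices are multiplied only for such pairs. *)
Definition kernel_ok (sw ow : seq (seq nat)) (gl : seq (seq (seq gi))) :=
  let rows := [seq (perm_list (rev q), q) | q <- ow] in
  all (fun p => let l := perm_list p in
    all (fun r : seq nat * seq nat => if l == r.1 then wmat (p ++ r.2) \in gl else true) rows) sw.

Definition unitary4 (A : seq (seq gi)) := mulm (mulm A H4) (ctr A) == H4.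

Definition tables_ok orb stab grp :=
  [&& roots_complete [seq p.1 | p <- orb],
      stab_complete [seq p.1 | p <- orb] [seq p.1 | p <- stab],
      orbit_ok orb, stab_ok stab, group_ok grp &
      kernel_ok [seq stab_word p.2 | p <- stab] [seq p.2 | p <- orb] [seq p.1 | p <- grp]].

(* Kept existential: unification must never unfold the tables. *)
Lemma tablesP : exists orb stab grp, tables_ok orb stab grp.
Proof. by exists orbit0, stab0, group0; vm_compute. Qed.

Definition N4 : seq (seq gi) :=
  [:: [:: (1%Z,0%Z); (-1,0)%Z; (0,0)%Z; (0,-1)%Z]; [:: (0,-1)%Z; (0,0)%Z; (0,1)%Z; (0,1)%Z];
      [:: (0,-1)%Z; (-1,0)%Z; (1,1)%Z; (0,0)%Z]; [:: (1,0)%Z; (-1,1)%Z; (0,0)%Z; (-1,-1)%Z]].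
Definition N4inv : seq (seq gi) :=
  [:: [:: (1,1)%Z; (0,0)%Z; (0,0)%Z; (0,-1)%Z]; [:: (0,0)%Z; (-1,-1)%Z; (0,1)%Z; (0,-1)%Z];
      [:: (0,1)%Z; (-1,0)%Z; (1,0)%Z; (0,-1)%Z]; [:: (1,0)%Z; (1,-1)%Z; (-1,0)%Z; (0,0)%Z]].
Definition T4 : seq (seq gi) :=
  [:: [:: (1,0)%Z; (0,0)%Z; (0,0)%Z; (0,0)%Z]; [:: (0,0)%Z; (-1,0)%Z; (0,0)%Z; (0,0)%Z];
      [:: (0,0)%Z; (-1,1)%Z; (1,0)%Z; (0,0)%Z]; [:: (1,-1)%Z; (0,0)%Z; (0,0)%Z; (-1,0)%Z]].
Definition npow j := iter j (mulm N4) id4.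

(** The relation [T_j N^j = N^j T_0] characterizes [T_j] without inverse powers. *)
Lemma Tmx_ok : [&& mulm N4 N4inv == id4,
  all (fun j => mulm (tmat j) (npow j) == mulm (npow j) T4) [:: 0; 1; 2; 3; 4] &
  tmat 5 == [seq [seq gmul gI x | x <- u] | u <- id4]].
Proof. by vm_compute. Qed.

Lemma twords_perm : all (fun w => perm_list w == [:: 0; 1; 2; 3; 4; 5]) twords.
Proof. by vm_compute. Qed.

Lemma gens_ok : all (fun A => [&& wf A, unitary4 A & mulm A A == id4]) gens4.
Proof. by vm_compute. Qed.
Lemma B4_ok : [&& wf B4, wf F4, mulm B4 (ctr B4) == [seq [seq double x | x <- u] | u <- H4],
  mulm B4 F4 == [seq [seq double x | x <- u] | u <- id4] & mulm F4 B4 == [seq [seq double x | x <- u] | u <- id4]].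
Proof. by vm_compute. Qed.

End UnitaryWordChecks.

(** * Words in the generators are unitary *)

Section UnitaryGroup.
Variable R : realType.
Local Notation C := R[i].
Local Notation mxr := (@mxr R).
Local Notation rvec := (@rvec R).

Lemma Hmx_mxr : Hmx R = mxr H4.
Proof.
apply/matrixP => i j; rewrite !mxE.
by elim/ord4_ind: i; elim/ord4_ind: j; apply/eqP; rewrite eq_complex /gc /zr /= ?oppr0 ?addr0 ?add0r ?sub0r ?subr0 ?eqxx.
Qed.

Lemma wf_gen k : wf (gen k).
Proof. by do 6?[case: k => [|k] //]. Qed.

Lemma wf_id4 : wf id4. Proof. by []. Qed.

Lemma wf_wmat w : wf (wmat w).
Proof. by elim: w => [|k w IH] //=; apply: wf_mulm => //; apply: wf_gen. Qed.

Lemma mxr_id4 : mxr id4 = 1%:M.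
Proof.
by apply/matrixP => i j; rewrite !mxE; elim/ord4_ind: i; elim/ord4_ind: j.
Qed.

Lemma mxr_gen2 k : mxr (gen k) *m mxr (gen k) = 1%:M.
Proof.
rewrite -mxrM ?wf_gen // -mxr_id4; congr mxr.
by do 6?[case: k => [|k] //]; apply/eqP; have /allP h := gens_ok; apply/implyP; rewrite /=.
Qed.

Lemma mxr_wmat_cat w1 w2 : mxr (wmat (w1 ++ w2)) = mxr (wmat w1) *m mxr (wmat w2).
Proof.
elim: w1 => [|k w IH] /=; first by rewrite mxr_id4 mul1mx.
by rewrite !mxrM ?wf_gen ?wf_wmat // IH mulmxA.
Qed.

Lemma mxr_wmat_rev w : mxr (wmat w) *m mxr (wmat (rev w)) = 1%:M.
Proof.
elim: w => [|k w IH] /=; first by rewrite mxr_id4 mul1mx.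
rewrite rev_cons -cats1 mxr_wmat_cat /= !mxrM ?wf_gen ?wf_wmat // mxr_id4 mulmx1.
by rewrite mulmxA -(mulmxA (mxr (gen k))) IH mulmx1 mxr_gen2.
Qed.

Lemma UH_mxr A : wf A -> unitary4 A ->
  (exists2 A', mxr A' *m mxr A = 1%:M & wf A') -> UH (mxr A).
Proof.
move=> wA /eqP uA [A' h wA']; have h' := mulmx1C h.
have uM : mxr A \in unitmx by case/mulmx1_unit: h.
split; last by rewrite Hmx_mxr -mxr_ctr // -!mxrM ?wf_ctr ?wf_mulm // uA.
have e : invmx (mxr A) = mxr A' by rewrite -[LHS]mul1mx -h -mulmxA mulmxV // mulmx1.
by split; rewrite ?e ?mxr_over.
Qed.

Lemma UH_gen k : UH (mxr (gen k)).
Proof.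
apply: UH_mxr; [exact: wf_gen| |by exists (gen k); [exact: mxr_gen2|exact: wf_gen]].
do 5?[case: k => [|k]; first by have /and5P[] := gens_ok => *; apply/eqP; vm_compute].
by rewrite /gen /= nth_nil; vm_compute.
Qed.

Lemma UH_mul (M N : 'M[C]_4) : UH M -> UH N -> UH (M *m N).
Proof.
move=> [[M1 M2 M3] M4] [[N1 N2 N3] N4].
have ov (X Y : 'M[C]_4) : X \is a mxOver (@gaussInt R) -> Y \is a mxOver (@gaussInt R) ->
    X *m Y \is a mxOver (@gaussInt R).
  by move=> /mxOver_mxr[A wA ->] /mxOver_mxr[A' wA' ->]; rewrite -mxrM // mxr_over.
split; last first.
  by rewrite map_mxM trmx_mul -{2}M4 -{2}N4 !mulmxA.
split; [exact: ov|by rewrite unitmx_mul M2|].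
have -> : invmx (M *m N) = invmx N *m invmx M.
  have u : M *m N \in unitmx by rewrite unitmx_mul M2.
  by apply: (can_inj (mulKmx u)); rewrite mulmxV // mulmxA mulmxK // mulmxV.
exact: ov N3 M3.
Qed.

Lemma UH1 : UH (1%:M : 'M[C]_4).
Proof.
rewrite -mxr_id4; apply: UH_mxr; [by []|by vm_compute|].
by exists id4 => //; rewrite mxr_id4 mul1mx.
Qed.

Lemma UH_inv (M : 'M[C]_4) : UH M -> UH (invmx M).
Proof.
move=> [[M1 M2 M3] M4]; split; first by split; rewrite ?unitmx_inv ?invmxK.
rewrite -{1}M4 !mulmxA mulVmx // mul1mx -mulmxA -trmx_mul -map_mxM mulVmx //.
by rewrite map_mx1 trmx1 mulmx1.
Qed.

Lemma UH_wmat w : UH (mxr (wmat w)).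
Proof.
elim: w => [|k w IH]; first by rewrite mxr_id4; exact: UH1.
by rewrite /= mxrM ?wf_gen ?wf_wmat //; apply: UH_mul => //; apply: UH_gen.
Qed.

End UnitaryGroup.

(** * Every unitary matrix is a word *)

Section UnitaryClassification.
Import BinInt.
Local Open Scope nat_scope.

Lemma small_giP p : Z.le (gnorm p) 4%Z -> p \in small_gi.
Proof.
case: p => a b; rewrite /gnorm /= => h.
have ha : a = (-2)%Z \/ a = (-1)%Z \/ a = 0%Z \/ a = 1%Z \/ a = 2%Z by nia.
have hb : b = (-2)%Z \/ b = (-1)%Z \/ b = 0%Z \/ b = 1%Z \/ b = 2%Z by nia.
by case: ha h => [->|[->|[->|[->|->]]]]; case: hb => [->|[->|[->|[->|->]]]]; vm_compute.
Qed.

Lemma half_double u : map half_gi (map double u) = u.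
Proof.
elim: u => [|[a b] u /= ->] //; congr (_ :: _); rewrite /half_gi /double /gadd /=.
by rewrite !Z.add_diag !(Z.mul_comm 2) !Z.div_mul.
Qed.

Lemma vecm_B4 u : size u = 4 -> herm u u = (2%Z, 0%Z) ->
  vecm (vecm u B4) F4 = map double u /\
  foldr (fun p s => Z.add (gnorm p) s) 0%Z (vecm u B4) = 4%Z.
Proof.
move=> /size4[[a a'] [[b b'] [[c c'] [[d d'] ->]]]] []; rewrite /herm /vecm /vadd /= => h _; split.
  clear h; rewrite /vecm /vadd /double /gadd /gmul /=.
  congr [:: _; _; _; _]; congr (_, _); lia.
by move: h; rewrite /herm /vecm /vadd /gnorm /gadd /gmul /=; lia.
Qed.

Lemma roots_completeP roots u : roots_complete roots -> size u = 4 -> herm u u = (2%Z, 0%Z) -> u \in roots.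
Proof.
move=> hr su hu; have [e1 e2] := vecm_B4 su hu.
have sv : size (vecm u B4) = 4 by apply: vecm_size.
have nn p : Z.le 0%Z (gnorm p) by rewrite /gnorm; nia.
case: (size4 sv) => x [y [z [t e]]]; rewrite e /= in e1 e2.
have := nn x; have := nn y; have := nn z; have := nn t => nt nz ny nx.
have [sx sy sz st] : [/\ x \in small_gi, y \in small_gi, z \in small_gi & t \in small_gi].
  by split; apply: small_giP; lia.
move: hr => /allP/(_ x sx)/allP/(_ y sy)/allP/(_ z sz)/allP/(_ t st).
have -> : Z.eqb (Z.add (gnorm x) (Z.add (gnorm y) (Z.add (gnorm z) (gnorm t)))) 4%Z.
  by apply/Z.eqb_spec; lia.
by cbv zeta; rewrite e1 half_double eqxx.
Qed.

Lemma unitary4_herm A : wf A -> unitary4 A -> forall i j, i < 4 -> j < 4 ->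
  herm (nth [::] A i) (nth [::] A j) = hentry i j.
Proof.
move=> /andP[/eqP/size4[u1 [u2 [u3 [u4 ->]]]] /=].
move=> /and5P[/eqP/size4[? [? [? [? ->]]]] /eqP/size4[? [? [? [? ->]]]]
  /eqP/size4[? [? [? [? ->]]]] /eqP/size4[? [? [? [? ->]]]] _].
move=> /eqP h i j hi hj; rewrite /hentry -[in RHS]h.
by move: i j hi hj => [|[|[|[|i]]]] [|[|[|[|j]]]].
Qed.

Variable R : realType.
Local Notation C := R[i].

Section AbstractLists.
Variables (roots : seq (seq gi)) (stab : seq (seq (seq gi))) (ow sw : seq (seq nat)).
Hypothesis roots_all : forall u, size u = 4 -> herm u u = (2%Z, 0%Z) -> u \in roots.
Hypothesis stab_all : stab_complete roots stab.
Hypothesis roots_ow : forall u, u \in roots -> exists2 w, w \in ow & u = nth [::] (wmat w) 0.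
Hypothesis stab_sw : forall A, A \in stab -> exists2 w, w \in sw & A = wmat w.

(** Orbit and stabilizer: the first row of [M] is a root, hence the first row of some word [q].
    Multiplying by the inverse word [rev q] turns it into [row0], and the resulting matrix is listed
    in [stab]. *)
Lemma UH_words_of (M : 'M[C]_4) : UH M ->
  exists p q, [/\ p \in sw, q \in ow & M = mxr R (wmat (p ++ q))].
Proof.
move=> hM; have [[/mxOver_mxr[A wA eA] _ _] hA] := hM.
have sA k : k < 4 -> size (nth [::] A k) = 4 by move=> k4; apply: (wf_nth (Ordinal k4)).
have uni D : wf D -> UH (mxr R D) -> unitary4 D.
  move=> wD [_]; rewrite Hmx_mxr -mxr_ctr // -!mxrM ?wf_ctr ?wf_mulm // => /mxr_inj h.
  by apply/eqP/h; rewrite ?wf_mulm ?wf_ctr.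
have root D k : wf D -> UH (mxr R D) -> k < 4 -> nth [::] D k \in roots.
  move=> wD uD k4; apply: roots_all; first exact: (wf_nth (Ordinal k4)).
  by rewrite unitary4_herm ?uni //; move: k k4 => [|[|[|[|k]]]].
have uA : UH (mxr R A) by rewrite -eA.
have [q q_in hq] := roots_ow (root A 0 wA uA isT).
pose D := mulm A (wmat (rev q)).
have wD : wf D by rewrite wf_mulm ?wf_wmat.
have uD : UH (mxr R D) by rewrite mxrM ?wf_wmat // -eA; apply: UH_mul => //; apply: UH_wmat.
have D0 : nth [::] D 0 = row0.
  apply: (@rvec_inj R) => //; first exact: (wf_nth ord0).
  rewrite -(row_mxr R D ord0) mxrM ?wf_wmat // row_mul row_mxr hq -(row_mxr R _ ord0).
  by rewrite -row_mul mxr_wmat_rev -mxr_id4 row_mxr.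
have hD i : i < 4 -> nth [::] D i \in with_row0 roots i.
  move=> i4; rewrite mem_filter (root D i wD uD i4) andbT -D0.
  by rewrite (@unitary4_herm D wD (uni D wD uD) i 0 i4 isT).
have [p p_in ep] : exists2 w, w \in sw & D = wmat w.
  apply: stab_sw.
  move: stab_all; rewrite /stab_complete => /allP/(_ _ (hD 1 isT))/allP/(_ _ (hD 2 isT)).
  rewrite unitary4_herm ?uni // eqxx => /allP/(_ _ (hD 3 isT)).
  rewrite !unitary4_herm ?uni // !eqxx -D0; move: wD => /andP[/eqP/size4[? [? [? [? ->]]]]] _.
  by [].
exists p, q; split => //; rewrite mxr_wmat_cat -ep mxrM ?wf_wmat // -mulmxA.
by rewrite -{2}(revK q) mxr_wmat_rev mulmx1.
Qed.

End AbstractLists.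

Lemma UH_words : exists sw ow grp,
  [/\ forall M : 'M[C]_4, UH M -> exists p q, [/\ p \in sw, q \in ow & M = mxr R (wmat (p ++ q))],
     kernel_ok sw ow grp & forall A, A \in grp -> exists w, A = tprod w].
Proof.
have [orb [stab [grp /and5P[h1 h2 h3 h4 /andP[h5 h6]]]]] := tablesP.
exists [seq stab_word p.2 | p <- stab], [seq p.2 | p <- orb], [seq p.1 | p <- grp].
split=> //.
- apply: (UH_words_of (fun u => @roots_completeP _ u h1) h2) => [u|A] /mapP[p hp ->].
    by exists p.2; [exact: map_f|rewrite (eqP (allP h3 p hp))].
  by exists (stab_word p.2); [exact: (map_f (fun p => stab_word p.2))|rewrite (eqP (allP h4 p hp))].
- by move=> A /mapP[p hp ->]; exists p.2; rewrite (eqP (allP h5 p hp)).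
Qed.

End UnitaryClassification.

(** * Polynomials are determined by their values *)

Section PolynomialIdentity.
Variable K : numFieldType.

Lemma poly_eq0_eval (P : {poly K}) : (forall z, P.[z] = 0) -> P = 0.
Proof.
move=> h; apply/eqP; apply: contraT => P0.
have := max_poly_roots P0 (rs := [seq k%:R | k <- iota 0 (size P)]).
rewrite size_map size_iota ltnn => -> //; first by apply/allP => z _; rewrite /root h.
by rewrite map_inj_uniq ?iota_uniq // => i j /eqP; rewrite eqr_nat => /eqP.
Qed.

Lemma digits_inj (N n : nat) (a b : nat -> nat) :
  (forall i, (a i < N)%N) -> (forall i, (b i < N)%N) ->
  (\sum_(i < n) a i * N ^ i = \sum_(i < n) b i * N ^ i)%N ->
  forall i, (i < n)%N -> a i = b i.
Proof.
elim: n a b => [|n IH] a b ha hb // e.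
have e0 : a 0%N = b 0%N.
  have := congr1 (modn^~ N) e; rewrite !big_ord_recl !muln1.
  have md (f : nat -> nat) : ((\sum_(i < n) f i.+1 * N ^ i.+1) %% N = 0)%N.
    apply/eqP; apply: dvdn_sum => j _; rewrite expnS mulnCA; exact: dvdn_mulr.
  by rewrite -modnDmr md addn0 -[RHS]modnDmr md addn0 !modn_small.
case=> [|i] hi //; have hN : (0 < N)%N by apply: leq_trans (ha 0%N).
apply: (IH (fun i => a i.+1) (fun i => b i.+1)) => //.
move: e; rewrite !big_ord_recl e0 => /addnI.
have sh (f : nat -> nat) : (\sum_(i < n) f i.+1 * N ^ i.+1 = N * \sum_(i < n) f i.+1 * N ^ i)%N.
  by rewrite big_distrr; apply: eq_bigr => j _; rewrite expnS mulnCA.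
by rewrite !sh => /eqP; rewrite eqn_pmul2l // => /eqP.
Qed.

(** Kronecker substitution [v_i = z^(N^i)]: as [N] exceeds all exponents, distinct monomials give
    distinct powers of [z] by uniqueness of base [N] digits, and the one-variable case applies. *)
Lemma mpoly_eq0_eval n (p : mpoly n K) : (forall v, meval v p = 0) -> p = 0.
Proof.
move=> h; apply/eqP; apply: contraT => p0; pose N := msize p.
pose e (m : multinom n) := (\sum_(i < n) m i * N ^ i)%N.
pose P : {poly K} := \sum_(m <- msupp p) (mcoeff m p) *: 'X^(e m).
have P0 : P = 0.
  apply: poly_eq0_eval => z; rewrite -(h (fun i : 'I_n => z ^+ (N ^ i))) mevalE horner_sum.
  apply: eq_bigr => m _; rewrite hornerZ hornerXn /e; congr (_ * _).
  by rewrite expr_sum; apply: eq_bigr => i _; rewrite mulnC exprM.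
have [m0 m0p] : exists m, m \in msupp p.
  have := p0; rewrite -msupp_eq0; case: (msupp p) => // m s _; exists m; exact: mem_head.
have lt m : m \in msupp p -> forall i, (m i < N)%N.
  move=> mp i; apply: leq_ltn_trans (msize_mdeg_lt mp).
  by rewrite mdegE (bigD1 i) //= leq_addr.
have := congr1 (coefp (e m0)) P0; rewrite /coefp coef0 coef_sum (bigD1_seq m0) ?msupp_uniq //=.
rewrite coefZ coefXn eqxx mulr1 big_seq_cond big1 => [|m /andP[mp mm0]].
  by rewrite addr0 => /eqP; rewrite mcoeff_eq0 m0p.
rewrite coefZ coefXn; case: eqVneq => [e0|]; last by rewrite mulr0.
case/negP: mm0; apply/eqP/mnmP => i.
pose f (m : multinom n) (j : nat) := if insub j is Some j' then m (j' : 'I_n) else 0%N.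
have fE (m' : multinom n) (j : 'I_n) : f m' j = m' j by rewrite /f valK.
rewrite -!fE; apply: (@digits_inj N n (f m) (f m0)) => // [j|j|].
- by rewrite /f; case: insub => [j'|]; [exact: lt|apply: leq_ltn_trans (lt _ mp i)].
- by rewrite /f; case: insub => [j'|]; [exact: lt|apply: leq_ltn_trans (lt _ mp i)].
transitivity (e m); first by apply: eq_bigr => j _; rewrite fE.
by rewrite -e0; apply: eq_bigr => j _; rewrite fE.
Qed.

Lemma mpoly_eval_inj n (p q : mpoly n K) : (forall v, meval v p = meval v q) -> p = q.
Proof.
by move=> h; apply/eqP; rewrite -subr_eq0; apply/eqP/mpoly_eq0_eval => v; rewrite mevalB h subrr.
Qed.

End PolynomialIdentity.

(** * The six invariants and the action of the generators on them *)

Section Invariants.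

Section Formula.
Variable K : comNzRingType.
Definition squares (a b c d : K) : seq K :=
  [:: a ^+ 2 + b ^+ 2 + c ^+ 2 + d ^+ 2; a ^+ 2 - b ^+ 2 + c ^+ 2 - d ^+ 2;
      a ^+ 2 + b ^+ 2 - c ^+ 2 - d ^+ 2; a ^+ 2 - b ^+ 2 - c ^+ 2 + d ^+ 2].
(** The sum is [2 S + 6 S - 8 S = 0], and 48 is the weight for which the relation between the [A_k]
    and [t] becomes the Igusa quartic, see [igusa_coords_quartic]. The ring is arbitrary because
    both values and polynomials are inserted. *)
Definition igusa_coords (A0 A1 A2 A3 t : K) : seq K :=
  let S := A0 + A1 + A2 + A3 in
  [:: S + t *+ 48; S - t *+ 48; A0 *+ 6 - S *+ 2; A1 *+ 6 - S *+ 2; A2 *+ 6 - S *+ 2; A3 *+ 6 - S *+ 2].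
Definition y_formula (a b c d : K) : seq K :=
  let w := squares a b c d in
  igusa_coords (w`_0 ^+ 2) (w`_1 ^+ 2) (w`_2 ^+ 2) (w`_3 ^+ 2) (a * b * c * d).

End Formula.

Lemma meval_squares n (K : comNzRingType) (v : 'I_n -> K) (a b c d : mpoly n K) k : (k < 4)%N ->
  meval v (squares a b c d)`_k = (squares (meval v a) (meval v b) (meval v c) (meval v d))`_k.
Proof.
have sq p : meval v (p ^+ 2) = (meval v p) ^+ 2 by rewrite !expr2 mevalM.
by case: k => [|[|[|[|k]]]] // _; rewrite /= !(mevalB v, mevalD v) !sq.
Qed.

Lemma meval_igusa_coords n (K : comNzRingType) (v : 'I_n -> K) (A0 A1 A2 A3 t : mpoly n K) (j : 'I_6) :
  meval v (igusa_coords A0 A1 A2 A3 t)`_j =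
  (igusa_coords (meval v A0) (meval v A1) (meval v A2) (meval v A3) (meval v t))`_j.
Proof.
by case: j => [[|[|[|[|[|[|]]]]]] h] //=; rewrite !(mevalB v, mevalD v, mevalMn v).
Qed.

Lemma meval_y_formula n (K : comNzRingType) (v : 'I_n -> K) (a b c d : mpoly n K) (j : 'I_6) :
  meval v (y_formula a b c d)`_j = (y_formula (meval v a) (meval v b) (meval v c) (meval v d))`_j.
Proof.
have sq p : meval v (p ^+ 2) = (meval v p) ^+ 2 by rewrite !expr2 mevalM.
by rewrite /y_formula meval_igusa_coords !sq !meval_squares // !mevalM.
Qed.

Variable R : realType.
Local Notation C := R[i].
Definition Bmx : 'M[C]_4 := mxr R B4.
Definition Binv : 'M[C]_4 := 2^-1 *: mxr R F4.

Lemma mxr_double A : wf A -> mxr R [seq [seq double x | x <- u] | u <- A] = 2 *: mxr R A.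
Proof.
move=> wA; apply/matrixP => i j; rewrite !mxE (nth_map [::]) ?(nth_map g0) ?wf_nth //.
  by rewrite /double gcD mulr2n mulrDl mul1r.
by case/andP: wA => /eqP ->.
Qed.

Lemma BmxK : Bmx *m Binv = 1%:M.
Proof.
have /and5P[w1 w2 _ /eqP h _] := B4_ok.
by rewrite /Bmx /Binv -scalemxAr -mxrM // h mxr_double // mxr_id4 scalerA mulVf ?scale1r ?pnatr_eq0.
Qed.

Lemma BinvK : Binv *m Bmx = 1%:M. Proof. exact: mulmx1C BmxK. Qed.

Definition ypoly_coord (k : 'I_4) : mpoly 4 C := \sum_(i < 4) Bmx i k *: mpolyX C (mnm1 i).
Definition Ytuple : 6.-tuple (mpoly 4 C) :=
  [tuple (y_formula (ypoly_coord o0) (ypoly_coord o1) (ypoly_coord o2) (ypoly_coord o3))`_j | j < 6].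

Definition yval (x : 'rV[C]_4) : seq C := y_formula (x 0 o0) (x 0 o1) (x 0 o2) (x 0 o3).

Lemma Ytuple_eval (x : 'rV[C]_4) (j : 'I_6) :
  meval (x ord0) (tnth Ytuple j) = (yval (x *m Bmx))`_j.
Proof.
rewrite tnth_mktuple meval_y_formula /yval.
have e k : meval (x ord0) (ypoly_coord k) = (x *m Bmx) 0 k.
  by rewrite rmorph_sum mxE; apply: eq_bigr => i _; rewrite /= mevalZ mevalXU mulrC.
by rewrite !e.
Qed.

Lemma lin_subst_eval (M : 'M[C]_4) p (x : 'rV[C]_4) :
  meval (x ord0) (lin_subst M p) = meval ((x *m M) ord0) p.
Proof.
rewrite /lin_subst comp_mpoly_meval; apply: meval_eq => k; rewrite tnth_mktuple mxE rmorph_sum.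
by apply: eq_bigr => i _; rewrite /= mevalZ mevalXU mulrC.
Qed.

Lemma mpoly_row_inj n (p q : mpoly n C) :
  (forall x : 'rV[C]_n, meval (x ord0) p = meval (x ord0) q) -> p = q.
Proof.
move=> h; apply: mpoly_eval_inj => v; have := h (\row_i v i).
by rewrite !(@meval_eq _ _ ((\row_i v i) ord0) v) // => i; rewrite mxE.
Qed.

Lemma lin_substM (M N : 'M[C]_4) p : lin_subst (M *m N) p = lin_subst M (lin_subst N p).
Proof. apply: mpoly_row_inj => x; apply: (etrans (lin_subst_eval (M *m N) p x)).
apply/esym; apply: (etrans (lin_subst_eval M (lin_subst N p) x)).
by apply: (etrans (lin_subst_eval N p (x *m M))); rewrite mulmxA.
Qed.

End Invariants.

Section GeneratorAction.
Import BinInt.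
Local Open Scope nat_scope.

(* Twice the matrices of the generators in the coordinates x *m Bmx. *)
Definition refl4 : seq (seq (seq gi)) := [::
  [:: [:: (-2,0)%Z; (0,0)%Z; (0,0)%Z; (0,0)%Z]; [:: (0,0)%Z; (2,0)%Z; (0,0)%Z; (0,0)%Z]; [:: (0,0)%Z; (0,0)%Z; (2,0)%Z; (0,0)%Z]; [:: (0,0)%Z; (0,0)%Z; (0,0)%Z; (2,0)%Z]];
  [:: [:: (1,0)%Z; (-1,0)%Z; (-1,0)%Z; (1,0)%Z]; [:: (-1,0)%Z; (1,0)%Z; (-1,0)%Z; (1,0)%Z]; [:: (-1,0)%Z; (-1,0)%Z; (1,0)%Z; (1,0)%Z]; [:: (1,0)%Z; (1,0)%Z; (1,0)%Z; (1,0)%Z]];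
  [:: [:: (0,0)%Z; (0,0)%Z; (0,-2)%Z; (0,0)%Z]; [:: (0,0)%Z; (2,0)%Z; (0,0)%Z; (0,0)%Z]; [:: (0,2)%Z; (0,0)%Z; (0,0)%Z; (0,0)%Z]; [:: (0,0)%Z; (0,0)%Z; (0,0)%Z; (2,0)%Z]];
  [:: [:: (0,0)%Z; (-2,0)%Z; (0,0)%Z; (0,0)%Z]; [:: (-2,0)%Z; (0,0)%Z; (0,0)%Z; (0,0)%Z]; [:: (0,0)%Z; (0,0)%Z; (2,0)%Z; (0,0)%Z]; [:: (0,0)%Z; (0,0)%Z; (0,0)%Z; (2,0)%Z]];
  [:: [:: (0,0)%Z; (0,0)%Z; (-2,0)%Z; (0,0)%Z]; [:: (0,0)%Z; (2,0)%Z; (0,0)%Z; (0,0)%Z]; [:: (-2,0)%Z; (0,0)%Z; (0,0)%Z; (0,0)%Z]; [:: (0,0)%Z; (0,0)%Z; (0,0)%Z; (2,0)%Z]]].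

Lemma refl4_ok : all (fun k => mulm (mulm F4 (gen k)) B4 == nth id4 refl4 k) [:: 0; 1; 2; 3; 4].
Proof. by vm_compute. Qed.

End GeneratorAction.

Section GaussianValues.
Variable R : realType.
Local Notation C := R[i].

Lemma gc_int (a b : int) : gc R (Z_of_int a, Z_of_int b) = a%:~R + b%:~R * 'i.
Proof.
by rewrite /gc /zr !Z_of_intK -(rmorph_int (real_complex R) a) -(rmorph_int (real_complex R) b) /=; simpc.
Qed.

End GaussianValues.

Section GaussianValuesList.
Import BinInt.
Variable R : realType.

Lemma gc_values : (gc R (0, 0)%Z = 0) * (gc R (1, 0)%Z = 1) * (gc R (-1, 0)%Z = -1) *
  (gc R (2, 0)%Z = 2) * (gc R (-2, 0)%Z = -2) * (gc R (0, 2)%Z = 2 * 'i) *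
  (gc R (0, -2)%Z = - (2 * 'i)) * (gc R (0, 1)%Z = 'i) * (gc R (0, -1)%Z = - 'i).
Proof.
do !split => //.
- by rewrite (gc_int R (Negz 0) 0) mul0r addr0.
- by rewrite (gc_int R (Posz 2) 0) mul0r addr0.
- by rewrite (gc_int R (Negz 1) 0) mul0r addr0.
- by rewrite (gc_int R 0 (Posz 2)) add0r.
- by rewrite (gc_int R 0 (Negz 1)) add0r mulNr.
by rewrite (gc_int R 0 (Negz 0)) add0r mulN1r.
Qed.

End GaussianValuesList.

Section SymmetricAction.
Variable R : realType.
Local Notation C := R[i].
Local Notation Bmx := (Bmx R).

Lemma gen_coords k (x : 'rV[C]_4) : (k < 5)%N ->
  x *m mxr R (gen k) *m Bmx = 2^-1 *: ((x *m Bmx) *m mxr R (nth id4 refl4 k)).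
Proof.
move=> k5; have /eqP <- : mulm (mulm F4 (gen k)) B4 == nth id4 refl4 k.
  by move: refl4_ok k k5 => /and5P[? ? ? ? /andP[? _]] [|[|[|[|[|k]]]]].
have /and5P[w1 w2 _ _ _] := B4_ok.
rewrite !mxrM ?wf_mulm ?wf_gen // -[mxr R B4]/Bmx -{1}(mulmx1 x) -(BmxK R).
by rewrite -!scalemxAr -!scalemxAl -?scalemxAr !mulmxA.
Qed.

(** Thirty polynomial identities modulo ['i ^+ 2 = -1], one for each generator and each
    coordinate. *)
Lemma yval_gen k (x : 'rV[C]_4) (j : nat) : (k < 5)%N -> (j < 6)%N ->
  (yval (x *m mxr R (gen k) *m Bmx))`_(swap2 (nth (0, 0)%N transp k) j) = (yval (x *m Bmx))`_j.
Proof.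
move=> k5 j6; rewrite gen_coords //; move: (x *m Bmx) => y {x}.
have i2 : ('i : C) ^+ 2 = -1 := sqr_i _.
rewrite /yval !mxE !sum4.
case: k k5 => [|[|[|[|[|k]]]]] // _; rewrite !mxE /= !(gc_values R).
all: case: j j6 => [|[|[|[|[|[|j]]]]]] // _; rewrite /yval.
all: move: (y 0 o0) (y 0 o1) (y 0 o2) (y 0 o3) i2 => a b c d.
all: move: ('i : C) => q q2; rewrite /swap2 /y_formula /squares /igusa_coords /=.
all: by field: q2.
Qed.

End SymmetricAction.

(** * The homomorphism from the unitary group onto the symmetric group *)

Section Representation.
Variable R : realType.
Local Notation C := R[i].
Local Notation Y := (Ytuple R).

Lemma swap2K p : involutive (swap2 p).
Proof.
case: p => a b j; rewrite /swap2 /=; case: (eqVneq j a) => [->|ja].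
  by rewrite eqxx; case: eqVneq.
by case: (eqVneq j b) => [->|jb]; rewrite ?eqxx // (negPf ja) (negPf jb).
Qed.

Lemma word_perm_cat p q j : word_perm (p ++ q) j = word_perm q (word_perm p j).
Proof. by rewrite /word_perm foldl_cat. Qed.

Lemma word_permK q j : word_perm (rev q) (word_perm q j) = j.
Proof.
by elim: q j => [|k q IH] j //=; rewrite rev_cons -cats1 word_perm_cat IH /= swap2K.
Qed.

Definition gperm k : 'S_6 := tperm (inord (nth (0, 0)%N transp k).1) (inord (nth (0, 0)%N transp k).2).
Definition wperm w : 'S_6 := foldr (fun k s => (gperm k * s)%g) 1%g w.

Lemma transp_lt k : ((nth (0, 0)%N transp k).1 < 6)%N /\ ((nth (0, 0)%N transp k).2 < 6)%N.
Proof. by case: k => [|[|[|[|[|k]]]]] //=; rewrite nth_nil. Qed.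

Lemma gpermE k j : gperm k j = swap2 (nth (0, 0)%N transp k) j :> nat.
Proof.
have [l1 l2] := transp_lt k; rewrite /gperm /swap2 permE /=.
by rewrite -!val_eqE /= !inordK //; case: ifP => _; [rewrite inordK|case: ifP => _ //; rewrite inordK].
Qed.

Lemma wpermE w j : wperm w j = word_perm w j :> nat.
Proof.
elim: w j => [|k w IH] j; first by rewrite /wperm /word_perm /= perm.perm1.
by rewrite -[wperm (k :: w)]/(gperm k * wperm w)%g permM IH gpermE.
Qed.

(** The permutation stands inside the substitution; on the other side of the equation it would give
    an antihomomorphism. *)
Definition acts_as (M : 'M[C]_4) (s : 'S_6) := forall j, lin_subst M (tnth Y (s j)) = tnth Y j.

Lemma acts_asM M N s t : acts_as M s -> acts_as N t -> acts_as (M *m N) (s * t)%g.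
Proof. by move=> h1 h2 j; rewrite lin_substM permM h2 h1. Qed.

Lemma lin_subst1 (p : mpoly 4 C) : lin_subst 1%:M p = p.
Proof.
by apply: mpoly_row_inj => x; apply: (etrans (lin_subst_eval _ p x)); rewrite mulmx1.
Qed.

Lemma acts_as1 : acts_as 1%:M 1%g.
Proof. by move=> j; rewrite lin_subst1 perm.perm1. Qed.

Lemma acts_as_gen k : acts_as (mxr R (gen k)) (gperm k).
Proof.
case: (ltnP k 5) => k5 j; last first.
  have -> : gperm k = 1%g by rewrite /gperm nth_default // tperm1.
  by rewrite /gen nth_default // mxr_id4 acts_as1.
apply: mpoly_row_inj => x; apply: (etrans (lin_subst_eval _ _ x)).
by rewrite !Ytuple_eval gpermE yval_gen.
Qed.

Lemma acts_as_word w : acts_as (mxr R (wmat w)) (wperm w).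
Proof.
elim: w => [|k w IH]; first by rewrite mxr_id4; exact: acts_as1.
rewrite -[wmat (k :: w)]/(mulm (gen k) (wmat w)) (mxrM R (wf_gen k) (wf_wmat w)).
exact: (acts_asM (acts_as_gen k) IH).
Qed.

Lemma wperm_cat p q : wperm (p ++ q) = (wperm p * wperm q)%g.
Proof. by elim: p => [|k p IH] /=; rewrite ?mul1g // IH mulgA. Qed.

(** The generators are the edges of the path [0 - 1 - 2 - 3 - 5 - 4]. The palindrome
    [i, ..., j-1, ..., i] induces the transposition of its vertices number [i] and [j]; the empty
    word serves the case of equal letters. *)
Definition conj_words := [:: [::]] ++
  [seq iota p.1 (p.2 - p.1) ++ rev (iota p.1 (p.2 - p.1).-1) | p <- [seq (i, j) | i <- iota 0 6, j <- iota 0 6]].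

Lemma conj_words_ok : all (fun x => all (fun y =>
  has (fun w => perm_list w == map (swap2 (x, y)) (iota 0 6)) conj_words) (iota 0 6)) (iota 0 6).
Proof. by vm_compute. Qed.

Lemma perm_listE w (j : 'I_6) : nth 0%N (perm_list w) j = word_perm w j.
Proof. by rewrite /perm_list (nth_map 0%N) //; case: j => [[|[|[|[|[|[|]]]]]]]. Qed.

Lemma wperm_surj s : exists w, wperm w = s.
Proof.
have [ts -> _] := prod_tpermP s; elim: ts => [|[x y] ts [w IH]].
  by exists [::]; rewrite big_nil.
have mi (z : 'I_6) : (z : nat) \in iota 0 6 by rewrite mem_iota /=.
have /allP/(_ _ (mi x))/allP/(_ _ (mi y))/hasP[v _ /eqP hv] := conj_words_ok.
exists (v ++ w); rewrite wperm_cat IH big_cons /=; congr (_ * _)%g.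
apply/permP => j; apply: val_inj; rewrite /= wpermE -perm_listE hv (nth_map 0%N) ?size_iota //.
rewrite nth_iota // add0n permE /= /swap2 /= -!val_eqE /=.
by case: ifP => _ //; case: ifP.
Qed.

(** Since the words act transitively on pairs of letters, an equality would give [Y_0 = Y_1]; but
    these differ by 96 times the product of the coordinates. *)
Lemma Ytuple_inj : injective (tnth Y).
Proof.
move=> j k ejk; apply/eqP; apply: contraT => jk; exfalso.
pose q0 : 'I_6 := ord0; pose q1 : 'I_6 := lift ord0 ord0.
pose k' := tperm q0 j q1; have kj : k' != j by rewrite -[X in _ != X](tpermL q0 j) (inj_eq perm_inj).
have [w hw] := wperm_surj (tperm q0 j * tperm k' k)%g.
have ej : wperm w q0 = j by rewrite hw permM tpermL tpermD // eq_sym.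
have ek : wperm w q1 = k by rewrite hw permM -/k' tpermL.
have e := acts_as_word w q0; rewrite ej ejk -ek (acts_as_word w q1) in e.
pose x : 'rV[C]_4 := const_mx 1.
have := congr1 (meval ((x *m Binv R) ord0)) e; rewrite !Ytuple_eval -mulmxA BinvK mulmx1.
rewrite /yval /y_formula /squares /igusa_coords !mxE /= => /eqP.
by rewrite -subr_eq0 [X in X == 0](_ : _ = - 96%:R) ?oppr_eq0 ?pnatr_eq0 //; ring.
Qed.

Lemma lin_substK (M : 'M[C]_4) : M \in unitmx -> cancel (lin_subst M) (lin_subst (invmx M)).
Proof.
move=> uM p; apply: (etrans (esym (lin_substM (invmx M) M p))).
by rewrite (mulVmx uM); exact: lin_subst1.
Qed.

Lemma acts_as_uniq M s t : M \in unitmx -> acts_as M s -> acts_as M t -> s = t.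
Proof.
move=> uM h1 h2; apply/permP => j; apply: Ytuple_inj.
exact: (can_inj (lin_substK uM)) (etrans (h1 j) (esym (h2 j))).
Qed.

(** On [U(H)] such a permutation exists because every element is a word, and it is unique by
    [Ytuple_inj]. *)
Definition rho (M : 'M[C]_4) : 'S_6 := xget 1%g [set s | acts_as M s].

Lemma UH_word (M : 'M[C]_4) : UH M -> exists w, M = mxr R (wmat w).
Proof.
have [sw [ow [grp [h _ _]]]] := UH_words R.
by move=> /h[p [q [_ _ ->]]]; exists (p ++ q).
Qed.

Lemma rhoP M : UH M -> acts_as M (rho M).
Proof.
move=> /UH_word[w ->]; rewrite /rho.
by case: xgetP => [s _ hs //|/(_ (wperm w)) []]; exact: acts_as_word.
Qed.

Lemma UH_unit (M : 'M[C]_4) : UH M -> M \in unitmx. Proof. by case=> [[]]. Qed.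

Lemma rho_uniq M s : UH M -> acts_as M s -> rho M = s.
Proof. by move=> hM hs; apply: acts_as_uniq (UH_unit hM) (rhoP hM) hs. Qed.

Lemma rho1 : rho 1%:M = 1%g.
Proof. exact: rho_uniq (UH1 R) acts_as1. Qed.

Lemma rhoM M N : UH M -> UH N -> rho (M *m N) = (rho M * rho N)%g.
Proof. by move=> hM hN; apply: rho_uniq (UH_mul hM hN) (acts_asM (rhoP hM) (rhoP hN)). Qed.

Lemma rho_word w : rho (mxr R (wmat w)) = wperm w.
Proof. exact: rho_uniq (UH_wmat _ w) (acts_as_word w). Qed.

Lemma rho_surj s : exists2 M : 'M[C]_4, UH M & rho M = s.
Proof. by have [w <-] := wperm_surj s; exists (mxr R (wmat w)); [exact: UH_wmat|exact: rho_word]. Qed.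

Lemma tmat_default k : (5 < k)%N -> tmat k = id4.
Proof. by case: k => [|[|[|[|[|[|k]]]]]] // _; rewrite /tmat /twords /= nth_nil. Qed.

Lemma wf_tmat k : wf (tmat k). Proof. exact: wf_wmat. Qed.

Lemma wf_npow j : wf (npow j).
Proof. by elim: j => [|j IH]; [exact: wf_id4|exact: (@wf_mulm N4 _ isT IH)]. Qed.

Lemma mxr_N4 : mxr R N4 = N5 R.
Proof.
apply/matrixP => i j; rewrite !mxE.
by elim/ord4_ind: i; elim/ord4_ind: j; apply/eqP; rewrite eq_complex /gc /zr /= ?oppr0 ?addr0 ?add0r ?sub0r ?subr0 ?eqxx.
Qed.

Lemma mxr_T4 : mxr R T4 = T0 R.
Proof.
apply/matrixP => i j; rewrite !mxE.
by elim/ord4_ind: i; elim/ord4_ind: j; apply/eqP; rewrite eq_complex /gc /zr /= ?oppr0 ?addr0 ?add0r ?sub0r ?subr0 ?eqxx.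
Qed.

Lemma iI_tmat : 'i%:M = mxr R (tmat 5).
Proof.
have /and3P[_ _ /eqP ->] := Tmx_ok.
apply/matrixP => i j; rewrite !mxE.
by elim/ord4_ind: i; elim/ord4_ind: j; apply/eqP; rewrite eq_complex /gc /zr /= ?oppr0 ?addr0 ?add0r ?sub0r ?subr0 ?eqxx.
Qed.

Lemma mxr_npow j : mxr R (npow j) = N5 R ^+ j.
Proof.
elim: j => [|j IH]; first by rewrite mxr_id4.
by rewrite exprS -IH -mxr_N4 -[RHS](@mxrM R N4 (npow j) isT (wf_npow j)).
Qed.

Lemma N5_unit : N5 R \is a GRing.unit.
Proof.
have /and3P[/eqP hN _ _] := Tmx_ok.
have : mxr R N4 *m mxr R N4inv = 1%:M by rewrite -(@mxrM R N4 N4inv isT isT) hN mxr_id4.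
by rewrite mxr_N4 => /mulmx1_unit[].
Qed.

Lemma Tmx_tmat (j : 'I_5) : Tmx R j = mxr R (tmat j).
Proof.
have /and3P[_ /allP hT _] := Tmx_ok.
have jin : (j : nat) \in [:: 0; 1; 2; 3; 4]%N by case: j => [[|[|[|[|[|]]]]]].
have := congr1 (mxr R) (eqP (hT j jin)).
rewrite (mxrM R (wf_tmat j) (wf_npow j)) (@mxrM R (npow j) T4 (wf_npow j) isT) mxr_T4 mxr_npow => e.
exact: (esym (canRL (mulrK (unitrX j N5_unit)) e)).
Qed.

Lemma Gi_tmat k : Gi (mxr R (tmat k)).
Proof.
have [k5|k5] := ltnP k 5.
  apply: generated_in; left; apply: generated_in; exists (Ordinal k5).
  exact: (esym (Tmx_tmat (Ordinal k5))).
have [->|k6] := eqVneq k 5%N; first by apply: generated_in; right; rewrite -iI_tmat.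
have k7 : (5 < k)%N by rewrite ltn_neqAle eq_sym k6 k5.
by rewrite (tmat_default k7) mxr_id4; exact: generated_1.
Qed.

Lemma wf_tprod v : wf (tprod v).
Proof.
elim/last_ind: v => [|v k IH]; first exact: wf_id4.
by rewrite /tprod foldl_rcons; exact: wf_mulm IH (wf_tmat k).
Qed.

Lemma Gi_tprod w : Gi (mxr R (tprod w)).
Proof.
elim/last_ind: w => [|w k IH]; first by rewrite mxr_id4; exact: generated_1.
rewrite /tprod foldl_rcons (mxrM R (wf_tprod w) (wf_tmat k)).
exact: generated_M IH (Gi_tmat k).
Qed.

(** The one place where [kernel_ok] is used: a matrix [p ++ q] with trivial permutation is in the
    table of products of the [T_j] and [i]. *)
Lemma UH_rho1_Gi (M : 'M[C]_4) : UH M -> rho M = 1%g -> Gi M.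
Proof.
have [sw [ow [grp [h /allP hk hg]]]] := UH_words R; move=> /h[p [q [hp hq ->]]].
rewrite rho_word => h1.
have pq j : (j < 6)%N -> word_perm p j = word_perm (rev q) j.
  move=> j6; have e : word_perm q (word_perm p j) = j.
    by rewrite -word_perm_cat -(wpermE (p ++ q) (Ordinal j6)) h1 perm.perm1.
  by rewrite -{1}(word_permK q (word_perm p j)) e.
have /allP/(_ (perm_list (rev q), q)) := hk p hp.
have -> : perm_list p = perm_list (rev q).
  by rewrite /perm_list /=; congr [:: _; _; _; _; _; _]; exact: pq.
rewrite eqxx => hin; have [|w ->] := hg (wmat (p ++ q)); last exact: Gi_tprod.
by apply: hin; apply: (map_f (fun q => (perm_list (rev q), q))).
Qed.

Lemma tmat_rho k : rho (mxr R (tmat k)) = 1%g.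
Proof.
case: (ltnP k 6) => k6; last by rewrite (tmat_default k6) mxr_id4 rho1.
rewrite rho_word; apply/permP => j; apply: val_inj; rewrite /= wpermE -perm_listE perm.perm1.
have /allP/(_ _ (mem_nth [::] (k6 : (k < size twords)%N)))/eqP -> := twords_perm.
by case: j => [[|[|[|[|[|[|]]]]]]].
Qed.

Lemma rho_inv (M : 'M[C]_4) : UH M -> rho (invmx M) = (rho M)^-1%g.
Proof.
move=> hM; apply/esym/eqP; rewrite eq_invg_mul -(rhoM hM (UH_inv hM)) (mulmxV (UH_unit hM)).
by rewrite rho1.
Qed.

Lemma Gi_UH (M : 'M[C]_4) : Gi M -> UH M /\ rho M = 1%g.
Proof.
have one : UH (1 : 'M[C]_4) /\ rho (1 : 'M[C]_4) = 1%g by split; [exact: UH1|exact: rho1].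
have mul (A B : 'M[C]_4) : UH A /\ rho A = 1%g -> UH B /\ rho B = 1%g -> UH (A * B) /\ rho (A * B) = 1%g.
  by move=> [uA rA] [uB rB]; split; [exact: UH_mul|rewrite [rho _](rhoM uA uB) rA rB mulg1].
have inv (A : 'M[C]_4) : UH A /\ rho A = 1%g -> UH A^-1 /\ rho A^-1 = 1%g.
  by move=> [uA rA]; split; [exact: UH_inv|rewrite [rho _](rho_inv uA) rA invg1].
have tm k : UH (mxr R (tmat k)) /\ rho (mxr R (tmat k)) = 1%g by split; [exact: UH_wmat|exact: tmat_rho].
elim=> {M} [M [hM|->]| |A B _ hA _ hB|A _ hA]; [|rewrite iI_tmat; exact: tm|exact: one|exact: mul|exact: inv].
elim: hM => {M} [M [j ->]| |A B _ hA _ hB|A _ hA]; [rewrite Tmx_tmat; exact: tm|exact: one|exact: mul|exact: inv].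
Qed.

Lemma rho_kernel (M : 'M[C]_4) : UH M -> (rho M = 1%g <-> Gi M).
Proof. by move=> hM; split=> [|/Gi_UH[]//]; exact: UH_rho1_Gi. Qed.

Lemma Ytuple_invariant j : invariant_poly (@Gi R) (tnth Y j).
Proof. by move=> M /Gi_UH[hM h1]; have := rhoP hM j; rewrite h1 perm.perm1. Qed.

End Representation.

(** * The group (G,i) as a Pauli group *)

Section PauliMatrices.
Variable R : realType.
Local Notation C := R[i].

Definition pauli (N : 'M[C]_4) := Gi (Bmx R *m N *m Binv R).

Lemma pauliM M N : pauli M -> pauli N -> pauli (M *m N).
Proof.
move=> hM hN; have := generated_M hM hN; rewrite /pauli -mulmxE.
by rewrite -(mulmxA (Bmx R *m M)) (mulmxA (Binv R)) (mulmxA (Binv R)) BinvK mul1mx !mulmxA.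
Qed.

Definition diag4 (p q r s : gi) : seq (seq gi) :=
  [:: [:: p; g0; g0; g0]; [:: g0; q; g0; g0]; [:: g0; g0; r; g0]; [:: g0; g0; g0; s]].
Definition gm1 : gi := (BinInt.Z.opp 1, BinNums.Z0).

(** Words in the [T_j], with letter 5 for [i], and the matrices that they become in the coordinates
    of [Bmx]: the six double sign changes and two double transpositions. *)
Definition pauli_table : seq (seq nat * seq (seq gi)) :=
  [:: ([:: 0; 1; 5], diag4 gm1 gm1 g1 g1); ([:: 2], diag4 gm1 g1 gm1 g1);
      ([:: 3; 4; 5], diag4 gm1 g1 g1 gm1); ([:: 4; 3; 5], diag4 g1 gm1 gm1 g1);
      ([:: 0; 2; 0], diag4 g1 gm1 g1 gm1); ([:: 1; 0; 5], diag4 g1 g1 gm1 gm1);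
      ([:: 3; 2; 5], [:: [:: g0; g1; g0; g0]; [:: g1; g0; g0; g0]; [:: g0; g0; g0; g1]; [:: g0; g0; g1; g0]]);
      ([:: 4; 0; 5], [:: [:: g0; g0; g1; g0]; [:: g0; g0; g0; g1]; [:: g1; g0; g0; g0]; [:: g0; g1; g0; g0]])]%N.

Lemma pauli_table_ok : all (fun p => mulm (mulm F4 (tprod p.1)) B4 == [seq [seq double x | x <- u] | u <- p.2])
  pauli_table.
Proof. by vm_compute. Qed.

Lemma pauli_mxr w N : wf N ->
  mulm (mulm F4 (tprod w)) B4 == [seq [seq double x | x <- u] | u <- N] -> pauli (mxr R N).
Proof.
move=> wN /eqP h; rewrite /pauli; have /and5P[wB wF _ _ _] := B4_ok.
have e : Binv R *m mxr R (tprod w) *m Bmx R = mxr R N.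
  have := congr1 (mxr R) h.
  rewrite (mxr_double R wN) (mxrM R (wf_mulm wF (wf_tprod w)) wB) (mxrM R wF (wf_tprod w)).
  rewrite /Binv -!scalemxAl -/(Bmx R) => ->; rewrite scalerA mulVf ?scale1r ?pnatr_eq0 //.
rewrite -e !mulmxA (BmxK R) mul1mx -mulmxA (BmxK R) mulmx1; exact: Gi_tprod.
Qed.

Lemma pauli_entry k : (k < 8)%N -> pauli (mxr R (nth ([::], id4) pauli_table k).2).
Proof.
move=> k8; have /allP h := pauli_table_ok.
apply: (@pauli_mxr (nth ([::], id4) pauli_table k).1).
  by move: k k8 => [|[|[|[|[|[|[|[|]]]]]]]].
exact: (h _ (mem_nth _ (k8 : (k < size pauli_table)%N))).
Qed.

Lemma gc_m1 : gc R gm1 = -1.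
Proof. by rewrite -[LHS]/(gc R (Z_of_int (Negz 0), Z_of_int 0)) gc_int mul0r addr0. Qed.

Lemma reflC k l : refl R k l = refl R l k.
Proof. by apply/matrixP => i j; rewrite !mxE /neg2 orbC. Qed.

Lemma pauli_refl k l : k != l -> pauli (refl R k l).
Proof.
have r n p q r s k' l' : (n < 8)%N -> (nth ([::], id4) pauli_table n).2 = diag4 p q r s ->
    (forall i : 'I_4, gc R (nth g0 [:: p; q; r; s] i) = neg2 R k' l' i) -> pauli (refl R k' l').
  move=> n8 e h; have := pauli_entry n8; rewrite e; congr pauli.
  apply/matrixP => i j; rewrite !mxE -h.
  by elim/ord4_ind: i; elim/ord4_ind: j => /=; rewrite ?mulr1 ?mulr0.
have q01 : pauli (refl R o0 o1).
  by apply: (r 0%N gm1 gm1 g1 g1); [by []|by []|elim/ord4_ind; rewrite /= ?gc_m1].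
have q02 : pauli (refl R o0 o2).
  by apply: (r 1%N gm1 g1 gm1 g1); [by []|by []|elim/ord4_ind; rewrite /= ?gc_m1].
have q03 : pauli (refl R o0 o3).
  by apply: (r 2%N gm1 g1 g1 gm1); [by []|by []|elim/ord4_ind; rewrite /= ?gc_m1].
have q12 : pauli (refl R o1 o2).
  by apply: (r 3%N g1 gm1 gm1 g1); [by []|by []|elim/ord4_ind; rewrite /= ?gc_m1].
have q13 : pauli (refl R o1 o3).
  by apply: (r 4%N g1 gm1 g1 gm1); [by []|by []|elim/ord4_ind; rewrite /= ?gc_m1].
have q23 : pauli (refl R o2 o3).
  by apply: (r 5%N g1 g1 gm1 gm1); [by []|by []|elim/ord4_ind; rewrite /= ?gc_m1].
elim/ord4_ind: k; elim/ord4_ind: l => h; [case/negP: h; exact: eqxx|..].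
- exact: q01.
- exact: q02.
- exact: q03.
- rewrite reflC; exact: q01.
- case/negP: h; exact: eqxx.
- exact: q12.
- exact: q13.
- rewrite reflC; exact: q02.
- rewrite reflC; exact: q12.
- case/negP: h; exact: eqxx.
- exact: q23.
- rewrite reflC; exact: q03.
- rewrite reflC; exact: q13.
- rewrite reflC; exact: q23.
case/negP: h; exact: eqxx.
Qed.

Lemma pauli_perm1 : pauli (perm1 R).
Proof.
have := @pauli_entry 6 isT; congr pauli; apply/matrixP => i j; rewrite !mxE mul1r.
by elim/ord4_ind: i; elim/ord4_ind: j.
Qed.

Lemma pauli_perm2 : pauli (perm2 R).
Proof.
have := @pauli_entry 7 isT; congr pauli; apply/matrixP => i j; rewrite !mxE mul1r.
by elim/ord4_ind: i; elim/ord4_ind: j.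
Qed.

Lemma pauli_i : pauli 'i%:M.
Proof.
rewrite /pauli mul_mx_scalar -scalemxAl BmxK scalemx1 (iI_tmat R); exact: Gi_tmat.
Qed.

End PauliMatrices.

(** * Generators of the invariant ring *)

Section InvariantRing.
Variable R : realType.
Local Notation C := R[i].
Local Notation Y := (Ytuple R).
Local Notation V := ('rV[R[i]]_4).

(** Adding [f (g x)] to [f x] doubles the terms of sign 1 and cancels those of sign -1. *)
Lemma filter_sum (I : Type) (s : seq I) (P : pred I) (F : I -> V -> C) (g : V -> V) (b : I -> bool)
    (f : V -> C) :
  (forall m x, F m (g x) = (-1) ^+ b m * F m x) -> (forall x, f x = \sum_(m <- s | P m) F m x) ->
  (forall x, f (g x) = f x) -> forall x, f x = \sum_(m <- s | P m && ~~ b m) F m x.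
Proof.
move=> hF hf hg x; have h2 : f x *+ 2 = (\sum_(m <- s | P m && ~~ b m) F m x) *+ 2.
  rewrite [LHS]mulr2n -{2}hg !hf -big_split /= (bigID b) /= big1 => [|m /andP[_ hb]]; last first.
    by rewrite hF hb expr1 mulN1r subrr.
  by rewrite add0r -sumrMnl; apply: eq_bigr => m /andP[_ /negPf hb]; rewrite hF hb expr0 mul1r mulr2n.
by apply/eqP; rewrite -(eqr_pMn2r (n := 2)) //; apply/eqP.
Qed.

Definition in_Y (f : V -> C) := exists Q : mpoly 6 C,
  forall x, f x = meval (fun j : 'I_6 => (yval x)`_j) Q.

Lemma in_Y_ext f g : (forall x, f x = g x) -> in_Y f -> in_Y g.
Proof. by move=> e [Q h]; exists Q => x; rewrite -e. Qed.

Lemma in_Y_D f g : in_Y f -> in_Y g -> in_Y (fun x => f x + g x).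
Proof. by move=> [P h] [Q k]; exists (P + Q) => x; rewrite mevalD h k. Qed.

Lemma in_Y_M f g : in_Y f -> in_Y g -> in_Y (fun x => f x * g x).
Proof. by move=> [P h] [Q k]; exists (P * Q) => x; rewrite mevalM h k. Qed.

Lemma in_Y_cst c : in_Y (fun=> c).
Proof. by exists (mpolyC 6 c) => x; rewrite mevalC. Qed.

Lemma in_Y_Z c f : in_Y f -> in_Y (fun x => c * f x).
Proof. exact: in_Y_M (in_Y_cst c). Qed.

Lemma in_Y_X f n : in_Y f -> in_Y (fun x => f x ^+ n).
Proof.
move=> hf; elim: n => [|n IH]; first by apply: in_Y_ext (in_Y_cst 1) => x; rewrite expr0.
by apply: in_Y_ext (in_Y_M hf IH) => x; rewrite exprS.
Qed.

Lemma in_Y_sum (I : eqType) (s : seq I) (P : pred I) (F : I -> V -> C) :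
  (forall i, P i -> in_Y (F i)) -> in_Y (fun x => \sum_(i <- s | P i) F i x).
Proof.
move=> h; elim: s => [|i s IH]; first by apply: in_Y_ext (in_Y_cst 0) => x; rewrite big_nil.
case Pi: (P i); last by apply: in_Y_ext IH => x; rewrite big_cons Pi.
by apply: in_Y_ext (in_Y_D (h i Pi) IH) => x; rewrite big_cons Pi.
Qed.

Lemma in_Y_coord (j : 'I_6) : in_Y (fun x => (yval x)`_j).
Proof. by exists (mpolyX C (mnm1 j)) => x; rewrite mevalXU. Qed.

Definition wq (x : V) (k : 'I_4) : C := (squares (x 0 o0) (x 0 o1) (x 0 o2) (x 0 o3))`_k.
Definition prod4 (x : V) : C := x 0 o0 * x 0 o1 * x 0 o2 * x 0 o3.

Lemma yvalE x : yval x = igusa_coords (wq x o0 ^+ 2) (wq x o1 ^+ 2) (wq x o2 ^+ 2) (wq x o3 ^+ 2) (prod4 x).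
Proof. by []. Qed.

Lemma in_Y_prod4 : in_Y prod4.
Proof.
have h := in_Y_D (in_Y_Z 96^-1 (in_Y_coord (inord 0))) (in_Y_Z (- 96^-1) (in_Y_coord (inord 1))).
by apply: in_Y_ext h => x; rewrite yvalE !inordK //=; move: (prod4 x) => t; field.
Qed.

Lemma in_Y_wq2 k : in_Y (fun x => wq x k ^+ 2).
Proof.
have h := in_Y_Z 6^-1 (in_Y_D (in_Y_coord (inord (k.+2))) (in_Y_D (in_Y_coord (inord 0)) (in_Y_coord (inord 1)))).
apply: in_Y_ext h => x; rewrite yvalE !inordK //=; first by elim/ord4_ind: k => /=; field.
by rewrite 2!ltnS; exact: ltn_ord.
Qed.

(** It puts the product of the four quadrics into the ring generated by the [A_k] and [prod4]. The
    square of that product is [A_0 A_1 A_2 A_3], so squaring the identity gives the one relation of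
    the invariant ring. *)
Lemma wq_relation x (A := fun k => wq x k ^+ 2) :
  8 * (wq x o0 * wq x o1 * wq x o2 * wq x o3) = 256 * prod4 x ^+ 2 -
  (A o0 ^+ 2 + A o1 ^+ 2 + A o2 ^+ 2 + A o3 ^+ 2 - 2 * (A o0 * A o1 + A o0 * A o2 + A o0 * A o3 +
     A o1 * A o2 + A o1 * A o3 + A o2 * A o3)).
Proof. rewrite /A /wq /squares /prod4 /=; ring. Qed.

Lemma in_Y_wprod : in_Y (fun x => wq x o0 * wq x o1 * wq x o2 * wq x o3).
Proof.
have A k := in_Y_wq2 k.
have sq k := in_Y_X 2 (A k).
have h1 := in_Y_D (in_Y_D (in_Y_D (sq o0) (sq o1)) (sq o2)) (sq o3).
have h2 := in_Y_D (in_Y_D (in_Y_D (in_Y_D (in_Y_D (in_Y_M (A o0) (A o1)) (in_Y_M (A o0) (A o2)))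
  (in_Y_M (A o0) (A o3))) (in_Y_M (A o1) (A o2))) (in_Y_M (A o1) (A o3))) (in_Y_M (A o2) (A o3)).
have h := in_Y_Z 8^-1 (in_Y_D (in_Y_Z 256 (in_Y_X 2 in_Y_prod4)) (in_Y_D (in_Y_Z (-1) h1) (in_Y_Z 2 h2))).
apply: in_Y_ext h => x; apply: (@mulfI _ 8); first by rewrite pnatr_eq0.
rewrite wq_relation /= mulrA mulfV ?pnatr_eq0 // mul1r; ring.
Qed.

Definition hadamard (K : comNzRingType) (a b c d : K) : seq K :=
  [:: a + b + c + d; a - b + c - d; a + b - c - d; a - b - c + d].
(** The inverse of the Hadamard matrix behind [wq]: it expresses the squares of the coordinates
    linearly in the quadrics. *)
Definition half_sums : 4.-tuple (mpoly 4 C) :=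
  [tuple 4^-1 *: (hadamard (mpolyX C (mnm1 o0)) (mpolyX C (mnm1 o1)) (mpolyX C (mnm1 o2)) (mpolyX C (mnm1 o3)))`_j | j < 4].

Lemma half_sums_eval x (i : 'I_4) : meval (wq x) (tnth half_sums i) = x 0 i ^+ 2.
Proof.
rewrite tnth_mktuple mevalZ; elim/ord4_ind: i => /=.
- by rewrite !mevalD !mevalXU /wq /squares /=; field.
- by rewrite mevalB mevalD mevalB !mevalXU /wq /squares /=; field.
- by rewrite mevalB mevalB mevalD !mevalXU /wq /squares /=; field.
by rewrite mevalD mevalB mevalB !mevalXU /wq /squares /=; field.
Qed.

Lemma bigprod4 (F : 'I_4 -> C) : \prod_(i < 4) F i = F o0 * F o1 * F o2 * F o3.
Proof.
rewrite !big_ord_recr big_ord0 /= mul1r.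
by congr (F _ * F _ * F _ * F _); apply: val_inj.
Qed.

Lemma signed_prod (F F' : 'I_4 -> C) (s : 'I_4 -> bool) (m : multinom 4) :
  (forall i, F' i = (-1) ^+ s i * F i) ->
  \prod_(i < 4) F' i ^+ m i = (-1) ^+ odd (\sum_(i < 4 | s i) m i) * \prod_(i < 4) F i ^+ m i.
Proof.
move=> h; rewrite signr_odd expr_sum [X in _ = X * _]big_mkcond -big_split /=.
apply: eq_bigr => i _; rewrite h exprMn; congr (_ * _).
by case: (s i); rewrite ?expr1 // expr0 expr1n.
Qed.

Lemma equal_parity (F : 'I_4 -> C) (m : multinom 4) :
  ~~ odd (m o0 + m o1) -> ~~ odd (m o0 + m o2) -> ~~ odd (m o0 + m o3) ->
  \prod_(i < 4) F i ^+ m i =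
  (F o0 * F o1 * F o2 * F o3) ^+ odd (m o0) * \prod_(i < 4) (F i ^+ 2) ^+ (m i)./2.
Proof.
rewrite !oddD !negb_add => /eqP h1 /eqP h2 /eqP h3.
rewrite !bigprod4 -!exprM ![(2 * _)%N]mulnC !muln2 !exprMn.
rewrite -{1}(odd_double_half (m o0)) -{1}(odd_double_half (m o1)) -{1}(odd_double_half (m o2))
  -{1}(odd_double_half (m o3)) !exprD -h1 -h2 -h3; ring.
Qed.
Lemma coord_mono (x : V) (sg : 'I_4 -> 'I_4) e i : (forall k, sg (sg k) = k) ->
  (x *m mono sg e) 0 (sg i) = e i * x 0 i.
Proof.
move=> sK; rewrite mxE (bigD1 i) //= mxE eqxx mulr1 big1 ?addr0 1?mulrC // => k ki.
by rewrite mxE (can_eq sK) eq_sym (negPf ki) !mulr0.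
Qed.

Lemma coord_refl (x : V) k l i : (x *m refl R k l) 0 i = (-1) ^+ ((i == k) || (i == l)) * x 0 i.
Proof. by rewrite (@coord_mono x id) // /neg2; case: ifP => _; rewrite ?expr1. Qed.

Lemma wq_perm1 x k : wq (x *m perm1 R) k = (-1) ^+ ((k == o1) || (k == o3)) * wq x k.
Proof.
have e i : (x *m perm1 R) 0 (sw1 i) = x 0 i.
  by rewrite (@coord_mono x sw1) ?mul1r //; elim/ord4_ind.
have := (e o0, e o1, e o2, e o3); rewrite /= /wq => -[[[-> ->] ->] ->].
by elim/ord4_ind: k => /=; ring.
Qed.

Lemma wq_perm2 x k : wq (x *m perm2 R) k = (-1) ^+ ((k == o2) || (k == o3)) * wq x k.
Proof.
have e i : (x *m perm2 R) 0 (sw2 i) = x 0 i.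
  by rewrite (@coord_mono x sw2) ?mul1r //; elim/ord4_ind.
have := (e o0, e o1, e o2, e o3); rewrite /= /wq => -[[[-> ->] ->] ->].
by elim/ord4_ind: k => /=; ring.
Qed.

Lemma wq_i x k : wq (x *m 'i%:M) k = (-1) ^+ true * wq x k.
Proof.
rewrite mul_mx_scalar /wq !mxE; have i2 : ('i : C) ^+ 2 = -1 := sqr_i _; move: ('i : C) i2 => q q2.
by elim/ord4_ind: k => /=; ring: q2.
Qed.

Lemma prod4_i x : prod4 (x *m 'i%:M) = prod4 x.
Proof.
rewrite mul_mx_scalar /prod4 !mxE; have i2 : ('i : C) ^+ 2 = -1 := sqr_i _; move: ('i : C) i2 => q q2.
by ring: q2.
Qed.

Lemma prod4_perm1 x : prod4 (x *m perm1 R) = prod4 x.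
Proof.
have e i : (x *m perm1 R) 0 (sw1 i) = x 0 i.
  by rewrite (@coord_mono x sw1) ?mul1r //; elim/ord4_ind.
have := (e o0, e o1, e o2, e o3); rewrite /= /prod4 => -[[[-> ->] ->] ->]; ring.
Qed.

Lemma prod4_perm2 x : prod4 (x *m perm2 R) = prod4 x.
Proof.
have e i : (x *m perm2 R) 0 (sw2 i) = x 0 i.
  by rewrite (@coord_mono x sw2) ?mul1r //; elim/ord4_ind.
have := (e o0, e o1, e o2, e o3); rewrite /= /prod4 => -[[[-> ->] ->] ->]; ring.
Qed.

Lemma sum_pair (m : multinom 4) k l : k != l -> (\sum_(i < 4 | (i == k) || (i == l)) m i = m k + m l)%N.
Proof.
move=> kl; rewrite (bigD1 k) ?eqxx //= (bigD1 l) /=; last by rewrite eqxx orbT eq_sym.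
by rewrite big_pred0 ?addn0 // => i; case: (i == k); case: (i == l).
Qed.

Definition half_monomial (m : multinom 4) : multinom 4 :=
  Multinom [tuple (m i)./2 | i < 4].

(** Double sign changes leave only monomials whose four exponents have equal parity: [prod4] to the
    power 0 or 1 times a monomial in the squares. The squares are linear in the quadrics [wq], on
    which [i] and the double transpositions act by signs, so the same filter applies again and
    leaves polynomials in the [wq^2] and their product. *)
Lemma invariant_in_Y (p : mpoly 4 C) :
  (forall N, pauli N -> forall x : V, meval ((x *m N) ord0) p = meval (x ord0) p) ->
  in_Y (fun x => meval (x ord0) p).
Proof.
move=> hp; pose f (x : V) := meval (x ord0) p.
pose F (m : multinom 4) (x : V) := mcoeff m p * \prod_(i < 4) x 0 i ^+ m i.
have f0 x : f x = \sum_(m <- msupp p | true) F m x by exact: mevalE.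
have sF k m x : k != o0 -> F m (x *m refl R o0 k) = (-1) ^+ odd (m o0 + m k) * F m x.
  move=> k0; rewrite /F (signed_prod m (coord_refl x o0 k)) sum_pair 1?eq_sym // mulrCA; congr (_ * _).
have f1 := filter_sum (fun m x => sF o1 m x isT) f0 (hp _ (pauli_refl R (isT : o0 != o1))).
have f2 := filter_sum (fun m x => sF o2 m x isT) f1 (hp _ (pauli_refl R (isT : o0 != o2))).
have f3 := filter_sum (fun m x => sF o3 m x isT) f2 (hp _ (pauli_refl R (isT : o0 != o3))).
(* The monomial in the squares of the coordinates, rewritten as a polynomial in the quadrics. *)
pose h m := comp_mpoly half_sums (mpolyX C (half_monomial m)).
pose par (m : multinom 4) := [&& ~~ odd (m o0 + m o1), ~~ odd (m o0 + m o2) & ~~ odd (m o0 + m o3)].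
pose F' (q : multinom 4 * multinom 4) (x : V) :=
  mcoeff q.1 p * prod4 x ^+ odd (q.1 o0) * (mcoeff q.2 (h q.1) * \prod_(i < 4) wq x i ^+ q.2 i).
pose s := [seq (m, n) | m <- [seq m <- msupp p | par m], n <- msupp (h m)].
have g0 x : f x = \sum_(q <- s | true) F' q x.
  rewrite f3 big_allpairs_dep big_filter; apply: eq_big => [m|m]; first by rewrite /par andbA.
  move=> /andP[/andP[/andP[_ p1] p2] p3]; rewrite /F (equal_parity _ p1 p2 p3) mulrA.
  transitivity (mcoeff m p * prod4 x ^+ odd (m o0) * meval (wq x) (h m)); last by rewrite mevalE big_distrr.
  rewrite comp_mpoly_meval mevalX; congr (_ * _).
  by apply: eq_bigr => i _; rewrite half_sums_eval mnmE.
have sF' (N : 'M[C]_4) (b : 'I_4 -> bool) q x : (forall x, prod4 (x *m N) = prod4 x) ->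
    (forall x k, wq (x *m N) k = (-1) ^+ b k * wq x k) ->
    F' q (x *m N) = (-1) ^+ odd (\sum_(i < 4 | b i) q.2 i) * F' q x.
  by move=> hN wN; rewrite /F' hN (signed_prod q.2 (wN x)); ring.
have g1 := filter_sum (fun q x => sF' _ _ q x prod4_i wq_i) g0 (hp _ (pauli_i R)).
have g2 := filter_sum (fun q x => sF' _ _ q x prod4_perm1 wq_perm1) g1 (hp _ (pauli_perm1 R)).
have g3 := filter_sum (fun q x => sF' _ _ q x prod4_perm2 wq_perm2) g2 (hp _ (pauli_perm2 R)).
apply: (in_Y_ext (fun x => esym (g3 x))); apply: in_Y_sum => q.
(* Three sums of exponents are even: over all four indices, over [o1] and [o3], over [o2] and [o3].
   Hence all four exponents are congruent modulo 2. *)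
rewrite !sum_pair // sum4 !oddD => hq.
have [q1 q2 q3] : [/\ ~~ odd (q.2 o0 + q.2 o1), ~~ odd (q.2 o0 + q.2 o2) & ~~ odd (q.2 o0 + q.2 o3)].
  by rewrite !oddD; move: hq; do 4![case: (odd _)].
apply: (@in_Y_ext (fun x => (mcoeff q.1 p * prod4 x ^+ odd (q.1 o0)) * (mcoeff q.2 (h q.1) *
   ((wq x o0 * wq x o1 * wq x o2 * wq x o3) ^+ odd (q.2 o0) *
    ((wq x o0 ^+ 2) ^+ (q.2 o0)./2 * (wq x o1 ^+ 2) ^+ (q.2 o1)./2 *
     (wq x o2 ^+ 2) ^+ (q.2 o2)./2 * (wq x o3 ^+ 2) ^+ (q.2 o3)./2))))).
  by move=> x; rewrite /F' (equal_parity _ q1 q2 q3) bigprod4.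
apply: in_Y_M; first by apply: in_Y_M (in_Y_cst _) (in_Y_X _ in_Y_prod4).
apply: in_Y_M; first exact: in_Y_cst.
apply: in_Y_M; first exact: in_Y_X in_Y_wprod.
by do !apply: in_Y_M; apply: in_Y_X; exact: in_Y_wq2.
Qed.

Lemma invariant_generated (p : mpoly 4 C) : invariant_poly (@Gi R) p -> exists q, p = comp_mpoly Y q.
Proof.
move=> hp; pose p' := lin_subst (Binv R) p.
have [|Q hQ] := @invariant_in_Y p'.
  move=> N hN x; rewrite /p'.
  apply: (etrans (lin_subst_eval (Binv R) p (x *m N))); apply/esym.
  apply: (etrans (lin_subst_eval (Binv R) p x)); rewrite -{1}(hp _ hN).
  apply: (etrans (lin_subst_eval _ p (x *m Binv R))).
  by rewrite !mulmxA -(mulmxA x) BinvK mulmx1.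
exists Q; apply: mpoly_row_inj => x; rewrite comp_mpoly_meval.
transitivity (meval ((x *m Bmx R) ord0) p').
  by apply/esym; apply: (etrans (lin_subst_eval (Binv R) p (x *m Bmx R))); rewrite -mulmxA BmxK mulmx1.
by rewrite hQ; apply: meval_eq => j; rewrite -Ytuple_eval.
Qed.

End InvariantRing.

(** * The ideal of relations *)

Section Relations.
Variable R : realType.
Local Notation C := R[i].
Local Notation Y := (Ytuple R).
Local Notation V := ('rV[R[i]]_4).
Local Notation ideal := (in_ideal (igusa_cone_eqs R)).
Local Notation e0 := (tnth (igusa_cone_eqs R) ord0).
Local Notation e1 := (tnth (igusa_cone_eqs R) (lift ord0 ord0)).

Lemma sum6 (K : nmodType) (f : 'I_6 -> K) :
  \sum_(j < 6) f j = f (inord 0) + f (inord 1) + f (inord 2) + f (inord 3) + f (inord 4) + f (inord 5).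
Proof.
rewrite !big_ord_recr big_ord0 /= add0r.
by congr (f _ + f _ + f _ + f _ + f _ + f _); apply: val_inj; rewrite /= inordK.
Qed.

Section Igusa.
Variable K : comNzRingType.
Definition discr (A0 A1 A2 A3 : K) : K :=
  A0 ^+ 2 + A1 ^+ 2 + A2 ^+ 2 + A3 ^+ 2 -
  2 * (A0 * A1 + A0 * A2 + A0 * A3 + A1 * A2 + A1 * A3 + A2 * A3).
Definition quartic (A0 A1 A2 A3 t : K) : K :=
  (256 * t ^+ 2 - discr A0 A1 A2 A3) ^+ 2 - 64 * (A0 * A1 * A2 * A3).

Lemma igusa_coords_quartic (A0 A1 A2 A3 t : K) (y := fun j : 'I_6 => (igusa_coords A0 A1 A2 A3 t)`_j) :
  \sum_(j < 6) y j = 0 /\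
  (\sum_(j < 6) y j ^+ 2) ^+ 2 - 4 * \sum_(j < 6) y j ^+ 4 = - 324%:R * quartic A0 A1 A2 A3 t.
Proof.
rewrite !sum6 /y !inordK //= /quartic /discr; split; ring.
Qed.

End Igusa.

Lemma rmorph_discr (K L : comNzRingType) (f : {rmorphism K -> L}) (a b c d : K) :
  f (discr a b c d) = discr (f a) (f b) (f c) (f d).
Proof. by rewrite /discr rmorphB rmorphM rmorph_nat !rmorphD !rmorphXn !rmorphM. Qed.

Lemma quartic_wq (x : V) :
  quartic (wq x o0 ^+ 2) (wq x o1 ^+ 2) (wq x o2 ^+ 2) (wq x o3 ^+ 2) (prod4 x) = 0.
Proof.
rewrite /quartic; have := wq_relation x; rewrite /= -/(discr _ _ _ _) => <-; ring.
Qed.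

Lemma e0E : e0 = \sum_(j < 6) mpolyX C (mnm1 j).
Proof. by rewrite (tnth_nth 0) /= /power_sum; apply: eq_bigr => j _; rewrite expr1. Qed.

Lemma e1E : e1 = (\sum_(j < 6) mpolyX C (mnm1 j) ^+ 2) ^+ 2 - 4 * \sum_(j < 6) mpolyX C (mnm1 j) ^+ 4.
Proof. by rewrite (tnth_nth 0) /= /power_sum -mulr_algl scaler_nat. Qed.

Lemma igusa_eqs_yval (x : V) (k : 'I_2) :
  meval (fun j : 'I_6 => (yval x)`_j) (tnth (igusa_cone_eqs R) k) = 0.
Proof.
have [h0 h1] := igusa_coords_quartic (wq x o0 ^+ 2) (wq x o1 ^+ 2) (wq x o2 ^+ 2) (wq x o3 ^+ 2) (prod4 x).
have : k = ord0 \/ k = lift ord0 ord0.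
  by case: k => [[|[|k]] h] //; [left|right]; apply: val_inj.
case=> ->; rewrite ?e0E ?e1E.
  by rewrite rmorph_sum -[RHS]h0; apply: eq_bigr => j _; rewrite /= mevalXU.
have sq n : meval (fun j : 'I_6 => (yval x)`_j) (\sum_(j < 6) mpolyX C (mnm1 j) ^+ n) =
    \sum_(j < 6) (yval x)`_j ^+ n.
  by rewrite rmorph_sum; apply: eq_bigr => j _; rewrite /= rmorphXn /= mevalXU.
have e4 : meval (fun j : 'I_6 => (yval x)`_j) 4 = 4 by rewrite rmorph_nat.
rewrite mevalB expr2 mevalM mevalM e4 !sq -expr2.
by apply: (etrans h1); rewrite quartic_wq mulr0.
Qed.

Lemma ideal_D p q : ideal p -> ideal q -> ideal (p + q).
Proof.
move=> [a ->] [b ->]; exists (fun k => a k + b k).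
by rewrite -big_split /=; apply: eq_bigr => k _; rewrite mulrDl.
Qed.

Lemma ideal_M p q : ideal q -> ideal (p * q).
Proof.
move=> [a ->]; exists (fun k => p * a k).
by rewrite big_distrr /=; apply: eq_bigr => k _; rewrite mulrA.
Qed.

Lemma ideal_0 : ideal 0.
Proof. by exists (fun=> 0); rewrite big1 // => k _; rewrite mul0r. Qed.

Lemma ideal_e k : ideal (tnth (igusa_cone_eqs R) k).
Proof.
exists (fun j => (j == k)%:R); rewrite (bigD1 k) //= eqxx mul1r big1 ?addr0 // => j /negPf ->.
by rewrite mul0r.
Qed.

Definition cong p q := ideal (p - q).

Lemma cong_refl p : cong p p.
Proof. by rewrite /cong subrr; exact: ideal_0. Qed.

Lemma cong_trans q p r : cong p q -> cong q r -> cong p r.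
Proof. by move=> h k; have := ideal_D h k; rewrite addrA subrK. Qed.

Lemma cong_D p q p' q' : cong p q -> cong p' q' -> cong (p + p') (q + q').
Proof. by move=> h k; have := ideal_D h k; rewrite /cong opprD addrACA. Qed.

Lemma cong_N p q : cong p q -> cong (- p) (- q).
Proof. by move=> /(ideal_M (-1)); rewrite /cong mulN1r opprD. Qed.

Lemma cong_M p q p' q' : cong p q -> cong p' q' -> cong (p * p') (q * q').
Proof.
move=> h k; have := ideal_D (ideal_M p' h) (ideal_M q k); rewrite /cong.
by congr ideal; ring.
Qed.

Lemma cong_X p q n : cong p q -> cong (p ^+ n) (q ^+ n).
Proof.
by move=> h; elim: n => [|n IH]; rewrite ?expr0 ?exprS; [exact: cong_refl|exact: cong_M].
Qed.

Lemma cong_sum n (F G : 'I_n -> mpoly 6 C) : (forall j, cong (F j) (G j)) ->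
  cong (\sum_(j < n) F j) (\sum_(j < n) G j).
Proof.
by move=> h; elim/big_rec2: _ => [|j p q _ IH]; [exact: cong_refl|exact: cong_D].
Qed.

(* Kept abstract so that unification does not unfold the linear forms. *)

Section Reduction.
Variables (A : 'I_4 -> mpoly 6 C) (T : mpoly 6 C).
Hypothesis Aeval : forall v c, meval v (A c) = 6^-1 * (v (inord c.+2) + v (inord 0) + v (inord 1)).
Hypothesis Teval : forall v, meval v T = 96^-1 * (v (inord 0) - v (inord 1)).

(** With [s] the sum of the six variables, the [A_c] add up to [s/6 + (y_0 + y_1)/2]; this explains
    the multiples [-1/6] and [1/3] of the linear equation. *)
Lemma coord_cong (j : 'I_6) : cong (mpolyX C (mnm1 j))
  (igusa_coords (A o0) (A o1) (A o2) (A o3) T)`_j.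
Proof.
rewrite /cong (_ : _ - _ = mpolyC 6 (if (j < 2)%N then - 6^-1 else 3^-1) * e0).
  by apply: ideal_M; exact: ideal_e.
apply: mpoly_eval_inj => v; rewrite mevalB mevalXU meval_igusa_coords !Aeval Teval.
rewrite mevalM mevalC e0E rmorph_sum /= (eq_bigr v) => [|k _]; last by rewrite mevalXU.
have {1}-> : j = inord j by rewrite inord_val.
by rewrite sum6; case: j => [[|[|[|[|[|[|]]]]]] h] //=; field.
Qed.

Lemma quartic_cong : ideal (quartic (A o0) (A o1) (A o2) (A o3) T).
Proof.
have [_ h] := igusa_coords_quartic (A o0) (A o1) (A o2) (A o3) T.
have c n : cong (\sum_(j < 6) mpolyX C (mnm1 j) ^+ n)
    (\sum_(j < 6) (igusa_coords (A o0) (A o1) (A o2) (A o3) T)`_j ^+ n).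
  by apply: cong_sum => j; apply: cong_X; exact: coord_cong.
have k : cong e1 (- 324%:R * quartic (A o0) (A o1) (A o2) (A o3) T).
  rewrite -h e1E; apply: cong_D; first exact: cong_X (c 2).
  by apply: cong_N; apply: cong_M (cong_refl _) (c 4%N).
have := ideal_D (ideal_M (-1) k) (ideal_e (lift ord0 ord0)).
rewrite mulN1r opprB subrK => /(ideal_M (mpolyC 6 (- 324%:R^-1))).
congr ideal; rewrite mulrA (_ : _ * - 324%:R = 1) ?mul1r //.
rewrite (_ : - 324%:R = mpolyC 6 (- 324%:R : C)); last by rewrite mpolyCN mpolyC_nat.
by rewrite -mpolyCM mulrNN mulVf ?pnatr_eq0 // mpolyC1.
Qed.

Definition At : 4.-tuple (mpoly 6 C) := [tuple A c | c < 4].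
Let rhoA : {rmorphism mpoly 4 C -> mpoly 6 C} := comp_mpoly At.
(** The relation has degree 4 in [T] with leading coefficient the unit [256^2], so modulo the ideal
    the powers [1, T, T^2, T^3] span over the polynomials in the [A_c]. *)
Definition normal_form (r0 r1 r2 r3 : mpoly 4 C) : mpoly 6 C :=
  rhoA r0 + rhoA r1 * T + rhoA r2 * T ^+ 2 +
  rhoA r3 * T ^+ 3.
Definition reducible q := exists r0 r1 r2 r3, cong q (normal_form r0 r1 r2 r3).

Lemma comp_Avar c : rhoA (mpolyX C (mnm1 c)) = A c.
Proof. by rewrite /rhoA /= comp_mpolyXU -tnth_nth tnth_mktuple. Qed.

Lemma reducible_D p q : reducible p -> reducible q -> reducible (p + q).
Proof.
move=> [r0 [r1 [r2 [r3 h]]]] [s0 [s1 [s2 [s3 k]]]].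
exists (r0 + s0), (r1 + s1), (r2 + s2), (r3 + s3); apply: cong_trans (cong_D h k) _.
rewrite (_ : normal_form _ _ _ _ + _ = normal_form (r0 + s0) (r1 + s1) (r2 + s2) (r3 + s3)); first exact: cong_refl.
rewrite /normal_form (rmorphD rhoA r0 s0) (rmorphD rhoA r1 s1) (rmorphD rhoA r2 s2) (rmorphD rhoA r3 s3).
move: (rhoA r0) (rhoA r1) (rhoA r2) (rhoA r3) (rhoA s0) (rhoA s1) (rhoA s2) (rhoA s3) => *; ring.
Qed.

Lemma reducible_cong p q : cong p q -> reducible q -> reducible p.
Proof. by move=> h [r0 [r1 [r2 [r3 k]]]]; exists r0, r1, r2, r3; apply: cong_trans k. Qed.

Lemma reducible_A s q : reducible q -> reducible (rhoA s * q).
Proof.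
move=> [r0 [r1 [r2 [r3 h]]]]; exists (s * r0), (s * r1), (s * r2), (s * r3).
apply: cong_trans (cong_M (cong_refl _) h) _.
rewrite (_ : _ * normal_form _ _ _ _ = normal_form (s * r0) (s * r1) (s * r2) (s * r3)); first exact: cong_refl.
rewrite /normal_form (rmorphM rhoA s r0) (rmorphM rhoA s r1) (rmorphM rhoA s r2) (rmorphM rhoA s r3).
move: (rhoA r0) (rhoA r1) (rhoA r2) (rhoA r3) (rhoA s) => *; ring.
Qed.

Local Notation XA c := (mpolyX C (mnm1 (c : 'I_4))).
Definition discr4 : mpoly 4 C := discr (XA o0) (XA o1) (XA o2) (XA o3).
Definition prodA : mpoly 4 C := XA o0 * XA o1 * XA o2 * XA o3.

Lemma reducible_T q : reducible q -> reducible (q * T).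
Proof.
move=> [r0 [r1 [r2 [r3 h]]]].
pose d := discr4; pose c : mpoly 4 C := mpolyC 4 (256^-1 ^+ 2).
(* The quartic reads [256^2 T^4 = 512 d T^2 - d^2 + 64 A_0 A_1 A_2 A_3]. *)
exists (c * r3 * (64 * prodA - d ^+ 2)), r0, (r1 + c * r3 * (512 * d)), r2.
apply: cong_trans (cong_M h (cong_refl _)) _.
rewrite /cong (_ : _ - _ = (rhoA (c * r3)) * quartic (A o0) (A o1) (A o2) (A o3) T).
  by apply: ideal_M; exact: quartic_cong.
have hc : mpolyC 6 (256^-1 ^+ 2 : C) * 256 ^+ 2 = 1.
  by rewrite -[256 in X in _ * X](mpolyC_nat 6 C 256) expr2 [in X in _ * X]expr2 -!mpolyCM mulrACA mulVf ?pnatr_eq0 // mulr1 mpolyC1.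
have dE : rhoA d = discr (A o0) (A o1) (A o2) (A o3).
  by rewrite /d /discr4 rmorph_discr !comp_Avar.
have pE : rhoA prodA = A o0 * A o1 * A o2 * A o3.
  by rewrite /prodA !rmorphM /= !comp_Avar.
have e1 : rhoA (c * r3) = mpolyC 6 (256^-1 ^+ 2) * rhoA r3.
  by rewrite (rmorphM rhoA c r3) /rhoA /= comp_mpolyC.
have e2 : rhoA (c * r3 * (64 * prodA - d ^+ 2)) = mpolyC 6 (256^-1 ^+ 2) * rhoA r3 *
    (64 * (A o0 * A o1 * A o2 * A o3) - discr (A o0) (A o1) (A o2) (A o3) ^+ 2).
  rewrite (rmorphM rhoA (c * r3)) e1 (rmorphB rhoA (64 * prodA)) (rmorphM rhoA 64 prodA) pE (rmorphXn rhoA 2 d) dE.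
  by rewrite (rmorph_nat rhoA 64).
have e3 : rhoA (r1 + c * r3 * (512 * d)) = rhoA r1 + mpolyC 6 (256^-1 ^+ 2) * rhoA r3 *
    (512 * discr (A o0) (A o1) (A o2) (A o3)).
  by rewrite (rmorphD rhoA r1) (rmorphM rhoA (c * r3)) e1 (rmorphM rhoA 512 d) dE (rmorph_nat rhoA 512).
rewrite /normal_form e1 e2 e3 /quartic.
move: hc; set g := mpolyC 6 _; move: g (discr _ _ _ _) (A o0 * _ * _ * _) => g D P.
move: (rhoA r0) (rhoA r1) (rhoA r2) (rhoA r3) => a0 a1 a2 a3 hc.
apply/eqP; rewrite -subr_eq0 [X in X == 0](_ : _ = (1 - g * 256 ^+ 2) * (a3 * T ^+ 4)).
  by rewrite hc subrr mul0r.
clear; ring.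
Qed.

Lemma reducible_Mvar c q : reducible q -> reducible (q * A c).
Proof. by rewrite mulrC -comp_Avar; exact: reducible_A. Qed.

Lemma reducible_C c q : reducible q -> reducible (mpolyC 6 c * q).
Proof. by move=> /(reducible_A (mpolyC 4 c)); rewrite /rhoA /= comp_mpolyC. Qed.

Lemma reducible_igusa_coord (j : 'I_6) q : reducible q -> reducible (q * mpolyX C (mnm1 j)).
Proof.
move=> h; apply: reducible_cong (cong_M (cong_refl q) (coord_cong j)) _.
have [hA hT] := (fun c => reducible_Mvar c h, reducible_T h).
have hS := reducible_D (reducible_D (reducible_D (hA o0) (hA o1)) (hA o2)) (hA o3).
have k (n : int) p : reducible p -> reducible (p *~ n).
  by move=> /(reducible_C n%:~R); rewrite rmorph_int mulrzl.
have e c : reducible ((q * A c) *~ 6 + (q * A o0 + q * A o1 + q * A o2 + q * A o3) *~ (- 2)).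
  by apply: reducible_D (k 6 _ (hA c)) (k (-2) _ hS).
have e' n : reducible ((q * A o0 + q * A o1 + q * A o2 + q * A o3) + (q * T) *~ n).
  by apply: reducible_D hS (k n _ hT).
case: j => [[|[|[|[|[|[|j]]]]]] hj] //=.
- by have := e' 48; congr reducible; clear; ring.
- by have := e' (- 48); congr reducible; clear; ring.
- by have := e o0; congr reducible; clear; ring.
- by have := e o1; congr reducible; clear; ring.
- by have := e o2; congr reducible; clear; ring.
by have := e o3; congr reducible; clear; ring.
Qed.

Lemma reducible1 : reducible 1.
Proof.
exists 1, 0, 0, 0; rewrite (_ : normal_form _ _ _ _ = 1); first exact: cong_refl.
by rewrite /normal_form (rmorph1 rhoA) (rmorph0 rhoA) !mul0r !addr0.
Qed.

Lemma reducible_all q : reducible q.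
Proof.
have red0 : reducible 0 by have := reducible_C 0 reducible1; rewrite mpolyC0 mul0r.
rewrite (mpolyE q); elim/big_rec: _ => [|m p _ hp]; first exact: red0.
apply: reducible_D hp; rewrite -mul_mpolyC; apply: reducible_C.
rewrite mpolyXE_id; elim/big_rec: _ => [|j p' _ IH]; first exact: reducible1.
rewrite mulrC; elim: (m j) => [|n IHn]; first by rewrite expr0 mulr1.
by rewrite exprSr mulrA; exact: reducible_igusa_coord.
Qed.

End Reduction.

End Relations.

(** * The quotient is the cone over the Igusa quartic *)

Section QuotientIso.
Variable R : realType.
Local Notation C := R[i].
Local Notation Y := (Ytuple R).
Local Notation V := ('rV[R[i]]_4).
Local Notation XY k := (mpolyX C (mnm1 (inord k : 'I_6))).

Definition Aform (c : 'I_4) : mpoly 6 C := 6^-1 *: (mpolyX C (mnm1 (inord c.+2 : 'I_6)) + XY 0 + XY 1).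
Definition Tform : mpoly 6 C := 96^-1 *: (XY 0 - XY 1).

Lemma Aform_eval v c : meval v (Aform c) = 6^-1 * (v (inord c.+2) + v (inord 0) + v (inord 1)).
Proof. by rewrite mevalZ !mevalD !mevalXU. Qed.

Lemma Tform_eval v : meval v Tform = 96^-1 * (v (inord 0) - v (inord 1)).
Proof. by rewrite mevalZ mevalB !mevalXU. Qed.

Lemma wq_surj (w : 'I_4 -> C) : exists x : V, forall k, wq x k = w k.
Proof.
pose X := hadamard (w o0) (w o1) (w o2) (w o3).
exists (\row_k sqrtC (4^-1 * X`_k)) => k; rewrite /wq !mxE /squares !sqrtCK /X /=.
by elim/ord4_ind: k => /=; field.
Qed.

(** A symmetry outside the Pauli group: it fixes the quadrics [wq] and changes the sign of
    [prod4]. *)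
Definition flip0 : 'M[C]_4 := mono id (fun i => if i == o0 then -1 else 1).

Lemma wq_flip0 (x : V) k : wq (x *m flip0) k = wq x k.
Proof.
have e i : (x *m flip0) 0 i = (if i == o0 then -1 else 1) * x 0 i by rewrite (@coord_mono R x id).
by rewrite /wq !e /= !mul1r mulN1r /squares !sqrrN.
Qed.

Lemma prod4_flip0 (x : V) : prod4 (x *m flip0) = - prod4 x.
Proof.
have e i : (x *m flip0) 0 i = (if i == o0 then -1 else 1) * x 0 i by rewrite (@coord_mono R x id).
by rewrite /prod4 !e /=; ring.
Qed.

Section Independence.
Variables r0 r1 r2 r3 : mpoly 4 C.
Let ev r (w : 'I_4 -> C) := meval (fun k => w k ^+ 2) r.
Hypothesis h0 : forall x : V, ev r0 (wq x) + ev r1 (wq x) * prod4 x + ev r2 (wq x) * prod4 x ^+ 2 +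
  ev r3 (wq x) * prod4 x ^+ 3 = 0.

Let D (w : 'I_4 -> C) := discr (w o0 ^+ 2) (w o1 ^+ 2) (w o2 ^+ 2) (w o3 ^+ 2).
Let b (w : 'I_4 -> C) := w o0 * w o1 * w o2 * w o3.

(** [flip0] separates the even and odd powers of [prod4], and [256 prod4^2 = D + 8 b] by
    [wq_relation]. The odd part is multiplied once more by [prod4] to become a polynomial in [w]. *)
Lemma even_odd (w : 'I_4 -> C) :
  256 * ev r0 w + ev r2 w * (D w + 8 * b w) = 0 /\
  (D w + 8 * b w) * (256 * ev r1 w + ev r3 w * (D w + 8 * b w)) = 0.
Proof.
have [x hx] := wq_surj w; have wx : wq x = w by apply/funext.
have h1 := h0 x; have h2 := h0 (x *m flip0).
have wf : wq (x *m flip0) = w by apply/funext => k; rewrite wq_flip0.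
rewrite wf prod4_flip0 in h2; rewrite wx in h1.
have t2 : 256 * prod4 x ^+ 2 = D w + 8 * b w.
  by have := wq_relation x; rewrite wx /D /b /discr /= => ->; ring.
move: h1 h2 t2; move: (ev r0 w) (ev r1 w) (ev r2 w) (ev r3 w) (prod4 x) => a0 a1 a2 a3 t h1 h2 t2.
have two : (2 : C) != 0 by rewrite pnatr_eq0.
rewrite -t2; split; apply: (mulfI two); rewrite mulr0.
  transitivity (256 * ((a0 + a1 * t + a2 * t ^+ 2 + a3 * t ^+ 3) +
    (a0 + a1 * - t + a2 * (- t) ^+ 2 + a3 * (- t) ^+ 3))); first by ring.
  by rewrite h1 h2 addr0 mulr0.
transitivity (256 * 256 * t * ((a0 + a1 * t + a2 * t ^+ 2 + a3 * t ^+ 3) -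
    (a0 + a1 * - t + a2 * (- t) ^+ 2 + a3 * (- t) ^+ 3))); first by ring.
by rewrite h1 h2 subr0 mulr0.
Qed.

Lemma mpoly_squares_eq0 (p : mpoly 4 C) : (forall w, ev p w = 0) -> p = 0.
Proof.
move=> h; apply: mpoly_eq0_eval => v; rewrite -(h (fun k => sqrtC (v k))).
by apply: meval_eq => k; rewrite sqrtCK.
Qed.

Definition neg_first (w : 'I_4 -> C) k := if k == o0 then - w k else w k.

Lemma neg_first_ev p w : ev p (neg_first w) = ev p w.
Proof. by apply: meval_eq => k; rewrite /neg_first; case: ifP => _; rewrite ?sqrrN. Qed.

(** Replacing [w_0] by [- w_0] preserves the squares and [D] but changes the sign of [b], which
    gives a second equation for the same values of the [r_k]. In other words [prod4] has degree 4
    over the field generated by the [A_k]. *)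
Lemma independence : [/\ r0 = 0, r1 = 0, r2 = 0 & r3 = 0].
Proof.
have Dn w : D (neg_first w) = D w by rewrite /D /neg_first /= !sqrrN.
have bn w : b (neg_first w) = - b w by rewrite /b /neg_first /=; ring.
have n16 : (16 : C) != 0 by rewrite pnatr_eq0.
have n256 : (256 : C) != 0 by rewrite pnatr_eq0.
have evA w : ev (prodA R) w = b w ^+ 2.
  by rewrite /ev /prodA !mevalM !mevalXU /b; ring.
have evD w : ev (discr4 R) w = D w by rewrite /ev /discr4 rmorph_discr /= !mevalXU.
have evM p q w : ev (p * q) w = ev p w * ev q w by exact: mevalM.
have nA : prodA R != 0.
  by rewrite /prodA !mulf_neq0 // -?msupp_eq0 msuppX.
have r2w w : ev r2 w * b w = 0.
  have [e _] := even_odd w; have [e' _] := even_odd (neg_first w).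
  rewrite !neg_first_ev Dn bn in e'; apply: (mulfI n16); rewrite mulr0.
  transitivity ((256 * ev r0 w + ev r2 w * (D w + 8 * b w)) - (256 * ev r0 w + ev r2 w * (D w + 8 * - b w))).
    by ring.
  by rewrite e e' subrr.
have z2 : r2 = 0.
  have : r2 * prodA R = 0 by apply: mpoly_squares_eq0 => w; rewrite (evM r2) evA expr2 mulrA r2w mul0r.
  by move=> e; apply: (mulIf nA); rewrite e mul0r.
have z0 : r0 = 0.
  apply: mpoly_squares_eq0 => w; have [e _] := even_odd w; apply: (mulfI n256); rewrite mulr0 -e.
  by rewrite z2 /ev meval0 mul0r addr0.
have evB p q w : ev (p - q) w = ev p w - ev q w by exact: mevalB.
have ev64 w : ev 64 w = 64 by exact: (rmorph_nat (meval (fun k => w k ^+ 2)) 64).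
have evN w : ev (discr4 R ^+ 2 - 64 * prodA R) w = D w ^+ 2 - 64 * b w ^+ 2.
  by rewrite evB (expr2 (discr4 R)) (evM (discr4 R)) (evM 64) ev64 evA evD -expr2.
have nd : discr4 R ^+ 2 - 64 * prodA R != 0.
  (* At [w = (1,0,0,0)] the value is 1. *)
  apply/eqP => /(congr1 (fun p => ev p (fun k => (k == o0)%:R))).
  rewrite evN /D /b /discr /ev meval0 /= => /eqP.
  by rewrite !(expr0n, expr1n, mulr0, mul0r, addr0, subr0) /= oner_eq0.
have r3w w : ev r3 w * (D w ^+ 2 - 64 * b w ^+ 2) * b w = 0.
  have [_ e] := even_odd w; have [_ e'] := even_odd (neg_first w).
  rewrite !neg_first_ev Dn bn in e'; apply: (mulfI n16); rewrite mulr0.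
  transitivity ((D w + 8 * - b w) * ((D w + 8 * b w) * (256 * ev r1 w + ev r3 w * (D w + 8 * b w))) -
    (D w + 8 * b w) * ((D w + 8 * - b w) * (256 * ev r1 w + ev r3 w * (D w + 8 * - b w)))); first by ring.
  by rewrite e e' !mulr0 subrr.
have z3 : r3 = 0.
  have : r3 * (discr4 R ^+ 2 - 64 * prodA R) * prodA R = 0.
    by apply: mpoly_squares_eq0 => w; rewrite (evM (r3 * _)) (evM r3) evN evA expr2 mulrA r3w mul0r.
  by move=> e; apply: (mulIf nd); apply: (mulIf nA); rewrite e !mul0r.
have : r1 * (discr4 R ^+ 2 - 64 * prodA R) = 0.
  apply: mpoly_squares_eq0 => w; rewrite (evM r1) evN; apply: (mulfI n256); rewrite mulr0.
  have [_] := even_odd w; rewrite z3 {2}/ev meval0 mul0r addr0 => e.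
  transitivity ((D w - 8 * b w) * ((D w + 8 * b w) * (256 * ev r1 w))); first by ring.
  by rewrite e mulr0.
by move=> e; split=> //; apply: (mulIf nd); rewrite e mul0r.
Qed.

End Independence.

Lemma Y_eval_eq0 q : comp_mpoly Y q = 0 -> forall x : V, meval (fun j : 'I_6 => (yval x)`_j) q = 0.
Proof.
move=> h x; transitivity (meval ((x *m Binv R) ord0) (comp_mpoly Y q)); last by rewrite h meval0.
by rewrite comp_mpoly_meval; apply: meval_eq => j; rewrite Ytuple_eval -mulmxA BinvK mulmx1.
Qed.

Lemma Ytuple_quotient_iso : quotient_iso (@Gi R) Y (igusa_cone_eqs R).
Proof.
split; [exact: Ytuple_invariant|exact: invariant_generated|move=> q; split].
  move=> /Y_eval_eq0 h; have [r0 [r1 [r2 [r3 hr]]]] := reducible_all Aform_eval Tform_eval q.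
  suff [e0 e1 e2 e3] : [/\ r0 = 0, r1 = 0, r2 = 0 & r3 = 0].
    move: hr; rewrite /cong /normal_form e0 e1 e2 e3 /= !comp_mpoly0 !mul0r !addr0 subr0; exact.
  apply: independence => x; have [a ha] := hr.
  have e : meval (fun j : 'I_6 => (yval x)`_j) (q - normal_form Aform Tform r0 r1 r2 r3) = 0.
    rewrite ha rmorph_sum big1 // => k _; rewrite /= mevalM igusa_eqs_yval mulr0 //.
  have hA r : meval (fun j : 'I_6 => (yval x)`_j) (comp_mpoly (At Aform) r) = meval (fun k => wq x k ^+ 2) r.
    rewrite comp_mpoly_meval; apply: meval_eq => k; rewrite tnth_mktuple Aform_eval yvalE !inordK //=.
      by elim/ord4_ind: k => /=; field.
    by rewrite 2!ltnS; exact: ltn_ord.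
  have hT : meval (fun j : 'I_6 => (yval x)`_j) Tform = prod4 x.
    by rewrite Tform_eval yvalE !inordK //=; move: (prod4 x) => t; field.
  move: e; rewrite mevalB h sub0r => /eqP; rewrite oppr_eq0 /normal_form /= => /eqP <-.
  move: (hA r0) (hA r1) (hA r2) (hA r3) hT; clear.
  move: (comp_mpoly _ r0) (comp_mpoly _ r1) (comp_mpoly _ r2) (comp_mpoly _ r3) Tform => c0 c1 c2 c3 T <- <- <- <- <-.
  move: (fun j : 'I_6 => (yval x)`_j) => f; have X n : meval f (T ^+ n) = meval f T ^+ n := rmorphXn (meval f) n T.
  by rewrite !mevalD (mevalM f c1) (mevalM f c2) (mevalM f c3) !X.
move=> [a ->]; apply: mpoly_row_inj => x; rewrite comp_mpoly_meval meval0 rmorph_sum big1 // => k _.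
rewrite /= mevalM; set m := meval _ (tnth _ k); suff -> : m = 0 by rewrite mulr0.
apply: (etrans _ (igusa_eqs_yval (x *m Bmx R) k)); apply: meval_eq => j; exact: Ytuple_eval.
Qed.

End QuotientIso.

(** * Limits of complex sequences *)

Section SequenceLimits.
Variable R : realType.
Local Notation C := R[i].
Local Notation cmod := (@cmod R).

Definition tends (u : nat -> C) (l : C) := forall e : R, 0 < e ->
  exists N0, forall N, (N0 <= N)%N -> cmod (u N - l) <= e.

Lemma tends_uniq u l m : tends u l -> tends u m -> l = m.
Proof.
move=> hl hm; apply/eqP; rewrite -subr_eq0; apply/eqP; apply: cmod_small => e e0.
have e2 : 0 < e / 2 by rewrite divr_gt0.
have [N1 h1] := hl _ e2; have [N2 h2] := hm _ e2.
have := h1 _ (leq_maxl N1 N2); have := h2 _ (leq_maxr N1 N2) => k2 k1.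
apply: le_trans (cmod_dist l m (u (maxn N1 N2))) _; rewrite cmodBC.
by apply: le_trans (lerD k1 k2) _; rewrite -splitr.
Qed.

Lemma tends_ext u v l : u =1 v -> tends u l -> tends v l.
Proof. by move=> /funext ->. Qed.

Lemma tends_D u v l m : tends u l -> tends v m -> tends (fun N => u N + v N) (l + m).
Proof.
move=> hl hm e e0; have e2 : 0 < e / 2 by rewrite divr_gt0.
have [N1 h1] := hl _ e2; have [N2 h2] := hm _ e2; exists (maxn N1 N2) => N.
rewrite geq_max => /andP[/h1 k1 /h2 k2].
rewrite (_ : _ - _ = (u N - l) + (v N - m)); last by ring.
by apply: le_trans (cmodD _ _) _; apply: le_trans (lerD k1 k2) _; rewrite -splitr.
Qed.

Lemma tends_Z c u l : tends u l -> tends (fun N => c * u N) (c * l).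
Proof.
move=> hl e e0; have k0 : 0 < 1 + cmod c by rewrite ltr_wpDr // cmod_ge0.
have [N1 h1] := hl _ (divr_gt0 e0 k0); exists N1 => N /h1 h.
rewrite -mulrBr cmodM; apply: (@le_trans _ _ ((1 + cmod c) * (e / (1 + cmod c)))).
  by apply: ler_pM => //; rewrite ?cmod_ge0 // lerDr.
by rewrite mulrC divfK // gt_eqF.
Qed.

Lemma half_pow_small (e : R) : 0 < e -> exists N, forall M, (N <= M)%N -> 2^-1 ^+ M <= e.
Proof.
move=> e0; have [N hN] : exists N : nat, e^-1 <= N%:R.
  by exists (Num.truncn e^-1).+1; exact: ltW (truncnS_gt _).
exists N => M NM; have N2 : (N%:R : R) <= 2 ^+ M.
  rewrite -natrX ler_nat; apply: leq_trans NM _; exact: ltnW (ltn_expl _ _).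
rewrite exprVn -[e]invrK lef_pV2 ?posrE ?exprn_gt0 ?invr_gt0 //; exact: le_trans hN N2.
Qed.

Lemma real_geometric_limit (u : nat -> R) N0 :
  (forall N, (N0 <= N)%N -> `|u N.+1 - u N| <= 2^-1 ^+ N) ->
  exists l, forall N, (N0 <= N)%N -> `|u N - l| <= 2 * 2^-1 ^+ N.
Proof.
move=> h; pose lo N := u N - 2 * 2^-1 ^+ N; pose hi N := u N + 2 * 2^-1 ^+ N.
have pw N : 0 <= (2^-1 : R) ^+ N by rewrite exprn_ge0.
have half N : 2 * (2^-1 : R) ^+ N.+1 = 2^-1 ^+ N by rewrite exprS mulrA mulfV ?mul1r.
have loS N : (N0 <= N)%N -> lo N <= lo N.+1.
  by move=> /h; rewrite ler_norml /lo half => /andP[]; have := pw N; lra.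
have hiS N : (N0 <= N)%N -> hi N.+1 <= hi N.
  by move=> /h; rewrite ler_norml /hi half => /andP[]; have := pw N; lra.
have lom N k : (N0 <= N)%N -> lo N <= lo (N + k)%N.
  move=> hN; elim: k => [|k IH]; first by rewrite addn0.
  by rewrite addnS; apply: le_trans IH (loS _ _); exact: leq_trans hN (leq_addr _ _).
have him N k : (N0 <= N)%N -> hi (N + k)%N <= hi N.
  move=> hN; elim: k => [|k IH]; first by rewrite addn0.
  by rewrite addnS; apply: le_trans (hiS _ _) IH; exact: leq_trans hN (leq_addr _ _).
have lohi N M : (N0 <= N)%N -> (N0 <= M)%N -> lo N <= hi M.
  move=> hN hM; apply: le_trans (lom N M hN) _; rewrite addnC; apply: le_trans _ (him M N hM).
  by rewrite /lo /hi; have := pw (M + N)%N; lra.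
pose A := [set lo N | N in [set N | (N0 <= N)%N]].
have A0 : A !=set0 by exists (lo N0), N0 => /=.
have ubA M : (N0 <= M)%N -> ubound A (hi M) by move=> hM _ [N /= hN <-]; exact: lohi.
exists (sup A) => N hN; rewrite ler_norml.
have l1 : lo N <= sup A.
  by apply: sup_upper_bound; [split => //; exists (hi N0); exact: ubA|exists N].
have l2 : sup A <= hi N by apply: ge_sup => //; exact: ubA.
by move: l1 l2; rewrite /lo /hi; lra.
Qed.

Lemma geometric_limit (u : nat -> C) N0 :
  (forall N, (N0 <= N)%N -> cmod (u N.+1 - u N) <= 2^-1 ^+ N) ->
  exists l, forall N, (N0 <= N)%N -> cmod (u N - l) <= 4 * 2^-1 ^+ N.
Proof.
move=> h.
have [a ha] : exists l, forall N, (N0 <= N)%N -> `|complex.Re (u N) - l| <= 2 * 2^-1 ^+ N.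
  apply: real_geometric_limit => N hN; apply: le_trans (h N hN).
  by have := Re_le_cmod (u N.+1 - u N); case: (u N.+1) (u N) => ? ? [].
have [b hb] : exists l, forall N, (N0 <= N)%N -> `|complex.Im (u N) - l| <= 2 * 2^-1 ^+ N.
  apply: real_geometric_limit => N hN; apply: le_trans (h N hN).
  by have := Im_le_cmod (u N.+1 - u N); case: (u N.+1) (u N) => ? ? [].
exists (a +i* b) => N hN; apply: le_trans (cmod_le_ReIm _) _.
have := ha N hN; have := hb N hN; case: (u N) => x y /=; lra.
Qed.

End SequenceLimits.

(** * A Jacobi theta function on the square lattice *)

Section Theta.
Variable R : realType.
Local Notation C := R[i].
Local Notation cmod := (@cmod R).
Local Notation pc := ((pi : R)%:C).

Lemma cexp_pii : cexp (pc * 'i) = -1 :> C.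
Proof.
have -> : pc * 'i = 0 +i* pi :> C by simpc.
rewrite /cexp /= expR0 cospi sinpi mul1r; apply/eqP; by rewrite eq_complex /= oppr0 !eqxx.
Qed.

Lemma cexp_2piin (n : int) : cexp (2 * pc * 'i * n%:~R) = 1 :> C.
Proof.
have h1 : cexp (2 * pc * 'i) = 1 :> C.
  by rewrite -mulrA mulrDl mul1r cexpD cexp_pii mulrNN mulr1.
have hn (k : nat) : cexp (2 * pc * 'i * k%:R) = 1 :> C.
  elim: k => [|k IH]; first by rewrite mulr0 cexp0.
  by rewrite -[k.+1]addn1 natrD mulrDr cexpD IH mulr1 h1 mulr1.
case: n => k; first exact: hn.
by rewrite NegzE mulrNz mulrN cexpN hn invr1.
Qed.

(** The terms of the Jacobi function [theta_4], of characteristic [(0,1/2)], for [tau = i]. It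
    vanishes at [i/2] and not at [1/2]. *)
Definition theta_term (n : int) (z : C) : C :=
  cexp (pc * 'i * n%:~R - pc * n%:~R ^+ 2 + 2 * pc * 'i * n%:~R * z).

Lemma theta_term1 n z : theta_term n (z + 1) = theta_term n z.
Proof. by rewrite /theta_term mulrDr mulr1 addrA cexpD cexp_2piin mulr1. Qed.

Lemma theta_termN n z : theta_term n (- z) = theta_term (- n) z.
Proof.
rewrite /theta_term mulrNz; set k := n%:~R : C.
rewrite (_ : _ + _ * - z = (pc * 'i * - k - pc * (- k) ^+ 2 + 2 * pc * 'i * - k * z) + 2 * pc * 'i * k).
  by rewrite cexpD cexp_2piin mulr1.
by ring.
Qed.

Lemma theta_termi n z : theta_term n (z + 'i) =
  cexp (pc - pc * 'i - 2 * pc * 'i * z) * theta_term (n + 1) z.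
Proof.
have i2 : ('i : C) ^+ 2 = -1 := sqr_i _.
rewrite /theta_term -cexpD; congr cexp; rewrite !mulrzDr mulr1z; move: (n%:~R : C) => k.
by move: ('i : C) i2 => q q2; ring: q2.
Qed.

(** Symmetric partial sums: they are even in [z] on the nose, and a shift by [i] leaves just two
    boundary terms. *)
Fixpoint theta_sum N z : C :=
  if N is N'.+1 then theta_sum N' z + (theta_term N'.+1%:Z z + theta_term (- N'.+1%:Z) z)
  else theta_term 0 z.

Lemma theta_sum_i N z : theta_sum N (z + 'i) = cexp (pc - pc * 'i - 2 * pc * 'i * z) *
  (theta_sum N z + (theta_term N.+1%:Z z - theta_term (- N%:Z) z)).
Proof.
elim: N => [|N IH]; first by rewrite /= theta_termi oppr0 add0r; congr (_ * _); ring.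
rewrite /= IH !theta_termi -!mulrDr; congr (_ * _).
have -> : N.+1%:Z + 1 = N.+2%:Z by rewrite -[N.+2]addn1 PoszD.
have -> : - N.+1%:Z + 1 = - N%:Z by rewrite -[N.+1]addn1 PoszD; ring.
ring.
Qed.

(** The exponent has real part at most [- pi (m^2 - 2 m r) <= - m], and [exp(-1) <= 1/2]. The
    threshold depends only on [r], so convergence is uniform on discs. *)
Lemma cmod_theta_term (n : int) (m : nat) z r : (`|n| = m)%N -> cmod z <= r -> 2 * r + 1 <= m%:R ->
  cmod (theta_term n z) <= 2^-1 ^+ m.
Proof.
move=> nm zr rm; rewrite /theta_term cmod_cexp.
have zi : `|complex.Im z| <= r by apply: le_trans (Im_le_cmod z) zr.
have r0 : 0 <= r by apply: le_trans zi.
have e : complex.Re (pc * 'i * n%:~R - pc * n%:~R ^+ 2 + 2 * pc * 'i * n%:~R * z) =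
    - pi * n%:~R ^+ 2 - 2 * pi * n%:~R * complex.Im z.
  have -> : (n%:~R : C) = (n%:~R : R)%:C by rewrite rmorph_int.
  by case: z {zr zi} => a b; rewrite -[2]/(1 + 1) expr2; simpc; rewrite /= ; ring.
rewrite e.
have nn : (n%:~R : R) ^+ 2 = m%:R ^+ 2 by rewrite -nm -(real_normK (num_real _)) -intr_norm -abszE.
have ni : `|n%:~R * complex.Im z| <= m%:R * r.
  by rewrite normrM -intr_norm -abszE nm ler_wpM2l.
have p1 : (1 : R) <= pi by apply: le_trans (pi_ge2 R); lra.
have b1 : - pi * (n%:~R : R) ^+ 2 - 2 * pi * n%:~R * complex.Im z <= - m%:R.
  rewrite nn; move: ni; rewrite ler_norml => /andP[h _].
  have m0 : (0 : R) <= m%:R by [].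
  have h2 : pi * (- (m%:R * r)) <= pi * (n%:~R * complex.Im z) by rewrite ler_pM2l // (lt_le_trans ltr01).
  have h3 : m%:R * 1 <= pi * (m%:R * (m%:R - 2 * r)).
    apply: le_trans (_ : 1 * (m%:R * (m%:R - 2 * r)) <= _); first by rewrite mul1r ler_wpM2l //; lra.
    by rewrite ler_wpM2r // mulr_ge0 //; lra.
  nra.
apply: le_trans (_ : expR (- m%:R) <= _); first by rewrite ler_expR.
rewrite (_ : - m%:R = m%:R * -1); last by rewrite mulrN1.
rewrite expRM_natl.
apply: lerXn2r; rewrite ?nnegrE ?expR_ge0 ?invr_ge0 // expRN lef_pV2 ?posrE ?expR_gt0 //.
by have := expR_ge1Dx (1 : R); lra.
Qed.
Lemma entire_theta_term n : entire (theta_term n).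
Proof.
move=> z; eexists; apply: (cder_comp (g := @cexp R) (f := fun z => _ + _ * z)); last exact: cder_cexp.
by apply: cderD; [exact: cder_cst|apply: cderM; [exact: cder_cst|exact: cder_id]].
Qed.

Lemma entire_theta_sum N : entire (theta_sum N).
Proof.
elim: N => [|N IH]; first exact: entire_theta_term.
by apply: entireD => //; apply: entireD; exact: entire_theta_term.
Qed.

Lemma theta_sum_step z r N : cmod z <= r -> 2 * r + 1 <= N%:R ->
  cmod (theta_sum N.+1 z - theta_sum N z) <= 2^-1 ^+ N.
Proof.
move=> zr rN; rewrite /= addrC addKr.
have rN' : 2 * r + 1 <= N.+1%:R :> R by apply: le_trans rN _; rewrite ler_nat.
apply: le_trans (cmodD _ _) _.
have h1 := cmod_theta_term (erefl `|N.+1%:Z|%N) zr rN'.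
have h2 := @cmod_theta_term (- N.+1%:Z) N.+1 z r (abszN _) zr rN'.
by apply: le_trans (lerD h1 h2) _; rewrite exprS; have := exprn_ge0 N (_ : 0 <= 2^-1 :> R); lra.
Qed.

Lemma theta_limit (r : R) : exists N0, forall z, cmod z <= r -> exists l, forall N, (N0 <= N)%N ->
  cmod (theta_sum N z - l) <= 4 * 2^-1 ^+ N.
Proof.
exists (Num.truncn (2 * r + 1)).+1 => z zr; apply: geometric_limit => N hN; apply: theta_sum_step zr _.
by apply: le_trans (ltW (truncnS_gt _)) _; rewrite ler_nat.
Qed.

Definition theta z : C := xget 0 [set l | tends (theta_sum ^~ z) l].

Lemma theta_bound (r : R) : exists N0, forall z, cmod z <= r -> forall N, (N0 <= N)%N ->
  cmod (theta_sum N z - theta z) <= 4 * 2^-1 ^+ N.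
Proof.
have [N0 h] := theta_limit r; exists N0 => z zr; have [l hl] := h z zr.
have tl : tends (theta_sum ^~ z) l.
  move=> e e0; have [N1 h1] := @half_pow_small R (e / 4) (divr_gt0 e0 (ltr0n _ 4)).
  exists (maxn N0 N1) => N; rewrite geq_max => /andP[n0 /h1 n1].
  by apply: le_trans (hl N n0) _; rewrite mulrC -ler_pdivlMr.
suff -> : theta z = l by [].
by rewrite /theta; case: xgetP => [l' _ /= hl'|/(_ l)//]; exact: tends_uniq hl' tl.
Qed.

Lemma theta_tends z : tends (theta_sum ^~ z) (theta z).
Proof.
have [N0 h] := theta_bound (cmod z) => e e0.
have [N1 h1] := @half_pow_small R (e / 4) (divr_gt0 e0 (ltr0n _ 4)).
exists (maxn N0 N1) => N; rewrite geq_max => /andP[n0 /h1 n1].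
by apply: le_trans (h z (lexx _) N n0) _; rewrite mulrC -ler_pdivlMr.
Qed.

Lemma entire_theta : entire theta.
Proof.
apply: uniform_limit_entire => e r e0; have [N0 h] := theta_bound r.
have [N1 h1] := @half_pow_small R (e / 4) (divr_gt0 e0 (ltr0n _ 4)).
exists (theta_sum (maxn N0 N1)); first exact: entire_theta_sum.
move=> z zr; apply: le_trans (h z zr _ (leq_maxl _ _)) _.
by rewrite mulrC -ler_pdivlMr // h1 // leq_maxr.
Qed.

Lemma theta1 z : theta (z + 1) = theta z.
Proof.
apply: tends_uniq (theta_tends z); apply: tends_ext (theta_tends (z + 1)) => N.
by elim: N => [|N IH] /=; rewrite ?IH !theta_term1.
Qed.

Lemma thetaN z : theta (- z) = theta z.
Proof.
apply: tends_uniq (theta_tends z); apply: tends_ext (theta_tends (- z)) => N.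
elim: N => [|N IH] /=; first by rewrite theta_termN oppr0.
by rewrite IH !theta_termN opprK; congr (_ + _); rewrite addrC.
Qed.

Lemma theta_term_tends0 z (b : nat -> int) : (forall N, (N <= `|b N|)%N) ->
  tends (fun N => theta_term (b N) z) 0.
Proof.
move=> hb e e0; have [N1 h1] := @half_pow_small R e e0.
exists (maxn N1 (Num.truncn (2 * cmod z + 1)).+1) => N; rewrite geq_max => /andP[n1 n0].
rewrite subr0; apply: le_trans (cmod_theta_term (erefl _) (lexx (cmod z)) _) _.
  by apply: le_trans (ltW (truncnS_gt _)) _; rewrite ler_nat; exact: leq_trans n0 (hb N).
by apply: h1; exact: leq_trans n1 (hb N).
Qed.

Lemma theta_i z : theta (z + 'i) = cexp (pc - pc * 'i - 2 * pc * 'i * z) * theta z.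
Proof.
apply: (@tends_uniq _ (theta_sum ^~ (z + 'i))); first exact: theta_tends.
apply: tends_ext (fun N => esym (theta_sum_i N z)) _; apply: tends_Z.
rewrite -[X in tends _ X]addr0; apply: tends_D; first exact: theta_tends.
have t1 : tends (fun N => theta_term N.+1%:Z z) 0 by apply: theta_term_tends0 => N; exact: leqnSn.
have t2 : tends (fun N => theta_term (- N%:Z) z) 0 by apply: theta_term_tends0 => N; rewrite abszN.
have := tends_D t1 (tends_Z (-1) t2); rewrite mulr0 addr0; apply: tends_ext => N.
by rewrite mulN1r.
Qed.

(** At [1/2] the alternating signs disappear: all terms are positive, and the term of index 0 is
    1. *)
Lemma theta_half_neq0 : theta (2^-1) != 0.
Proof.
have te n : theta_term n 2^-1 = (expR (- pi * n%:~R ^+ 2))%:C.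
  rewrite /theta_term (_ : _ + _ = - (pc * n%:~R ^+ 2) + 2 * pc * 'i * n%:~R); last by field.
  rewrite cexpD cexp_2piin mulr1 (_ : - (_ * _) = (- pi * n%:~R ^+ 2)%:C).
    by rewrite /cexp /= cos0 sin0 mulr1.
  by rewrite rmorphM rmorphN rmorphXn /= rmorph_int mulNr.
have s1 N : 1 <= complex.Re (theta_sum N 2^-1).
  elim: N => [|N IH]; first by rewrite -[theta_sum 0 _]/(theta_term 0 _) te /= expr0n mulr0 expR0.
  rewrite -[theta_sum N.+1 _]/(theta_sum N _ + (theta_term N.+1%:Z _ + theta_term (- N.+1%:Z) _)) !te; move: IH; case: (theta_sum N _) => a b /= h; apply: le_trans h _.
  by rewrite lerDl addr_ge0 ?expR_ge0.
apply/eqP => t0; have h0 : 0 < 2^-1 :> R by rewrite invr_gt0.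
have [N0 h] := theta_tends 2^-1 h0.
have := h N0 (leqnn _); rewrite t0 subr0 => /(le_trans (Re_le_cmod _)).
by have := s1 N0; move=> s; rewrite ger0_norm ?(le_trans ler01 s) //; lra.
Qed.

End Theta.

(** * Half-period shifts of the theta function *)

Section HalfPeriods.
Variable R : realType.
Local Notation C := R[i].
Local Notation pc := ((pi : R)%:C).

Let i2 : ('i : C) ^+ 2 = -1 := sqr_i _.

(** The Gaussian factor treats the periods [1] and [i] alike: as for the Weierstrass sigma function,
    the exponents become those of a Hermitian form, up to constants. *)
Definition sigma (z : C) : C := cexp (pc / 2 * z ^+ 2) * theta z.

Lemma sigma1 z : sigma (z + 1) = cexp (pc * z + pc / 2) * sigma z.
Proof.
by rewrite /sigma theta1 mulrA -cexpD; congr (cexp _ * _); field.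
Qed.

Lemma sigma_i z : sigma (z + 'i) = cexp (pc / 2 - pc * 'i * z - pc * 'i) * sigma z.
Proof.
rewrite /sigma theta_i mulrA -cexpD mulrA -cexpD; congr (cexp _ * _).
by move: ('i : C) i2 => q q2; field: q2.
Qed.

Lemma sigmaN z : sigma (- z) = sigma z.
Proof. by rewrite /sigma thetaN sqrrN. Qed.

Lemma entire_sigma : entire sigma.
Proof.
apply: entireM; last exact: entire_theta.
move=> z; eexists; apply: (cder_comp (g := @cexp R) (f := fun z => _ * z ^+ 2)); last exact: cder_cexp.
by apply: cderM; [exact: cder_cst|apply: cderM; exact: cder_id].
Qed.

(** Rescaled so that the period lattice is [(1 + i) Z[i]]. Then [1], [i], [-1] and [-i] are
    half-periods of one class, and a shift by any of them exchanges [tp] and [tq] up to an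
    exponential. *)
Definition tp (y : C) : C := sigma (y * ((1 - 'i) / 2)).
Definition tq (y : C) : C := tp (y + 1) * cexp (- (pc / 2) * y - pc / 4).

Lemma tpN y : tp (- y) = tp y. Proof. by rewrite /tp mulNr sigmaN. Qed.

Lemma tp_a y : tp (y + (1 + 'i)) = cexp (pc * (y * ((1 - 'i) / 2)) + pc / 2) * tp y.
Proof.
rewrite /tp -sigma1; congr sigma; move: ('i : C) i2 => q q2; by field: q2.
Qed.

Lemma tp_b y : tp (y + ('i - 1)) =
  cexp (pc / 2 - pc * 'i * (y * ((1 - 'i) / 2)) - pc * 'i) * tp y.
Proof.
rewrite /tp -sigma_i; congr sigma; move: ('i : C) i2 => q q2; by field: q2.
Qed.

Lemma cexp_swap (a : C) x y : x = cexp a * y -> y = cexp (- a) * x.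
Proof. by move=> ->; rewrite mulrA -cexpD addNr cexp0 mul1r. Qed.

Lemma tp_b' y : tp (y + (1 - 'i)) = cexp (- (pc / 2) + pc * ((1 + 'i) / 2) * y + pc + pc * 'i) * tp y.
Proof.
have := tp_b (y + (1 - 'i)); rewrite (_ : y + _ + _ = y); last by ring.
move=> /cexp_swap ->; congr (cexp _ * _); move: ('i : C) i2 => q q2; by field: q2.
Qed.

Lemma tp_2 y : tp (y + 2) = cexp (pc * (y + 1)) * tp y.
Proof.
rewrite (_ : y + 2 = (y + (1 - 'i)) + (1 + 'i)); last by ring.
rewrite tp_a tp_b' mulrA -cexpD; congr (cexp _ * _); move: ('i : C) i2 => q q2; by field: q2.
Qed.

Lemma tp_2i y : tp (y + 2 * 'i) = cexp (pc * (1 - 'i * y)) * tp y.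
Proof.
rewrite (_ : y + 2 * 'i = (y + ('i - 1)) + (1 + 'i)); last by ring.
rewrite tp_a tp_b mulrA -cexpD; congr (cexp _ * _); move: ('i : C) i2 => q q2; by field: q2.
Qed.

Lemma tp_tq y : tp (y + 1) = cexp (pc / 2 * y + pc / 4) * tq y.
Proof. by rewrite /tq mulrCA -cexpD [X in cexp X](_ : _ = 0) ?cexp0 ?mulr1 //; ring. Qed.

Lemma cexp_2pii (a : C) : cexp (a + 2 * pc * 'i) = cexp a.
Proof. by rewrite cexpD -[2 * _ * _]mulr1 (cexp_2piin R 1) mulr1. Qed.

(** The extra constant for a shift by an odd power of [i], with opposite signs for [tp] and [tq].
    Over four coordinates with an even number of odd shifts both become the same sign. *)
Definition halfturn (k : nat) : C := pc * 'i / 2 * (odd k)%:R.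
Definition unit_exp (k : nat) (y : C) : C := pc / 2 * (- 'i) ^+ k * y + pc / 4.

Lemma tp_i y : tp (y + 'i) = cexp (halfturn 1 + unit_exp 1 y) * tq y.
Proof.
rewrite (_ : y + 'i = (y + 1) + ('i - 1)); last by ring.
rewrite tp_b tp_tq mulrA -cexpD -[in LHS](cexp_2pii (_ + _)) /halfturn /unit_exp /=.
congr (cexp _ * _).
by move: ('i : C) i2 => q q2; field: q2.
Qed.

Lemma tp_unit k y : (k < 4)%N -> tp (y + 'i ^+ k) = cexp (halfturn k + unit_exp k y) * tq y.
Proof.
rewrite /halfturn /unit_exp; move: k => [|[|[|[|k]]]] // _ /=.
- by rewrite expr0 tp_tq; congr (cexp _ * _); ring.
- by rewrite expr1 tp_i.
- have := tp_2 (y - 1); rewrite (_ : y - 1 + 2 = y + 1); last by ring.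
  rewrite tp_tq i2 => /esym/esym/cexp_swap ->; rewrite mulrA -cexpD; congr (cexp _ * _).
  by move: ('i : C) i2 => q q2; field: q2.
have := tp_2i (y - 'i); rewrite (_ : y - 'i + 2 * 'i = y + 'i); last by ring.
have -> : ('i : C) ^+ 3 = - 'i by rewrite exprS i2 mulrN1.
rewrite tp_i /halfturn /unit_exp => /cexp_swap ->; rewrite mulrA -cexpD; congr (cexp _ * _).
by rewrite /= ; move: ('i : C) i2 => q q2; field: q2.
Qed.

Lemma tq_unit k y : (k < 4)%N -> tq (y + 'i ^+ k) = cexp (- halfturn k + unit_exp k y) * tp y.
Proof.
rewrite /halfturn /unit_exp; move: k => [|[|[|[|k]]]] // _ /=.
- rewrite expr0 /tq (_ : y + 1 + 1 = y + 2); last by ring.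
  by rewrite tp_2 mulrAC -cexpD; congr (cexp _ * _); field.
- rewrite expr1 /tq (_ : y + 'i + 1 = y + (1 + 'i)); last by ring.
  rewrite tp_a mulrAC -cexpD; congr (cexp _ * _); move: ('i : C) i2 => q q2; by field: q2.
- rewrite i2 /tq (_ : y + -1 + 1 = y); last by ring.
  rewrite mulrC; congr (cexp _ * _); move: ('i : C) i2 => q q2; by field: q2.
have -> : ('i : C) ^+ 3 = - 'i by rewrite exprS i2 mulrN1.
rewrite /tq (_ : y + - 'i + 1 = y + (1 - 'i)); last by ring.
rewrite tp_b' mulrAC -cexpD -[in RHS]cexp_2pii; congr (cexp _ * _).
by move: ('i : C) i2 => q q2; field: q2.
Qed.

Lemma tqN y : tq (- y) = tq y.
Proof.
rewrite {1}/tq -tpN opprD opprK -i2 (tp_unit y (isT : (2 < 4)%N)) mulrAC -cexpD.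
rewrite /halfturn /unit_exp /= [X in cexp X](_ : _ = 0) ?cexp0 ?mul1r //.
by move: ('i : C) i2 => q q2; field: q2.
Qed.

Lemma entire_tp : entire tp.
Proof.
move=> z; have [l hl] := entire_sigma (z * ((1 - 'i) / 2)).
eexists; apply: (cder_comp (g := sigma) (f := fun y => y * _)); last exact: hl.
by apply: cderM; [exact: cder_id|exact: cder_cst].
Qed.

Lemma entire_tq : entire tq.
Proof.
apply: entireM.
  move=> z; have [l hl] := entire_tp (z + 1); eexists.
  apply: (cder_comp (g := tp) (f := fun y => y + 1)); last exact: hl.
  by apply: cderD; [exact: cder_id|exact: cder_cst].
move=> z; eexists; apply: (cder_comp (g := @cexp R) (f := fun y => _ * y - _)); last exact: cder_cexp.
by apply: cderD; [apply: cderM; [exact: cder_cst|exact: cder_id]|exact: cder_cst].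
Qed.

Lemma tp_half : tp ((1 + 'i) / 2) = sigma 2^-1.
Proof. by rewrite /tp; congr sigma; move: ('i : C) i2 => q q2; field: q2. Qed.

Lemma sigma_half_neq0 : sigma 2^-1 != 0.
Proof. by rewrite mulf_neq0 ?cexp_neq0 // theta_half_neq0. Qed.

Lemma sigma_ihalf : sigma ('i / 2) = 0.
Proof.
have := sigma_i (- ('i / 2)); rewrite sigmaN (_ : - ('i / 2) + 'i = 'i / 2); last by field.
rewrite (_ : _ - _ = - (pc * 'i)); last by move: ('i : C) i2 => q q2; field: q2.
by rewrite cexpN cexp_pii invrN1 mulN1r; exact: opp_eq0.
Qed.

Lemma tp_ihalf : tp (('i - 1) / 2) = 0.
Proof. by rewrite -sigma_ihalf /tp; congr sigma; move: ('i : C) i2 => q q2; field: q2. Qed.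

Lemma tq_half : tq ((1 + 'i) / 2) = 0.
Proof.
rewrite /tq (_ : (1 + 'i) / 2 + 1 = ('i - 1) / 2 + 2); last by field.
by rewrite tp_2 tp_ihalf mulr0 mul0r.
Qed.

Lemma tq_ihalf : tq (('i - 1) / 2) = cexp (- (pc * 'i / 4)) * sigma 2^-1.
Proof.
rewrite /tq (_ : ('i - 1) / 2 + 1 = (1 + 'i) / 2); last by field.
by rewrite tp_half mulrC; congr (cexp _ * _); field.
Qed.

End HalfPeriods.

(** * Holomorphic functions of four variables *)

Section HolomorphicTools.
Variable R : realType.
Local Notation C := R[i].
Local Notation V := ('rV[R[i]]_4 : normedModType R[i]).

Lemma cder_differentiable (p : C^o -> C^o) (z : C^o) (l : C) : cder p z l -> differentiable p z.
Proof.
move=> h; apply/derivable1_diffP; apply: (cvgP (l : C^o)).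
apply/cvgrPdist_le => e e0; have [ee er] := pos_complex e0; have [d d0 hd] := h _ er.
apply/nbhs_ballP; exists d%:C => /=; first by rewrite ltcR.
move=> k; rewrite /ball_ /ball /= sub0r normrN cmodE ltcR => kd k0.
have zk : cmod (k + z - z) < d by rewrite addrK.
rewrite ee cmodE lecR /= [k *: (1 : C^o)]mulr1 -cmodN opprB.
have := hd _ zk; rewrite addrK => hk.
have k0' : 0 < cmod k by rewrite cmod_gt0.
rewrite -(ler_pM2r k0') -cmodM mulrBl; congr (_ <= _): hk; congr (cmod _).
by rewrite [k^-1 *: _]/(k^-1 * _) mulrAC mulVf // mul1r.
Qed.

Lemma hol_entire (p : C -> C) (f : V -> C^o) : entire p -> holomorphic f ->
  holomorphic (fun x => p (f x) : C^o).
Proof.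
move=> hp hf x; apply: (@differentiable_comp _ _ _ _ f (p : C^o -> C^o)); first exact: hf.
by have [l hl] := hp (f x); exact: cder_differentiable hl.
Qed.

Lemma hol_coord j : holomorphic (fun x : V => (x : 'rV[R[i]]_4) 0 j : C^o).
Proof. by move=> x; exact: differentiable_coord. Qed.

Lemma hol_cst (c : C) : holomorphic (fun=> c : C^o).
Proof. by move=> x; exact: differentiable_cst. Qed.

Lemma hol_D (f g : V -> C^o) : holomorphic f -> holomorphic g -> holomorphic (fun x => f x + g x : C^o).
Proof. by move=> hf hg x; apply: differentiableD; [exact: hf|exact: hg]. Qed.

Lemma hol_M (f g : V -> C^o) : holomorphic f -> holomorphic g ->
  holomorphic (fun x => (f x : C) * (g x : C) : C^o).
Proof. by move=> hf hg x; apply: differentiableM; [exact: hf|exact: hg]. Qed.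

Lemma hol_prod (f : 'I_4 -> V -> C^o) : (forall j, holomorphic (f j)) ->
  holomorphic (fun x => \prod_(j < 4) (f j x : C) : C^o).
Proof.
move=> h; rewrite (_ : (fun x => _) = (fun x => f o0 x * f o1 x * f o2 x * f o3 x : C)).
  by do !apply: hol_M.
by apply/funext => x; rewrite bigprod4.
Qed.

Lemma hol_sum (f : 'I_4 -> V -> C^o) : (forall j, holomorphic (f j)) ->
  holomorphic (fun x => \sum_(j < 4) (f j x : C) : C^o).
Proof.
move=> h; rewrite (_ : (fun x => _) = (fun x => f o0 x + f o1 x + f o2 x + f o3 x : C)).
  by do !apply: hol_D.
by apply/funext => x; rewrite sum4.
Qed.

Lemma hol_linear (F : V -> C^o) (M : 'M[C]_4) : holomorphic F ->
  holomorphic (fun x : 'rV[R[i]]_4 => F (x *m M) : C^o).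
Proof.
move=> hF x; apply: (@differentiable_comp _ _ _ _ (fun x : V => (x : 'rV[R[i]]_4) *m M : V) F); last exact: hF.
rewrite (_ : (fun x : V => _) = (fun x : V => \sum_(i < 4) (x : 'rV[R[i]]_4) 0 i *: (row i M : V))).
  rewrite (_ : (fun x : V => _) = \sum_(i < 4) (fun x : V => (x : 'rV[R[i]]_4) 0 i *: (row i M : V))).
    apply: differentiable_sum => i; apply: differentiableZl; exact: differentiable_coord.
  by apply/funext => y; rewrite fct_sumE.
by apply/funext => y; rewrite -mulmx_sum_row.
Qed.

End HolomorphicTools.

(** * A quasi-periodic combination of products of theta functions *)

Section ThetaProduct.
Variable R : realType.
Local Notation C := R[i].
Local Notation V := ('rV[R[i]]_4 : normedModType R[i]).
Local Notation pc := ((pi : R)%:C).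

Let i2 : ('i : C) ^+ 2 = -1 := sqr_i _.

Lemma cexp_shift (a : C) (n : int) : cexp (a + 2 * pc * 'i * n%:~R) = cexp a.
Proof. by rewrite cexpD cexp_2piin mulr1. Qed.

Definition herm_dot (x l : 'rV[R[i]]_4) : C := \sum_(j < 4) x 0 j * (l 0 j)^*%C.
(** In the coordinates of [Bmx] the standard product is [2 H], so this is the canonical exponent
    [pi H(x,l) + pi/2 H(l,l)]. The constant beside it stays existential in [quasi], since it does
    not affect the Chern class. *)
Definition Lexp (l x : 'rV[R[i]]_4) : C := pc / 2 * herm_dot x l + pc / 4 * herm_dot l l.

Definition quasi (F : V -> C) (l : 'rV[R[i]]_4) := exists c : C, forall x : 'rV[R[i]]_4,
  F (x + l) = cexp (c + Lexp l x) * F x.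

Lemma quasi_D F l m : quasi F l -> quasi F m -> quasi F (l + m).
Proof.
move=> [c hc] [d hd].
exists (c + d + pc / 4 * (herm_dot l m - herm_dot m l)) => x.
rewrite addrA hd hc mulrA -cexpD; congr (cexp _ * _).
rewrite /Lexp /herm_dot !sum4 !mxE !rmorphD /=.
by move: (l 0 o0) (l 0 o1) (l 0 o2) (l 0 o3) (m 0 o0) (m 0 o1) (m 0 o2) (m 0 o3) => *; field.
Qed.

Lemma quasi_N F l : quasi F l -> quasi F (- l).
Proof.
move=> [c hc]; exists (- c) => x; have := hc (x - l); rewrite subrK => /(@cexp_swap R _ _ _) ->.
congr (cexp _ * _); rewrite /Lexp /herm_dot !sum4 !mxE !rmorphN /=.
by move: (l 0 o0) (l 0 o1) (l 0 o2) (l 0 o3) => *; field.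
Qed.

Lemma quasi_0 F : quasi F 0.
Proof.
exists 0 => x; rewrite addr0 /Lexp /herm_dot !big1 ?mulr0 ?addr0 ?cexp0 ?mul1r // => j _.
  by rewrite !mxE mul0r.
by rewrite mxE conjc0 mulr0.
Qed.

Lemma quasi_int F l (n : int) : quasi F l -> quasi F (n%:~R *: l).
Proof.
move=> h; have hn (k : nat) : quasi F (k%:R *: l).
  elim: k => [|k IH]; first by rewrite scale0r; exact: quasi_0.
  by rewrite -[k.+1]addn1 natrD scalerDl scale1r; exact: quasi_D.
case: n => k; first exact: hn.
by rewrite NegzE mulrNz scaleNr; exact/quasi_N/hn.
Qed.

Definition unit_row (k : 'I_4 -> nat) : 'rV[R[i]]_4 := \row_j 'i ^+ k j.

Lemma i_mod (k : nat) : [/\ ('i : C) ^+ k = 'i ^+ (k %% 4), halfturn R k = halfturn R (k %% 4) &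
  forall y, unit_exp k y = unit_exp (R := R) (k %% 4) y].
Proof.
have i4 : ('i : C) ^+ 4 = 1 by rewrite -[4%N]/(2 * 2)%N exprM i2 sqrrN expr1n.
have n4 : (- 'i : C) ^+ 4 = 1 by rewrite -[4%N]/(2 * 2)%N exprM sqrrN i2 sqrrN expr1n.
have e (q : C) : q ^+ 4 = 1 -> q ^+ k = q ^+ (k %% 4).
  by move=> q4; rewrite {1}(divn_eq k 4) exprD mulnC exprM q4 expr1n mul1r.
split; first exact: e.
  by rewrite /halfturn {1}(divn_eq k 4) oddD oddM andbF.
by move=> y; rewrite /unit_exp (e _ n4).
Qed.

Lemma tp_unit_any k y : tp (y + 'i ^+ k) = cexp (halfturn R k + unit_exp k y) * tq y.
Proof. by have [-> -> ->] := i_mod k; apply: tp_unit; rewrite ltn_mod. Qed.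

Lemma tq_unit_any k y : tq (y + 'i ^+ k) = cexp (- halfturn R k + unit_exp k y) * tp y.
Proof. by have [-> -> ->] := i_mod k; apply: tq_unit; rewrite ltn_mod. Qed.

Definition theta_pair (x : 'rV[R[i]]_4) : C := \prod_(j < 4) tp (x 0 j) + \prod_(j < 4) tq (x 0 j).
(** Shifts by rows of units exchange the two products in [theta_pair]. Antisymmetry under
    multiplication by [i] makes the form vanish at [0]. *)
Definition theta_form (x : 'rV[R[i]]_4) : C := theta_pair x - theta_pair ('i *: x).

Definition nodd (k : 'I_4 -> nat) := (odd (k o0) + odd (k o1) + odd (k o2) + odd (k o3))%N.

(** The halfturns add up to [pi i m] in one product and to [- pi i m] in the other; these agree
    modulo [2 pi i] because [m] is an integer, that is because [nodd k] is even. *)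
Lemma theta_pair_unit (k : 'I_4 -> nat) m (x : 'rV[R[i]]_4) : nodd k = m.*2 ->
  theta_pair (x + unit_row k) =
  cexp (pc * 'i * m%:R + \sum_(j < 4) unit_exp (k j) (x 0 j)) * theta_pair x.
Proof.
move=> hk; rewrite /theta_pair !bigprod4 sum4 !mxE !tp_unit_any !tq_unit_any mulrDr [LHS]addrC.
have hs : (m%:R : C) * 2 = (odd (k o0))%:R + (odd (k o1))%:R + (odd (k o2))%:R + (odd (k o3))%:R.
  by rewrite -!natrD -/(nodd k) hk -muln2 natrM.
move: (unit_exp (k o0) _) (unit_exp (k o1) _) (unit_exp (k o2) _) (unit_exp (k o3) _) => e0 e1 e2 e3.
have ph : halfturn R (k o0) + halfturn R (k o1) + halfturn R (k o2) + halfturn R (k o3) = pc * 'i * m%:R.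
  transitivity (pc * 'i / 2 * (m%:R * 2)); last by field.
  by rewrite hs /halfturn; field.
have nh : cexp (- (pc * 'i * m%:R) + (e0 + e1 + e2 + e3)) = cexp (pc * 'i * m%:R + (e0 + e1 + e2 + e3)).
  by rewrite -[LHS](cexp_shift _ m%:Z) -pmulrn; congr cexp; ring.
congr (_ + _).
  rewrite -nh -ph !opprD; move: (halfturn R (k o0)) (halfturn R (k o1)) (halfturn R (k o2)) (halfturn R (k o3)) => h0 h1 h2 h3.
  rewrite (_ : - h0 - h1 - h2 - h3 + _ = (- h0 + e0) + (- h1 + e1) + (- h2 + e2) + (- h3 + e3)); last by ring.
  rewrite !cexpD; ring.
rewrite -ph; move: (halfturn R (k o0)) (halfturn R (k o1)) (halfturn R (k o2)) (halfturn R (k o3)) => h0 h1 h2 h3.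
rewrite (_ : h0 + h1 + h2 + h3 + _ = (h0 + e0) + (h1 + e1) + (h2 + e2) + (h3 + e3)); last by ring.
rewrite !cexpD; ring.
Qed.

Lemma conj_i : ('i : C)^*%C = - 'i.
Proof. by apply/eqP; rewrite eq_complex /= oppr0 !eqxx. Qed.

Lemma conj_iX n : (('i : C) ^+ n)^*%C = (- 'i) ^+ n.
Proof.
elim: n => [|n IH]; first by rewrite !expr0 conjc1.
rewrite !exprS -IH -conj_i; exact: (rmorphM (@conjc R)).
Qed.

Lemma unit_exp_Lexp (k : 'I_4 -> nat) (x : 'rV[R[i]]_4) :
  \sum_(j < 4) unit_exp (k j) (x 0 j) = Lexp (unit_row k) x.
Proof.
rewrite /Lexp /herm_dot !big_distrr -big_split /=; apply: eq_bigr => j _.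
rewrite !mxE conj_iX /unit_exp -exprMn mulrN -expr2 i2 opprK expr1n mulr1; ring.
Qed.

Lemma theta_form_unit (k : 'I_4 -> nat) : ~~ odd (nodd k) -> quasi theta_form (unit_row k).
Proof.
move=> hk; pose m := (nodd k)./2; have km : nodd k = m.*2.
  by rewrite /m -[LHS]odd_double_half (negPf hk).
exists (pc * 'i * m%:R) => x; rewrite /theta_form mulrBr (theta_pair_unit x km) unit_exp_Lexp; congr (_ - _).
(* Multiplication by [i] raises all exponents by one and exchanges odd and even, so [m] becomes
   [2 - m], which has the same parity. *)
pose k' j := (k j).+1; have k'm : nodd k' = (2 - m).*2.
  have m2 : (m <= 2)%N by rewrite -leq_double -km /nodd; do 4![case: (odd _)].
  by move: km m2; rewrite /nodd /k' /=; do 4![case: (odd _) => /=]; case: m => [|[|[|]]].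
have -> : 'i *: (x + unit_row k) = 'i *: x + unit_row k'.
  by rewrite scalerDr; congr (_ + _); apply/rowP => j; rewrite !mxE exprS.
rewrite (theta_pair_unit _ k'm) unit_exp_Lexp; congr (_ * _).
have -> : Lexp (unit_row k') ('i *: x) = Lexp (unit_row k) x.
  rewrite -!unit_exp_Lexp; apply: eq_bigr => j _; rewrite /unit_exp mxE exprS /k'.
  by move: ('i : C) i2 => q q2; ring: q2.
have m2 : (m <= 2)%N by rewrite -leq_double -km /nodd; do 4![case: (odd _)].
rewrite -[RHS](cexp_shift _ (1 - m%:Z)); congr cexp.
by rewrite natrB // rmorphB /= -pmulrn mulr1z; ring.
Qed.

Lemma theta_form_i x : theta_form ('i *: x) = - theta_form x.
Proof.
rewrite /theta_form opprB scalerA -expr2 i2 scaleN1r; congr (_ - _).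
by rewrite /theta_pair !bigprod4 !mxE !tpN !tqN.
Qed.

Lemma theta_form_signs (x : 'rV[R[i]]_4) (y : 'rV[R[i]]_4) :
  (forall j, y 0 j = x 0 j \/ y 0 j = - x 0 j) -> theta_form y = theta_form x.
Proof.
have h (a b : C) : a = b \/ a = - b -> (tp a = tp b) * (tq a = tq b) * (tp ('i * a) = tp ('i * b)) *
    (tq ('i * a) = tq ('i * b)).
  by case=> ->; rewrite ?mulrN ?tpN ?tqN.
move=> hy; rewrite /theta_form /theta_pair !bigprod4 !mxE.
by rewrite !(h _ _ (hy o0)) !(h _ _ (hy o1)) !(h _ _ (hy o2)) !(h _ _ (hy o3)).
Qed.

Lemma theta_form_perm (s : 'I_4 -> 'I_4) (x y : 'rV[R[i]]_4) : injective s ->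
  (forall j, y 0 (s j) = x 0 j) -> theta_form y = theta_form x.
Proof.
move=> sI hy; rewrite /theta_form /theta_pair.
have e (f : C -> C) : \prod_(j < 4) f (y 0 j) = \prod_(j < 4) f (x 0 j).
  by rewrite (reindex_inj sI); apply: eq_bigr => j _; rewrite hy.
have e' (f : C -> C) : \prod_(j < 4) f (('i *: y) 0 j) = \prod_(j < 4) f (('i *: x) 0 j).
  by rewrite (reindex_inj sI); apply: eq_bigr => j _; rewrite !mxE hy.
by rewrite !e !e'.
Qed.

Lemma theta_form0 : theta_form 0 = 0.
Proof. by rewrite /theta_form scaler0 subrr. Qed.

(** Where all coordinates are [(1 + i)/2] the factor [tq] vanishes, and at [i] times this point [tp]
    does. Since the fourth power of [exp(- pi i / 4)] is -1, the two remaining products add up to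
    twice a nonzero fourth power. *)
Lemma theta_form_neq0 : exists x, theta_form x != 0.
Proof.
exists (const_mx ((1 + 'i) / 2)); rewrite /theta_form /theta_pair !bigprod4 !mxE.
have -> : 'i * ((1 + 'i) / 2) = ('i - 1) / 2 :> C.
  by move: ('i : C) i2 => q q2; field: q2.
rewrite tp_half tq_half tp_ihalf tq_ihalf; have := sigma_half_neq0 R; set a := sigma _ => a0.
have e4 : cexp (- (pc * 'i / 4)) ^+ 4 = -1 :> C.
  by rewrite !exprS expr0 mulr1 -!cexpD -[RHS]invrN1 -cexp_pii -cexpN; congr cexp; field.
rewrite (_ : _ - _ = a ^+ 4 - cexp (- (pc * 'i / 4)) ^+ 4 * a ^+ 4); last by ring.
by rewrite e4 mulN1r opprK -mulr2n -mulr_natr mulf_neq0 ?expf_neq0 ?pnatr_eq0.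
Qed.

Lemma hol_theta_form : holomorphic (theta_form : V -> C^o).
Proof.
have hp (f : 'I_4 -> V -> C^o) (p : C -> C) : entire p -> (forall j, holomorphic (f j)) ->
    holomorphic (fun x => \prod_(j < 4) p (f j x) : C^o).
  by move=> pe hf; apply: hol_prod => j; apply: hol_entire.
have hi j : holomorphic (fun x : V => ('i *: (x : 'rV[R[i]]_4)) 0 j : C^o).
  rewrite (_ : (fun x => _) = (fun x : V => 'i * (x : 'rV[R[i]]_4) 0 j : C^o)).
    by apply: hol_M; [exact: hol_cst|exact: hol_coord].
  by apply/funext => x; rewrite mxE.
have hc := @hol_coord R.
rewrite (_ : theta_form = (fun x => (\prod_(j < 4) tp (x 0 j) + \prod_(j < 4) tq (x 0 j)) +
   -1 * (\prod_(j < 4) tp (('i *: x) 0 j) + \prod_(j < 4) tq (('i *: x) 0 j)))).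
  apply: hol_D; first by apply: hol_D; apply: hp => //; [exact: entire_tp|exact: entire_tq].
  by apply: hol_M; [exact: hol_cst|apply: hol_D; apply: hp => //; [exact: entire_tp|exact: entire_tq]].
by apply/funext => x; rewrite mulN1r.
Qed.

End ThetaProduct.

(** * One invariant divisor through 0 *)

Section BaseDivisor.
Variable R : realType.
Local Notation C := R[i].
Local Notation V := ('rV[R[i]]_4 : normedModType R[i]).
Local Notation pc := ((pi : R)%:C).
Local Notation B := (Bmx R).

Definition base_form (x : 'rV[R[i]]_4) : C := theta_form (x *m B).

Definition monomial_word (s : seq nat) (e : seq gi) : seq (seq gi) :=
  [seq [seq (if j == p.1 then p.2 else g0) | j <- [:: 0; 1; 2; 3]%N] | p <- zip s e].
Definition gim : gi := (BinNums.Z0, BinInt.Z.opp 1).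
(** The [T_j] in the coordinates of [Bmx]: for each row the column and the value of its only nonzero
    entry. Within one matrix the entries are all [1, -1] or all [i, -i]. *)
Definition monomial_T : seq (seq nat * seq gi) :=
  [:: ([:: 3; 2; 1; 0]%N, [:: gI; gI; gim; gim]); ([:: 3; 2; 1; 0]%N, [:: g1; g1; g1; g1]);
      ([:: 0; 1; 2; 3]%N, [:: gm1; g1; gm1; g1]); ([:: 1; 0; 3; 2]%N, [:: gim; gI; gim; gI]);
      ([:: 1; 0; 3; 2]%N, [:: gm1; gm1; g1; g1])].

Lemma monomial_T_ok : all (fun j => let p := nth ([::], [::]) monomial_T j in
  mulm (mulm F4 (tmat j)) B4 == [seq [seq double x | x <- u] | u <- monomial_word p.1 p.2]) [:: 0; 1; 2; 3; 4]%N.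
Proof. by vm_compute. Qed.

Lemma conj_Tmat N w : wf N ->
  mulm (mulm F4 (tmat w)) B4 == [seq [seq double x | x <- u] | u <- N] ->
  mxr R (tmat w) *m B = B *m mxr R N.
Proof.
move=> wN /eqP h; have /and5P[wB wF _ _ _] := B4_ok.
have := congr1 (mxr R) h; rewrite (mxr_double R wN) (mxrM R (wf_mulm wF (wf_tmat w)) wB) (mxrM R wF (wf_tmat w)) => e.
have -> : mxr R N = Binv R *m mxr R (tmat w) *m B.
  by rewrite /Binv -!scalemxAl -/(Bmx R) e scalerA mulVf ?scale1r ?pnatr_eq0.
by rewrite !mulmxA BmxK mul1mx.
Qed.

(** The form is symmetric and even in each coordinate, so only the common power of [i] matters, and
    [i] acts by -1. *)
Lemma theta_form_monomial (s : seq nat) (e : seq gi) (k : nat) (y : 'rV[R[i]]_4) :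
  perm_eq s [:: 0; 1; 2; 3]%N -> size e = 4%N ->
  (forall c, c \in e -> gc R c = 'i ^+ k \/ gc R c = - 'i ^+ k) -> (k < 2)%N ->
  theta_form (y *m mxr R (monomial_word s e)) = (-1) ^+ k * theta_form y.
Proof.
move=> ps se he k2; have ss : size s = 4%N by rewrite (perm_size ps).
have sl j : (j < 4)%N -> (nth 0%N s j < 4)%N.
  by move=> j4; have := mem_nth 0%N (s := s) (n := j); rewrite ss (perm_mem ps) => /(_ j4); rewrite !inE => /or4P[] /eqP ->.
pose sg (j : 'I_4) : 'I_4 := Ordinal (sl j (ltn_ord j)).
have sgI : injective sg.
  move=> i j /(congr1 val)/eqP /=; rewrite nth_uniq ?ss // ?(perm_uniq ps) // => /eqP; exact: val_inj.
have co (j : 'I_4) : (y *m mxr R (monomial_word s e)) 0 (sg j) = gc R (nth g0 e j) * y 0 j.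
  rewrite mxE (bigD1 j) //= big1 => [|i ij]; rewrite mxE /monomial_word (nth_map (0%N, g0)) ?size_zip ?ss ?se //.
    rewrite addr0 mulrC (nth_map 0%N) ?sl // nth_zip ?ss ?se //=.
    rewrite (_ : nth _ [:: 0; 1; 2; 3]%N (nth 0%N s j) = nth 0%N s j) ?eqxx //.
    by move: (nth 0%N s j) (sl j (ltn_ord j)) => [|[|[|[|]]]].
  rewrite (nth_map 0%N) ?sl // nth_zip ?ss ?se //=.
  rewrite (_ : nth _ [:: 0; 1; 2; 3]%N (nth 0%N s j) = nth 0%N s j).
    by rewrite nth_uniq ?ss ?(perm_uniq ps) // eq_sym (inj_eq val_inj) (negPf ij) gc0 mulr0.
  by move: (nth 0%N s j) (sl j (ltn_ord j)) => [|[|[|[|]]]].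
pose w : 'rV[R[i]]_4 := \row_j (gc R (nth g0 e j) * y 0 j).
have -> : theta_form (y *m mxr R (monomial_word s e)) = theta_form w.
  by apply: theta_form_perm sgI _ => j; rewrite co mxE.
have hw j : w 0 j = ('i ^+ k *: y) 0 j \/ w 0 j = - ('i ^+ k *: y) 0 j.
  have := he (nth g0 e j); rewrite mem_nth ?se // !mxE => /(_ isT)[] ->; [by left|by right; rewrite mulNr].
rewrite (theta_form_signs hw); move: k k2 {he hw} => [|[|k]] // _.
  by rewrite !expr0 scale1r mul1r.
by rewrite !expr1 theta_form_i mulN1r.
Qed.

Lemma base_form_T (j : 'I_5) : exists2 c : C, c != 0 & forall x, base_form (x *m Tmx R j) = c * base_form x.
Proof.
have h k m : (m < 2)%N -> (k < 5)%N -> (forall c, c \in (nth ([::], [::]) monomial_T k).2 ->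
    gc R c = 'i ^+ m \/ gc R c = - 'i ^+ m) ->
    exists2 c : C, c != 0 & forall x, base_form (x *m mxr R (tmat k)) = c * base_form x.
  move=> m2 k5 he; exists ((-1) ^+ m); first by rewrite signr_eq0.
  move=> x; have kin : k \in [:: 0; 1; 2; 3; 4]%N by move: k k5 {he} => [|[|[|[|[|]]]]].
  rewrite /base_form -mulmxA (conj_Tmat _ (allP monomial_T_ok k kin)) ?mulmxA.
    by apply: theta_form_monomial => //; move: k k5 {kin he} => [|[|[|[|[|]]]]].
  by move: k k5 {kin he} => [|[|[|[|[|]]]]].
have gi1 : gc R gI = 'i by rewrite -[LHS]/(gc R (Z_of_int 0, Z_of_int 1)) gc_int add0r mul1r.
have gim1 : gc R gim = - 'i by rewrite -[LHS]/(gc R (Z_of_int 0, Z_of_int (Negz 0))) gc_int add0r mulN1r.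
rewrite Tmx_tmat; case: j => [[|[|[|[|[|j]]]]] j5] //=.
- by apply: (@h 0%N 1%N) => // c; rewrite !inE expr1 => /or4P[] /eqP ->; rewrite ?gi1 ?gim1; auto.
- by apply: (@h 1%N 0%N) => // c; rewrite !inE expr0 => /or4P[] /eqP ->; rewrite ?gc_m1; auto.
- by apply: (@h 2%N 0%N) => // c; rewrite !inE expr0 => /or4P[] /eqP ->; rewrite ?gc_m1; auto.
- by apply: (@h 3%N 1%N) => // c; rewrite !inE expr1 => /or4P[] /eqP ->; rewrite ?gi1 ?gim1; auto.
by apply: (@h 4%N 0%N) => // c; rewrite !inE expr0 => /or4P[] /eqP ->; rewrite ?gc_m1; auto.
Qed.

Lemma base_form_Gi M : Gi M -> exists2 c : C, c != 0 & forall x, base_form (x *m M) = c * base_form x.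
Proof.
have one : exists2 c : C, c != 0 & forall x, base_form (x *m 1%:M) = c * base_form x.
  by exists 1; rewrite ?oner_eq0 // => x; rewrite mulmx1 mul1r.
have mul (P Q : 'M[C]_4) : (exists2 c : C, c != 0 & forall x, base_form (x *m P) = c * base_form x) ->
    (exists2 c : C, c != 0 & forall x, base_form (x *m Q) = c * base_form x) ->
    exists2 c : C, c != 0 & forall x, base_form (x *m (P *m Q)) = c * base_form x.
  move=> [c c0 hc] [d d0 hd]; exists (d * c); first by rewrite mulf_neq0.
  by move=> x; rewrite mulmxA hd hc mulrA.
have inv (P : 'M[C]_4) : Gi P -> (exists2 c : C, c != 0 & forall x, base_form (x *m P) = c * base_form x) ->
    exists2 c : C, c != 0 & forall x, base_form (x *m invmx P) = c * base_form x.
  move=> /Gi_UH[/UH_unit uP _] [c c0 hc]; exists c^-1; first by rewrite invr_neq0.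
  move=> x; have := hc (x *m invmx P); rewrite (mulmxKV uP) => ->; rewrite mulrA (mulVf c0).
  exact: (esym (mul1r _)).
elim=> {M} [M [hM|->]| |P Q _ hP _ hQ|P hP0 hP]; [| |exact: one|exact: mul hP hQ|exact: inv hP0 hP].
  elim: hM => {M} [M [j ->]| |P Q _ hP _ hQ|P hP0 hP]; [exact: base_form_T|exact: one|exact: mul hP hQ|].
  by apply: inv hP; apply: generated_in; left.
by exists (-1); rewrite ?oppr_eq0 ?oner_eq0 // => x; rewrite /base_form mul_mx_scalar -scalemxAl theta_form_i mulN1r.
Qed.

(** The entries of [Bmx] as powers of [i]. Every row has an even number of odd exponents, as
    [theta_form_unit] requires. *)
Definition B_exponents := [:: [:: 1; 2; 3; 2]; [:: 2; 0; 3; 1]; [:: 1; 3; 3; 1]; [:: 0; 1; 3; 2]]%N.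
Lemma row_B (r : 'I_4) (s : nat) :
  'i ^+ s *: row r B = unit_row R (fun j => nth 0 (nth [::] B_exponents r) j + s)%N.
Proof.
have gi1 : gc R gI = 'i by rewrite -[LHS]/(gc R (Z_of_int 0, Z_of_int 1)) gc_int add0r mul1r.
have gim1 : gc R gim = - 'i by rewrite -[LHS]/(gc R (Z_of_int 0, Z_of_int (Negz 0))) gc_int add0r mulN1r.
have i2 : ('i : C) ^+ 2 = -1 := sqr_i _.
have i3 : ('i : C) ^+ 3 = - 'i by rewrite exprS i2 mulrN1.
apply/rowP => j; rewrite !mxE exprD mulrC; congr (_ * _).
by elim/ord4_ind: r; elim/ord4_ind: j => /=; rewrite ?expr0 ?expr1 ?i2 ?i3 -?gi1 -?gim1 -?gc_m1.
Qed.

Lemma quasi_row_B r (s : nat) : (s < 2)%N -> quasi (@theta_form R) ('i ^+ s *: row r B).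
Proof.
move=> s2; rewrite row_B; apply: theta_form_unit.
by elim/ord4_ind: r; move: s s2 => [|[|]].
Qed.

Lemma lattice_quasi (l : 'rV[R[i]]_4) : lattice l -> quasi (@theta_form R) (l *m B).
Proof.
move=> /mxOverP hl; rewrite mulmx_sum_row sum4.
have h r : quasi (@theta_form R) (l 0 r *: row r B).
  have := hl 0 r; case: (l 0 r) => x y /andP[/= /intrP[a ->] /intrP[b ->]].
  have -> : a%:~R +i* b%:~R = (a%:~R : C) + b%:~R * 'i.
    by rewrite -(rmorph_int (real_complex R) a) -(rmorph_int (real_complex R) b) /=; simpc.
  rewrite scalerDl -scalerA; apply: quasi_D; apply: quasi_int.
    by have := @quasi_row_B r 0 isT; rewrite expr0 scale1r.
  by have := @quasi_row_B r 1 isT; rewrite expr1.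
exact: quasi_D (quasi_D (quasi_D (h o0) (h o1)) (h o2)) (h o3).
Qed.

Lemma hol_Lexp (l : 'rV[R[i]]_4) : holomorphic (Lexp l : V -> C^o).
Proof.
apply: hol_D; last exact: hol_cst.
apply: hol_M; first exact: hol_cst.
by apply: hol_sum => j; apply: hol_M; [exact: hol_coord|exact: hol_cst].
Qed.

Lemma twopii_neq0 : twopii R != 0.
Proof. by rewrite eq_complex /= eqxx mulf_eq0 pnatr_eq0 (gt_eqF (pi_gt0 R)). Qed.

Lemma twopiiE : twopii R = 2 * pc * 'i.
Proof. by rewrite /twopii -[2 in RHS](rmorph_nat (real_complex R) 2) /=; simpc. Qed.

Lemma herm_dot_H (x l : 'rV[R[i]]_4) : herm_dot (x *m B) (l *m B) = 2 * Hform x l.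
Proof.
have -> : herm_dot (x *m B) (l *m B) = ((x *m B) *m (map_mx (@conjc R) (l *m B))^T) ord0 ord0.
  by move: (x *m B) (l *m B) => u v; rewrite /herm_dot mxE; apply: eq_bigr => j _; rewrite !mxE.
have /and5P[wB _ /eqP hB _ _] := B4_ok.
have e : B *m (map_mx (@conjc R) B)^T = 2 *: Hmx R.
  by rewrite Hmx_mxr -mxr_double // -hB mxrM ?wf_ctr // mxr_ctr.
rewrite /Hform map_mxM trmx_mul mulmxA -(mulmxA x) e -scalemxAr -scalemxAl mxE //.
Qed.

Lemma base_form_chern : has_chern_class base_form (@ImH R).
Proof.
have [c hc] : exists c : 'rV[R[i]]_4 -> C, forall l, lattice l -> forall x : 'rV[R[i]]_4,
    theta_form (x + l *m B) = cexp (c l + Lexp (l *m B) x) * theta_form x.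
  exists (fun l => xget 0 [set c | forall x : 'rV[R[i]]_4,
    theta_form (x + l *m B) = cexp (c + Lexp (l *m B) x) * theta_form x]) => l hl.
  by case: xgetP => [c _ //|no]; have [c h] := lattice_quasi hl; case: (no c).
exists (fun l x => (twopii R)^-1 * (c l + Lexp (l *m B) (x *m B))); split.
- move=> l _; apply: hol_M; first exact: hol_cst.
  apply: hol_D; first exact: hol_cst.
  exact: (@hol_linear R (Lexp (l *m B)) B (hol_Lexp (l *m B))).
- by move=> l x hl; rewrite /base_form mulmxDl hc // mulVKf // twopii_neq0.
(* The unknown constants [c l] and [c m] cancel in the coboundary; what is left is [pi / 2] times a
   Hermitian product minus its conjugate. *)
move=> l m x _ _; rewrite -!mulrDr -!mulrBr /ImH.
have e (w : C) : 2 * 'i * (complex.Im w)%:C = w - w^*%C.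
  case: w => a b; rewrite -[2](rmorph_nat (real_complex R) 2) /=; simpc.
  by apply/eqP; rewrite eq_complex /=; apply/andP; split; apply/eqP; ring.
have hsym : herm_dot (m *m B) (l *m B) = (herm_dot (l *m B) (m *m B))^*%C.
  rewrite /herm_dot (rmorph_sum (@conjc R)); apply: eq_bigr => j _.
  by rewrite (rmorphM (@conjc R)) /= conjcK mulrC.
apply: (mulfI twopii_neq0); rewrite mulVKf ?twopii_neq0 //.
transitivity (pc / 2 * (herm_dot (l *m B) (m *m B) - herm_dot (m *m B) (l *m B))).
  by rewrite /Lexp /herm_dot !sum4 !mulmxDl ![(_ + _ *m B) 0 _]mxE; ring.
have c2 (w : C) : (2 * w)^*%C = 2 * w^*%C by rewrite !mulr_natl (rmorphMn (@conjc R)).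
rewrite hsym herm_dot_H c2 (_ : twopii R = pc * (2 * 'i)); last by rewrite twopiiE; ring.
by rewrite -[RHS]mulrA e; field.
Qed.

Lemma base_form_invariant : invariant_divisor_through0 base_form.
Proof.
have hB : holomorphic (base_form : V -> C^o) := hol_linear B (@hol_theta_form R).
split; last by rewrite /base_form mul0mx theta_form0.
- split; first exact: hB.
    have [x hx] := theta_form_neq0 R; exists (x *m Binv R).
    by rewrite /base_form -mulmxA BinvK mulmx1.
  move=> l /lattice_quasi[c hc]; exists (fun x => cexp (c + Lexp (l *m B) (x *m B))); split.
  + apply: hol_entire; first exact: entire_cexp.
    apply: hol_D; first exact: hol_cst.
    exact: (@hol_linear R (Lexp (l *m B)) B (hol_Lexp (l *m B))).
  + by move=> x; exact: cexp_neq0.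
  + by move=> x; rewrite /base_form mulmxDl hc.
- exact: base_form_chern.
move=> M /base_form_Gi[c c0 hc]; exists (fun=> c); split => //; exact: hol_cst.
Qed.

End BaseDivisor.

(** * The quadratic term of an invariant divisor *)

Section TangentCones.
Variable R : realType.
Local Notation C := R[i].
Local Notation V := ('rV[R[i]]_4 : normedModType R[i]).
Local Notation B := (Bmx R).
Local Notation Bi := (Binv R).

Definition g11 : gi := gadd g1 gI.
Definition axis_list (i : nat) : seq gi := [seq (if k == i then double g1 else g0) | k <- [:: 0; 1; 2; 3]%N].
Definition plane_list (s : gi) (i j : nat) : seq gi :=
  [seq (if k == i then g11 else if k == j then gmul s g11 else g0) | k <- [:: 0; 1; 2; 3]%N].
(** [vecm u F4] is even exactly when [u] is the image under [Bmx] of a lattice vector; the last test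
    is Hermitian square 4. *)
Definition root_ok (u : seq gi) :=
  [&& size u == 4%N, map double (map half_gi (vecm u F4)) == vecm u F4 &
    foldr (fun c s => gadd (gmul c (gconj c)) s) g0 u == double (double g1)].

Lemma roots_ok : [&& all (fun i => root_ok (axis_list i)) [:: 0; 1; 2; 3]%N, root_ok [:: g1; g1; g1; g1] &
  all (fun s => all (fun i => all (fun j => if i == j then true else root_ok (plane_list s i j))
    [:: 0; 1; 2; 3]%N) [:: 0; 1; 2; 3]%N) [:: g1; gm1]].
Proof. by vm_compute. Qed.

Lemma root_vector_list (l : 'rV[R[i]]_4) : root_vector l -> exists2 u, root_ok u & l = rvec R u.
Proof.
have /and3P[/allP hax hd /allP hpl] := roots_ok.
have mem4 (k : 'I_4) : (k : nat) \in [:: 0; 1; 2; 3]%N by elim/ord4_ind: k.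
have e11 : gc R g11 = 1 + 'i.
  by rewrite gcD gc1 -[gc R gI]/(gc R (Z_of_int 0, Z_of_int 1)) gc_int add0r mul1r.
have pl s (i j : 'I_4) : i != j -> s \in [:: g1; gm1] -> root_ok (plane_list s i j).
  move=> ij hs; have /allP/(_ _ (mem4 i))/allP/(_ _ (mem4 j)) := hpl s hs.
  by rewrite (inj_eq val_inj) (negPf ij).
case=> [j|i j ij|i j ij|].
- exists (axis_list j); first exact: hax (mem4 j).
  apply/rowP => k; rewrite !mxE (nth_map 0%N) //.
  have -> : nth 0%N [:: 0; 1; 2; 3]%N k = k by elim/ord4_ind: k.
  rewrite (inj_eq val_inj) /=; case: eqP => _; rewrite ?mulr0 // mulr1.
  by rewrite /double gcD gc1.
- exists (plane_list g1 i j); first by apply: pl.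
  apply/rowP => k; rewrite !mxE (nth_map 0%N) //.
  have -> : nth 0%N [:: 0; 1; 2; 3]%N k = k by elim/ord4_ind: k.
  rewrite !(inj_eq val_inj) /=; case: (eqVneq k i) => [->|_].
    by rewrite (negPf ij) addr0 mulr1 e11.
  by case: eqP => _; rewrite add0r ?mulr0 // mulr1 gcM gc1 mul1r e11.
- exists (plane_list gm1 i j); first by apply: pl.
  apply/rowP => k; rewrite !mxE (nth_map 0%N) //.
  have -> : nth 0%N [:: 0; 1; 2; 3]%N k = k by elim/ord4_ind: k.
  rewrite !(inj_eq val_inj) /=; case: (eqVneq k i) => [->|_].
    by rewrite (negPf ij) subr0 mulr1 e11.
  by case: eqP => _; rewrite sub0r ?oppr0 ?mulr0 // mulrN1 gcM gc_m1 mulN1r e11.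
exists [:: g1; g1; g1; g1] => //; apply/rowP => k; rewrite !mxE.
by elim/ord4_ind: k.
Qed.

Lemma root_lattice (l : 'rV[R[i]]_4) : root_vector l ->
  [/\ lattice (l *m Bi), lattice ('i *: (l *m Bi)) & ImH ('i *: (l *m Bi)) (l *m Bi) = 2].
Proof.
move=> /root_vector_list[u /and3P[/eqP su /eqP hd /eqP hn] ->].
have /and5P[_ wF _ _ _] := B4_ok.
have e : rvec R u *m Bi = rvec R (map half_gi (vecm u F4)).
  rewrite /Binv -scalemxAr -rvec_vecm // -[in LHS]hd; apply/rowP => j; rewrite !mxE.
  have sh : size (map half_gi (vecm u F4)) = 4%N by rewrite size_map vecm_size.
  move: (map half_gi _) sh => h sh; rewrite (nth_map g0) ?sh // /double gcD.
  by move: (gc R _) => w; field.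
have hH : Hform (rvec R u *m Bi) (rvec R u *m Bi) = 2.
  apply: (@mulfI _ (2 : C)); first by rewrite pnatr_eq0.
  rewrite -herm_dot_H -mulmxA BinvK mulmx1 /herm_dot sum4 !mxE -!gcJ -!gcM -!gcD.
  have := congr1 (gc R) hn; case: (size4 su) => a [b [c [d ->]]] /=.
  rewrite !gcD gc0 addr0 gc1 !addrA => ->; ring.
split.
- by rewrite e; apply/mxOverP => i j; rewrite mxE; exact: gc_gaussInt.
- have -> : 'i *: (rvec R u *m Bi) = rvec R (map (gmul gI) (map half_gi (vecm u F4))).
    rewrite e; have sh : size (map half_gi (vecm u F4)) = 4%N by rewrite size_map vecm_size.
    move: (map half_gi _) sh => h sh; apply/rowP => j; rewrite !mxE (nth_map g0) ?sh //.
    by rewrite gcM -[gc R gI]/(gc R (Z_of_int 0, Z_of_int 1)) gc_int add0r mul1r.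
  by apply/mxOverP => i j; rewrite mxE; exact: gc_gaussInt.
rewrite /ImH /Hform -!scalemxAl mxE -/(Hform _ _) hH.
by rewrite -[2 in X in complex.Im X](rmorph_nat (real_complex R) 2) /=; simpc.
Qed.

Definition approx (F Q : 'rV[R[i]]_4 -> C) := forall e : R, 0 < e -> exists2 d : R, 0 < d &
  forall x : V, vnorm x < d -> cmod (F x - Q x) <= e * vnorm x ^+ 2.

(** The Chern class supplies the quasi-periods along root lines, and the invariance supplies the
    factors for the Pauli group; both are transported to the coordinates of [Bmx]. *)
Lemma approx_quadric (F : V -> C) : invariant_divisor_through0 F ->
  exists k e, [/\ (k < 10)%N, e != 0 & approx (fun x => F (x *m Bi)) (fun x => e * quadric k x)].
Proof.
move=> [[hF [x0 Fx0] _] [f [hf fF fE]] inv F0].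
pose Phi (x : V) : C^o := F ((x : 'rV[R[i]]_4) *m Bi).
have hPhi : holomorphic Phi := hol_linear Bi hF.
have Phi0 : Phi 0 = 0 by rewrite /Phi mul0mx.
have Phiv : Phi ((x0 : 'rV[R[i]]_4) *m B) != 0 by rewrite /Phi -mulmxA BmxK mulmx1.
have hroot l : root_vector l -> quasi_periodic2 Phi l.
  move=> /root_lattice[l1 l2 l3].
  exists (fun x => f (l *m Bi) (x *m Bi)), (fun x => f ('i *: (l *m Bi)) (x *m Bi)); split.
  - by apply: hol_linear; exact: hf.
  - by apply: hol_linear; exact: hf.
  - by move=> x; rewrite /Phi mulmxDl fF.
  - by move=> x; rewrite /Phi mulmxDl -scalemxAl fF.
  - by move=> x; rewrite !mulmxDl -scalemxAl fE // l3 rmorph_nat.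
have hsemi M : pauli M -> exists u, semi_invariant Phi M u.
  move=> /inv[u [hu u0 hu2]]; exists (fun x => u ((x : 'rV[R[i]]_4) *m Bi)); split => [||x] //.
    exact: hol_linear.
  by rewrite /Phi -hu2 !mulmxA -(mulmxA x Bi B) BinvK mulmx1.
have [k [e [k10 e0 he]]] := second_order_ten hPhi Phi0 Phiv hroot (@pauliM R) (@pauli_refl R)
  (pauli_perm1 R) (pauli_perm2 R) hsemi.
exists k, e; split => // r r0.
have d0 := dPhi_zero hPhi Phi0 (@pauli_refl R) (pauli_perm1 R) (pauli_perm2 R) hsemi.
have [d dp hd] := second_order_little_o hPhi Phi0 d0 r0.
by exists d => // x xd; rewrite -he; exact: hd.
Qed.

End TangentCones.

(** * Uniqueness of the initial form *)

Section InitialForms.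
Variable R : realType.
Local Notation C := R[i].
Local Notation V := ('rV[R[i]]_4 : normedModType R[i]).
Local Notation B := (Bmx R).

Lemma coord_vnorm (x : V) i : cmod ((x : 'rV[R[i]]_4) 0 i) <= vnorm x.
Proof.
rewrite leNgt; apply/negP => h.
have : ball (0 : V) (cmod ((x : 'rV[R[i]]_4) 0 i))%:C x.
  by rewrite -ball_normE /ball_ /= sub0r normrN vnormE ltcR.
by move=> [_ /(_ 0 i)]; rewrite mxE -ball_normE /ball_ /= sub0r normrN cmodE ltcR ltxx.
Qed.

Lemma vnorm_linear (M : 'M[C]_4) : exists2 K : R, 0 <= K &
  forall x : V, vnorm ((x : 'rV[R[i]]_4) *m M : V) <= K * vnorm x.
Proof.
exists (vnorm (row o0 M) + vnorm (row o1 M) + vnorm (row o2 M) + vnorm (row o3 M)).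
  by rewrite !addr_ge0 ?vnorm_ge0.
move=> x; rewrite mulmx_sum_row sum4 !mulrDl.
have h i : vnorm ((x : 'rV[R[i]]_4) 0 i *: row i M : V) <= vnorm (row i M : V) * vnorm x.
  by rewrite vnormZ mulrC ler_wpM2l ?vnorm_ge0 ?coord_vnorm.
apply: le_trans (vnormD _ _) _; apply: lerD => //.
apply: le_trans (vnormD _ _) _; apply: lerD => //.
by apply: le_trans (vnormD _ _) _; apply: lerD.
Qed.

Definition approx_at (d : nat) (F Q : 'rV[R[i]]_4 -> C) := forall e : R, 0 < e -> exists2 r : R, 0 < r &
  forall x : V, vnorm x < r -> cmod (F x - Q x) <= e * vnorm x ^+ d.

Lemma approx_linear (F Q : V -> C) (M : 'M[C]_4) : approx_at 2 F Q ->
  approx_at 2 (fun x => F (x *m M)) (fun x => Q (x *m M)).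
Proof.
move=> h e e0; have [K K0 hK] := vnorm_linear M; have k0 : 0 < 1 + K by rewrite ltr_wpDr.
have [r r0 hr] := h (e / (1 + K) ^+ 2) (divr_gt0 e0 (exprn_gt0 2 k0)).
exists (r / (1 + K)); first by rewrite divr_gt0.
move=> x; rewrite ltr_pdivlMr // => xr.
have xK : vnorm ((x : 'rV[R[i]]_4) *m M : V) <= (1 + K) * vnorm x.
  by apply: le_trans (hK x) _; rewrite ler_wpM2r ?vnorm_ge0 // lerDr.
apply: le_trans (hr _ _) _; first by apply: le_lt_trans xK _; rewrite mulrC.
rewrite mulrAC ler_pdivrMr ?exprn_gt0 // -mulrA ler_wpM2l ?(ltW e0) // -exprMn mulrC.
by apply: lerXn2r; rewrite ?nnegrE ?vnorm_ge0 ?mulr_ge0 ?vnorm_ge0 ?(ltW k0) // mulrC.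
Qed.

Definition homog (d : nat) (Q : 'rV[R[i]]_4 -> C) := forall (z : C) (x : 'rV[R[i]]_4), Q (z *: x) = z ^+ d * Q x.

(** Both approximations are compared at [t x] for one explicit small [t] and divided by [t^a]; for
    [a < b] the term of degree [b] is itself negligible. *)
Lemma approx_ray a b (F P S : V -> C) x : (a <= b)%N -> approx_at a F P -> approx_at b F S ->
  homog a P -> homog b S -> P x = if a == b then S x else 0.
Proof.
move=> ab hP hS oP oS; apply/eqP; rewrite -subr_eq0; apply/eqP; apply: cmod_small => e e0.
pose n := vnorm x; have n0 : 0 <= n := vnorm_ge0 x.
pose m := n ^+ a + n ^+ b + 1; have m0 : 0 < m by rewrite ltr_wpDl ?addr_ge0 ?exprn_ge0.
have [r r0 hr] := hP _ (divr_gt0 e0 (mulr_gt0 (ltr0n _ 2) m0)).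
have [s s0 hs] := hS _ (divr_gt0 e0 (mulr_gt0 (ltr0n _ 2) m0)).
have s1 : 0 < cmod (S x) + 1 by rewrite ltr_wpDl ?cmod_ge0.
pose t := Num.min 1 (Num.min (Num.min r s / (2 * (n + 1))) (e / (2 * (cmod (S x) + 1)))).
have n1 : 0 < n + 1 by rewrite ltr_wpDl.
have t0 : 0 < t by rewrite !lt_min ltr01 !divr_gt0 ?mulr_gt0 // lt_min r0.
have t1 : t <= 1 by rewrite ge_min lexx.
have trs : t * (2 * (n + 1)) <= Num.min r s.
  by rewrite -ler_pdivlMr ?mulr_gt0 // !ge_min lexx orbT.
have ts : t * (2 * (cmod (S x) + 1)) <= e.
  by rewrite -ler_pdivlMr ?mulr_gt0 // !ge_min lexx !orbT.
have ct : cmod t%:C = t by rewrite cmodR ger0_norm ?(ltW t0).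
have vt : vnorm (t%:C *: x : V) = t * n by rewrite vnormZ ct.
have tn : t * n < Num.min r s by apply: lt_le_trans trs; rewrite ltr_pM2l //; lra.
have k1 := hr (t%:C *: x : V); have k2 := hs (t%:C *: x : V).
rewrite vt oP exprMn in k1; rewrite vt oS exprMn in k2.
have /andP[tr tS] : (t * n < r) && (t * n < s) by rewrite -lt_min.
have {}k1 := k1 tr; have {}k2 := k2 tS.
have ta : 0 < t ^+ a by rewrite exprn_gt0.
have tb : t ^+ b <= t ^+ a by rewrite ler_wiXn2l // ltW.
have q0 : 0 <= e / (2 * m) by rewrite ltW // divr_gt0 // mulr_gt0.
have b1 : e / (2 * m) * (t ^+ a * n ^+ a) + e / (2 * m) * (t ^+ b * n ^+ b) <= t ^+ a * (e / 2).
  apply: (@le_trans _ _ (e / (2 * m) * (t ^+ a * (n ^+ a + n ^+ b)))).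
    by rewrite -mulrDr ler_wpM2l // mulrDr lerD2l ler_wpM2r // exprn_ge0.
  rewrite mulrCA ler_pM2l //; apply: (@le_trans _ _ (e / (2 * m) * m)).
    by rewrite ler_wpM2l // /m lerDl.
  by rewrite invfM mulrA divfK // gt_eqF.
rewrite -(ler_pM2l ta) -{1}ct -cmodX -cmodM.
case: eqVneq => [eab|nab].
  rewrite (_ : _ * (P x - S x) = (F (t%:C *: x) - t%:C ^+ b * S x) - (F (t%:C *: x) - t%:C ^+ a * P x)).
    apply: le_trans (cmodB _ _) _; rewrite addrC; apply: le_trans (lerD k1 k2) _.
    by apply: le_trans b1 _; rewrite ler_pM2l //; lra.
  by rewrite eab; ring.
have ab' : (a < b)%N by rewrite ltn_neqAle nab.
rewrite subr0 (_ : _ * P x = ((F (t%:C *: x) - t%:C ^+ b * S x) - (F (t%:C *: x) - t%:C ^+ a * P x))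
    + t%:C ^+ b * S x); last by ring.
apply: le_trans (cmodD _ _) _.
have c1 : cmod (t%:C ^+ b * S x) <= t ^+ a * (e / 2).
  rewrite cmodM cmodX ct; apply: (@le_trans _ _ (t ^+ a * t * cmod (S x))).
    by rewrite ler_wpM2r ?cmod_ge0 // -exprSr ler_wiXn2l // ltW.
  by rewrite -mulrA ler_pM2l //; have := cmod_ge0 (S x); nra.
have c2 : cmod ((F (t%:C *: x) - t%:C ^+ b * S x) - (F (t%:C *: x) - t%:C ^+ a * P x)) <= t ^+ a * (e / 2).
  by apply: le_trans (cmodB _ _) _; rewrite addrC; apply: le_trans (lerD k1 k2) b1.
by apply: le_trans (lerD c2 c1) _; rewrite -mulrDr ler_pM2l //; lra.
Qed.

Lemma approx_initial d (F : V -> C) (q : mpoly 4 C) :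
  ((fun x : V => F x - meval ((x : 'rV[R[i]]_4) ord0) q : C^o) =o_ (0 : V) (fun x : V => `|x| ^+ d : C^o))
  <-> approx_at d F (fun x => meval (x ord0) q).
Proof.
have n d' (x : V) : cmod (`|x| ^+ d' : C) = vnorm x ^+ d'.
  by rewrite cmodX vnormE cmodR ger0_norm ?vnorm_ge0.
split=> [/eqoP h e e0|h].
  have /h : 0 < e%:C by rewrite ltcR.
  move=> /near_vnorm[r r0 hr]; exists r => // x xr; have := hr x; rewrite subr0 => /(_ xr).
  by rewrite !norm_regular -rmorphM lecR n.
apply/eqoP => e /pos_complex[-> e0]; have [r r0 hr] := h _ e0.
apply/near_vnorm; exists r => // x; rewrite subr0 => /hr.
by rewrite !norm_regular -rmorphM lecR n.
Qed.

Lemma homog_meval d (q : mpoly 4 C) : q \is ishomog1 d (@mdeg 4) -> homog d (fun x => meval (x ord0) q).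
Proof.
move=> hq z x; rewrite !mevalE big_distrr /= big_seq [RHS]big_seq; apply: eq_bigr => m mq.
have dm : mdeg m = d := dhomog_mf hq mq.
rewrite mulrCA; congr (_ * _); rewrite -dm mdegE expr_sum -big_split /=.
by apply: eq_bigr => i _; rewrite mxE exprMn.
Qed.

Lemma mpoly_neq0_point (q : mpoly 4 C) : q != 0 -> exists x : 'rV[C]_4, meval (x ord0) q != 0.
Proof.
move=> q0; apply: contrapT => h; case/eqP: q0; apply: mpoly_row_inj => x.
by rewrite meval0; apply/eqP/negPn/negP => hx; apply: h; exists x.
Qed.

(** [tangent_cone] allows any initial form of any degree. If the degrees differed, [approx_ray]
    would make the one of lower degree vanish identically. *)
Lemma tangent_cone_of (F : V -> C) (Q : mpoly 4 C) : Q \is ishomog1 2 (@mdeg 4) -> Q != 0 ->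
  approx_at 2 F (fun x => meval (x ord0) Q) -> tangent_cone F = [set x | meval (x ord0) Q = 0].
Proof.
move=> hQ Q0 aQ; have iQ : initial_form F Q by exists 2; split => //; apply/approx_initial.
apply/seteqP; split => [x [q [d [hq q0 /approx_initial aq]] qx]|x /= Qx]; last by exists Q.
have oQ := homog_meval hQ; have oq := homog_meval hq.
have [xq nq] := mpoly_neq0_point q0; have [xQ nQ] := mpoly_neq0_point Q0.
case: (ltngtP d 2) => [d2|d2|d2].
- by case/eqP: nq; rewrite (approx_ray xq (ltnW d2) aq aQ oq oQ) (ltn_eqF d2).
- by case/eqP: nQ; rewrite (approx_ray xQ (ltnW d2) aQ aq oQ oq) (ltn_eqF d2).
move: aq oq; rewrite d2 => aq oq; rewrite /=.
by rewrite (approx_ray x (leqnn 2) aQ aq oQ oq) eqxx.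
Qed.

Definition quadric_poly (k : nat) : mpoly 4 C :=
  let a := ypoly_coord R o0 in let b := ypoly_coord R o1 in
  let c := ypoly_coord R o2 in let d := ypoly_coord R o3 in
  nth 0 [:: a * a + b * b + c * c + d * d; a * a - b * b + c * c - d * d;
      a * a + b * b - c * c - d * d; a * a - b * b - c * c + d * d;
      a * b + c * d; a * b - c * d; a * c + b * d; a * c - b * d;
      a * d + b * c; a * d - b * c] k.

Lemma quadric_poly_eval k (x : 'rV[C]_4) : (k < 10)%N -> meval (x ord0) (quadric_poly k) = quadric k (x *m B).
Proof.
have e j : meval (x ord0) (ypoly_coord R j) = (x *m B) 0 j.
  by rewrite rmorph_sum mxE; apply: eq_bigr => i _; rewrite /= mevalZ mevalXU mulrC.
rewrite /quadric_poly /quadric /ten_quadrics -!e.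
move: (ypoly_coord R o0) (ypoly_coord R o1) (ypoly_coord R o2) (ypoly_coord R o3) => a b c d.
by move: k => [|[|[|[|[|[|[|[|[|[|k]]]]]]]]]] // _; rewrite /= ?expr2 !(mevalB, mevalD, mevalM).
Qed.

Lemma quadric_poly_homog k : quadric_poly k \is ishomog1 2 (@mdeg 4).
Proof.
have h j : ypoly_coord R j \is ishomog1 1 (@mdeg 4).
  by apply: rpred_sum => i _; apply: dhomogZ; rewrite dhomogX; apply/eqP; exact: mdeg1.
have m i j : ypoly_coord R i * ypoly_coord R j \is ishomog1 2 (@mdeg 4) := dhomogM (h i) (h j).
have D (p q : mpoly 4 C) : p \is ishomog1 2 (@mdeg 4) -> q \is ishomog1 2 (@mdeg 4) -> p + q \is ishomog1 2 (@mdeg 4).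
  exact: dhomogD.
have S (p q : mpoly 4 C) : p \is ishomog1 2 (@mdeg 4) -> q \is ishomog1 2 (@mdeg 4) -> p - q \is ishomog1 2 (@mdeg 4).
  by move=> hp hq; apply: D => //; rewrite dhomogN.
rewrite /quadric_poly; move: {h} (m o0 o0) (m o1 o1) (m o2 o2) (m o3 o3) (m o0 o1) (m o2 o3) (m o0 o2) (m o1 o3)
  (m o0 o3) (m o1 o2).
move: (ypoly_coord R o0) (ypoly_coord R o1) (ypoly_coord R o2) (ypoly_coord R o3) {m} => a b c d aa bb cc dd ab cd ac bd ad bc.
case: k => [|[|[|[|[|[|[|[|[|[|k]]]]]]]]]]; last by rewrite /= nth_nil rpred0.
- exact: (D _ _ (D _ _ (D _ _ aa bb) cc) dd).
- exact: (S _ _ (D _ _ (S _ _ aa bb) cc) dd).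
- exact: (S _ _ (S _ _ (D _ _ aa bb) cc) dd).
- exact: (D _ _ (S _ _ (S _ _ aa bb) cc) dd).
- exact: (D _ _ ab cd).
- exact: (S _ _ ab cd).
- exact: (D _ _ ac bd).
- exact: (S _ _ ac bd).
- exact: (D _ _ ad bc).
- exact: (S _ _ ad bc).
Qed.

End InitialForms.

(** List each set followed by its complement and match positions. *)
Lemma set_perm (S S' : {set 'I_6}) : #|S| = #|S'| -> exists s : 'S_6, forall j, (s j \in S') = (j \in S).
Proof.
move=> card; pose l (T : {set 'I_6}) := enum T ++ enum (~: T).
have lu T : uniq (l T).
  rewrite cat_uniq !enum_uniq andbT; apply/hasPn => j; rewrite !mem_enum inE => /negPf h.
  by rewrite h.
have lm T j : j \in l T by rewrite mem_cat !mem_enum inE orbN.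
have ls T : size (l T) = 6%N.
  by rewrite size_cat -!cardE cardsC card_ord.
have il j T : (index j (l S) < size (l T))%N.
  by rewrite (_ : size (l T) = size (l S)) ?index_mem ?lm // !ls.
pose f j := nth (ord0 : 'I_6) (l S') (index j (l S)).
have fE j : f j = if (index j (l S) < #|S'|)%N then nth ord0 (enum S') (index j (l S))
    else nth ord0 (enum (~: S')) (index j (l S) - #|S'|).
  by rewrite /f /l nth_cat -cardE.
have fI : injective f.
  move=> i j /eqP; rewrite /f nth_uniq ?il ?lu // => /eqP h.
  by rewrite -(nth_index ord0 (lm S i)) h nth_index // lm.
have jS j : (j \in S) = (index j (l S) < #|S|)%N.
  by rewrite cardE /l index_cat mem_enum; case: ifP => h; rewrite ?index_mem ?mem_enum ?h // ltnNge leq_addr.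
exists (perm fI) => j; rewrite permE fE -card jS; case: ifP => h.
  have hm : (index j (l S) < size (enum S'))%N by rewrite -cardE -card.
  by have := mem_nth ord0 hm; rewrite mem_enum => ->.
have hm : (index j (l S) - #|S| < size (enum (~: S')))%N.
  rewrite -cardE; have := cardsC S'; rewrite card_ord -card; move/negbT: h; rewrite -leqNgt.
  have := il j S; rewrite ls; move: #|S| #|~: S'| (index j (l S)) => a b c; lia.
by have := mem_nth ord0 hm; rewrite mem_enum inE => /negPf.
Qed.

(** * Hyperplane sections of the cone and transport of divisors *)

Section HyperplaneSections.
Variable R : realType.
Local Notation C := R[i].
Local Notation V := ('rV[R[i]]_4 : normedModType R[i]).
Local Notation B := (Bmx R).
Local Notation Y := (Ytuple R).

(** Position [k] holds the triple whose sum of coordinates is a multiple of the square of quadric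
    number [k]. On the cone the complementary triple has the opposite sum, so ten stand for all
    twenty. *)
Definition triples := [:: [:: 0; 1; 2]; [:: 0; 1; 3]; [:: 0; 1; 4]; [:: 0; 1; 5]; [:: 0; 2; 4];
  [:: 1; 2; 4]; [:: 0; 2; 3]; [:: 1; 2; 3]; [:: 0; 2; 5]; [:: 1; 2; 5]]%N.
Definition triple (k : nat) : {set 'I_6} := [set j : 'I_6 | (j : nat) \in nth [::] triples k].

Lemma sum_set6 (K : nmodType) (S : {set 'I_6}) (f : 'I_6 -> K) :
  \sum_(j in S) f j = \sum_(j < 6) (if j \in S then f j else 0).
Proof. exact: big_mkcond. Qed.

Lemma sum_triple k (x : 'rV[C]_4) : (k < 10)%N ->
  exists2 c : C, c != 0 & \sum_(j in triple k) (yval x)`_j = c * quadric k x ^+ 2.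
Proof.
have n6 : (6 : C) != 0 by rewrite pnatr_eq0.
have n24 : (24 : C) != 0 by rewrite pnatr_eq0.
move=> k10; exists (if (k < 4)%N then 6 else 24); first by case: ifP.
rewrite sum_set6 sum6 !inE !inordK // /yval /y_formula /squares /igusa_coords /quadric /ten_quadrics.
move: (x 0 o0) (x 0 o1) (x 0 o2) (x 0 o3) => a b c d.
by move: k k10 => [|[|[|[|[|[|[|[|[|[|k]]]]]]]]]] // _ /=; ring.
Qed.

(** The point determines the [A_k] and [T]. The quartic fixes the product of square roots of the
    [A_k] up to sign, and negating one root corrects it. Solving for the coordinates then gives the
    right value of [prod4^2], and [flip0] corrects the sign of [prod4]. *)
Lemma quotient_surj (y : 'rV[C]_6) : igusa_cone y -> exists x : 'rV[C]_4, forall j : 'I_6, (yval x)`_j = y 0 j.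
Proof.
move=> hy.
have h0 : \sum_(j < 6) y 0 j = 0.
  have := hy ord0; rewrite e0E rmorph_sum /= => h; rewrite -[RHS]h.
  by apply: eq_bigr => j _; rewrite mevalXU.
have sq n : meval (y ord0) (\sum_(j < 6) mpolyX C (mnm1 j) ^+ n) = \sum_(j < 6) y 0 j ^+ n.
  by rewrite rmorph_sum; apply: eq_bigr => j _; rewrite /= rmorphXn /= mevalXU.
have h1 : (\sum_(j < 6) y 0 j ^+ 2) ^+ 2 - 4 * \sum_(j < 6) y 0 j ^+ 4 = 0.
  have e4 : meval (y ord0) 4 = 4 by rewrite rmorph_nat.
  by have := hy (lift ord0 ord0); rewrite e1E mevalB expr2 mevalM mevalM e4 !sq -expr2.
pose A (c : 'I_4) : C := 6^-1 * (y 0 (inord c.+2) + y 0 (inord 0) + y 0 (inord 1)).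
pose T : C := 96^-1 * (y 0 (inord 0) - y 0 (inord 1)).
have yE (j : 'I_6) : y 0 j = (igusa_coords (A o0) (A o1) (A o2) (A o3) T)`_j.
  have ej : y 0 j = y 0 (inord j) by rewrite inord_val.
  have y5 : y 0 (inord 5) = - (y 0 (inord 0) + y 0 (inord 1) + y 0 (inord 2) + y 0 (inord 3) + y 0 (inord 4)).
    by move: h0; rewrite sum6 => /eqP; rewrite addr_eq0 => /eqP ->; rewrite opprK.
  by rewrite ej /A /T /= y5; case: j {ej} => [[|[|[|[|[|[|j]]]]]] hj] //=; rewrite ?y5; field.
have q0 : quartic (A o0) (A o1) (A o2) (A o3) T = 0.
  have [_ hq] := igusa_coords_quartic (A o0) (A o1) (A o2) (A o3) T.
  have n : - 324%:R != 0 :> C by rewrite oppr_eq0 pnatr_eq0.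
  apply: (mulfI n); rewrite mulr0 -hq -[RHS]h1.
  by congr (_ ^+ 2 - 4 * _); apply: eq_bigr => j _; rewrite yE.
have [w [wA wb]] : exists w : 'I_4 -> C, (forall k, w k ^+ 2 = A k) /\
    8 * (w o0 * w o1 * w o2 * w o3) = 256 * T ^+ 2 - discr (A o0) (A o1) (A o2) (A o3).
  pose v k := sqrtC (A k); have vA k : v k ^+ 2 = A k by rewrite sqrtCK.
  have : (256 * T ^+ 2 - discr (A o0) (A o1) (A o2) (A o3)) ^+ 2 = (8 * (v o0 * v o1 * v o2 * v o3)) ^+ 2.
    by apply/eqP; rewrite -subr_eq0 -q0 /quartic -!vA; apply/eqP; ring.
  move=> /eqP; rewrite eqf_sqr => /orP[/eqP ->|/eqP ->]; first by exists v.
  exists (fun k => if k == o0 then - v k else v k); split; last by rewrite /=; ring.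
  by move=> k; case: ifP => _; rewrite ?sqrrN.
have [x hx] := wq_surj w.
have tT : prod4 x ^+ 2 = T ^+ 2.
  apply: (@mulfI _ (256 : C)); first by rewrite pnatr_eq0.
  have := wq_relation x; rewrite /= !hx !wA wb -/(discr _ _ _ _) => /eqP.
  by rewrite (inj_eq (addIr _)) => /eqP.
have [z [zw zt]] : exists z : 'rV[C]_4, (forall k, wq z k = w k) /\ prod4 z = T.
  move/eqP: tT; rewrite eqf_sqr => /orP[/eqP e|/eqP e]; first by exists x.
  by exists (x *m flip0 R); rewrite prod4_flip0 e opprK; split=> // k; rewrite wq_flip0.
by exists z => j; rewrite yvalE !zw !wA zt -yE.
Qed.

Lemma card6 (S : {set 'I_6}) : #|S| = ((inord 0 \in S) + (inord 1%N \in S) + (inord 2 \in S) +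
  (inord 3 \in S) + (inord 4 \in S) + (inord 5 \in S))%N.
Proof.
transitivity (\sum_(j < 6) (j \in S : nat))%N; last exact: (sum6 (fun j => (j \in S : nat))).
by rewrite -sum1_card big_mkcond; apply: eq_bigr => j _; case: (j \in S).
Qed.

Lemma card_triple k : (k < 10)%N -> #|triple k| = 3%N.
Proof.
move=> k10; rewrite card6 !inE !inordK //.
by move: k k10 => [|[|[|[|[|[|[|[|[|[|k]]]]]]]]]].
Qed.

Lemma igusa_quotient_map (x : 'rV[C]_4) : igusa_cone (quotient_map Y x).
Proof.
move=> k; rewrite -[RHS](igusa_eqs_yval (x *m B) k); apply: meval_eq => j.
by rewrite mxE Ytuple_eval.
Qed.

Lemma hyperplane_sectionE (S : {set 'I_6}) : hyperplane_section S =
  [set y : 'rV[C]_6 | igusa_cone y /\ \sum_(j in S) y ord0 j = 0].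
Proof.
apply/seteqP; split => [y [h1 h2 _]//|y /= [h1 h2]]; split => //.
have h0 : \sum_(j < 6) y 0 j = 0.
  have := h1 ord0; rewrite e0E rmorph_sum /= => h; rewrite -[RHS]h.
  by apply: eq_bigr => j _; rewrite mevalXU.
by move: h0; rewrite (bigID (mem S)) /= h2 add0r => h0; rewrite -[RHS]h0; apply: eq_bigl => j; rewrite inE.
Qed.

(* The image of {x | sum over S of Y_j vanishes} is the whole section since the quotient map is onto the cone. *)
Lemma section_image (S : {set 'I_6}) (Z : set 'rV[C]_4) :
  (forall x, Z x <-> \sum_(j in S) quotient_map Y x ord0 j = 0) ->
  quotient_map Y @` Z = hyperplane_section S.
Proof.
move=> hZ; rewrite hyperplane_sectionE; apply/seteqP; split => [_ [x Zx <-]|y [hy sy]].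
  by split; [exact: igusa_quotient_map|exact/hZ].
have [x hx] := quotient_surj hy; have e : quotient_map Y (x *m Binv R) = y.
  by apply/rowP => j; rewrite mxE Ytuple_eval -mulmxA BinvK mulmx1 hx.
by exists (x *m Binv R); [apply/hZ; rewrite e|].
Qed.

Lemma quadric_section k x : (k < 10)%N ->
  quadric k (x *m B) = 0 <-> \sum_(j in triple k) quotient_map Y x ord0 j = 0.
Proof.
move=> k10; have [c c0 hc] := sum_triple (x *m B) k10.
have -> : \sum_(j in triple k) quotient_map Y x ord0 j = \sum_(j in triple k) (yval (x *m B))`_j.
  by apply: eq_bigr => j _; rewrite mxE Ytuple_eval.
rewrite hc; split => [->|/eqP]; first by rewrite expr0n mulr0.
by rewrite mulf_eq0 (negPf c0) expf_eq0 /= => /eqP.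
Qed.

Lemma divisor_tangent_cone (F : V -> C) : invariant_divisor_through0 F ->
  exists k e, [/\ (k < 10)%N, e != 0, approx_at 2 F (fun x => e * quadric k (x *m B)) &
    tangent_cone F = [set x : 'rV[C]_4 | quadric k (x *m B) = 0]].
Proof.
move=> hF; have [k [e [k10 e0 he]]] := approx_quadric hF; exists k, e.
have aF : approx_at 2 F (fun x => e * quadric k (x *m B)).
  have := @approx_linear R _ _ B he; congr approx_at; apply/funext => x.
  by rewrite -mulmxA BmxK mulmx1.
split => //; have nq : e *: quadric_poly R k != 0.
  rewrite scaler_eq0 (negPf e0) /=; apply/eqP => q0.
  have h : forall x : 'rV[C]_4, quadric k x = 0.
    by move=> x; rewrite -[x]mulmx1 -(BinvK R) mulmxA -quadric_poly_eval // q0 meval0.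
  have n0 (m : nat) : (0 < m)%N -> m%:R <> 0 :> C by case: m => // m _; move/eqP; rewrite pnatr_eq0.
  have n1 (m : nat) : (0 < m)%N -> - m%:R <> 0 :> C by move=> m0 /eqP; rewrite oppr_eq0 => /eqP; exact: n0.
  (* A point off all ten quadrics. *)
  have := h (\row_j ([:: 1; 2; 4; 16] : seq C)`_j); rewrite /quadric /ten_quadrics !mxE; clear -n0 n1 k10.
  move: k k10 => [|[|[|[|[|[|[|[|[|[|k]]]]]]]]]] //= _ E.
  - by apply: (n0 277%N isT); rewrite -[RHS]E; ring.
  - by apply: (n1 243%N isT); rewrite -[RHS]E; ring.
  - by apply: (n1 267%N isT); rewrite -[RHS]E; ring.
  - by apply: (n0 237%N isT); rewrite -[RHS]E; ring.
  - by apply: (n0 66%N isT); rewrite -[RHS]E; ring.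
  - by apply: (n1 62%N isT); rewrite -[RHS]E; ring.
  - by apply: (n0 36%N isT); rewrite -[RHS]E; ring.
  - by apply: (n1 28%N isT); rewrite -[RHS]E; ring.
  - by apply: (n0 24%N isT); rewrite -[RHS]E; ring.
  - by apply: (n0 8%N isT); rewrite -[RHS]E; ring.
rewrite (@tangent_cone_of R F (e *: quadric_poly R k)) //.
- apply/seteqP; split => x /=; rewrite mevalZ quadric_poly_eval //.
    by move/eqP; rewrite mulf_eq0 (negPf e0) => /eqP.
  by move=> ->; rewrite mulr0.
- exact: dhomogZ (quadric_poly_homog R k).
by move: aF; congr approx_at; apply/funext => x; rewrite mevalZ quadric_poly_eval.
Qed.
(** [M] preserves the lattice and [H], hence the Chern class. For the invariance, [(G,i)] has to be
    normal in [U(H)], which holds because it is the kernel of [rho]. *)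
Lemma divisor_compose (F : V -> C) (M : 'M[C]_4) : UH M -> invariant_divisor_through0 F ->
  invariant_divisor_through0 (fun x => F (x *m M)).
Proof.
move=> hM [[hF [x0 Fx0] lF] [f [hf fF fE]] inv F0].
have [[M1 M2 M3] M4] := hM.
have lat (l : 'rV[C]_4) : lattice l -> lattice (l *m M).
  move=> /mxOverP hl; apply/mxOverP => i j; rewrite mxE.
  have h k : gaussInt (l i k * M k j).
    have [p ->] := gaussInt_gc (hl i k); have [q ->] := gaussInt_gc (mxOverP M1 k j).
    by rewrite -gcM; exact: gc_gaussInt.
  rewrite sum4; have [a ->] := gaussInt_gc (h o0); have [b ->] := gaussInt_gc (h o1).
  have [c ->] := gaussInt_gc (h o2); have [d ->] := gaussInt_gc (h o3).
  by rewrite -!gcD; exact: gc_gaussInt.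
split; last by rewrite mul0mx.
- split; first exact: hol_linear.
    by exists (x0 *m invmx M); rewrite (mulmxKV M2).
  move=> l /lat/lF[u [hu u0 eu]]; exists (fun x => u (x *m M)); split; [exact: hol_linear|by move=> x; exact: u0|].
  by move=> x; rewrite mulmxDl eu.
- exists (fun l x => f (l *m M) (x *m M)); split.
  + by move=> l /lat hl; apply: hol_linear; exact: hf.
  + by move=> l x /lat hl; rewrite mulmxDl fF.
  + move=> l m x /lat hl /lat hm; rewrite !mulmxDl fE // /ImH /Hform; congr ((complex.Im (fun_of_matrix _ _ _))%:C).
    by rewrite map_mxM trmx_mul -[in RHS]M4 !mulmxA.
move=> N hN; have [uN rN] := Gi_UH hN.
have hN' : Gi (invmx M *m N *m M).
  apply/rho_kernel; first by apply: UH_mul => //; apply: UH_mul => //; exact: UH_inv.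
  by rewrite (rhoM (UH_mul (UH_inv hM) uN) hM) (rhoM (UH_inv hM) uN) rN mulg1 (rho_inv hM) mulVg.
have [u [hu u0 eu]] := inv _ hN'; exists (fun x => u (x *m M)); split; [exact: hol_linear|by move=> x; exact: u0|].
by move=> x; rewrite -eu -!mulmxA (mulmxA M) (mulmxV M2) mul1mx mulmxA.
Qed.

End HyperplaneSections.

(** * The ten hyperplane sections as images of tangent cones *)

Section DivisorImages.
Variable R : realType.
Local Notation C := R[i].
Local Notation V := ('rV[R[i]]_4 : normedModType R[i]).
Local Notation B := (Bmx R).
Local Notation Y := (Ytuple R).

(** One divisor suffices to reach every section: whatever triple it belongs to, some [M] in [U(H)]
    carries [S] to that triple, and pulling back by [M] gives a divisor for [S]. *)
Lemma divisor_images : [set A | exists2 F : 'rV[C]_4 -> C, invariant_divisor_through0 F &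
    A = quotient_map Y @` tangent_cone F] =
  [set A | exists2 S : {set 'I_6}, #|S| = 3%N & A = @hyperplane_section R S].
Proof.
apply/seteqP; split => [A [F hF ->]|A [S S3 ->]] /=.
  have [k [e [k10 _ _ ->]]] := divisor_tangent_cone hF.
  exists (triple k); first exact: card_triple.
  by apply: section_image => x; exact: quadric_section.
have hF := base_form_invariant R; have [k [e [k10 e0 aF _]]] := divisor_tangent_cone hF.
have [s hs] : exists s : 'S_6, forall j, (s j \in triple k) = (j \in S).
  by apply: set_perm; rewrite S3 card_triple.
have [M uM rM] := rho_surj R s.
exists (fun x => base_form (x *m M)); first exact: divisor_compose.
have [k' [e' [k10' e0' aF' ->]]] := divisor_tangent_cone (divisor_compose uM hF).
apply/esym/section_image => x.
have h2 (P : nat) : (P < 10)%N -> forall c, homog 2 (fun x : 'rV[C]_4 => c * quadric P (x *m B)).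
  move=> P10 c z y; rewrite -!(quadric_poly_eval _ P10) (homog_meval (quadric_poly_homog R P)).
  by rewrite mulrCA.
(* By uniqueness of the quadratic term, the quadric of the pulled back divisor is the pullback of
   the quadric; the action of [M] on the ten quadrics is not computed. *)
have eq : e' * quadric k' (x *m B) = e * quadric k (x *m M *m B).
  have h2M : homog 2 (fun x : 'rV[C]_4 => e * quadric k (x *m M *m B)).
    by move=> z y; rewrite -scalemxAl; exact: (h2 k k10 e).
  by rewrite (approx_ray x (leqnn 2) aF' (approx_linear M aF) (h2 k' k10' e') h2M) eqxx.
have -> : \sum_(j in S) quotient_map Y x ord0 j = \sum_(j in triple k) quotient_map Y (x *m M) ord0 j.
  rewrite [RHS](reindex_inj (@perm_inj _ s)) /=; apply: eq_big => [j|j _]; first by rewrite hs.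
  rewrite !mxE; have := rhoP uM j; rewrite rM => <-.
  exact: (lin_subst_eval M (tnth Y (s j)) x).
rewrite -(quadric_section _ k10); split=> [q0|q0].
  by move: eq; rewrite q0 mulr0 => /esym/eqP; rewrite mulf_eq0 (negPf e0) => /eqP.
by move: eq; rewrite q0 mulr0 => /eqP; rewrite mulf_eq0 (negPf e0') => /eqP.
Qed.

End DivisorImages.

Theorem proposition5p7 (R : realType) :
  exists (Y : 6.-tuple (mpoly 4 R[i])) (rho : 'M[R[i]]_4 -> 'S_6),
    [/\ quotient_iso (@Gi R) Y (igusa_cone_eqs R),
        [set A | exists2 F : 'rV[R[i]]_4 -> R[i],
                   invariant_divisor_through0 F &
                   A = quotient_map Y @` tangent_cone F] =
          [set A | exists2 S : {set 'I_6}, #|S| = 3%N &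
                   A = @hyperplane_section R S],
        [/\ forall M N : 'M[R[i]]_4, UH M -> UH N ->
              rho (M *m N) = (rho M * rho N)%g,
            forall s : 'S_6, exists2 M : 'M[R[i]]_4, UH M & rho M = s
          & forall M : 'M[R[i]]_4, UH M -> (rho M = 1%g <-> Gi M)]
      & forall (M : 'M[R[i]]_4) (j : 'I_6), UH M ->
          lin_subst M (tnth Y (rho M j)) = tnth Y j].
Proof.
exists (Ytuple R), (@rho R); split.
- exact: Ytuple_quotient_iso.
- exact: divisor_images.
- split; [exact: rhoM | exact: rho_surj | exact: rho_kernel].
- by move=> M j hM; exact: rhoP hM j.
Qed.
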